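(* Let $n\ge1$ be an integer. Then for all $z\in\mathbb{C}\setminus\{-1,-2,-3,\dots\}$, $$G_n(z+1)=\exp\left(F_n(z)\right)\prod_{k=1}^{\infty}\left\{\left(1+\frac{z}{k}\right)^{-\binom{-k}{n-1}}\exp\left(\Phi_n(z,k)\right)\right\},$$ where $$F_n(z)=\sum_{j=0}^{n-1}G_{n,j}(z)Q_j(z)+\sum_{r=0}^{n-2}\left[\frac{1}{r!}\left(\frac{\partial}{\partial u}\right)^{r}\binom{z-u}{n-1}\right]_{u=0}^{u=z}\zeta'(-r)-\gamma\int_0^z\binom{z-u}{n-1}\,du,$$ $$\Phi_n(z,k)=\frac{1}{(n-1)!}\sum_{\mu=-1}^{n-2}\left\{\sum_{r=\mu+1}^{n-1}\frac{{}_{n-1}S_r}{r-\mu}z^{r-\mu}\right\}(-1)^{\mu+1}k^{\mu},$$ and $[f(u)]_{u=0}^{u=z}=f(z)-f(0)$.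
   Context: Multiple gamma functions (Vignéras). $(G_n)_{n\ge0}$ is the unique hierarchy of meromorphic functions on $\mathbb{C}$ such that $G_0(z)=z$ and, for $n\ge1$: $G_n(z+1)=G_{n-1}(z)G_n(z)$; $G_n(1)=1$; and $\frac{d^{n+1}}{dz^{n+1}}\log G_n(z+1)\ge0$ for real $z\ge0$ (existence and uniqueness are known). So $G_1=\Gamma$ and $G_2$ is the Barnes $G$-function. Notation. Bernoulli polynomials: $\frac{x e^{tx}}{e^x-1}=\sum_{k\ge0}\frac{B_k(t)}{k!}x^k$, and $B_k=B_k(0)$ (so $B_1=-1/2$). $\binom{x}{k}=x(x-1)\cdots(x-k+1)/k!$ is the binomial polynomial, with $\binom{x}{0}=1$ (so $\binom{-k}{n-1}$ is an integer for integers $k$). $\gamma$ is Euler's constant, $\zeta$ the Riemann zeta function and $\zeta'$ its derivative. ${}_nS_j$ are the (signed) Stirling numbers of the first kind: $\sum_{j=0}^{n}{}_nS_j\,u^j=u(u-1)\cdots(u-n+1)$ (with ${}_0S_0=1$). The polynomials $G_{n,j}(z)$ are defined by $\binom{z-u}{n-1}=\sum_{j=0}^{n-1}G_{n,j}(z)u^j$. For integers $j\ge0$, $$\varphi_{j,r}=\left(\frac{d}{dt}\right)^{r}\left\{\frac{t^{j+1}}{j+1}\log t-\frac{t^{j+1}}{(j+1)^2}\right\}\Bigg|_{t=1},\qquad P_j(x)=\sum_{r=0}^{j+1}\frac{B_r}{r!}\varphi_{j,r}\,x^{j-r+1},$$ $$Q_j(z)=P_j(z+1)-\sum_{r=0}^{j}\binom{j}{r}z^rP_{j-r}(1)+\frac{1}{j+1}\sum_{r=1}^{j+1}\binom{j+1}{r}B_{j+1-r}(z)\sum_{l=1}^{r}\frac{(-1)^{l-1}z^l}{l}.$$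 Empty sums are $0$. *)

(* Defs.v *)
(* Stdlib reals and Coquelicot's complex numbers [C]. *)
From Stdlib Require Import Reals ZArith Lia.
From Coquelicot Require Import Coquelicot.
Open Scope C_scope.

Definition Nat2C (n : nat) : C := RtoC (INR n).
Notation "n %:C" := (Nat2C n) (at level 2, left associativity, format "n %:C").

(* Half-open sum of [f i] over [a <= i < b]; it is [0] when [b <= a]. *)
Definition Csum (a b : nat) (f : nat -> C) : C :=
  match b with
  | O => 0
  | S b' => @sum_n_m C_AbelianMonoid f a b'
  end.

Lemma Csum_S (a b : nat) (f : nat -> C) :
  (a <= b)%nat -> Csum a (S b) f = Csum a b f + f b.
Proof.
  intros Hab. destruct b as [|b]; simpl.
  - replace a with 0%nat by lia. rewrite (@sum_n_n C_AbelianMonoid). ring.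
  - rewrite (@sum_n_Sm C_AbelianMonoid) by lia. reflexivity.
Qed.

Fixpoint Cprod (n : nat) (f : nat -> C) : C :=
  match n with
  | O => 1
  | S m => Cprod m f * f m
  end.

Definition Cexp (z : C) : C :=
  (exp (Re z) * cos (Im z), exp (Re z) * sin (Im z))%R.

Definition CpowZ (z : C) (m : Z) : C :=
  match m with
  | Z0 => 1
  | Zpos p => z ^ Pos.to_nat p
  | Zneg p => / z ^ Pos.to_nat p
  end.

(* The product over [k >= 1] of [a k].  As usual for infinite products of
   nonvanishing factors, convergence requires a nonzero limit. *)
Definition is_infprod (a : nat -> C) (P : C) : Prop :=
  P <> 0 /\
  filterlim (fun N : nat => Cprod N (fun i => a (S i))) eventually
    (@locally C_UniformSpace P).

(** * Analytic and meromorphic functions *)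

Definition analytic_at (f : C -> C) (a : C) : Prop :=
  exists (c : nat -> C) (r : R), (0 < r)%R /\
    forall w : C, (Cmod (w - a) < r)%R ->
      @is_pseries C_AbsRing C_NormedModule c (w - a) (f w).

Definition pole_at (f : C -> C) (a : C) : Prop :=
  exists (m : nat) (g : C -> C) (r : R), (1 <= m)%nat /\ (0 < r)%R /\
    analytic_at g a /\ g a <> 0 /\
    forall w : C, w <> a -> (Cmod (w - a) < r)%R -> f w = g w / (w - a) ^ m.

(* A meromorphic function on [C] is a total function whose values at its poles
   are irrelevant; there are no spurious values at removable singularities. *)
Definition meromorphic (f : C -> C) : Prop :=
  forall a : C, analytic_at f a \/ pole_at f a.

(** * Multiple gamma functions *)

(* [G n (z + 1) = G (n - 1) z * G n z] is an identity between meromorphic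
   functions, hence is required where the three of them are finite.
   In the last condition [log] is the real logarithm, so [G n (x + 1)] is
   positive: with complex values allowed, [Gamma z * exp (2 i pi z)] would
   satisfy the same conditions as [Gamma z]. *)
Definition is_multiple_gamma (G : nat -> C -> C) : Prop :=
  (forall n : nat, meromorphic (G n)) /\
  (forall z : C, G 0%nat z = z) /\
  forall n : nat, (1 <= n)%nat ->
    (forall z : C,
       analytic_at (G n) (z + 1) -> analytic_at (G (n - 1)%nat) z ->
       analytic_at (G n) z ->
       G n (z + 1) = G (n - 1)%nat z * G n z) /\
    G n 1 = 1 /\
    forall x : R, (0 <= x)%R ->
      analytic_at (G n) (x + 1) /\
      Im (G n (x + 1)) = 0%R /\ (0 < Re (G n (x + 1)))%R /\
      (0 <= Derive_n (fun t : R => ln (Re (G n (t + 1)))) (n + 1) x)%R.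

(** * Bernoulli polynomials, the zeta function, Euler's constant *)

Definition is_bernoulli_poly (B : nat -> C -> C) : Prop :=
  forall t x : C, (0 < Cmod x < 2 * PI)%R ->
    @is_pseries C_AbsRing C_NormedModule
      (fun k => B k t / (fact k)%:C) x (x * Cexp (t * x) / (Cexp x - 1)).

(* The analytic continuation to [C \ {1}] of the Dirichlet series; the term
   [n^-s] of the series is [exp (- s ln n)]. *)
Definition is_riemann_zeta (zeta : C -> C) : Prop :=
  (forall s : C, s <> 1 -> analytic_at zeta s) /\
  forall s : C, (1 < Re s)%R ->
    @is_series C_AbsRing C_NormedModule
      (fun k => Cexp (- s * ln (INR (S k)))) (zeta s).

Definition euler_gamma : R :=
  real (Lim_seq (fun n => sum_n (fun k => / INR (S k)) n - ln (INR (S n)))%R).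

(** * Binomial polynomials, Stirling numbers and the polynomials [G_{n,j}] *)

Definition Cbinom (x : C) (k : nat) : C :=
  Cprod k (fun i => x - i%:C) / (fact k)%:C.

Fixpoint Zfalling (x : Z) (k : nat) : Z :=
  match k with
  | O => 1
  | S m => Zfalling x m * (x - Z.of_nat m)
  end%Z.

(* The integer value of the binomial polynomial at an integer: the division is
   exact, see [Zbinom_Cbinom]. *)
Definition Zbinom (x : Z) (k : nat) : Z :=
  (Zfalling x k / Z.of_nat (fact k))%Z.

(* Coefficient of [u^j] in the product over [i < n] of [a i + b i * u]. *)
Fixpoint linprod_coef (a b : nat -> C) (n j : nat) : C :=
  match n with
  | O => match j with O => 1 | S _ => 0 end
  | S m => a m * linprod_coef a b m j +
      b m * match j with O => 0 | S i => linprod_coef a b m i end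
  end.

Definition stirling1 (n j : nat) : C :=
  linprod_coef (fun i => - i%:C) (fun _ => 1) n j.

Definition Gpoly (n j : nat) (z : C) : C :=
  linprod_coef (fun i => z - i%:C) (fun _ => - (1)) (n - 1) j
    / (fact (n - 1))%:C.

Lemma Nat2C_neq0 (n : nat) : (n <> 0)%nat -> n%:C <> 0.
Proof. intros Hn H. apply RtoC_inj in H. now apply Hn, INR_eq. Qed.

Lemma Zfalling_fact_dvd (k : nat) (x : Z) :
  (Z.of_nat (fact k) | Zfalling x k)%Z.
Proof.
  assert (Hstep : forall m y,
    (Zfalling (y + 1) (S m) =
     Zfalling y (S m) + Z.of_nat (S m) * Zfalling y m)%Z).
  { induction m as [|m IH]; intros y; [cbn [Zfalling]; lia|].
    change (Zfalling (y + 1) (S (S m)))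
      with (Zfalling (y + 1) (S m) * (y + 1 - Z.of_nat (S m)))%Z.
    rewrite IH.
    change (Zfalling y (S (S m)))
      with (Zfalling y (S m) * (y - Z.of_nat (S m)))%Z.
    change (Zfalling y (S m)) with (Zfalling y m * (y - Z.of_nat m))%Z.
    rewrite !Nat2Z.inj_succ. ring. }
  revert x. induction k as [|k IH]; intros x.
  { exists 1%Z. reflexivity. }
  assert (Hfact : Z.of_nat (fact (S k)) =
                  (Z.of_nat (S k) * Z.of_nat (fact k))%Z).
  { change (fact (S k)) with (S k * fact k)%nat. apply Nat2Z.inj_mul. }
  assert (Hd : forall y, (Z.of_nat (fact (S k)) | Z.of_nat (S k) * Zfalling y k)%Z).
  { intros y. rewrite Hfact. apply Z.mul_divide_mono_l, IH. }
  assert (H0 : Zfalling 0 (S k) = 0%Z).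
  { clear. induction k as [|k IH]; [reflexivity|].
    change (Zfalling 0 (S (S k)))
      with (Zfalling 0 (S k) * (0 - Z.of_nat (S k)))%Z.
    rewrite IH. reflexivity. }
  apply (Z.bi_induction
           (fun y => (Z.of_nat (fact (S k)) | Zfalling y (S k))%Z)).
  - intros a b ->. reflexivity.
  - rewrite H0. apply Z.divide_0_r.
  - intros y. rewrite <- Z.add_1_r, Hstep. split; intros H.
    + apply Z.divide_add_r; auto.
    + apply (Z.divide_add_cancel_r _ _ _ (Hd y)). now rewrite Z.add_comm.
Qed.

Lemma Zbinom_Cbinom (x : Z) (k : nat) :
  RtoC (IZR (Zbinom x k)) = Cbinom (RtoC (IZR x)) k.
Proof.
  assert (Hf : RtoC (IZR (Zfalling x k)) =
               Cprod k (fun i => RtoC (IZR x) - i%:C)).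
  { induction k as [|k IH]; [reflexivity|]. simpl.
    rewrite <- IH, mult_IZR, minus_IZR, <- INR_IZR_INZ.
    now rewrite RtoC_mult, RtoC_minus. }
  unfold Cbinom, Zbinom. rewrite <- Hf.
  destruct (Zfalling_fact_dvd k x) as [q Hq]. rewrite Hq.
  assert (Hk := fact_neq_0 k).
  rewrite Z.div_mul by lia.
  rewrite mult_IZR, <- INR_IZR_INZ, RtoC_mult.
  fold (Nat2C (fact k)). field. now apply Nat2C_neq0.
Qed.

Lemma linprod_coef_spec (a b : nat -> C) (n : nat) (u : C) :
  Csum 0 (n + 1) (fun j => linprod_coef a b n j * u ^ j) =
  Cprod n (fun i => a i + b i * u).
Proof.
  assert (H0 : forall n j, (n < j)%nat -> linprod_coef a b n j = 0).
  { induction n0 as [|m IH]; intros [|j] Hj; simpl; try lia; trivial.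
    rewrite !IH by lia. ring. }
  assert (Hs : forall N (f : nat -> C),
    Csum 0 (S N) (fun j => match j with O => 0 | S i => f i end * u ^ j)
    = u * Csum 0 N (fun j => f j * u ^ j)).
  { induction N as [|N IH]; intros f.
    - rewrite Csum_S by lia. simpl. ring.
    - rewrite Csum_S by lia. rewrite IH, (Csum_S 0 N) by lia. simpl. ring. }
  assert (Hl : forall N (f g : nat -> C) (c d : C),
    Csum 0 N (fun j => (c * f j + d * g j) * u ^ j)
    = c * Csum 0 N (fun j => f j * u ^ j) + d * Csum 0 N (fun j => g j * u ^ j)).
  { induction N as [|N IH]; intros f g c d; [simpl; ring|].
    rewrite !Csum_S by lia. rewrite IH. ring. }
  rewrite Nat.add_1_r.
  induction n as [|m IH].
  - rewrite Csum_S by lia. simpl. ring.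
  - simpl Cprod. rewrite <- IH. simpl linprod_coef.
    rewrite (Hl (S (S m)) (linprod_coef a b m)
      (fun j => match j with O => 0 | S i => linprod_coef a b m i end)).
    rewrite Hs, (Csum_S 0 (S m)) by lia. rewrite (H0 m (S m)) by lia. ring.
Qed.

Lemma stirling1_spec (n : nat) (u : C) :
  Csum 0 (n + 1) (fun j => stirling1 n j * u ^ j) =
  Cprod n (fun i => u - i%:C).
Proof.
  unfold stirling1. rewrite linprod_coef_spec.
  induction n as [|n IH]; simpl; [reflexivity|]. rewrite IH. ring.
Qed.

Lemma Gpoly_spec (n : nat) (z u : C) :
  (1 <= n)%nat ->
  Csum 0 n (fun j => Gpoly n j z * u ^ j) = Cbinom (z - u) (n - 1).
Proof.
  intros Hn. unfold Gpoly, Cbinom.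
  assert (Hp : Cprod (n - 1) (fun i => z - u - i%:C) =
               Cprod (n - 1) (fun i => z - i%:C + - (1) * u)).
  { induction (n - 1)%nat as [|m IH]; simpl; [reflexivity|].
    rewrite IH. ring. }
  rewrite Hp, <- linprod_coef_spec. replace (n - 1 + 1)%nat with n by lia.
  unfold Cdiv.
  generalize (/ (fact (n - 1))%:C). generalize (n - 1)%nat.
  clear. intros m c.
  induction n as [|n IH]; [simpl; ring|].
  rewrite !Csum_S, IH by lia. ring.
Qed.

(** * The ingredients of the product formula *)

Definition phi (j r : nat) : R :=
  Derive_n (fun t : R => (t ^ (j + 1) / INR (j + 1) * ln t
                          - t ^ (j + 1) / INR (j + 1) ^ 2)%R) r 1.

Definition Ppoly (B : nat -> C -> C) (j : nat) (x : C) : C :=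
  Csum 0 (j + 2) (fun r =>
    B r 0 / (fact r)%:C * phi j r * x ^ (j + 1 - r)).

Definition Qpoly (B : nat -> C -> C) (j : nat) (z : C) : C :=
  Ppoly B j (z + 1)
  - Csum 0 (j + 1) (fun r =>
      Cbinom j%:C r * z ^ r * Ppoly B (j - r) 1)
  + / (j + 1)%:C * Csum 1 (j + 2) (fun r =>
      Cbinom (j + 1)%:C r * B (j + 1 - r)%nat z *
      Csum 1 (r + 1) (fun l => (- (1)) ^ (l - 1) * z ^ l / l%:C)).

(* [d/du] is the complex derivative; the integral from [0] to [z] is taken
   along the segment [u = t z], [0 <= t <= 1]. *)
Definition Ffun (B : nat -> C -> C) (zeta : C -> C) (n : nat) (z : C) : C :=
  let b : C -> C := fun u => Cbinom (z - u) (n - 1) in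
  let db : nat -> C -> C := fun r => Nat.iter r C_derive b in
  Csum 0 n (fun j => Gpoly n j z * Qpoly B j z)
  + Csum 0 (n - 1) (fun r =>
      (/ (fact r)%:C * db r z - / (fact r)%:C * db r 0)
      * C_derive zeta (- r%:C))
  - euler_gamma * @RInt C_R_CompleteNormedModule (fun t : R => z * b (t * z)) 0 1.

(* The index [m] stands for [mu + 1]. *)
Definition Phifun (n : nat) (z : C) (k : nat) : C :=
  / (fact (n - 1))%:C *
  Csum 0 n (fun m =>
    Csum m n (fun r => stirling1 (n - 1) r / (r - m + 1)%:C * z ^ (r - m + 1))
    * (- (1)) ^ m * CpowZ k%:C (Z.of_nat m - 1)).

Definition gamma_factor (n : nat) (z : C) (k : nat) : C :=
  CpowZ (1 + z / k%:C) (- Zbinom (- Z.of_nat k) (n - 1)) * Cexp (Phifun n z k).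

(* Main.v *)
(* Put D_j(x) = zeta'(-j, x+1) - zeta'(-j), given as the limit of an
   Euler-Maclaurin expression, so that D_j(x+1) - D_j(x) = (x+1)^j ln(x+1).
   Then L_n(x) = sum_j G_{n,j}(x) D_j(x) satisfies
   L_n(x+1) = L_n(x) + L_{n-1}(x), where L_0(x) = ln(x+1), and its
   (n+1)-st derivative is a positive series.  The derivative condition makes the solution of this difference
   equation unique: the difference of two solutions is periodic, and its n-th
   derivative is constant because its oscillation is at most the n-th
   derivative of L_{n-1} at infinity, which is 0.  Hence
   log G_n(x+1) = L_n(x) for real x >= 0.

   Expanding the k-th term of D_j in powers of k separates the terms of
   Phi_n(x,k) from the logarithms; the constants left over are Q_j, because a
   polynomial in N tending to 0 vanishes, gamma, and the limits of
   Euler-Maclaurin sums that equal zeta'(-r).  The latter are identified by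
   continuing zeta, with its Euler-Maclaurin expression, along the segments
   from 3 to i and from i to -r.

   Both sides of the product formula are meromorphic, so it propagates from the
   positive reals to z along the segments from 1 to i or -i and from there
   to z, which avoid -1, -2, -3, ... *)

Require Import Defs.
From Stdlib Require Import Reals ZArith Lia Lra ClassicalEpsilon
  FunctionalExtensionality.
From Coquelicot Require Import Coquelicot.
Open Scope C_scope.

(** The obstacle is the complex logarithm: [(k + z)^j * ln (k + z)] has branches. Every
    Euler-Maclaurin computation is therefore done for real [x >= 0] with the real [ln], and only the
    final identity is continued to complex [z]. One truncation serves three purposes. [Mfun] stops
    at order [j + 1]: its one-step error is then [O(1/x^2)], hence summable; its part free of
    logarithms is the polynomial [P_j]; and it is the derivative at [s = -j] of the Euler-Maclaurin
    tail of zeta cut at the same order, because the coefficients on both sides obey the same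
    recursion. The order [n + 1] of the derivative comes from a count of degrees: [G_{n,j}] has
    degree at most [n - 1 - j] and [Q_j] at most [j + 1], so [F_n], like [Phi_n], has degree at most
    [n] in [z] and is annihilated. Only logarithms remain, and the sign of [binom(-k, n-1)] makes
    each of their contributions nonnegative. *)

Fixpoint Rsum (n : nat) (f : nat -> R) : R :=
  match n with
  | O => 0%R
  | S m => (Rsum m f + f m)%R
  end.

Lemma RtoC_Rinv (x : R) : RtoC (/ x) = / RtoC x.
Proof.
  destruct (Req_dec x 0) as [->|Hx]; [|now apply RtoC_inv].
  rewrite Rinv_0. apply injective_projections; simpl; unfold Rdiv; ring.
Qed.

(** * Finite sums and elementary modulus inequalities *)

Lemma Csum_nil (a b : nat) (f : nat -> C) : (b <= a)%nat -> Csum a b f = 0.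
Proof.
  intros H. destruct b as [|b]; [reflexivity|]. simpl.
  apply (sum_n_m_zero (G := C_AbelianMonoid)). lia.
Qed.

Lemma Csum0_S (n : nat) (f : nat -> C) : Csum 0 (S n) f = Csum 0 n f + f n.
Proof. apply Csum_S. lia. Qed.

Lemma Csum_ext (a b : nat) (f g : nat -> C) :
  (forall i, (a <= i < b)%nat -> f i = g i) -> Csum a b f = Csum a b g.
Proof.
  intros H. destruct (Nat.le_gt_cases b a) as [Hb|Hb].
  { now rewrite !Csum_nil. }
  induction b as [|b IH]; [reflexivity|].
  rewrite !Csum_S by lia.
  rewrite H by lia. destruct (Nat.eq_dec a b) as [->|Hn].
  - now rewrite !Csum_nil by lia.
  - rewrite IH; [reflexivity| |lia]. intros i Hi. apply H. lia.
Qed.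

Lemma Csum_plus (a b : nat) (f g : nat -> C) :
  Csum a b (fun i => f i + g i) = Csum a b f + Csum a b g.
Proof.
  destruct (Nat.le_gt_cases b a) as [Hb|Hb].
  { rewrite !Csum_nil by lia. ring. }
  induction b as [|b IH]; [simpl; ring|].
  rewrite !Csum_S by lia. destruct (Nat.eq_dec a b) as [->|Hn].
  - rewrite !Csum_nil by lia. ring.
  - rewrite IH by lia. ring.
Qed.

Lemma Csum_scal (a b : nat) (c : C) (f : nat -> C) :
  Csum a b (fun i => c * f i) = c * Csum a b f.
Proof.
  destruct (Nat.le_gt_cases b a) as [Hb|Hb].
  { rewrite !Csum_nil by lia. ring. }
  induction b as [|b IH]; [simpl; ring|].
  rewrite !Csum_S by lia. destruct (Nat.eq_dec a b) as [->|Hn].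
  - rewrite !Csum_nil by lia. ring.
  - rewrite IH by lia. ring.
Qed.

Lemma Csum_scal_r (a b : nat) (c : C) (f : nat -> C) :
  Csum a b (fun i => f i * c) = Csum a b f * c.
Proof.
  rewrite Cmult_comm, <- Csum_scal. apply Csum_ext. intros; ring.
Qed.

Lemma Csum_minus (a b : nat) (f g : nat -> C) :
  Csum a b (fun i => f i - g i) = Csum a b f - Csum a b g.
Proof.
  transitivity (Csum a b (fun i => f i + (- (1)) * g i)).
  { apply Csum_ext; intros; ring. }
  rewrite Csum_plus, Csum_scal. ring.
Qed.

Lemma Csum_zero (a b : nat) (f : nat -> C) :
  (forall i, (a <= i < b)%nat -> f i = 0) -> Csum a b f = 0.
Proof.
  intros H. rewrite (Csum_ext a b f (fun i => 0 * 0)).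
  - rewrite Csum_scal. ring.
  - intros. rewrite H by lia. ring.
Qed.

Lemma Csum_chasles (a b c : nat) (f : nat -> C) :
  (a <= b)%nat -> (b <= c)%nat -> Csum a c f = Csum a b f + Csum b c f.
Proof.
  intros Hab Hbc. induction c as [|c IH].
  - rewrite !(Csum_nil _ 0) by lia. replace b with 0%nat by lia.
    rewrite Csum_nil by lia. ring.
  - destruct (Nat.eq_dec b (S c)) as [->|Hn].
    + rewrite (Csum_nil (S c) (S c)) by lia. ring.
    + rewrite (Csum_S a c), (Csum_S b c) by lia. rewrite IH by lia. ring.
Qed.

Lemma Csum_shift (a n : nat) (f : nat -> C) :
  Csum a (a + n) f = Csum 0 n (fun i => f (a + i)%nat).
Proof.
  induction n as [|n IH].
  - rewrite !Csum_nil by lia. reflexivity.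
  - rewrite Nat.add_succ_r, Csum_S, Csum0_S, IH by lia. reflexivity.
Qed.

Lemma Csum0_S_l (n : nat) (f : nat -> C) :
  Csum 0 (S n) f = f 0%nat + Csum 0 n (fun i => f (S i)).
Proof.
  rewrite (Csum_chasles 0 1 (S n)) by lia.
  rewrite Csum0_S, (Csum_nil 0 0) by lia.
  change (S n) with (1 + n)%nat. rewrite Csum_shift. simpl. ring.
Qed.

Lemma Csum_swap (a b c d : nat) (f : nat -> nat -> C) :
  Csum a b (fun i => Csum c d (fun j => f i j)) =
  Csum c d (fun j => Csum a b (fun i => f i j)).
Proof.
  destruct (Nat.le_gt_cases b a) as [Hb|Hb].
  { rewrite Csum_nil by lia. symmetry. apply Csum_zero. intros.
    now rewrite Csum_nil by lia. }
  induction b as [|b IH]; [lia|].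
  rewrite Csum_S by lia. destruct (Nat.eq_dec a b) as [->|Hn].
  - rewrite Csum_nil by lia. rewrite Cplus_0_l. apply Csum_ext. intros.
    rewrite Csum_S, Csum_nil by lia. ring.
  - rewrite IH by lia. rewrite <- Csum_plus. apply Csum_ext. intros.
    rewrite Csum_S by lia. reflexivity.
Qed.

(** The triangle [r + i < n] is cut by diagonals and by rows. In this way Taylor and binomial
    expansions are regrouped by total order, where the Bernoulli recursion applies. *)
Lemma Csum_triangle (n : nat) (f : nat -> nat -> C) :
  Csum 0 n (fun q => Csum 0 (S q) (fun r => f r (q - r)%nat)) =
  Csum 0 n (fun r => Csum 0 (n - r) (fun i => f r i)).
Proof.
  induction n as [|n IH]; [reflexivity|].
  rewrite Csum0_S, IH, (Csum0_S n (fun r => Csum 0 (S n - r) _)).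
  rewrite (Csum_ext 0 n (fun r => Csum 0 (S n - r) (fun i => f r i))
    (fun r => Csum 0 (n - r) (fun i => f r i) + f r (n - r)%nat)).
  - rewrite Csum_plus, Csum0_S. rewrite Nat.sub_diag.
    replace (S n - n)%nat with 1%nat by lia.
    rewrite (Csum0_S 0), (Csum_nil 0 0) by lia. ring.
  - intros i Hi. replace (S n - i)%nat with (S (n - i)) by lia.
    now rewrite Csum0_S.
Qed.

Lemma Csum_rev (n : nat) (f : nat -> C) :
  Csum 0 (S n) f = Csum 0 (S n) (fun i => f (n - i)%nat).
Proof.
  revert f. induction n as [|n IH]; intros f; [reflexivity|].
  rewrite Csum0_S, IH, (Csum0_S_l (S n)). rewrite Nat.sub_0_r, Cplus_comm.
  reflexivity.
Qed.

Lemma Rsum_ext (n : nat) (f g : nat -> R) :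
  (forall i, (i < n)%nat -> f i = g i) -> Rsum n f = Rsum n g.
Proof.
  induction n as [|n IH]; intros H; simpl; [reflexivity|].
  rewrite IH, H; auto with arith.
Qed.

Lemma Rsum_le (n : nat) (f g : nat -> R) :
  (forall i, (i < n)%nat -> (f i <= g i)%R) -> (Rsum n f <= Rsum n g)%R.
Proof.
  induction n as [|n IH]; intros H; simpl; [lra|].
  apply Rplus_le_compat; auto with arith.
Qed.

Lemma Rsum_scal (n : nat) (c : R) (f : nat -> R) :
  Rsum n (fun i => c * f i)%R = (c * Rsum n f)%R.
Proof. induction n as [|n IH]; simpl; [ring|]. rewrite IH. ring. Qed.

Lemma Rsum_plus (n : nat) (f g : nat -> R) :
  Rsum n (fun i => f i + g i)%R = (Rsum n f + Rsum n g)%R.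
Proof. induction n as [|n IH]; simpl; [ring|]. rewrite IH. ring. Qed.

Lemma Rsum_pos (n : nat) (f : nat -> R) :
  (forall i, (0 <= f i)%R) -> (0 <= Rsum n f)%R.
Proof.
  intros H. induction n as [|n IH]; simpl; [lra|].
  specialize (H n). lra.
Qed.

Lemma Rsum_mono (n m : nat) (f : nat -> R) :
  (forall i, (0 <= f i)%R) -> (n <= m)%nat -> (Rsum n f <= Rsum m f)%R.
Proof.
  intros H Hnm. induction Hnm as [|m Hnm IH]; simpl; [lra|].
  specialize (H m). lra.
Qed.

Lemma Csum_RtoC (n : nat) (f : nat -> R) :
  Csum 0 n (fun i => RtoC (f i)) = RtoC (Rsum n f).
Proof.
  induction n as [|n IH]; [reflexivity|].
  rewrite Csum0_S, IH. simpl. now rewrite RtoC_plus.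
Qed.

Lemma Re_Csum (n : nat) (f : nat -> C) :
  Re (Csum 0 n f) = Rsum n (fun i => Re (f i)).
Proof.
  induction n as [|n IH]; [reflexivity|]. rewrite Csum0_S. simpl.
  now rewrite <- IH.
Qed.

Lemma Im_Csum (n : nat) (f : nat -> C) :
  Im (Csum 0 n f) = Rsum n (fun i => Im (f i)).
Proof.
  induction n as [|n IH]; [reflexivity|]. rewrite Csum0_S. simpl.
  now rewrite <- IH.
Qed.

Lemma Cmod_Csum (n : nat) (f : nat -> C) :
  (Cmod (Csum 0 n f) <= Rsum n (fun i => Cmod (f i)))%R.
Proof.
  induction n as [|n IH].
  - simpl. rewrite Cmod_0. lra.
  - rewrite Csum0_S. simpl. eapply Rle_trans; [apply Cmod_triangle|]. lra.
Qed.

Lemma Cmod_Csum_le (n : nat) (f : nat -> C) (g : nat -> R) :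
  (forall i, (i < n)%nat -> (Cmod (f i) <= g i)%R) ->
  (Cmod (Csum 0 n f) <= Rsum n g)%R.
Proof.
  intros H. eapply Rle_trans; [apply Cmod_Csum|]. now apply Rsum_le.
Qed.

Lemma Cmod_le_Re_Im (z : C) : (Cmod z <= Rabs (Re z) + Rabs (Im z))%R.
Proof.
  replace z with (RtoC (Re z) + RtoC (Im z) * Ci) at 1.
  - eapply Rle_trans; [apply Cmod_triangle|].
    rewrite Cmod_mult, !Cmod_R, Cmod_Ci. lra.
  - apply injective_projections; simpl; unfold Re, Im; ring.
Qed.

Lemma im_le_Cmod (z : C) : (Rabs (Im z) <= Cmod z)%R.
Proof.
  eapply Rle_trans; [|apply Rmax_Cmod]. apply Rmax_r.
Qed.

Lemma Cmod_minus_sym (a b : C) : Cmod (a - b) = Cmod (b - a).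
Proof. rewrite <- Cmod_opp. f_equal. ring. Qed.

Lemma Cmod_rev_triangle (a b : C) : (Cmod a - Cmod b <= Cmod (a - b))%R.
Proof.
  assert (H := Cmod_triangle (a - b) b).
  replace (a - b + b) with a in H by ring. lra.
Qed.

(** * Limits and absolutely convergent series of complex numbers *)

(** Convergence is phrased through real distances so that the squeeze lemmas for real sequences
    apply; [Clim_filterlim] translates to filters. *)
Definition Clim (u : nat -> C) (l : C) : Prop :=
  is_lim_seq (fun n => Cmod (u n - l)) 0%R.

Lemma Clim_eps (u : nat -> C) (l : C) :
  Clim u l <-> forall eps : R, (0 < eps)%R ->
    exists N, forall n, (N <= n)%nat -> (Cmod (u n - l) < eps)%R.
Proof.
  unfold Clim. rewrite <- is_lim_seq_spec. unfold is_lim_seq'. split.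
  - intros H eps He. destruct (H (mkposreal eps He)) as [N HN]. exists N.
    intros n Hn. specialize (HN n Hn). simpl in HN.
    rewrite Rminus_0_r, Rabs_pos_eq in HN by apply Cmod_ge_0. exact HN.
  - intros H eps. destruct (H eps (cond_pos eps)) as [N HN]. exists N.
    intros n Hn. rewrite Rminus_0_r, Rabs_pos_eq by apply Cmod_ge_0. auto.
Qed.

Lemma Clim_squeeze (u : nat -> C) (l : C) (v : nat -> R) (N : nat) :
  (forall n, (N <= n)%nat -> (Cmod (u n - l) <= v n)%R) -> is_lim_seq v 0%R ->
  Clim u l.
Proof.
  intros H Hv.
  apply is_lim_seq_le_le_loc with (u := fun _ => 0%R) (w := v); trivial.
  - exists N. intros n Hn. split; [apply Cmod_ge_0|auto].
  - apply is_lim_seq_const.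
Qed.

Lemma Clim_const (l : C) : Clim (fun _ => l) l.
Proof.
  apply Clim_squeeze with (v := fun _ => 0%R) (N := 0%nat).
  - intros _ _. replace (l - l) with (RtoC 0) by ring. rewrite Cmod_0. lra.
  - apply is_lim_seq_const.
Qed.

Lemma Clim_ext_loc (u v : nat -> C) (l : C) (N : nat) :
  (forall n, (N <= n)%nat -> u n = v n) -> Clim u l -> Clim v l.
Proof.
  intros H Hu. apply Clim_squeeze with (v := fun n => Cmod (u n - l)) (N := N).
  - intros n Hn. rewrite H; trivial. lra.
  - exact Hu.
Qed.

Lemma Clim_ext (u v : nat -> C) (l : C) :
  (forall n, u n = v n) -> Clim u l -> Clim v l.
Proof. intros H. apply Clim_ext_loc with (N := 0%nat). auto. Qed.

Lemma Clim_plus (u v : nat -> C) (l k : C) :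
  Clim u l -> Clim v k -> Clim (fun n => u n + v n) (l + k).
Proof.
  intros Hu Hv.
  apply Clim_squeeze with (v := fun n => (Cmod (u n - l) + Cmod (v n - k))%R)
    (N := 0%nat).
  - intros n _. replace (u n + v n - (l + k)) with (u n - l + (v n - k)) by ring.
    apply Cmod_triangle.
  - replace 0%R with (0 + 0)%R by ring. now apply is_lim_seq_plus'.
Qed.

Lemma Clim_scal (c : C) (u : nat -> C) (l : C) :
  Clim u l -> Clim (fun n => c * u n) (c * l).
Proof.
  intros Hu.
  apply Clim_squeeze with (v := fun n => (Cmod c * Cmod (u n - l))%R)
    (N := 0%nat).
  - intros n _. replace (c * u n - c * l) with (c * (u n - l)) by ring.
    rewrite Cmod_mult. lra.
  - replace 0%R with (Cmod c * 0)%R by ring.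
    now apply is_lim_seq_mult'; [apply is_lim_seq_const|].
Qed.

Lemma Clim_opp (u : nat -> C) (l : C) : Clim u l -> Clim (fun n => - u n) (- l).
Proof.
  intros H. replace (- l) with (- (1) * l) by ring.
  apply Clim_ext with (u := fun n => - (1) * u n); [intros; ring|].
  now apply Clim_scal.
Qed.

Lemma Clim_minus (u v : nat -> C) (l k : C) :
  Clim u l -> Clim v k -> Clim (fun n => u n - v n) (l - k).
Proof. intros Hu Hv. apply Clim_plus; [|apply Clim_opp]; trivial. Qed.

Lemma Clim_bound (u : nat -> C) (l : C) (M : R) (N : nat) :
  Clim u l -> (forall n, (N <= n)%nat -> (Cmod (u n) <= M)%R) -> (Cmod l <= M)%R.
Proof.
  intros Hu HM. apply Rnot_lt_le. intros Hlt.
  destruct (proj1 (Clim_eps u l) Hu (Cmod l - M)%R) as [K HK]; [lra|].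
  specialize (HK (N + K)%nat ltac:(lia)). specialize (HM (N + K)%nat ltac:(lia)).
  rewrite Cmod_minus_sym in HK.
  assert (H := Cmod_rev_triangle l (u (N + K)%nat)). lra.
Qed.

Lemma Clim_ev_bounded (u : nat -> C) (l : C) :
  Clim u l -> exists N, forall n, (N <= n)%nat -> (Cmod (u n) <= Cmod l + 1)%R.
Proof.
  intros H. destruct (proj1 (Clim_eps u l) H 1%R Rlt_0_1) as [N HN].
  exists N. intros n Hn. specialize (HN n Hn).
  assert (Ht := Cmod_rev_triangle (u n) l). lra.
Qed.

Lemma Clim_mult (u v : nat -> C) (l k : C) :
  Clim u l -> Clim v k -> Clim (fun n => u n * v n) (l * k).
Proof.
  intros Hu Hv. destruct (Clim_ev_bounded u l Hu) as [N HN].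
  apply Clim_squeeze with (N := N) (v := fun n =>
    ((Cmod l + 1) * Cmod (v n - k) + Cmod (u n - l) * Cmod k)%R).
  - intros n Hn.
    replace (u n * v n - l * k) with (u n * (v n - k) + (u n - l) * k) by ring.
    eapply Rle_trans; [apply Cmod_triangle|]. rewrite !Cmod_mult.
    apply Rplus_le_compat; [|lra]. apply Rmult_le_compat_r; [apply Cmod_ge_0|].
    auto.
  - replace 0%R with ((Cmod l + 1) * 0 + 0 * Cmod k)%R by ring.
    apply is_lim_seq_plus'; apply is_lim_seq_mult'; trivial;
      apply is_lim_seq_const.
Qed.

Lemma Clim_unique (u : nat -> C) (l k : C) : Clim u l -> Clim u k -> l = k.
Proof.
  intros Hl Hk. assert (H := Clim_minus _ _ _ _ Hl Hk).
  assert (H0 : (Cmod (l - k) <= 0)%R).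
  { apply Clim_bound with (u := fun n => u n - u n) (N := 0%nat); trivial.
    intros n _. replace (u n - u n) with (RtoC 0) by ring. rewrite Cmod_0. lra. }
  assert (H1 : l - k = 0).
  { apply Cmod_eq_0. assert (H2 := Cmod_ge_0 (l - k)). lra. }
  replace l with (l - k + k) by ring. rewrite H1. ring.
Qed.

Lemma Clim_incr_n (u : nat -> C) (l : C) (N : nat) :
  Clim u l <-> Clim (fun n => u (n + N)%nat) l.
Proof. apply (is_lim_seq_incr_n (fun n => Cmod (u n - l))). Qed.

Lemma Clim_incr_1 (u : nat -> C) (l : C) :
  Clim u l <-> Clim (fun n => u (S n)) l.
Proof. apply (is_lim_seq_incr_1 (fun n => Cmod (u n - l))). Qed.

Lemma Clim_RtoC (u : nat -> R) (l : R) :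
  is_lim_seq u l -> Clim (fun n => RtoC (u n)) (RtoC l).
Proof.
  intros H. apply Clim_squeeze with (v := fun n => Rabs (u n - l)) (N := 0%nat).
  - intros n _. rewrite <- RtoC_minus, Cmod_R. lra.
  - assert (H' : is_lim_seq (fun n => (u n - l)%R) (l - l)%R)
      by now apply is_lim_seq_minus'; [|apply is_lim_seq_const].
    apply is_lim_seq_abs in H'. simpl in H'.
    replace (Rabs (l - l)) with 0%R in H'; [exact H'|].
    now rewrite Rminus_diag, Rabs_R0.
Qed.

Lemma is_lim_seq_of_abs (u : nat -> R) (l : R) (v : nat -> R) :
  (forall n, (Rabs (u n - l) <= v n)%R) -> is_lim_seq v 0%R -> is_lim_seq u l.
Proof.
  intros H Hv.
  apply is_lim_seq_le_le with (u := fun n => (l - v n)%R) (w := fun n => (l + v n)%R).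
  - intros n. specialize (H n). apply Rabs_le_between in H.
    lra.
  - replace l with (l - 0)%R at 1 by ring.
    now apply is_lim_seq_minus'; [apply is_lim_seq_const|].
  - replace l with (l + 0)%R at 1 by ring.
    now apply is_lim_seq_plus'; [apply is_lim_seq_const|].
Qed.

Lemma Clim_Re (u : nat -> C) (l : C) :
  Clim u l -> is_lim_seq (fun n => Re (u n)) (Re l).
Proof.
  intros H. apply is_lim_seq_of_abs with (v := fun n => Cmod (u n - l)); trivial.
  intros n. apply (re_le_Cmod (u n - l)).
Qed.

Lemma Clim_Im (u : nat -> C) (l : C) :
  Clim u l -> is_lim_seq (fun n => Im (u n)) (Im l).
Proof.
  intros H. apply is_lim_seq_of_abs with (v := fun n => Cmod (u n - l)); trivial.
  intros n. apply (im_le_Cmod (u n - l)).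
Qed.

Lemma Clim_Re_Im (u : nat -> C) (a b : R) :
  is_lim_seq (fun n => Re (u n)) a -> is_lim_seq (fun n => Im (u n)) b ->
  Clim u (a, b).
Proof.
  intros Ha Hb.
  apply Clim_ext with (u := fun n => RtoC (Re (u n)) + RtoC (Im (u n)) * Ci).
  { intros n. apply injective_projections; simpl; unfold Re, Im; ring. }
  replace ((a, b) : C) with (RtoC a + RtoC b * Ci)
    by (apply injective_projections; simpl; ring).
  apply Clim_plus; [now apply Clim_RtoC|].
  apply Clim_mult; [now apply Clim_RtoC|apply Clim_const].
Qed.

Lemma Clim_cauchy (u : nat -> C) :
  (forall eps : R, (0 < eps)%R -> exists N, forall n m,
    (N <= n)%nat -> (N <= m)%nat -> (Cmod (u n - u m) < eps)%R) ->
  exists l, Clim u l.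
Proof.
  intros H.
  assert (Hre : ex_finite_lim_seq (fun n => Re (u n))).
  { apply ex_lim_seq_cauchy_corr. intros eps.
    destruct (H eps (cond_pos eps)) as [N HN]. exists N. intros n m Hn Hm.
    eapply Rle_lt_trans; [apply (re_le_Cmod (u n - u m))|]. auto. }
  assert (Him : ex_finite_lim_seq (fun n => Im (u n))).
  { apply ex_lim_seq_cauchy_corr. intros eps.
    destruct (H eps (cond_pos eps)) as [N HN]. exists N. intros n m Hn Hm.
    eapply Rle_lt_trans; [apply (im_le_Cmod (u n - u m))|]. auto. }
  destruct Hre as [a Ha]. destruct Him as [b Hb].
  exists (a, b). now apply Clim_Re_Im.
Qed.

Lemma Clim_filterlim (u : nat -> C) (l : C) :
  Clim u l <-> filterlim u eventually (@locally C_UniformSpace l).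
Proof.
  split; intros H.
  - apply filterlim_locally. intros eps.
    destruct (proj1 (Clim_eps u l) H eps (cond_pos eps)) as [N HN].
    exists N. intros n Hn. apply C_NormedModule_mixin_compat1. now apply HN.
  - apply Clim_eps. intros eps He.
    (* Balls of [C_UniformSpace] are squares; the one of half-side [eps / sqrt 2] lies in the disc
       of radius [eps]. *)
    assert (H2 : (0 < eps / sqrt 2)%R).
    { apply Rdiv_lt_0_compat; trivial. apply sqrt_lt_R0. lra. }
    assert (H' := proj1 (filterlim_locally u (l : C_UniformSpace)) H
      (mkposreal _ H2)).
    destruct H' as [N HN]. exists N. intros n Hn.
    specialize (HN n Hn). apply C_NormedModule_mixin_compat2 in HN. simpl in HN.
    replace (sqrt 2 * (eps / sqrt 2))%R with eps in HN. { exact HN. }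
    field. apply Rgt_not_eq, sqrt_lt_R0. lra.
Qed.

Lemma Rsum_conv (M : nat -> R) (T : R) :
  (forall i, (0 <= M i)%R) -> (forall n, (Rsum n M <= T)%R) ->
  exists S : R, is_lim_seq (fun n => Rsum n M) S /\ (S <= T)%R /\
    forall n, (Rsum n M <= S)%R.
Proof.
  intros Hp HT.
  assert (Hi : forall n, (Rsum n M <= Rsum (S n) M)%R).
  { intros n. simpl. specialize (Hp n). lra. }
  destruct (ex_finite_lim_seq_incr (fun n => Rsum n M) T) as [S HS]; trivial.
  exists S. split; [exact HS|]. split.
  - apply (is_lim_seq_le (fun n => Rsum n M) (fun _ => T) S T); trivial.
    apply is_lim_seq_const.
  - intros n. now apply (is_lim_seq_incr_compare (fun n => Rsum n M)).
Qed.

Lemma Csum_abs_conv (a : nat -> C) (M : nat -> R) (T : R) :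
  (forall i, (Cmod (a i) <= M i)%R) -> (forall n, (Rsum n M <= T)%R) ->
  exists l, Clim (fun n => Csum 0 n a) l.
Proof.
  intros Ha HT.
  assert (Hp : forall i, (0 <= M i)%R).
  { intros i. eapply Rle_trans; [apply Cmod_ge_0|apply Ha]. }
  destruct (Rsum_conv M T Hp HT) as (S & HS & _ & Hle).
  apply Clim_cauchy. intros eps He.
  apply is_lim_seq_spec in HS. destruct (HS (mkposreal eps He)) as [N HN].
  simpl in HN.
  assert (Hw : forall n m, (n <= m)%nat ->
    (Cmod (Csum 0 m a - Csum 0 n a) <= Rsum m M - Rsum n M)%R).
  { intros n m Hnm. induction Hnm as [|m Hnm IH].
    - replace (Csum 0 n a - Csum 0 n a) with (RtoC 0) by ring.
      rewrite Cmod_0. lra.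
    - rewrite Csum0_S. simpl.
      replace (Csum 0 m a + a m - Csum 0 n a)
        with (Csum 0 m a - Csum 0 n a + a m) by ring.
      eapply Rle_trans; [apply Cmod_triangle|]. specialize (Ha m). lra. }
  exists N. intros n m Hn Hm.
  assert (Hnn := HN n Hn). assert (Hmm := HN m Hm).
  apply Rabs_def2 in Hnn. apply Rabs_def2 in Hmm.
  assert (Hn2 := Hle n). assert (Hm2 := Hle m).
  destruct (Nat.le_gt_cases n m) as [Hc|Hc].
  - rewrite Cmod_minus_sym. eapply Rle_lt_trans; [apply Hw; trivial|]. lra.
  - eapply Rle_lt_trans; [apply Hw; lia|]. lra.
Qed.

Lemma Csum_tail_le (a : nat -> C) (M : nat -> R) (l : C) (S : R) (n : nat) :
  (forall i, (Cmod (a i) <= M i)%R) -> (forall n, (Rsum n M <= S)%R) ->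
  Clim (fun n => Csum 0 n a) l -> (Cmod (l - Csum 0 n a) <= S - Rsum n M)%R.
Proof.
  intros Ha HS Hl.
  apply Clim_bound with (u := fun m => Csum 0 m a - Csum 0 n a) (N := n).
  - apply Clim_minus; [exact Hl|apply Clim_const].
  - intros m Hm. apply Rle_trans with (Rsum m M - Rsum n M)%R;
      [|specialize (HS m); lra].
    induction Hm as [|m Hm IH].
    + replace (Csum 0 n a - Csum 0 n a) with (RtoC 0) by ring.
      rewrite Cmod_0. lra.
    + rewrite Csum0_S. simpl.
      replace (Csum 0 m a + a m - Csum 0 n a)
        with (Csum 0 m a - Csum 0 n a + a m) by ring.
      eapply Rle_trans; [apply Cmod_triangle|]. specialize (Ha m). lra.
Qed.

Lemma Clim_Csum (K : nat) (a : nat -> nat -> C) (b : nat -> C) :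
  (forall k, (k < K)%nat -> Clim (fun n => a n k) (b k)) ->
  Clim (fun n => Csum 0 K (a n)) (Csum 0 K b).
Proof.
  induction K as [|K IH]; intros H; [exact (Clim_const 0)|].
  rewrite Csum0_S. apply Clim_ext with (u := fun n => Csum 0 K (a n) + a n K).
  - intros n. now rewrite Csum0_S.
  - apply Clim_plus; auto.
Qed.

(* Tannery's theorem. *)
Lemma Clim_dominated (a : nat -> nat -> C) (b : nat -> C) (M : nat -> R) (T : R)
    (s : nat -> C) (t : C) :
  (forall k, Clim (fun n => a n k) (b k)) ->
  (forall n k, (Cmod (a n k) <= M k)%R) -> (forall n, (Rsum n M <= T)%R) ->
  (forall n, Clim (fun K => Csum 0 K (a n)) (s n)) ->
  Clim (fun K => Csum 0 K b) t -> Clim s t.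
Proof.
  intros Hab Ha HT Hs Ht.
  assert (Hp : forall i, (0 <= M i)%R).
  { intros i. eapply Rle_trans; [apply Cmod_ge_0|apply (Ha 0%nat)]. }
  destruct (Rsum_conv M T Hp HT) as (S & HS & _ & Hle).
  assert (Hb : forall k, (Cmod (b k) <= M k)%R).
  { intros k. apply Clim_bound with (u := fun n => a n k) (N := 0%nat); auto. }
  apply Clim_eps. intros eps He.
  apply is_lim_seq_spec in HS.
  destruct (HS (mkposreal (eps / 3)%R ltac:(lra))) as [K HK]. simpl in HK.
  specialize (HK K (Nat.le_refl K)). apply Rabs_def2 in HK.
  assert (Hf := Clim_Csum K a b (fun k _ => Hab k)).
  destruct (proj1 (Clim_eps _ _) Hf (eps / 3)%R ltac:(lra)) as [N HN].
  exists N. intros n Hn. specialize (HN n Hn).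
  assert (H1 := Csum_tail_le (a n) M (s n) S K (Ha n) Hle (Hs n)).
  assert (H2 := Csum_tail_le b M t S K Hb Hle Ht).
  replace (s n - t) with
    ((s n - Csum 0 K (a n)) + (Csum 0 K (a n) - Csum 0 K b) - (t - Csum 0 K b))
    by ring.
  eapply Rle_lt_trans; [apply Cmod_triangle|].
  eapply Rle_lt_trans; [apply Rplus_le_compat_r, Cmod_triangle|].
  rewrite Cmod_opp. lra.
Qed.

(** Interchange of a double series whose row norms are summable: Tannery's theorem, with the number
    of columns kept as the parameter that tends to infinity. *)
Lemma Csum_double (s : nat -> nat -> C) (m : nat -> R) (T : R)
    (S D : nat -> C) (t : C) :
  (forall k n, (Rsum n (fun i => Cmod (s k i)) <= m k)%R) ->
  (forall n, (Rsum n m <= T)%R) ->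
  (forall k, Clim (fun n => Csum 0 n (s k)) (S k)) ->
  (forall i, Clim (fun K => Csum 0 K (fun k => s k i)) (D i)) ->
  Clim (fun K => Csum 0 K S) t -> Clim (fun n => Csum 0 n D) t.
Proof.
  intros Hm HT HS HD Ht.
  apply Clim_dominated with (a := fun n k => Csum 0 n (s k)) (b := S)
    (M := m) (T := T); trivial.
  - intros n k. eapply Rle_trans; [apply Cmod_Csum|]. apply Hm.
  - intros n.
    apply Clim_ext with (u := fun K => Csum 0 n (fun i => Csum 0 K (fun k => s k i))).
    { intros K. apply Csum_swap. }
    apply (Clim_Csum n (fun K i => Csum 0 K (fun k => s k i))). auto.
Qed.

(** * Power series with a summable majorant *)

(* [m] bounds the norm [sum |c i| r^i] on the disc.  This norm is submultiplicative
   and countably subadditive, so that locally uniform sums of analytic functions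
   are handled without Cauchy's integral formula. *)
Definition psn (a : C) (r m : R) (c : nat -> C) (f : C -> C) : Prop :=
  (forall n, (Rsum n (fun i => Cmod (c i) * r ^ i) <= m)%R) /\
  forall w, (Cmod (w - a) <= r)%R ->
    Clim (fun n => Csum 0 n (fun i => c i * (w - a) ^ i)) (f w).

Definition NB (a : C) (r m : R) (f : C -> C) : Prop := exists c, psn a r m c f.

Lemma psn_term (a : C) (r : R) (c : nat -> C) (w : C) (i : nat) :
  (Cmod (w - a) <= r)%R ->
  (Cmod (c i * (w - a) ^ i)%C <= Cmod (c i) * r ^ i)%R.
Proof.
  intros H. rewrite Cmod_mult, Cmod_pow.
  apply Rmult_le_compat_l; [apply Cmod_ge_0|].
  apply pow_incr. split; [apply Cmod_ge_0|exact H].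
Qed.

Lemma psn_ext (a : C) (r m : R) (c : nat -> C) (f g : C -> C) :
  (forall w, (Cmod (w - a) <= r)%R -> f w = g w) ->
  psn a r m c f -> psn a r m c g.
Proof.
  intros H [H1 H2]. split; trivial. intros w Hw. rewrite <- H by trivial. auto.
Qed.

Lemma NB_ext (a : C) (r m : R) (f g : C -> C) :
  (forall w, (Cmod (w - a) <= r)%R -> f w = g w) -> NB a r m f -> NB a r m g.
Proof. intros H [c Hc]. exists c. now apply psn_ext with f. Qed.

Lemma psn_le (a : C) (r m m' : R) (c : nat -> C) (f : C -> C) :
  (m <= m')%R -> psn a r m c f -> psn a r m' c f.
Proof.
  intros H [H1 H2]. split; trivial. intros n. eapply Rle_trans; [apply H1|lra].
Qed.

Lemma NB_le (a : C) (r m m' : R) (f : C -> C) :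
  (m <= m')%R -> NB a r m f -> NB a r m' f.
Proof. intros H [c Hc]. exists c. now apply psn_le with m. Qed.

Lemma psn_pos (a : C) (r m : R) (c : nat -> C) (f : C -> C) :
  psn a r m c f -> (0 <= m)%R.
Proof. intros [H _]. exact (H 0%nat). Qed.

Lemma NB_pos (a : C) (r m : R) (f : C -> C) : NB a r m f -> (0 <= m)%R.
Proof. intros [c Hc]. now apply psn_pos with a r c f. Qed.

Lemma psn_restrict (a : C) (r r' m : R) (c : nat -> C) (f : C -> C) :
  (0 <= r' <= r)%R -> psn a r m c f -> psn a r' m c f.
Proof.
  intros Hr [H1 H2]. split.
  - intros n. eapply Rle_trans; [|apply (H1 n)]. apply Rsum_le. intros i _.
    apply Rmult_le_compat_l; [apply Cmod_ge_0|]. now apply pow_incr.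
  - intros w Hw. apply H2. lra.
Qed.

Lemma NB_restrict (a : C) (r r' m : R) (f : C -> C) :
  (0 <= r' <= r)%R -> NB a r m f -> NB a r' m f.
Proof. intros Hr [c Hc]. exists c. now apply psn_restrict with r. Qed.

(** Every term from index [k] on carries a factor at most [(|w - a| / r)^k] relative to its share of
    the norm. The orders 0, 1 and 2 give the bound, the value at the centre and the derivative;
    general orders give the identity theorem. *)
Lemma psn_remainder (a : C) (r m : R) (c : nat -> C) (f : C -> C) (w : C)
    (k : nat) :
  (0 < r)%R -> psn a r m c f -> (Cmod (w - a) <= r)%R ->
  (Cmod (f w - Csum 0 k (fun i => c i * (w - a) ^ i))%C
     <= m * (Cmod (w - a) / r) ^ k)%R.
Proof.
  intros Hr [H1 H2] Hw. set (d := Cmod (w - a)).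
  assert (Hd : (0 <= d)%R) by apply Cmod_ge_0.
  assert (Hq : (0 <= d / r <= 1)%R).
  { split; [apply Rmult_le_pos; [lra|]; apply Rlt_le, Rinv_0_lt_compat; lra|].
    apply (Rmult_le_reg_r r); [lra|]. unfold Rdiv.
    rewrite Rmult_assoc, Rinv_l by lra. unfold d. lra. }
  set (t := fun i => c i * (w - a) ^ i).
  assert (Hn : forall n, (k <= n)%nat ->
    (Cmod (Csum 0 n t - Csum 0 k t) <=
     (d / r) ^ k * (Rsum n (fun i => Cmod (c i) * r ^ i)
        - Rsum k (fun i => Cmod (c i) * r ^ i)))%R).
  { intros n Hkn. induction Hkn as [|n Hkn IH].
    - replace (Csum 0 k t - Csum 0 k t) with (RtoC 0) by ring.
      rewrite Cmod_0, Rminus_diag. lra.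
    - rewrite Csum0_S. simpl Rsum.
      replace (Csum 0 n t + t n - Csum 0 k t)
        with (Csum 0 n t - Csum 0 k t + t n) by ring.
      eapply Rle_trans; [apply Cmod_triangle|].
      assert (Ht : (Cmod (t n) <= (d / r) ^ k * (Cmod (c n) * r ^ n))%R).
      { unfold t. rewrite Cmod_mult, Cmod_pow. fold d.
        replace (d ^ n)%R with ((d / r) ^ n * r ^ n)%R
          by (rewrite <- Rpow_mult_distr; f_equal; field; lra).
        replace n with (k + (n - k))%nat at 2 by lia. rewrite pow_add.
        assert (H0 : (0 <= (d / r) ^ k)%R) by (apply pow_le; lra).
        assert (H3 : ((d / r) ^ (n - k) <= 1)%R).
        { rewrite <- (pow1 (n - k)). apply pow_incr. exact Hq. }
        assert (H4 : (0 <= Cmod (c n) * r ^ n)%R).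
        { apply Rmult_le_pos; [apply Cmod_ge_0|apply pow_le; lra]. }
        replace (Cmod (c n) * ((d / r) ^ k * (d / r) ^ (n - k) * r ^ n))%R with
          ((d / r) ^ k * (Cmod (c n) * r ^ n) * (d / r) ^ (n - k))%R by ring.
        rewrite <- (Rmult_1_r ((d / r) ^ k * (Cmod (c n) * r ^ n))) at 2.
        apply Rmult_le_compat_l; trivial. now apply Rmult_le_pos. }
      lra. }
  apply Clim_bound with (u := fun n => Csum 0 n t - Csum 0 k t) (N := k).
  - apply Clim_minus; [now apply H2|apply Clim_const].
  - intros n Hkn. eapply Rle_trans; [now apply Hn|]. rewrite Rmult_comm.
    apply Rmult_le_compat_r; [apply pow_le; lra|].
    assert (H3 := H1 n).
    assert (H4 : (0 <= Rsum k (fun i => Cmod (c i) * r ^ i))%R).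
    { apply Rsum_pos. intros. apply Rmult_le_pos; [apply Cmod_ge_0|].
      apply pow_le; lra. }
    lra.
Qed.

Lemma NB_bound (a : C) (r m : R) (f : C -> C) (w : C) :
  (0 < r)%R -> NB a r m f -> (Cmod (w - a) <= r)%R -> (Cmod (f w) <= m)%R.
Proof.
  intros Hr [c Hc] Hw.
  assert (H := psn_remainder a r m c f w 0 Hr Hc Hw). simpl in H.
  replace (f w - 0) with (f w) in H by ring. lra.
Qed.

Lemma psn_at (a : C) (r m : R) (c : nat -> C) (f : C -> C) :
  (0 < r)%R -> psn a r m c f -> f a = c 0%nat.
Proof.
  intros Hr Hc.
  assert (Ha : Cmod (a - a) = 0%R).
  { replace (a - a) with (RtoC 0) by ring. apply Cmod_0. }
  assert (H := psn_remainder a r m c f a 1 Hr Hc ltac:(lra)).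
  rewrite Ha in H. rewrite Csum0_S in H. simpl in H.
  replace (m * (0 / r * 1))%R with 0%R in H by (field; lra).
  assert (H0 : f a - c 0%nat = 0).
  { apply Cmod_eq_0. apply Rle_antisym; [|apply Cmod_ge_0].
    eapply Rle_trans; [|exact H]. right. f_equal. ring. }
  replace (f a) with (f a - c 0%nat + c 0%nat) by ring. rewrite H0. ring.
Qed.

Lemma psn_finite (a : C) (r : R) (N : nat) (e : nat -> C) :
  (0 <= r)%R -> (forall i, (N <= i)%nat -> e i = 0) ->
  psn a r (Rsum N (fun i => Cmod (e i) * r ^ i)%R) e
    (fun w => Csum 0 N (fun i => e i * (w - a) ^ i)).
Proof.
  intros Hr He. split.
  - intros m. apply Rle_trans with (Rsum (N + m) (fun i => Cmod (e i) * r ^ i)%R).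
    + apply Rsum_mono; [|lia]. intros i.
      apply Rmult_le_pos; [apply Cmod_ge_0|now apply pow_le].
    + induction m as [|m IH]; [rewrite Nat.add_0_r; lra|].
      rewrite Nat.add_succ_r. simpl. rewrite He, Cmod_0 by lia. lra.
  - intros w _. apply Clim_ext_loc with (N := N)
      (u := fun _ => Csum 0 N (fun i => e i * (w - a) ^ i)); [|apply Clim_const].
    intros m Hm. rewrite (Csum_chasles 0 N m), (Csum_zero N m) by
      (lia || (intros i Hi; rewrite He by lia; ring)). ring.
Qed.

Lemma NB_const (a : C) (r : R) (k : C) : NB a r (Cmod k) (fun _ => k).
Proof.
  exists (fun i => match i with O => k | S _ => RtoC 0 end). split.
  - intros n. assert (H := Cmod_ge_0 k).
    assert (Hn : forall n, Rsum (S n) (fun i =>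
      (Cmod (match i with O => k | S _ => RtoC 0 end)%C * r ^ i)%R) = Cmod k).
    { induction n0 as [|p IH]; [simpl; ring|]. simpl Rsum in *.
      rewrite IH, Cmod_0. ring. }
    destruct n as [|n]; [simpl; lra|]. rewrite Hn. lra.
  - intros w _. apply Clim_ext_loc with (u := fun _ => k) (N := 1%nat);
      [|apply Clim_const].
    intros [|n] Hn; [lia|]. clear Hn. induction n as [|n IH].
    + rewrite Csum0_S. simpl. ring.
    + rewrite Csum0_S, <- IH. ring.
Qed.

Lemma NB_shift (a : C) (r m : R) (f : C -> C) :
  (0 <= r)%R -> NB a r m f -> NB a r (r * m) (fun w => (w - a) * f w).
Proof.
  intros Hr [c [H1 H2]].
  exists (fun i => match i with O => RtoC 0 | S j => c j end). split.
  - intros [|n].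
    + simpl. apply Rmult_le_pos; trivial. exact (H1 0%nat).
    + assert (Hn : forall n, Rsum (S n) (fun i =>
        (Cmod (match i with O => RtoC 0 | S j => c j end)%C * r ^ i)%R) =
        (r * Rsum n (fun i => Cmod (c i) * r ^ i))%R).
      { induction n0 as [|p IH]; [simpl; rewrite Cmod_0; ring|].
        simpl Rsum in *. rewrite IH. simpl. ring. }
      rewrite Hn. apply Rmult_le_compat_l; trivial.
  - intros w Hw. apply Clim_incr_1.
    apply Clim_ext with (u := fun n =>
      (w - a) * Csum 0 n (fun i => c i * (w - a) ^ i)).
    + intros n. rewrite Csum0_S_l, <- Csum_scal. simpl.
      rewrite Cmult_0_l, Cplus_0_l. apply Csum_ext. intros i _. ring.
    + apply Clim_scal. auto.
Qed.

Lemma psn_plus (a : C) (r m m' : R) (c d : nat -> C) (f g : C -> C) :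
  psn a r m c f -> psn a r m' d g -> (0 <= r)%R ->
  psn a r (m + m') (fun i => c i + d i) (fun w => f w + g w).
Proof.
  intros [H1 H2] [H3 H4] Hr. split.
  - intros n. eapply Rle_trans.
    + apply Rsum_le with
        (g := fun i => (Cmod (c i) * r ^ i + Cmod (d i) * r ^ i)%R).
      intros i _. rewrite <- Rmult_plus_distr_r.
      apply Rmult_le_compat_r; [now apply pow_le|apply Cmod_triangle].
    + rewrite Rsum_plus. now apply Rplus_le_compat.
  - intros w Hw. apply Clim_ext with (u := fun n =>
      Csum 0 n (fun i => c i * (w - a) ^ i) +
      Csum 0 n (fun i => d i * (w - a) ^ i)).
    + intros n. rewrite <- Csum_plus. apply Csum_ext. intros; ring.
    + apply Clim_plus; auto.
Qed.

Lemma NB_plus (a : C) (r m m' : R) (f g : C -> C) :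
  (0 <= r)%R -> NB a r m f -> NB a r m' g ->
  NB a r (m + m') (fun w => f w + g w).
Proof. intros Hr [c Hc] [d Hd]. eexists. now apply psn_plus; eauto. Qed.

Lemma psn_scal (a : C) (r m : R) (k : C) (c : nat -> C) (f : C -> C) :
  psn a r m c f -> psn a r (Cmod k * m) (fun i => k * c i) (fun w => k * f w).
Proof.
  intros [H1 H2]. split.
  - intros n. rewrite (Rsum_ext n _ (fun i => (Cmod k * (Cmod (c i) * r ^ i))%R)).
    + rewrite Rsum_scal. apply Rmult_le_compat_l; [apply Cmod_ge_0|auto].
    + intros i _. rewrite Cmod_mult. ring.
  - intros w Hw. apply Clim_ext with (u := fun n =>
      k * Csum 0 n (fun i => c i * (w - a) ^ i)).
    + intros n. rewrite <- Csum_scal. apply Csum_ext. intros; ring.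
    + apply Clim_scal; auto.
Qed.

Lemma NB_scal (a : C) (r m : R) (k : C) (f : C -> C) :
  NB a r m f -> NB a r (Cmod k * m) (fun w => k * f w).
Proof. intros [c Hc]. eexists. now apply psn_scal; eauto. Qed.

Lemma psn_coef_le (a : C) (r m : R) (c : nat -> C) (f : C -> C) (i : nat) :
  (0 < r)%R -> psn a r m c f -> (Cmod (c i) <= m / r ^ i)%R.
Proof.
  intros Hr [H1 _]. assert (Hp : (0 < r ^ i)%R) by now apply pow_lt.
  apply (Rmult_le_reg_r (r ^ i)); trivial. unfold Rdiv.
  rewrite (Rmult_assoc m), Rinv_l, Rmult_1_r by lra.
  eapply Rle_trans; [|apply (H1 (S i))]. simpl.
  assert (H0 : (0 <= Rsum i (fun i => Cmod (c i) * r ^ i))%R).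
  { apply Rsum_pos. intros. apply Rmult_le_pos; [apply Cmod_ge_0|].
    apply pow_le; lra. }
  lra.
Qed.

(** The norm is bounded through finite partial sums, each of which is continuous in the
    coefficients, so the bound survives the limit. The values are summed by [Csum_double]. *)
Lemma psn_series (a : C) (r T : R) (m : nat -> R) (c : nat -> nat -> C)
    (f : nat -> C -> C) (D : nat -> C) (F : C -> C) :
  (0 <= r)%R -> (forall k, psn a r (m k) (c k) (f k)) ->
  (forall K, (Rsum K m <= T)%R) ->
  (forall w, (Cmod (w - a) <= r)%R ->
     Clim (fun K => Csum 0 K (fun k => f k w)) (F w)) ->
  (forall i, Clim (fun K => Csum 0 K (fun k => c k i)) (D i)) ->
  psn a r T D F.
Proof.
  intros Hr Hf HT HF HD. split.
  - intros n.
    assert (Hl : is_lim_seq (fun K => Rsum n (fun i =>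
        (Cmod (Csum 0 K (fun k => c k i)) * r ^ i)%R))
        (Rsum n (fun i => Cmod (D i) * r ^ i))%R).
    { clear HT HF. induction n as [|n IH]; [apply is_lim_seq_const|].
      simpl. apply is_lim_seq_plus'; trivial.
      apply is_lim_seq_mult'; [|apply is_lim_seq_const].
      apply is_lim_seq_of_abs with
        (v := fun K => Cmod (Csum 0 K (fun k => c k n) - D n)); [|apply HD].
      intros K. apply Rabs_le. split.
      - rewrite Cmod_minus_sym.
        assert (H := Cmod_rev_triangle (D n) (Csum 0 K (fun k => c k n))). lra.
      - apply Cmod_rev_triangle. }
    apply (is_lim_seq_le _ (fun _ => T) _ T) with (2 := Hl);
      [|apply is_lim_seq_const].
    intros K. eapply Rle_trans; [|apply (HT K)].
    assert (HK : (Rsum n (fun i => Cmod (Csum 0 K (fun k => c k i)) * r ^ i) <=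
      Rsum n (fun i => Rsum K (fun k => Cmod (c k i) * r ^ i)))%R).
    { apply Rsum_le. intros i _.
      rewrite (Rsum_ext K _ (fun k => r ^ i * Cmod (c k i))%R) by (intros; ring).
      rewrite Rsum_scal, Rmult_comm.
      apply Rmult_le_compat_l; [now apply pow_le|apply Cmod_Csum]. }
    eapply Rle_trans; [exact HK|]. clear HK Hl HF HD HT.
    assert (Hs : Rsum n (fun i => Rsum K (fun k => Cmod (c k i) * r ^ i))%R =
      Rsum K (fun k => Rsum n (fun i => Cmod (c k i) * r ^ i))%R).
    { induction n as [|n IH]; simpl.
      - induction K as [|K IHK]; simpl; [reflexivity|]. rewrite <- IHK. ring.
      - rewrite IH, <- Rsum_plus. reflexivity. }
    rewrite Hs. apply Rsum_le. intros k _. apply (proj1 (Hf k)).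
  - intros w Hw. apply Csum_double with (s := fun k i => c k i * (w - a) ^ i)
      (m := m) (T := T) (S := fun k => f k w); trivial.
    + intros k n. eapply Rle_trans; [|apply (proj1 (Hf k) n)]. apply Rsum_le.
      intros i _. now apply psn_term.
    + intros k. now apply (proj2 (Hf k)).
    + intros i. apply Clim_ext with (u := fun K =>
        Csum 0 K (fun k => c k i) * (w - a) ^ i).
      * intros K. now rewrite Csum_scal_r.
      * apply Clim_mult; [apply HD|apply Clim_const].
    + now apply HF.
Qed.

Lemma psn_series_coef (a : C) (r T : R) (m : nat -> R) (c : nat -> nat -> C)
    (f : nat -> C -> C) :
  (0 < r)%R -> (forall k, psn a r (m k) (c k) (f k)) ->
  (forall K, (Rsum K m <= T)%R) ->
  exists D, forall i, Clim (fun K => Csum 0 K (fun k => c k i)) (D i).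
Proof.
  intros Hr Hf HT.
  assert (H : forall i, exists d, Clim (fun K => Csum 0 K (fun k => c k i)) d).
  { intros i. apply Csum_abs_conv with (M := fun k => (/ r ^ i * m k)%R)
      (T := (/ r ^ i * T)%R).
    - intros k. rewrite Rmult_comm. now apply psn_coef_le with a (f k).
    - intros n. rewrite Rsum_scal. apply Rmult_le_compat_l; trivial.
      apply Rlt_le, Rinv_0_lt_compat, pow_lt, Hr. }
  exists (fun i => (real (Lim_seq (fun K => Re (Csum 0 K (fun k => c k i)))),
    real (Lim_seq (fun K => Im (Csum 0 K (fun k => c k i)))))).
  intros i. destruct (H i) as [d Hd].
  rewrite (is_lim_seq_unique _ _ (Clim_Re _ _ Hd)).
  rewrite (is_lim_seq_unique _ _ (Clim_Im _ _ Hd)). simpl.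
  destruct d; exact Hd.
Qed.

Lemma NB_series (a : C) (r T : R) (m : nat -> R) (f : nat -> C -> C)
    (F : C -> C) :
  (0 < r)%R -> (forall k, NB a r (m k) (f k)) ->
  (forall K, (Rsum K m <= T)%R) ->
  (forall w, (Cmod (w - a) <= r)%R ->
     Clim (fun K => Csum 0 K (fun k => f k w)) (F w)) ->
  NB a r T F.
Proof.
  intros Hr Hf HT HF.
  set (c := fun k => proj1_sig (constructive_indefinite_description _ (Hf k))).
  assert (Hc : forall k, psn a r (m k) (c k) (f k)).
  { intros k. exact (proj2_sig (constructive_indefinite_description _ (Hf k))). }
  destruct (psn_series_coef a r T m c f Hr Hc HT) as [D HD].
  exists D. apply psn_series with m c f; trivial. lra.
Qed.

Lemma NB_shift_pow (a : C) (r m : R) (f : C -> C) (i : nat) :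
  (0 <= r)%R -> NB a r m f -> NB a r (r ^ i * m) (fun w => (w - a) ^ i * f w).
Proof.
  intros Hr Hf. induction i as [|i IH].
  - apply NB_ext with f; [intros; simpl; ring|].
    apply NB_le with m; [simpl; lra|exact Hf].
  - apply NB_ext with (fun w => (w - a) * ((w - a) ^ i * f w)).
    { intros; simpl; ring. }
    apply NB_le with (r * (r ^ i * m))%R; [simpl; lra|]. now apply NB_shift.
Qed.

(** Only the first factor is expanded: the product is the series of the functions
    [c i * (w - a)^i * g w], whose norms add up to at most [m * m']. *)
Lemma NB_mult (a : C) (r m m' : R) (f g : C -> C) :
  (0 < r)%R -> NB a r m f -> NB a r m' g ->
  NB a r (m * m') (fun w => f w * g w).
Proof.
  intros Hr [c [H1 H2]] Hg.
  apply NB_series with (m := fun i => (Cmod (c i) * r ^ i * m')%R)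
    (f := fun i w => c i * ((w - a) ^ i * g w)); trivial.
  - intros i. rewrite Rmult_assoc. apply NB_scal. apply NB_shift_pow; trivial. lra.
  - intros K. rewrite (Rsum_ext K _ (fun i => (m' * (Cmod (c i) * r ^ i))%R)).
    + rewrite Rsum_scal, Rmult_comm. apply Rmult_le_compat_r; trivial.
      now apply NB_pos with a r g.
    + intros; ring.
  - intros w Hw. apply Clim_ext with (u := fun n =>
      Csum 0 n (fun i => c i * (w - a) ^ i) * g w).
    + intros n. rewrite <- Csum_scal_r. apply Csum_ext. intros; ring.
    + apply Clim_mult; [now apply H2|apply Clim_const].
Qed.

Lemma NB_id (a : C) (r : R) (p : C) :
  (0 <= r)%R -> NB a r (Cmod (a - p) + r) (fun w => w - p).
Proof.
  intros Hr. apply NB_ext with (fun w => (a - p) + (w - a) * 1).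
  { intros; ring. }
  apply NB_plus; [exact Hr|apply NB_const|].
  apply NB_le with (r * Cmod 1)%R; [rewrite Cmod_1; lra|].
  apply NB_shift; [exact Hr|apply NB_const].
Qed.

Lemma NB_pow (a : C) (r m : R) (f : C -> C) (k : nat) :
  (0 < r)%R -> NB a r m f -> NB a r (m ^ k) (fun w => f w ^ k).
Proof.
  intros Hr Hf. induction k as [|k IH].
  - simpl. apply NB_le with (Cmod 1); [rewrite Cmod_1; lra|apply NB_const].
  - simpl. now apply NB_mult.
Qed.

(** On the disc around [b] the function [w - a] has norm at most [|b - a| + p <= r], so each term
    keeps its bound and re-expansion is once more a sum of series. *)
Lemma NB_recentre (a b : C) (r p m : R) (f : C -> C) :
  (0 < p)%R -> (Cmod (b - a) + p <= r)%R -> NB a r m f -> NB b p m f.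
Proof.
  intros Hp Hbr [c [H1 H2]].
  assert (Hin : forall w, (Cmod (w - b) <= p)%R -> (Cmod (w - a) <= r)%R).
  { intros w Hw. replace (w - a) with (w - b + (b - a)) by ring.
    eapply Rle_trans; [apply Cmod_triangle|]. lra. }
  apply NB_series with (m := fun i => (Cmod (c i) * r ^ i)%R)
    (f := fun i w => c i * (w - a) ^ i); trivial.
  - intros i. apply NB_scal. apply NB_pow; trivial.
    apply NB_le with (Cmod (b - a) + p)%R; trivial. apply NB_id. lra.
  - intros w Hw. apply H2. auto.
Qed.

Lemma Clim_geom (q : C) :
  (Cmod q < 1)%R -> Clim (fun n => Csum 0 n (fun i => q ^ i)) (/ (1 - q)).
Proof.
  intros Hq.
  assert (Hn : 1 - q <> 0).
  { intros H. assert (H1 : q = 1) by (replace q with (1 - (1 - q)) by ring;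
      rewrite H; ring). rewrite H1, Cmod_1 in Hq. lra. }
  apply Clim_ext with (u := fun n => / (1 - q) - / (1 - q) * q ^ n).
  - intros n. induction n as [|n IH]; [simpl; ring|].
    rewrite Csum0_S, <- IH. simpl. field. exact Hn.
  - replace (/ (1 - q)) with (/ (1 - q) - / (1 - q) * 0) at 1 by ring.
    apply Clim_minus; [apply Clim_const|]. apply Clim_scal.
    apply Clim_squeeze with (v := fun n => (Cmod q ^ n)%R) (N := 0%nat).
    + intros n _. replace (q ^ n - 0) with (q ^ n) by ring. rewrite Cmod_pow. lra.
    + apply is_lim_seq_geom. rewrite Rabs_pos_eq; trivial. apply Cmod_ge_0.
Qed.

Lemma Rsum_geom_le (q : R) (n : nat) :
  (0 <= q < 1)%R -> (Rsum n (fun i => q ^ i) <= / (1 - q))%R.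
Proof.
  intros Hq.
  assert (H : Rsum n (fun i => q ^ i)%R = (/ (1 - q) - / (1 - q) * q ^ n)%R).
  { induction n as [|n IH]; simpl; [ring|]. rewrite IH. field. lra. }
  rewrite H. assert (H0 : (0 <= / (1 - q) * q ^ n)%R); [|lra].
  apply Rmult_le_pos; [|now apply pow_le].
  apply Rlt_le, Rinv_0_lt_compat. lra.
Qed.

(** Geometric series in [(w - a) / (p - a)], evaluated at the extreme ratio [r / |p - a|]. *)
Lemma NB_inv (a p : C) (r : R) :
  (0 < r)%R -> (r < Cmod (p - a))%R ->
  NB a r (/ (Cmod (p - a) - r)) (fun w => / (w - p)).
Proof.
  intros Hr Hp. set (P := Cmod (p - a)) in *.
  assert (Hpa : p - a <> 0) by (apply Cmod_gt_0; fold P; lra).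
  assert (Hq : (0 <= r / P < 1)%R).
  { split.
    - apply Rmult_le_pos; [lra|]. apply Rlt_le, Rinv_0_lt_compat. lra.
    - apply (Rmult_lt_reg_r P); [lra|]. unfold Rdiv.
      rewrite Rmult_assoc, Rinv_l by lra. lra. }
  exists (fun i => - / (p - a) * (/ (p - a)) ^ i). split.
  - intros n. rewrite (Rsum_ext n _ (fun i => (/ P * (r / P) ^ i)%R)).
    + rewrite Rsum_scal.
      replace (/ (P - r))%R with (/ P * / (1 - r / P))%R by (field; lra).
      apply Rmult_le_compat_l; [|now apply Rsum_geom_le].
      apply Rlt_le, Rinv_0_lt_compat. lra.
    + intros i _. rewrite Cmod_mult, Cmod_opp, Cmod_pow, Cmod_inv by trivial.
      fold P. unfold Rdiv. rewrite Rpow_mult_distr. ring.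
  - intros w Hw.
    apply Clim_ext with (u := fun n =>
      - / (p - a) * Csum 0 n (fun i => ((w - a) / (p - a)) ^ i)).
    + intros n. rewrite <- Csum_scal. apply Csum_ext. intros i _.
      unfold Cdiv. rewrite Cpow_mult_l. ring.
    + assert (Hwp : w - p <> 0).
      { intros H. assert (H1 : w = p) by (replace w with (w - p + p) by ring;
          rewrite H; ring). subst w. fold P in Hw. lra. }
      replace (/ (w - p)) with (- / (p - a) * / (1 - (w - a) / (p - a))).
      * apply Clim_scal, Clim_geom. rewrite Cmod_div by trivial. fold P.
        eapply Rle_lt_trans; [|apply Hq]. apply Rmult_le_compat_r; trivial.
        apply Rlt_le, Rinv_0_lt_compat. lra.
      * field. repeat split; trivial.
        intros H. apply Hwp. replace (w - p) with (- (p - a - (w - a))) by ring.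
        rewrite H. ring.
Qed.

(** * Comparison with Coquelicot's power series and complex derivative *)

Lemma pow_n_Cpow (x : C) (k : nat) : @pow_n C_Ring x k = x ^ k.
Proof.
  induction k as [|k IH]; [reflexivity|]. simpl. rewrite <- IH. reflexivity.
Qed.

Lemma is_series_Clim (a : nat -> C) (l : C) :
  @is_series C_AbsRing C_NormedModule a l <-> Clim (fun n => Csum 0 n a) l.
Proof.
  rewrite Clim_incr_1, Clim_filterlim. reflexivity.
Qed.

Lemma is_pseries_Clim (c : nat -> C) (x l : C) :
  @is_pseries C_AbsRing C_NormedModule c x l <->
  Clim (fun n => Csum 0 n (fun i => c i * x ^ i)) l.
Proof.
  unfold is_pseries. rewrite is_series_Clim.
  assert (H : forall n, Csum 0 n (fun k : nat =>
    @scal _ C_NormedModule (@pow_n C_AbsRing x k) (c k)) =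
    Csum 0 n (fun i => c i * x ^ i)).
  { intros n. apply Csum_ext. intros i _.
    change (@pow_n C_Ring x i * c i = c i * x ^ i).
    rewrite pow_n_Cpow. ring. }
  split; apply Clim_ext; intros n; now rewrite H.
Qed.

(** Abel's lemma: convergence at [x] bounds the terms there, so at a smaller radius they are
    dominated by a geometric series beyond a finite index. *)
Lemma pseries_abs (c : nat -> C) (x l : C) (r : R) :
  (0 <= r < Cmod x)%R -> Clim (fun n => Csum 0 n (fun i => c i * x ^ i)) l ->
  exists m, forall n, (Rsum n (fun i => Cmod (c i) * r ^ i) <= m)%R.
Proof.
  intros Hr H. set (d := Cmod x) in *.
  assert (Ht : Clim (fun i => c i * x ^ i) (l - l)).
  { apply Clim_ext with (u := fun n => Csum 0 (S n) (fun i => c i * x ^ i) -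
      Csum 0 n (fun i => c i * x ^ i)).
    - intros n. rewrite Csum0_S. ring.
    - apply Clim_minus; [|exact H]. now apply Clim_incr_1 in H. }
  apply Clim_ev_bounded in Ht. destruct Ht as [N HN].
  replace (l - l) with (RtoC 0) in HN by ring. rewrite Cmod_0 in HN.
  assert (Hq : (0 <= r / d < 1)%R).
  { split.
    - apply Rmult_le_pos; [lra|]. apply Rlt_le, Rinv_0_lt_compat. lra.
    - apply (Rmult_lt_reg_r d); [lra|]. unfold Rdiv.
      rewrite Rmult_assoc, Rinv_l by lra. lra. }
  set (t := fun i => (Cmod (c i) * r ^ i)%R).
  assert (Ht0 : forall i, (0 <= t i)%R).
  { intros i. apply Rmult_le_pos; [apply Cmod_ge_0|apply pow_le; lra]. }
  exists (Rsum N t + / (1 - r / d))%R. intros n.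
  apply Rle_trans with (Rsum N t + Rsum n (fun i => (r / d) ^ i))%R;
    [|apply Rplus_le_compat_l; now apply Rsum_geom_le].
  induction n as [|n IH].
  - simpl. rewrite Rplus_0_r. now apply Rsum_pos.
  - destruct (Nat.le_gt_cases N n) as [Hn|Hn].
    + simpl. fold (t n). apply Rle_trans with
        (Rsum N t + Rsum n (fun i => (r / d) ^ i) + t n)%R; [lra|].
      rewrite Rplus_assoc. apply Rplus_le_compat_l, Rplus_le_compat_l.
      specialize (HN n Hn). rewrite Cmod_mult, Cmod_pow in HN. fold d in HN.
      unfold t. replace (r ^ n)%R with (d ^ n * (r / d) ^ n)%R
        by (rewrite <- Rpow_mult_distr; f_equal; field; lra).
      rewrite <- Rmult_assoc, <- (Rmult_1_l ((r / d) ^ n)) at 1.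
      rewrite <- (Rmult_1_l ((r / d) ^ n)) at 2.
      rewrite Rmult_1_l at 1.
      apply Rmult_le_compat_r; [apply pow_le; lra|]. lra.
    + apply Rle_trans with (Rsum N t); [apply Rsum_mono; trivial; lia|].
      assert (H0 : (0 <= Rsum (S n) (fun i => (r / d) ^ i))%R).
      { apply Rsum_pos. intros. apply pow_le. lra. }
      lra.
Qed.

Lemma analytic_NB (f : C -> C) (a : C) :
  analytic_at f a <-> exists r m, (0 < r)%R /\ NB a r m f.
Proof.
  split.
  - intros (c & r & Hr & H).
    (* [analytic_at] promises plain convergence on an open disc. A point at distance [3r/4] yields a
       finite norm on the closed disc of radius [r/2]. *)
    set (w := a + RtoC (r * 3 / 4)).
    assert (Hw : Cmod (w - a) = (r * 3 / 4)%R).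
    { unfold w. replace (a + (r * 3 / 4)%R - a) with (RtoC (r * 3 / 4)) by ring.
      rewrite Cmod_R, Rabs_pos_eq; lra. }
    assert (H1 := H w ltac:(lra)). rewrite is_pseries_Clim in H1.
    destruct (pseries_abs c (w - a) (f w) (r / 2) ltac:(lra) H1) as [m Hm].
    exists (r / 2)%R, m. split; [lra|]. exists c. split; [exact Hm|].
    intros v Hv. apply is_pseries_Clim. apply H. lra.
  - intros (r & m & Hr & c & H1 & H2). exists c, r. split; [exact Hr|].
    intros w Hw. apply is_pseries_Clim, H2. lra.
Qed.

Lemma C_derive_lim (f : C -> C) (a l : C) (K r : R) :
  (0 < r)%R ->
  (forall w, w <> a -> (Cmod (w - a) < r)%R ->
     (Cmod ((f w - f a) / (w - a) - l)%C <= K * Cmod (w - a))%R) ->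
  C_derive f a = l.
Proof.
  intros Hr H. apply is_C_lim_unique. apply filterlim_locally. intros eps.
  assert (HK : (0 < Rabs K + 1)%R) by (assert (H0 := Rabs_pos K); lra).
  set (d := Rmin r (eps / (Rabs K + 1))).
  assert (Hd : (0 < d)%R).
  { apply Rmin_pos; trivial. apply Rdiv_lt_0_compat; trivial. apply cond_pos. }
  assert (H2 : (0 < sqrt 2)%R) by (apply sqrt_lt_R0; lra).
  assert (Hd2 : (0 < d / sqrt 2)%R) by now apply Rdiv_lt_0_compat.
  exists (mkposreal _ Hd2). intros w Hw Hwa.
  apply C_NormedModule_mixin_compat2 in Hw. simpl in Hw.
  replace (sqrt 2 * (d / sqrt 2))%R with d in Hw by (field; lra).
  change (Cmod (w - a) < d)%R in Hw.
  apply C_NormedModule_mixin_compat1.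
  change (Cmod ((f w - f a) / (w - a) - l)%C < eps)%R.
  eapply Rle_lt_trans; [apply H; trivial|].
  - eapply Rlt_le_trans; [exact Hw|apply Rmin_l].
  - assert (Hw0 := Cmod_ge_0 (w - a)).
    apply Rle_lt_trans with ((Rabs K + 1) * Cmod (w - a))%R.
    + apply Rmult_le_compat_r; trivial. assert (H0 := Rle_abs K). lra.
    + apply Rlt_le_trans with ((Rabs K + 1) * d)%R.
      * now apply Rmult_lt_compat_l.
      * apply Rle_trans with ((Rabs K + 1) * (eps / (Rabs K + 1)))%R.
        { apply Rmult_le_compat_l; [lra|apply Rmin_r]. }
        right. field. lra.
Qed.

Lemma psn_C_derive (a : C) (r m : R) (c : nat -> C) (f : C -> C) :
  (0 < r)%R -> psn a r m c f -> C_derive f a = c 1%nat.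
Proof.
  intros Hr Hc. apply C_derive_lim with (K := (m / r ^ 2)%R) (r := r); trivial.
  intros w Hwa Hw.
  assert (Hw0 : w - a <> 0).
  { intros H. apply Hwa. replace w with (w - a + a) by ring. rewrite H. ring. }
  assert (H := psn_remainder a r m c f w 2 Hr Hc ltac:(lra)).
  rewrite !Csum0_S in H. rewrite (psn_at a r m c f Hr Hc).
  replace (f w - (Csum 0 0 (fun i => c i * (w - a) ^ i) + c 0%nat * (w - a) ^ 0 +
    c 1%nat * (w - a) ^ 1)) with
    (((f w - c 0%nat) / (w - a) - c 1%nat) * (w - a)) in H
    by (simpl; field; exact Hw0).
  rewrite Cmod_mult in H.
  assert (Hp : (0 < Cmod (w - a))%R) by now apply Cmod_gt_0.
  apply (Rmult_le_reg_r (Cmod (w - a))); trivial.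
  eapply Rle_trans; [exact H|]. right. field. lra.
Qed.

(** * Identity theorem and continuation along a segment *)

Definition agree_acc (f g : C -> C) (a : C) : Prop :=
  forall eps : R, (0 < eps)%R ->
    exists w, w <> a /\ (Cmod (w - a) < eps)%R /\ f w = g w.

Definition agree_near (f g : C -> C) (a : C) : Prop :=
  exists eps : R, (0 < eps)%R /\
    forall w, (Cmod (w - a) < eps)%R -> f w = g w.

(** If the coefficients before [i] vanish, the remainder of order [i + 1] at a zero at distance [d]
    gives [|c i| * d^i <= m * (d/r)^(i+1)]. Dividing by [d^i > 0] and letting [d] be small forces
    [c i = 0]. *)
Lemma psn_zero (a : C) (r m : R) (c : nat -> C) (f : C -> C) :
  (0 < r)%R -> psn a r m c f -> agree_acc f (fun _ => 0) a ->
  forall i, c i = 0.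
Proof.
  intros Hr Hc Hacc i.
  induction i as [i IH] using (well_founded_induction lt_wf).
  destruct (Ceq_dec (c i) 0) as [E|E]; [exact E|exfalso].
  assert (Hm := psn_pos a r m c f Hc).
  assert (Hci : (0 < Cmod (c i))%R) by now apply Cmod_gt_0.
  assert (Hri : (0 < r ^ S i)%R) by now apply pow_lt.
  (* [d < e] contradicts [|c i| * r^(i+1) <= m * d]; the denominator is [m + 1] since [m] may be
     0. *)
  set (e := Rmin r (Cmod (c i) * r ^ S i / (m + 1))).
  assert (He : (0 < e)%R).
  { apply Rmin_pos; trivial. apply Rdiv_lt_0_compat; [|lra].
    now apply Rmult_lt_0_compat. }
  destruct (Hacc e He) as (w & Hwa & Hw & Hf).
  assert (He1 : (e <= r)%R) by apply Rmin_l.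
  assert (He2 : (e <= Cmod (c i) * r ^ S i / (m + 1))%R) by apply Rmin_r.
  assert (H := psn_remainder a r m c f w (S i) Hr Hc ltac:(lra)).
  rewrite Csum0_S, Csum_zero, Hf in H by (intros j Hj; rewrite IH by lia; ring).
  replace (0 - (0 + c i * (w - a) ^ i)) with (- (c i * (w - a) ^ i)) in H by ring.
  rewrite Cmod_opp, Cmod_mult, Cmod_pow in H.
  set (d := Cmod (w - a)) in *.
  assert (Hd : (0 < d)%R).
  { apply Cmod_gt_0. intros H0. apply Hwa. replace w with (w - a + a) by ring.
    rewrite H0. ring. }
  assert (Hdi : (0 < d ^ i)%R) by now apply pow_lt.
  replace (m * (d / r) ^ S i)%R with (m * d / r ^ S i * d ^ i)%R in H.
  2:{ unfold Rdiv. rewrite Rpow_mult_distr, pow_inv. simpl. ring. }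
  apply Rmult_le_reg_r in H; trivial.
  assert (H1 : (Cmod (c i) * r ^ S i <= m * d)%R).
  { replace (m * d)%R with (m * d / r ^ S i * r ^ S i)%R by (field; lra).
    apply Rmult_le_compat_r; lra. }
  assert (H2 : (d * (m + 1) < Cmod (c i) * r ^ S i)%R).
  { apply Rlt_le_trans with (Cmod (c i) * r ^ S i / (m + 1) * (m + 1))%R.
    - apply Rmult_lt_compat_r; lra.
    - right. field. lra. }
  nra.
Qed.

Lemma NB_agree (a : C) (r m m' : R) (f g : C -> C) :
  (0 < r)%R -> NB a r m f -> NB a r m' g -> agree_acc f g a ->
  forall w, (Cmod (w - a) <= r)%R -> f w = g w.
Proof.
  intros Hr Hf Hg Hacc w Hw.
  assert (Hh : NB a r (m + Cmod (- (1)) * m') (fun w => f w + - (1) * g w)).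
  { apply NB_plus; [lra|exact Hf|]. now apply NB_scal. }
  destruct Hh as [c Hc].
  assert (H0 : forall i, c i = 0).
  { apply (psn_zero a r _ c _ Hr Hc). intros eps He.
    destruct (Hacc eps He) as (v & Hv1 & Hv2 & Hv3). exists v.
    repeat split; trivial. rewrite Hv3. ring. }
  assert (H1 : f w + - (1) * g w = 0).
  { apply (Clim_unique _ _ _ (proj2 Hc w Hw)).
    apply Clim_ext with (u := fun _ => 0); [|apply Clim_const].
    intros n. rewrite Csum_zero; [reflexivity|]. intros i _. rewrite H0. ring. }
  replace (f w) with (f w + - (1) * g w + g w) by ring. rewrite H1. ring.
Qed.

Lemma analytic_agree (f g : C -> C) (a : C) :
  analytic_at f a -> analytic_at g a -> agree_acc f g a -> agree_near f g a.
Proof.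
  rewrite !analytic_NB. intros (r & m & Hr & Hf) (r' & m' & Hr' & Hg) Hacc.
  assert (Hrr : (0 < Rmin r r')%R) by now apply Rmin_pos.
  exists (Rmin r r'). split; trivial. intros w Hw.
  apply (NB_agree a (Rmin r r') m m' f g); trivial; [| |lra].
  - apply NB_restrict with r; trivial. split; [lra|apply Rmin_l].
  - apply NB_restrict with r'; trivial. split; [lra|apply Rmin_r].
Qed.

(** * Closure properties of analytic functions, and agreement at a possible pole *)

Lemma analytic_ext (f g : C -> C) (a : C) :
  agree_near f g a -> analytic_at g a -> analytic_at f a.
Proof.
  rewrite !analytic_NB. intros (e & He & H) (r & m & Hr & Hg).
  exists (Rmin r (e / 2)), m.
  assert (H1 : (0 < Rmin r (e / 2))%R) by (apply Rmin_pos; lra).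
  split; trivial. apply NB_ext with g.
  - intros w Hw. symmetry. apply H. eapply Rle_lt_trans; [exact Hw|].
    eapply Rle_lt_trans; [apply Rmin_r|]. lra.
  - apply NB_restrict with r; trivial. split; [lra|apply Rmin_l].
Qed.

Lemma analytic_mult (f g : C -> C) (a : C) :
  analytic_at f a -> analytic_at g a -> analytic_at (fun w => f w * g w) a.
Proof.
  rewrite !analytic_NB. intros (r & m & Hr & Hf) (r' & m' & Hr' & Hg).
  assert (H1 : (0 < Rmin r r')%R) by now apply Rmin_pos.
  exists (Rmin r r'), (m * m')%R. split; trivial. apply NB_mult; trivial.
  - apply NB_restrict with r; trivial. split; [lra|apply Rmin_l].
  - apply NB_restrict with r'; trivial. split; [lra|apply Rmin_r].
Qed.

Lemma analytic_plus (f g : C -> C) (a : C) :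
  analytic_at f a -> analytic_at g a -> analytic_at (fun w => f w + g w) a.
Proof.
  rewrite !analytic_NB. intros (r & m & Hr & Hf) (r' & m' & Hr' & Hg).
  assert (H1 : (0 < Rmin r r')%R) by now apply Rmin_pos.
  exists (Rmin r r'), (m + m')%R. split; trivial. apply NB_plus; trivial.
  - lra.
  - apply NB_restrict with r; trivial. split; [lra|apply Rmin_l].
  - apply NB_restrict with r'; trivial. split; [lra|apply Rmin_r].
Qed.

Lemma analytic_const (k a : C) : analytic_at (fun _ => k) a.
Proof.
  apply analytic_NB. exists 1%R, (Cmod k). split; [lra|apply NB_const].
Qed.

Lemma analytic_id (p a : C) : analytic_at (fun w => w - p) a.
Proof.
  apply analytic_NB. exists 1%R, (Cmod (a - p) + 1)%R.
  split; [lra|]. apply NB_id. lra.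
Qed.

Lemma analytic_pow (f : C -> C) (a : C) (k : nat) :
  analytic_at f a -> analytic_at (fun w => f w ^ k) a.
Proof.
  intros Hf. induction k as [|k IH]; [exact (analytic_const 1 a)|].
  simpl. now apply analytic_mult.
Qed.

Lemma analytic_translate (f : C -> C) (a b : C) :
  analytic_at f (a + b) -> analytic_at (fun w => f (w + b)) a.
Proof.
  intros (c & r & Hr & H). exists c, r. split; trivial. intros w Hw.
  replace (w - a) with (w + b - (a + b)) by ring. apply H.
  now replace (w + b - (a + b)) with (w - a) by ring.
Qed.

(** A pole of order [m >= 1] is impossible: its numerator [h] would agree with [g w * (w - a)^m] on
    points accumulating at [a], hence also at [a] itself, where the latter is 0 and [h] is not. *)
Lemma meromorphic_agree (f g : C -> C) (a : C) :
  analytic_at f a \/ pole_at f a -> analytic_at g a -> agree_acc f g a ->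
  agree_near f g a.
Proof.
  intros [Hf|Hf] Hg Hacc; [now apply analytic_agree|exfalso].
  destruct Hf as (m & h & r & Hm & Hr & Hh & Hha & Hf).
  assert (Hn : agree_near h (fun w => g w * (w - a) ^ m) a).
  { apply analytic_agree; trivial.
    - apply analytic_mult; trivial. apply analytic_pow, analytic_id.
    - intros eps He. destruct (Hacc (Rmin eps r)) as (w & Hw1 & Hw2 & Hw3).
      { now apply Rmin_pos. }
      exists w. split; [exact Hw1|]. split.
      + eapply Rlt_le_trans; [exact Hw2|apply Rmin_l].
      + rewrite <- Hw3, Hf; trivial.
        * field. apply Cpow_nz. intros H. apply Hw1.
          replace w with (w - a + a) by ring. rewrite H. ring.
        * eapply Rlt_le_trans; [exact Hw2|apply Rmin_r]. }
  destruct Hn as (e & He & Hn). apply Hha. rewrite Hn.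
  - replace (a - a) with (RtoC 0) by ring. destruct m as [|m]; [lia|].
    simpl. ring.
  - replace (a - a) with (RtoC 0) by ring. now rewrite Cmod_0.
Qed.

Lemma agree_near_acc (f g : C -> C) (a b : C) (eps : R) :
  (forall w, (Cmod (w - a) < eps)%R -> f w = g w) ->
  (Cmod (b - a) < eps)%R -> agree_near f g b.
Proof.
  intros H Hb. exists (eps - Cmod (b - a))%R. split; [lra|].
  intros w Hw. apply H. replace (w - a) with (w - b + (b - a)) by ring.
  eapply Rle_lt_trans; [apply Cmod_triangle|]. lra.
Qed.

(** Connectedness of the segment: let [T] be the supremum of the parameters up to which agreement is
    local. Agreement accumulates at [T] from below, so it holds near [T], and this neighbourhood
    would push the supremum further unless [T = 1]. Only a local identity theorem at the points of
    the segment is asked for. *)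
Lemma agree_continuation (f g : C -> C) (p q : C) :
  p <> q ->
  (forall t : R, (0 <= t <= 1)%R ->
     agree_acc f g (p + t * (q - p)) -> agree_near f g (p + t * (q - p))) ->
  agree_acc f g p -> agree_near f g q.
Proof.
  intros Hpq Hloc Hp. set (y := fun t : R => p + t * (q - p)).
  change (forall t : R, (0 <= t <= 1)%R ->
    agree_acc f g (y t) -> agree_near f g (y t)) in Hloc.
  set (D := Cmod (q - p)).
  assert (HD : (0 < D)%R).
  { apply Cmod_gt_0. intros H. apply Hpq.
    replace q with (q - p + p) by ring. rewrite H. ring. }
  assert (Hy : forall s t, Cmod (y s - y t) = (Rabs (s - t) * D)%R).
  { intros s t. unfold y.
    replace (p + s * (q - p) - (p + t * (q - p))) with (RtoC (s - t) * (q - p))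
      by (rewrite RtoC_minus; ring).
    rewrite Cmod_mult, Cmod_R. reflexivity. }
  assert (Hinj : forall s t, s <> t -> y s <> y t).
  { intros s t Hst Heq. assert (H := Hy s t). rewrite Heq in H.
    replace (y t - y t) with (RtoC 0) in H by ring. rewrite Cmod_0 in H.
    assert (H0 : (0 < Rabs (s - t))%R) by (apply Rabs_pos_lt; lra). nra. }
  set (E := fun t => (0 <= t <= 1)%R /\
    forall s, (0 <= s <= t)%R -> agree_near f g (y s)).
  assert (Hy0 : y 0%R = p) by (unfold y; ring).
  assert (H0 : E 0%R).
  { split; [lra|]. intros s Hs. replace s with 0%R by lra.
    apply Hloc; [lra|]. now rewrite Hy0. }
  destruct (completeness E) as [T [HT1 HT2]].
  { exists 1%R. intros t [Ht _]. lra. }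
  { now exists 0%R. }
  assert (HT0 : (0 <= T)%R) by now apply HT1.
  assert (HT1' : (T <= 1)%R) by (apply HT2; intros t [Ht _]; lra).
  assert (HTn : agree_near f g (y T)).
  { apply Hloc; [lra|]. destruct (Req_dec T 0) as [->|HTn0].
    { now rewrite Hy0. }
    intros eps He.
    assert (Hex : exists t, E t /\ (T - Rmin T (eps / D) < t)%R).
    { apply NNPP. intros Hno. assert (Hub : is_upper_bound E (T - Rmin T (eps / D))).
      { intros t Ht. apply Rnot_lt_le. intros Hlt. apply Hno. now exists t. }
      apply HT2 in Hub. assert (Hpos : (0 < Rmin T (eps / D))%R); [|lra].
      apply Rmin_pos; [lra|]. now apply Rdiv_lt_0_compat. }
    destruct Hex as (t & Ht & HtT).
    assert (HtT1 : (t <= T)%R) by now apply HT1.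
    assert (Hm1 := Rmin_l T (eps / D)). assert (Hm2 := Rmin_r T (eps / D)).
    (* The parameter [t] may equal [T]; the midpoint is strictly below [T], as accumulation
       requires, and still within reach. *)
    set (s := (t / 2 + (T - Rmin T (eps / D)) / 2)%R).
    assert (Hs : agree_near f g (y s)).
    { apply (proj2 Ht). unfold s. lra. }
    exists (y s). split; [|split].
    - apply Hinj. unfold s. lra.
    - rewrite Hy. rewrite Rabs_left by (unfold s; lra).
      apply Rlt_le_trans with (eps / D * D)%R; [|right; field; lra].
      apply Rmult_lt_compat_r; trivial. unfold s. lra.
    - destruct Hs as (e & He' & Hs). apply Hs.
      replace (y s - y s) with (RtoC 0) by ring. now rewrite Cmod_0. }
  destruct HTn as (e & He & HTe).
  assert (Hext : forall s, (Rabs (s - T) < e / D)%R -> agree_near f g (y s)).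
  { intros s Hs. apply agree_near_acc with (y T) e; trivial. rewrite Hy.
    apply Rlt_le_trans with (e / D * D)%R; [|right; field; lra].
    now apply Rmult_lt_compat_r. }
  assert (HeD : (0 < e / D)%R) by now apply Rdiv_lt_0_compat.
  assert (HT : forall s, (0 <= s < T + e / D)%R -> agree_near f g (y s)).
  { intros s Hs. destruct (Rlt_le_dec (T - e / D) s) as [Hc|Hc].
    - apply Hext. apply Rabs_def1; lra.
    - assert (Hex : exists t, E t /\ (s < t)%R).
      { apply NNPP. intros Hno. assert (Hub : is_upper_bound E s).
        { intros t Ht. apply Rnot_lt_le. intros Hlt. apply Hno. now exists t. }
        apply HT2 in Hub. lra. }
      destruct Hex as (t & Ht & Hst). apply (proj2 Ht). lra. }
  replace q with (y 1%R) by (unfold y; ring).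
  destruct (Req_dec T 1) as [->|HT1n]; [apply HT; lra|].
  exfalso. set (t := Rmin 1 (T + e / D / 2)).
  assert (Ht1 := Rmin_l 1 (T + e / D / 2)).
  assert (Ht2 := Rmin_r 1 (T + e / D / 2)). fold t in Ht1, Ht2.
  assert (Htt : (T < t)%R) by (apply Rmin_glb_lt; lra).
  assert (HE : E t).
  { split; [lra|]. intros s Hs. apply HT. lra. }
  apply HT1 in HE. lra.
Qed.

(** * Exponential and logarithm *)

Lemma Cexp_plus (a b : C) : Cexp (a + b) = Cexp a * Cexp b.
Proof.
  unfold Cexp. apply injective_projections; simpl; unfold Re, Im; simpl;
    rewrite exp_plus, ?cos_plus, ?sin_plus; ring.
Qed.

Lemma Cexp_RtoC (x : R) : Cexp (RtoC x) = RtoC (exp x).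
Proof.
  unfold Cexp. apply injective_projections; simpl; unfold Re, Im; simpl;
    rewrite ?cos_0, ?sin_0; ring.
Qed.

Lemma Cexp_0 : Cexp 0 = 1.
Proof. rewrite Cexp_RtoC, exp_0. reflexivity. Qed.

Lemma Cexp_neq0 (z : C) : Cexp z <> 0.
Proof.
  intros H. assert (H1 : Cexp (z + - z) = 0) by (rewrite Cexp_plus, H; ring).
  replace (z + - z) with (RtoC 0) in H1 by ring. rewrite Cexp_0 in H1.
  apply RtoC_inj in H1. lra.
Qed.

Lemma Cexp_opp (z : C) : Cexp (- z) = / Cexp z.
Proof.
  assert (H := Cexp_neq0 z).
  replace (Cexp (- z)) with (Cexp (- z) * Cexp z * / Cexp z) by (field; trivial).
  rewrite <- Cexp_plus. replace (- z + z) with (RtoC 0) by ring.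
  rewrite Cexp_0. ring.
Qed.

Lemma Cexp_minus (a b : C) : Cexp (a - b) = Cexp a / Cexp b.
Proof. unfold Cminus. rewrite Cexp_plus, Cexp_opp. reflexivity. Qed.

Lemma Cmod_Cexp (z : C) : Cmod (Cexp z) = exp (Re z).
Proof.
  unfold Cexp, Cmod. cbn [fst snd].
  assert (H := sin2_cos2 (Im z)). unfold Rsqr in H.
  replace ((exp (Re z) * cos (Im z)) ^ 2 + (exp (Re z) * sin (Im z)) ^ 2)%R
    with (exp (Re z) ^ 2)%R.
  - rewrite <- Rsqr_pow2. apply sqrt_Rsqr. left. apply exp_pos.
  - transitivity (exp (Re z) ^ 2 * (sin (Im z) * sin (Im z) + cos (Im z) * cos (Im z)))%R.
    + rewrite H. ring.
    + ring.
Qed.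

(** Iterated derivatives are read off an explicit family; an open interval is used because each
    stage has to rewrite the previous one on a neighbourhood. *)
Lemma Derive_n_family (f : nat -> R -> R) (a b : R) (n : nat) :
  (forall i t, (i < n)%nat -> (a < t < b)%R -> is_derive (f i) t (f (S i) t)) ->
  forall k t, (k <= n)%nat -> (a < t < b)%R ->
    ex_derive_n (f 0%nat) k t /\ Derive_n (f 0%nat) k t = f k t.
Proof.
  intros Hf k. induction k as [|k IH]; intros t Hk Ht.
  { split; reflexivity || exact I. }
  assert (Hl : locally t (fun s => f k s = Derive_n (f 0%nat) k s)).
  { assert (Hd : (0 < Rmin (t - a) (b - t))%R) by (apply Rmin_pos; lra).
    exists (mkposreal _ Hd). intros s Hs. symmetry. apply IH; [lia|].
    apply Rabs_def2 in Hs. simpl in Hs. unfold minus, plus, opp in Hs. simpl in Hs.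
    assert (H1 := Rmin_l (t - a) (b - t)). assert (H2 := Rmin_r (t - a) (b - t)).
    lra. }
  assert (Hd : is_derive (Derive_n (f 0%nat) k) t (f (S k) t)).
  { apply is_derive_ext_loc with (f k); trivial. apply Hf; [lia|trivial]. }
  split.
  - simpl. exists (f (S k) t). exact Hd.
  - simpl. now apply is_derive_unique.
Qed.

Lemma taylor_family (f : nat -> R -> R) (a b x y : R) (n : nat) :
  (a < x)%R -> (x < y)%R -> (y < b)%R ->
  (forall i t, (i < S n)%nat -> (a < t < b)%R -> is_derive (f i) t (f (S i) t)) ->
  exists s, (x < s < y)%R /\
    f 0%nat y = (Rsum (S n) (fun i => (y - x) ^ i / INR (fact i) * f i x) +
      (y - x) ^ S n / INR (fact (S n)) * f (S n) s)%R.
Proof.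
  intros Hx Hxy Hy Hf.
  assert (H := Derive_n_family f a b (S n) Hf).
  destruct (Taylor_Lagrange (f 0%nat) n x y Hxy) as (s & Hs & E).
  { intros t Ht k Hk. apply H; [lia|lra]. }
  exists s. split; trivial. rewrite E. rewrite (proj2 (H (S n) s (Nat.le_refl _) ltac:(lra))).
  f_equal. clear E Hs s.
  assert (H0 : forall m, (m <= n)%nat ->
    sum_f_R0 (fun m => (y - x) ^ m / INR (fact m) * Derive_n (f 0%nat) m x)%R m =
    Rsum (S m) (fun i => (y - x) ^ i / INR (fact i) * f i x)%R).
  { induction m as [|m IH]; intros Hm.
    - simpl. lra.
    - simpl sum_f_R0. rewrite IH by lia. simpl Rsum.
      change (Derive (Derive_n (f 0%nat) m) x) with (Derive_n (f 0%nat) (S m) x).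
      rewrite (proj2 (H (S m) x ltac:(lia) ltac:(lra))). reflexivity. }
  now apply H0.
Qed.

Lemma is_derive_Re_Cexp (c z : C) (t : R) :
  is_derive (fun t : R => Re (c * Cexp (t * z))) t (Re (c * z * Cexp (t * z))).
Proof.
  destruct c as [c1 c2]. destruct z as [x y]. unfold Cexp, Re, Im. simpl.
  auto_derive; [trivial|]. unfold Re, Im; simpl.
  replace (t * x + - (0 * y))%R with (t * x)%R by ring.
  replace (t * x - 0 * y)%R with (t * x)%R by ring.
  replace (t * y + 0 * x)%R with (t * y)%R by ring.
  ring.
Qed.

(** The real Taylor-Lagrange theorem applied to [t -> Re (c * Cexp (t * z))] on [[0, 1]]. The factor
    [c] selects the component: [1] gives the real part, [- Ci] the imaginary part. *)
Lemma Cexp_taylor (c z : C) (n : nat) :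
  (Rabs (Re (c * Cexp z)%C - Re (c * Csum 0 (S n) (fun i => z ^ i / (fact i)%:C))%C)
   <= Cmod c * exp (Rabs (Re z)) * (Cmod z ^ S n / INR (fact (S n))))%R.
Proof.
  destruct (taylor_family (fun i t => Re (c * z ^ i * Cexp (RtoC t * z))) (-1) 2 0 1 n)
    as (s & Hs & E); try lra.
  { intros i t _ _. replace (c * z ^ S i) with (c * z ^ i * z) by (simpl; ring).
    apply is_derive_Re_Cexp. }
  simpl pow in E at 1.
  replace (c * Cexp z) with (c * z ^ 0 * Cexp (1%R * z))
    by (rewrite Cmult_1_l; simpl; ring).
  rewrite E.
  assert (E2 : Re (c * Csum 0 (S n) (fun i => z ^ i / (fact i)%:C)) =
    Rsum (S n) (fun i => ((1 - 0) ^ i / INR (fact i) *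
      Re (c * z ^ i * Cexp (RtoC 0 * z))%C)%R)).
  { rewrite <- Csum_scal, Re_Csum. apply Rsum_ext. intros i _.
    replace (RtoC 0 * z) with (RtoC 0) by ring. rewrite Cexp_0.
    rewrite Rminus_0_r, pow1.
    unfold Cdiv, Nat2C. rewrite <- RtoC_Rinv.
    replace (c * (z ^ i * (/ INR (fact i))%R))
      with (RtoC (/ INR (fact i)) * (c * z ^ i * 1)) by ring.
    unfold Rdiv. rewrite Rmult_1_l.
    generalize (c * z ^ i * 1). intros v. simpl. unfold Re. ring. }
  rewrite E2.
  match goal with |- (Rabs (?A + ?B - ?A) <= _)%R =>
    replace (A + B - A)%R with B by ring end.
  rewrite Rminus_0_r, pow1, Rabs_mult.
  rewrite (Rabs_pos_eq (1 / INR (fact (S n)))).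
  2:{ apply Rlt_le, Rdiv_lt_0_compat; [lra|apply INR_fact_lt_0]. }
  assert (H : (Rabs (Re (c * z ^ S n * Cexp (s * z))%C) <=
    Cmod c * Cmod z ^ S n * exp (Rabs (Re z)))%R).
  { eapply Rle_trans; [apply re_le_Cmod|].
    rewrite !Cmod_mult, Cmod_pow, Cmod_Cexp.
    apply Rmult_le_compat_l.
    - apply Rmult_le_pos; [apply Cmod_ge_0|apply pow_le, Cmod_ge_0].
    - replace (Re (s * z)%C) with (s * Re z)%R by (destruct z; simpl; unfold Re; simpl; ring).
      apply Rnot_lt_le; intros Hlt; apply exp_lt_inv in Hlt.
      assert (Ha := Rle_abs (Re z)). assert (Hb := Rle_abs (- Re z)).
      rewrite Rabs_Ropp in Hb. nra. }
  apply Rle_trans with (1 / INR (fact (S n)) *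
    (Cmod c * Cmod z ^ S n * exp (Rabs (Re z))))%R.
  - apply Rmult_le_compat_l; trivial. apply Rlt_le, Rdiv_lt_0_compat;
      [lra|apply INR_fact_lt_0].
  - right. field. apply INR_fact_neq_0.
Qed.

Lemma Cexp_series (z : C) :
  Clim (fun n => Csum 0 n (fun i => z ^ i / (fact i)%:C)) (Cexp z).
Proof.
  apply Clim_incr_1.
  set (M := exp (Rabs (Re z))).
  apply Clim_squeeze with (N := 0%nat)
    (v := fun n => (2 * M * (Cmod z ^ S n / INR (fact (S n))))%R).
  - intros n _. rewrite Cmod_minus_sym.
    eapply Rle_trans; [apply Cmod_le_Re_Im|].
    assert (H1 := Cexp_taylor 1 z n). assert (H2 := Cexp_taylor (- Ci) z n).
    rewrite Cmod_1 in H1. rewrite Cmod_opp, Cmod_Ci in H2. fold M in H1, H2.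
    rewrite !Cmult_1_l in H1.
    set (S0 := Csum 0 (S n) (fun i => z ^ i / (fact i)%:C)) in *.
    replace (Re (- Ci * Cexp z)%C - Re (- Ci * S0)%C)%R with (Im (Cexp z - S0)%C) in H2
      by (simpl; unfold Re, Im; ring).
    replace (Re (Cexp z) - Re S0)%R with (Re (Cexp z - S0)%C) in H1
      by (simpl; unfold Re, Im; ring).
    lra.
  - replace 0%R with (2 * M * 0)%R by ring.
    apply is_lim_seq_mult'; [apply is_lim_seq_const|].
    apply (is_lim_seq_incr_1 (fun n => (Cmod z ^ n / INR (fact n))%R)).
    apply is_lim_seq_Reals. apply cv_speed_pow_fact.
Qed.

Lemma Rsum_exp_le (x : R) (n : nat) :
  (0 <= x)%R -> (Rsum n (fun i => x ^ i / INR (fact i)) <= exp x)%R.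
Proof.
  intros Hx.
  assert (H := Clim_Re _ _ (Cexp_series (RtoC x))). rewrite Cexp_RtoC in H.
  apply (is_lim_seq_incr_compare (fun n => Rsum n (fun i => x ^ i / INR (fact i))%R)).
  - eapply is_lim_seq_ext; [|exact H]. intros k. simpl. rewrite Re_Csum.
    apply Rsum_ext. intros i _. unfold Cdiv, Nat2C.
    rewrite <- RtoC_pow, <- RtoC_Rinv, <- RtoC_mult. reflexivity.
  - intros k. simpl. assert (H0 : (0 <= x ^ k / INR (fact k))%R); [|lra].
    apply Rmult_le_pos; [now apply pow_le|].
    apply Rlt_le, Rinv_0_lt_compat, INR_fact_lt_0.
Qed.

Lemma Cmod_Nat2C (n : nat) : Cmod n%:C = INR n.
Proof. unfold Nat2C. rewrite Cmod_R. apply Rabs_pos_eq, pos_INR. Qed.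

Lemma NB_exp (a : C) (r m : R) (f : C -> C) :
  (0 < r)%R -> NB a r m f -> NB a r (exp m) (fun w => Cexp (f w)).
Proof.
  intros Hr Hf. assert (Hm := NB_pos a r m f Hf).
  apply NB_series with (m := fun k => (m ^ k / INR (fact k))%R)
    (f := fun k w => / (fact k)%:C * f w ^ k); trivial.
  - intros k. apply NB_le with (Cmod (/ (fact k)%:C) * m ^ k)%R.
    + rewrite Cmod_inv, Cmod_Nat2C by apply Nat2C_neq0, fact_neq_0.
      right. unfold Rdiv. ring.
    + now apply NB_scal, NB_pow.
  - intros K. now apply Rsum_exp_le.
  - intros w _. eapply Clim_ext; [|apply Cexp_series]. intros n. simpl.
    apply Csum_ext. intros i _. unfold Cdiv. ring.
Qed.

Definition CLim (u : nat -> C) : C :=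
  (real (Lim_seq (fun n => Re (u n))), real (Lim_seq (fun n => Im (u n)))).

Lemma CLim_unique (u : nat -> C) (l : C) : Clim u l -> CLim u = l.
Proof.
  intros H. unfold CLim.
  rewrite (is_lim_seq_unique _ _ (Clim_Re _ _ H)).
  rewrite (is_lim_seq_unique _ _ (Clim_Im _ _ H)). now destruct l.
Qed.

Definition log1p_coef (i : nat) : C :=
  match i with O => 0%R | S j => (- (1)) ^ j / i%:C end.

(** The principal logarithm of [1 + u], meaningful for [|u| < 1]; elsewhere the value is whatever
    [CLim] returns. *)
Definition Clog1p (u : C) : C :=
  CLim (fun n => Csum 0 n (fun i => log1p_coef i * u ^ i)).

Lemma Cmod_log1p_coef (i : nat) : (Cmod (log1p_coef i) <= 1)%R.
Proof.
  destruct i as [|i]; simpl log1p_coef; [rewrite Cmod_0; lra|].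
  rewrite Cmod_div by now apply Nat2C_neq0.
  rewrite Cmod_pow, Cmod_m1, pow1, Cmod_Nat2C.
  assert (H : (1 <= INR (S i))%R) by (rewrite S_INR; assert (H := pos_INR i); lra).
  unfold Rdiv. rewrite Rmult_1_l. rewrite <- Rinv_1. apply Rinv_le_contravar; lra.
Qed.

Lemma Clog1p_series (u : C) :
  (Cmod u < 1)%R ->
  Clim (fun n => Csum 0 n (fun i => log1p_coef i * u ^ i)) (Clog1p u).
Proof.
  intros Hu.
  destruct (Csum_abs_conv (fun i => log1p_coef i * u ^ i)
    (fun i => (Cmod u ^ i)%R) (/ (1 - Cmod u))) as [l Hl].
  - intros i. rewrite Cmod_mult, Cmod_pow. rewrite <- (Rmult_1_l (Cmod u ^ i)) at 2.
    apply Rmult_le_compat_r; [apply pow_le, Cmod_ge_0|apply Cmod_log1p_coef].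
  - intros n. apply Rsum_geom_le. split; [apply Cmod_ge_0|trivial].
  - unfold Clog1p. now rewrite (CLim_unique _ _ Hl).
Qed.

Lemma NB_log1p (a : C) (r m : R) (f : C -> C) :
  (0 < r)%R -> (m <= / 2)%R -> NB a r m f ->
  NB a r 2 (fun w => Clog1p (f w)).
Proof.
  intros Hr Hm Hf. assert (Hm0 := NB_pos a r m f Hf).
  apply NB_series with (m := fun k => (m ^ k)%R)
    (f := fun k w => log1p_coef k * f w ^ k); trivial.
  - intros k. apply NB_le with (Cmod (log1p_coef k) * m ^ k)%R.
    + rewrite <- (Rmult_1_l (m ^ k)) at 2. apply Rmult_le_compat_r.
      * now apply pow_le.
      * apply Cmod_log1p_coef.
    + now apply NB_scal, NB_pow.
  - intros K. eapply Rle_trans; [apply Rsum_geom_le; lra|].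
    rewrite <- (Rinv_inv 2). apply Rinv_le_contravar; lra.
  - intros w Hw. apply Clog1p_series.
    assert (H := NB_bound a r m f w Hr Hf Hw). lra.
Qed.

Lemma is_derive_ln_comp (g : R -> R) (t g' : R) :
  is_derive g t g' -> (0 < g t)%R ->
  is_derive (fun t => ln (g t)) t (g' / g t)%R.
Proof.
  intros Hg Hp. apply (is_derive_comp ln g); [now apply is_derive_ln|exact Hg].
Qed.

Lemma is_derive_inv_pow (K t : R) (j : nat) :
  (1 + t <> 0)%R ->
  is_derive (fun x => K / (1 + x) ^ S j)%R t
    (- (K * INR (S j)) / (1 + t) ^ S (S j))%R.
Proof.
  intros Hp. assert (Hq : ((1 + t) ^ j <> 0)%R) by now apply pow_nonzero.
  auto_derive.
  - now apply Rmult_integral_contrapositive_currified.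
  - rewrite <- S_INR. simpl pred. destruct j as [|j]; [simpl; field; trivial|].
    simpl pow in *. field.
    split; trivial. intros H0. apply Hq. rewrite H0. ring.
Qed.

(** The Lagrange remainder has the denominator [(1 + s)^(n+1) >= 1]. Hence the estimate holds for
    all [x >= 0], even beyond the disc of convergence, and can be used at [x / (N + 1)] for every
    [N]. *)
Lemma ln1p_taylor (x : R) (n : nat) :
  (0 <= x)%R ->
  (Rabs (ln (1 + x) - Rsum (S n) (fun i => Re (log1p_coef i) * x ^ i))
   <= x ^ S n)%R.
Proof.
  intros [Hx|<-].
  2:{ rewrite Rplus_0_r, ln_1.
      replace (Rsum (S n) (fun i => (Re (log1p_coef i) * 0 ^ i)%R)) with 0%R.
      - rewrite Rminus_0_r, Rabs_R0. simpl. lra.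
      - induction n as [|n IH]; [simpl; unfold Re; simpl; ring|].
        simpl Rsum in *. rewrite <- IH. simpl. ring. }
  set (f := fun i t => match i with
    | O => ln (1 + t)
    | S j => ((-1) ^ j * INR (fact j) / (1 + t) ^ i)%R end).
  destruct (taylor_family f (-1) (x + 1) 0 x n) as (s & Hs & E); try lra.
  { intros i t _ Ht. destruct i as [|j].
    - unfold f. simpl. replace (1 * 1 / ((1 + t) * 1))%R with (1 / (1 + t))%R by (field; lra).
      apply (is_derive_ln_comp (fun t => 1 + t)%R); [|lra].
      auto_derive; trivial.
    - unfold f. replace ((-1) ^ S j * INR (fact (S j)) / (1 + t) ^ S (S j))%R
        with (- ((-1) ^ j * INR (fact j) * INR (S j)) / (1 + t) ^ S (S j))%R.
      + apply is_derive_inv_pow. lra.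
      + rewrite fact_simpl, mult_INR. simpl pow. field. split; [|lra].
        apply pow_nonzero. lra. }
  simpl f at 1 in E. rewrite E.
  assert (E2 : Rsum (S n) (fun i => (Re (log1p_coef i) * x ^ i)%R) =
    Rsum (S n) (fun i => ((x - 0) ^ i / INR (fact i) * f i 0)%R)).
  { apply Rsum_ext. intros i _. rewrite Rminus_0_r. destruct i as [|i].
    - simpl. rewrite Rplus_0_r, ln_1. unfold Re. simpl. ring.
    - unfold f, log1p_coef. rewrite Rplus_0_r, pow1.
      replace ((- (1)) ^ i / (S i)%:C) with (RtoC ((-1) ^ i / INR (S i))).
      + rewrite fact_simpl, mult_INR. unfold Re, RtoC. cbn [fst]. field.
        split; [apply INR_fact_neq_0|now apply not_0_INR].
      + unfold Nat2C, Cdiv, Rdiv. rewrite RtoC_mult, RtoC_pow, RtoC_Rinv.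
        f_equal. f_equal. apply injective_projections; simpl; ring. }
  rewrite E2. clear E E2.
  match goal with |- (Rabs (?A + ?B - ?A) <= _)%R =>
    replace (A + B - A)%R with B by ring end.
  rewrite Rminus_0_r. unfold f.
  assert (H1 : (1 <= (1 + s) ^ S n)%R) by (apply pow_R1_Rle; lra).
  assert (Hx0 : (0 <= x ^ S n)%R) by (apply pow_le; lra).
  replace (x ^ S n / INR (fact (S n)) * ((-1) ^ n * INR (fact n) / (1 + s) ^ S n))%R
    with (x ^ S n * ((-1) ^ n * (/ INR (S n) * / (1 + s) ^ S n)))%R.
  2:{ rewrite fact_simpl, mult_INR. field. repeat split.
      - lra.
      - apply INR_fact_neq_0.
      - now apply not_0_INR. }
  rewrite !Rabs_mult, pow_1_abs, Rmult_1_l, (Rabs_pos_eq (x ^ S n)) by trivial.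
  rewrite <- (Rmult_1_r (x ^ S n)) at 2.
  apply Rmult_le_compat_l; trivial.
  assert (HS : (1 <= INR (S n))%R).
  { rewrite S_INR. assert (H := pos_INR n). lra. }
  assert (Hi : forall y : R, (1 <= y)%R -> (0 <= Rabs (/ y) <= 1)%R).
  { intros y Hy. split; [apply Rabs_pos|]. rewrite Rabs_pos_eq.
    - rewrite <- Rinv_1. apply Rinv_le_contravar; lra.
    - apply Rlt_le, Rinv_0_lt_compat; lra. }
  destruct (Hi _ HS). destruct (Hi _ H1). nra.
Qed.

Lemma log1p_coef_real (i : nat) : log1p_coef i = RtoC (Re (log1p_coef i)).
Proof.
  destruct i as [|i]; [reflexivity|]. unfold log1p_coef.
  replace ((- (1)) ^ i / (S i)%:C) with (RtoC ((-1) ^ i / INR (S i)));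
    [reflexivity|].
  unfold Nat2C, Cdiv, Rdiv. rewrite RtoC_mult, RtoC_pow, RtoC_Rinv.
  f_equal. f_equal. apply injective_projections; simpl; ring.
Qed.

Lemma Clog1p_pos (x : R) : (0 <= x < 1)%R -> Clog1p (RtoC x) = RtoC (ln (1 + x)).
Proof.
  intros Hx. apply CLim_unique. apply Clim_incr_1.
  apply Clim_squeeze with (v := fun n => (x ^ S n)%R) (N := 0%nat).
  - intros n _.
    rewrite (Csum_ext 0 (S n) _ (fun i => RtoC (Re (log1p_coef i) * x ^ i))).
    + rewrite Csum_RtoC, <- RtoC_minus, Cmod_R, <- Rabs_Ropp, Ropp_minus_distr.
      apply ln1p_taylor. lra.
    + intros i _. rewrite RtoC_mult, <- log1p_coef_real, RtoC_pow. reflexivity.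
  - apply (is_lim_seq_incr_1 (fun n => (x ^ n)%R)). apply is_lim_seq_geom.
    rewrite Rabs_pos_eq; lra.
Qed.

(** Both sides have finite norm on the disc of radius 1/2 and agree at small positive reals, so the
    identity theorem applies. *)
Lemma Cexp_log1p (u : C) : (Cmod u <= / 2)%R -> Cexp (Clog1p u) = 1 + u.
Proof.
  intros Hu.
  apply (NB_agree 0 (/ 2) (exp 2) (Cmod (0 - - (1)) + / 2)
    (fun u => Cexp (Clog1p u)) (fun u => 1 + u)); try lra.
  - apply NB_exp; [lra|]. apply NB_log1p with (/ 2)%R; try lra.
    apply NB_ext with (fun w => w - 0); [intros; ring|].
    apply NB_le with (Cmod (0 - 0) + / 2)%R; [|apply NB_id; lra].
    replace (0 - 0) with (RtoC 0) by ring. rewrite Cmod_0. lra.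
  - apply NB_ext with (fun w => w - - (1)); [intros; ring|]. apply NB_id. lra.
  - intros eps He. exists (RtoC (Rmin (eps / 2) (/ 2))).
    assert (H1 := Rmin_l (eps / 2) (/ 2)). assert (H2 := Rmin_r (eps / 2) (/ 2)).
    assert (H3 : (0 < Rmin (eps / 2) (/ 2))%R) by (apply Rmin_pos; lra).
    set (x := Rmin (eps / 2) (/ 2)) in *. split; [|split].
    + intros H. apply RtoC_inj in H. lra.
    + replace (RtoC x - 0) with (RtoC x) by ring.
      rewrite Cmod_R, Rabs_pos_eq; lra.
    + rewrite Clog1p_pos, Cexp_RtoC, exp_ln, RtoC_plus by lra. reflexivity.
  - replace (u - 0) with u by ring. exact Hu.
Qed.

(** For negative [x] the Taylor estimate is replaced by [Cexp_log1p]: the series has real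
    coefficients, so [Clog1p x] is a real number with exponential [1 + x]. *)
Lemma Clog1p_real (x : R) :
  (Rabs x <= / 2)%R -> Clog1p (RtoC x) = RtoC (ln (1 + x)).
Proof.
  intros Hx.
  assert (Hs := Clog1p_series (RtoC x)). rewrite Cmod_R in Hs.
  specialize (Hs ltac:(lra)). apply Clim_Im in Hs.
  assert (Him : Im (Clog1p (RtoC x)) = 0%R).
  { apply is_lim_seq_unique in Hs.
    rewrite (Lim_seq_ext _ (fun _ => 0%R)), Lim_seq_const in Hs.
    - now injection Hs.
    - intros n. rewrite Im_Csum.
      rewrite (Rsum_ext n _ (fun _ => 0 * 0)%R); [rewrite Rsum_scal; ring|].
      intros i _. rewrite log1p_coef_real, <- RtoC_pow, <- RtoC_mult.
      simpl. ring. }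
  assert (He := Cexp_log1p (RtoC x)). rewrite Cmod_R in He. specialize (He Hx).
  assert (Hc : Clog1p (RtoC x) = RtoC (Re (Clog1p (RtoC x)))).
  { apply injective_projections; [reflexivity|exact Him]. }
  rewrite Hc in He |- *. rewrite Cexp_RtoC, <- RtoC_plus in He.
  apply RtoC_inj in He. rewrite <- He, ln_exp. reflexivity.
Qed.

(** * Bernoulli numbers and polynomials *)

Definition shift_coef (k : nat) (c : nat -> C) (i : nat) : C :=
  if (i <? k)%nat then 0%R else c (i - k)%nat.

Lemma psn_coef_ext (a : C) (r m : R) (c d : nat -> C) (f : C -> C) :
  (forall i, c i = d i) -> psn a r m c f -> psn a r m d f.
Proof.
  intros H [H1 H2]. split.
  - intros n. rewrite (Rsum_ext n _ (fun i => Cmod (c i) * r ^ i)%R); [apply H1|].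
    intros i _. now rewrite H.
  - intros w Hw. eapply Clim_ext; [|now apply H2]. intros n. simpl.
    apply Csum_ext. intros i _. now rewrite H.
Qed.

Lemma psn_shift (a : C) (r m : R) (c : nat -> C) (f : C -> C) (k : nat) :
  (0 <= r)%R -> psn a r m c f ->
  psn a r (r ^ k * m) (shift_coef k c) (fun w => (w - a) ^ k * f w).
Proof.
  intros Hr [H1 H2].
  assert (Hs : forall n g, Csum 0 (k + n) (fun i => shift_coef k c i * g i) =
    Csum 0 n (fun i => c i * g (k + i)%nat)).
  { intros n g. rewrite (Csum_chasles 0 k (k + n)) by lia.
    rewrite Csum_zero, Csum_shift, Cplus_0_l.
    - apply Csum_ext. intros i _. unfold shift_coef.
      destruct (Nat.ltb_spec (k + i) k); [lia|]. do 2 f_equal. lia.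
    - intros i Hi. unfold shift_coef.
      destruct (Nat.ltb_spec i k); [|lia]. ring. }
  split.
  - intros n. apply Rle_trans with
      (Rsum (k + n) (fun i => Cmod (shift_coef k c i) * r ^ i)%R).
    { apply Rsum_mono; [|lia]. intros i.
      apply Rmult_le_pos; [apply Cmod_ge_0|now apply pow_le]. }
    assert (E : Rsum (k + n) (fun i => Cmod (shift_coef k c i) * r ^ i)%R =
      (r ^ k * Rsum n (fun i => Cmod (c i) * r ^ i))%R).
    { rewrite <- Rsum_scal. clear H1 H2 Hs. revert n.
      assert (Hk : Rsum k (fun i => Cmod (shift_coef k c i) * r ^ i)%R = 0%R).
      { rewrite (Rsum_ext k _ (fun _ => 0 * 0)%R); [rewrite Rsum_scal; ring|].
        intros i Hi. unfold shift_coef. destruct (Nat.ltb_spec i k); [|lia].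
        rewrite Cmod_0. ring. }
      induction n as [|n IH].
      - rewrite Nat.add_0_r. exact Hk.
      - rewrite Nat.add_succ_r. simpl. rewrite IH. f_equal.
        unfold shift_coef. destruct (Nat.ltb_spec (k + n) k); [lia|].
        replace (k + n - k)%nat with n by lia. rewrite pow_add. ring. }
    rewrite E. apply Rmult_le_compat_l; [now apply pow_le|apply H1].
  - intros w Hw. apply (Clim_incr_n _ _ k).
    apply Clim_ext with (u := fun n =>
      (w - a) ^ k * Csum 0 n (fun i => c i * (w - a) ^ i)).
    + intros n. rewrite Nat.add_comm, Hs, <- Csum_scal. apply Csum_ext.
      intros i _. rewrite Cpow_add_r. ring.
    + apply Clim_scal. now apply H2.
Qed.

(** In contrast to [NB_mult] the coefficients are exhibited, so that [psn_unique] can compare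
    them. *)
Lemma psn_mult (a : C) (r m m' : R) (c d : nat -> C) (f g : C -> C) :
  (0 < r)%R -> psn a r m c f -> psn a r m' d g ->
  psn a r (m * m') (fun i => Csum 0 (S i) (fun k => c k * d (i - k)%nat))
    (fun w => f w * g w).
Proof.
  intros Hr [H1 H2] Hg.
  apply psn_series with (m := fun k => (Cmod (c k) * (r ^ k * m'))%R)
    (c := fun k i => c k * shift_coef k d i)
    (f := fun k w => c k * ((w - a) ^ k * g w)); trivial.
  - lra.
  - intros k. apply psn_scal. apply psn_shift; trivial. lra.
  - intros K. rewrite (Rsum_ext K _ (fun i => (m' * (Cmod (c i) * r ^ i))%R)).
    + rewrite Rsum_scal, Rmult_comm. apply Rmult_le_compat_r; trivial.
      now apply psn_pos with a r d g.
    + intros; ring.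
  - intros w Hw. apply Clim_ext with (u := fun n =>
      Csum 0 n (fun i => c i * (w - a) ^ i) * g w).
    + intros n. rewrite <- Csum_scal_r. apply Csum_ext. intros; ring.
    + apply Clim_mult; [now apply H2|apply Clim_const].
  - intros i. apply Clim_ext_loc with (N := S i)
      (u := fun _ => Csum 0 (S i) (fun k => c k * d (i - k)%nat));
      [|apply Clim_const].
    intros K HK. rewrite (Csum_chasles 0 (S i) K) by lia.
    rewrite (Csum_zero (S i) K), Cplus_0_r.
    + apply Csum_ext. intros k Hk. unfold shift_coef.
      destruct (Nat.ltb_spec i k); [lia|reflexivity].
    + intros k Hk. unfold shift_coef. destruct (Nat.ltb_spec i k); [ring|lia].
Qed.

Lemma psn_unique (a : C) (r m m' : R) (c d : nat -> C) (f g : C -> C) :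
  (0 < r)%R -> psn a r m c f -> psn a r m' d g -> agree_acc f g a ->
  forall i, c i = d i.
Proof.
  intros Hr Hf Hg Hacc i.
  assert (H : c i + - (1) * d i = 0).
  { apply (psn_zero a r (m + Cmod (- (1)) * m') (fun i => c i + - (1) * d i)
      (fun w => f w + - (1) * g w)); trivial.
    - apply psn_plus; trivial; [|lra]. now apply psn_scal.
    - intros eps He. destruct (Hacc eps He) as (w & Hw1 & Hw2 & Hw3).
      exists w. repeat split; trivial. rewrite Hw3. ring. }
  replace (c i) with (c i + - (1) * d i + d i) by ring. rewrite H. ring.
Qed.

Lemma fact_neq0_C (n : nat) : (fact n)%:C <> 0.
Proof. apply Nat2C_neq0, fact_neq_0. Qed.

Lemma fact_S_C (n : nat) : (fact (S n))%:C = (S n)%:C * (fact n)%:C.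
Proof. unfold Nat2C. rewrite fact_simpl, mult_INR, RtoC_mult. reflexivity. Qed.

(** Divided powers turn the binomial theorem, and all Bernoulli identities, into convolutions free
    of binomial coefficients. *)
Definition epow (n : nat) (x : C) : C := x ^ n / (fact n)%:C.

Lemma epow_0 (x : C) : epow 0 x = 1.
Proof. unfold epow. simpl. unfold Nat2C. simpl. field. Qed.

Lemma epow_S (n : nat) (x : C) : (S n)%:C * epow (S n) x = x * epow n x.
Proof.
  unfold epow. rewrite fact_S_C. simpl. field.
  split; [apply fact_neq0_C|now apply Nat2C_neq0].
Qed.

Lemma epow_plus (n : nat) (x y : C) :
  epow n (x + y) = Csum 0 (S n) (fun d => epow d y * epow (n - d) x).
Proof.
  induction n as [|n IH].
  - rewrite Csum0_S. simpl. rewrite !epow_0. ring.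
  - assert (Hn : (S n)%:C <> 0) by now apply Nat2C_neq0.
    assert (H : (S n)%:C * epow (S n) (x + y) =
      (S n)%:C * Csum 0 (S (S n)) (fun d => epow d y * epow (S n - d) x)).
    { rewrite epow_S, IH, <- (Csum_scal 0 (S (S n))).
      rewrite (Csum_ext 0 (S (S n)) _ (fun d =>
        (d%:C * epow d y) * epow (S n - d) x +
        epow d y * ((S n - d)%nat%:C * epow (S n - d) x))).
      2:{ intros d Hd. replace (S n)%:C with (d%:C + (S n - d)%nat%:C); [ring|].
          unfold Nat2C. rewrite <- RtoC_plus, <- plus_INR. do 2 f_equal. lia. }
      rewrite Csum_plus, (Csum0_S_l (S n)).
      rewrite (Csum0_S (S n) (fun d => epow d y * _)).
      rewrite Nat.sub_diag.
      replace (0%:C) with (RtoC 0) by reflexivity.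
      rewrite !Cmult_0_l, Cplus_0_l, Cmult_0_r, Cplus_0_r.
      rewrite Cmult_plus_distr_r, <- !Csum_scal, Cplus_comm. f_equal.
      - apply Csum_ext. intros d Hd. simpl Nat.sub. rewrite epow_S. ring.
      - apply Csum_ext. intros d Hd.
        replace (S n - d)%nat with (S (n - d)) by lia. rewrite epow_S. ring. }
    replace (epow (S n) (x + y)) with ((S n)%:C * epow (S n) (x + y) / (S n)%:C)
      by (field; trivial).
    rewrite H. field. trivial.
Qed.

Lemma Csum_triangle_swap (n : nat) (f : nat -> nat -> C) :
  Csum 0 n (fun r => Csum 0 (n - r) (fun i => f r i)) =
  Csum 0 n (fun i => Csum 0 (n - i) (fun r => f r i)).
Proof.
  rewrite <- Csum_triangle, <- (Csum_triangle n (fun i r => f r i)).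
  apply Csum_ext. intros q _. rewrite Csum_rev. apply Csum_ext. intros r Hr.
  f_equal. lia.
Qed.

(** The system is triangular with diagonal entries [1 / 1!]. Identities between Bernoulli-type
    sequences are proved below by checking that both sides have the same convolution. *)
Lemma bern_rec_unique (u v : nat -> C) :
  (forall q, Csum 0 (S q) (fun k => u k / (fact (S q - k))%:C) =
     Csum 0 (S q) (fun k => v k / (fact (S q - k))%:C)) ->
  forall k, u k = v k.
Proof.
  intros H k. induction k as [k IH] using (well_founded_induction lt_wf).
  specialize (H k). rewrite !Csum0_S in H.
  rewrite (Csum_ext 0 k (fun k0 => u k0 / _) (fun k0 => v k0 / (fact (S k - k0))%:C)) in H.
  - replace (S k - k)%nat with 1%nat in H by lia.
    assert (H' : u k / (fact 1)%:C = v k / (fact 1)%:C).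
    { set (s := Csum 0 k (fun k0 => v k0 / (fact (S k - k0))%:C)) in H.
      replace (u k / (fact 1)%:C) with (s + u k / (fact 1)%:C - s) by ring.
      rewrite H. ring. }
    unfold Nat2C in H'. simpl in H'.
    replace (u k) with (u k / 1) by field. rewrite H'. field.
  - intros i Hi. now rewrite IH.
Qed.

(* Recursion for [b k = B_k / k!], obtained by multiplying the generating
   series by [(exp x - 1) / x]. *)
Definition bern_rec (b : nat -> C) : Prop :=
  forall q, Csum 0 (S q) (fun k => b k / (fact (S q - k))%:C) =
    match q with O => 1%R | S _ => 0%R end.

(** With [b k = B_k / k!] this is [B_k(x) / k!]. *)
Definition bpoly (b : nat -> C) (k : nat) (x : C) : C :=
  Csum 0 (S k) (fun i => b i * epow (k - i) x).

(** Associativity of the convolution of [u], the divided powers of [y] and the sequence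
    [1 / (m + 1)!]. *)
Lemma bpoly_conv (u : nat -> C) (y : C) (q : nat) :
  Csum 0 (S q) (fun k =>
    Csum 0 (S k) (fun i => u i * epow (k - i) y) / (fact (S q - k))%:C) =
  Csum 0 (S q) (fun d => epow d y *
    Csum 0 (S (q - d)) (fun i => u i / (fact (S (q - d) - i))%:C)).
Proof.
  rewrite (Csum_ext 0 (S q) _ (fun k => Csum 0 (S k) (fun i =>
    (fun i d => u i * epow d y / (fact (S q - i - d))%:C) i (k - i)%nat))).
  2:{ intros k Hk. unfold Cdiv. rewrite <- Csum_scal_r. apply Csum_ext.
      intros i Hi. do 4 f_equal. lia. }
  rewrite (Csum_triangle (S q)
    (fun i d => u i * epow d y / (fact (S q - i - d))%:C)), Csum_triangle_swap.
  apply Csum_ext. intros d Hd. rewrite <- Csum_scal.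
  replace (S q - d)%nat with (S (q - d)) by lia. apply Csum_ext. intros i Hi.
  unfold Cdiv.
  replace (S q - i - d)%nat with (S (q - d) - i)%nat by lia. ring.
Qed.

Lemma bpoly_rec (b : nat -> C) (x : C) (q : nat) :
  bern_rec b ->
  Csum 0 (S q) (fun k => bpoly b k x / (fact (S q - k))%:C) = epow q x.
Proof.
  intros Hb. unfold bpoly. rewrite bpoly_conv.
  rewrite (Csum_ext 0 (S q) _ (fun d => if (d =? q)%nat then epow q x else 0%R)).
  - rewrite Csum0_S, Nat.eqb_refl, Csum_zero; [ring|].
    intros i Hi. destruct (Nat.eqb_spec i q); [lia|reflexivity].
  - intros d Hd. rewrite (Hb (q - d)%nat).
    destruct (Nat.eqb_spec d q) as [->|Hn].
    + rewrite Nat.sub_diag. ring.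
    + destruct (q - d)%nat eqn:E; [lia|]. ring.
Qed.

(** Convolved with [1 / (m + 1)!], the two sides become the two sides of [epow_plus]. *)
Lemma bpoly_plus (b : nat -> C) (x y : C) (k : nat) :
  bern_rec b ->
  bpoly b k (x + y) = Csum 0 (S k) (fun i => bpoly b i x * epow (k - i) y).
Proof.
  intros Hb. revert k. apply bern_rec_unique. intros q.
  rewrite bpoly_rec by trivial. rewrite bpoly_conv, epow_plus.
  apply Csum_ext. intros d Hd. now rewrite bpoly_rec.
Qed.

Lemma epow_at_0 (n : nat) : epow n 0 = match n with O => 1%R | S _ => 0%R end.
Proof.
  destruct n as [|n]; [apply epow_0|]. unfold epow. simpl. unfold Cdiv. ring.
Qed.

Lemma two_lt_2PI : (2 < 2 * PI)%R.
Proof. assert (H2 := PI2_1). unfold PI2 in H2. lra. Qed.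

Lemma bernoulli_rec_gen (B : nat -> C -> C) (hB : is_bernoulli_poly B) (t : C)
    (q : nat) :
  Csum 0 (S q) (fun k => B k t / (fact k)%:C / (fact (S q - k))%:C) = epow q t.
Proof.
  set (c := fun k => B k t / (fact k)%:C).
  assert (H2pi := two_lt_2PI).
  assert (Hs : forall x : C, (0 < Cmod x < 2 * PI)%R ->
    Clim (fun n => Csum 0 n (fun i => c i * x ^ i))
      (x * Cexp (t * x) / (Cexp x - 1))).
  { intros x Hx. apply is_pseries_Clim. now apply hB. }
  (* The point 2 lies in the punctured disc of radius [2 * PI]; convergence there gives a finite
     norm on the unit disc. *)
  destruct (pseries_abs c (RtoC 2) _ 1 ltac:(rewrite Cmod_R, Rabs_pos_eq; lra)
    (Hs (RtoC 2) ltac:(rewrite Cmod_R, Rabs_pos_eq; lra))) as [m Hm].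
  (* The generating function is prescribed only for [x <> 0]; the sum of the series is defined at 0
     too, and agreement at nearby points is enough to compare coefficients. *)
  set (f := fun x => CLim (fun n => Csum 0 n (fun i => c i * x ^ i))).
  assert (Hf : psn 0 1 m c f).
  { split; [exact Hm|]. intros w Hw. replace (w - 0) with w in * by ring.
    destruct (Csum_abs_conv (fun i => c i * w ^ i)
      (fun i => Cmod (c i) * 1 ^ i)%R m) as [l Hl]; trivial.
    - intros i. replace w with (w - 0) by ring. apply psn_term.
      now replace (w - 0) with w by ring.
    - unfold f. now rewrite (CLim_unique _ _ Hl). }
  set (d := fun i => match i with O => RtoC 0 | S _ => / (fact i)%:C end).
  assert (Hexp : forall s : C, psn 0 1 (exp (Cmod s))
    (fun i => epow i s) (fun x => Cexp (s * x))).
  { intros s. split.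
    - intros n. eapply Rle_trans; [|apply (Rsum_exp_le (Cmod s) n), Cmod_ge_0].
      apply Rsum_le. intros i _. unfold epow.
      rewrite Cmod_div, Cmod_pow, Cmod_Nat2C by apply fact_neq0_C.
      rewrite pow1. lra.
    - intros w _. eapply Clim_ext; [|apply Cexp_series]. intros n. simpl.
      apply Csum_ext. intros i _. unfold epow. rewrite Cpow_mult_l.
      replace (w - 0) with w by ring. unfold Cdiv. ring. }
  assert (Hd : psn 0 1 (exp (Cmod 1) + 1) d (fun x => Cexp x - 1)).
  { assert (H1 := Hexp 1). destruct H1 as [H1 H2]. split.
    - intros n. eapply Rle_trans; [|apply Rplus_le_compat_r, (H1 n)].
      apply Rle_trans with (Rsum n (fun i => Cmod (epow i 1) * 1 ^ i) )%R; [|lra].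
      apply Rsum_le. intros [|i] _.
      + simpl. rewrite Cmod_0. assert (H := Cmod_ge_0 (epow 0 1)). lra.
      + unfold d, epow, Cdiv. rewrite Cpow_1_l, Cmult_1_l. lra.
    - intros w Hw. specialize (H2 w Hw).
      apply Clim_ext_loc with (N := 1%nat)
        (u := fun n => Csum 0 n (fun i => epow i 1 * (w - 0) ^ i) - 1).
      + intros [|n] Hn; [lia|]. rewrite !Csum0_S_l, epow_0.
        rewrite (Csum_ext 0 n (fun i => epow (S i) 1 * (w - 0) ^ S i)
          (fun i => d (S i) * (w - 0) ^ S i)).
        * simpl. ring.
        * intros i _. unfold d, epow, Cdiv. now rewrite Cpow_1_l, Cmult_1_l.
      + apply Clim_minus; [|apply Clim_const]. now rewrite Cmult_1_l in H2. }
  assert (Hr := psn_shift 0 1 _ _ _ 1 ltac:(lra) (Hexp t)).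
  assert (Hl := psn_mult 0 1 _ _ _ _ _ _ ltac:(lra) Hf Hd).
  assert (E := psn_unique 0 1 _ _ _ _ _ _ ltac:(lra) Hl Hr).
  assert (Hacc : agree_acc (fun w => f w * (Cexp w - 1))
    (fun w => (w - 0) ^ 1 * Cexp (t * w)) 0).
  { intros eps He. set (x := Rmin (eps / 2) 1).
    assert (Hx1 := Rmin_l (eps / 2) 1). assert (Hx2 := Rmin_r (eps / 2) 1).
    assert (Hx : (0 < x)%R) by (apply Rmin_pos; lra). fold x in Hx1, Hx2.
    exists (RtoC x).
    assert (Hc : Cmod x = x) by (rewrite Cmod_R, Rabs_pos_eq; lra).
    split; [intros H; apply RtoC_inj in H; lra|]. split.
    - replace (RtoC x - 0) with (RtoC x) by ring. lra.
    - unfold f. rewrite (CLim_unique _ _ (Hs x ltac:(lra))).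
      replace (RtoC x - 0) with (RtoC x) by ring. rewrite (Cexp_RtoC x).
      assert (Hn : RtoC (exp x) - 1 <> 0).
      { rewrite <- RtoC_minus. intros H. apply RtoC_inj in H.
        assert (H0 := exp_ineq1 x). lra. }
      simpl. field. exact Hn. }
  (* Order [q + 1], since [Cexp x - 1] starts at order 1 and the other side carries the factor
     [x]. *)
  specialize (E Hacc (S q)).
  unfold shift_coef in E. change (S q <? 1)%nat with false in E. cbv iota in E.
  replace (S q - 1)%nat with q in E by lia.
  rewrite <- E. rewrite (Csum0_S (S q)), Nat.sub_diag. unfold d at 2.
  rewrite Cmult_0_r, Cplus_0_r. apply Csum_ext. intros k Hk.
  unfold c, d. destruct (S q - k)%nat eqn:E1; [lia|]. reflexivity.
Qed.

Definition bnum (B : nat -> C -> C) (k : nat) : C := B k 0 / (fact k)%:C.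

Lemma bnum_rec (B : nat -> C -> C) : is_bernoulli_poly B -> bern_rec (bnum B).
Proof.
  intros hB q. unfold bnum. rewrite bernoulli_rec_gen by trivial. apply epow_at_0.
Qed.

Lemma bernoulli_bpoly (B : nat -> C -> C) (k : nat) (t : C) :
  is_bernoulli_poly B -> B k t = (fact k)%:C * bpoly (bnum B) k t.
Proof.
  intros hB. assert (H : forall k, B k t / (fact k)%:C = bpoly (bnum B) k t).
  { apply bern_rec_unique. intros q.
    rewrite bernoulli_rec_gen, bpoly_rec; trivial. now apply bnum_rec. }
  rewrite <- H. field. apply fact_neq0_C.
Qed.

Lemma Cdiv_RtoC (a b : R) : RtoC a / RtoC b = RtoC (a / b).
Proof. unfold Cdiv, Rdiv. now rewrite RtoC_mult, RtoC_Rinv. Qed.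

Lemma Im_Cmult_RtoC (z : C) (x : R) : Im z = 0%R -> Im (z * RtoC x) = 0%R.
Proof. intros H. destruct z as [a b]. simpl in *. unfold Im in *. simpl in *. rewrite H. ring. Qed.

(** The Bernoulli polynomials are complex-valued here; realness is what lets the candidate for
    [log G_n] be compared with a real logarithm. *)
Lemma bnum_real (b : nat -> C) (k : nat) : bern_rec b -> Im (b k) = 0%R.
Proof.
  intros Hb. induction k as [k IH] using (well_founded_induction lt_wf).
  assert (H := Hb k). rewrite Csum0_S in H.
  replace (S k - k)%nat with 1%nat in H by lia.
  assert (H1 : b k = match k with O => 1%R | S _ => 0%R end -
    Csum 0 k (fun i => b i / (fact (S k - i))%:C)).
  { rewrite <- H. unfold Nat2C. simpl. field. }
  rewrite H1.
  change (Im (match k with O => RtoC 1 | S _ => RtoC 0 end) -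
    Im (Csum 0 k (fun i => b i / (fact (S k - i))%:C)%C) = 0)%R.
  rewrite Im_Csum, (Rsum_ext k _ (fun _ => 0 * 0)%R).
  - rewrite Rsum_scal. destruct k; simpl; ring.
  - intros i Hi. unfold Cdiv, Nat2C. rewrite <- RtoC_Rinv, Im_Cmult_RtoC; [ring|].
    now apply IH.
Qed.

(** * Euler-Maclaurin summation of [x ^ j * ln x] *)

(** The [r]-th derivative has the form [t^p * (a * ln t + c)] with [p = j + 1 - r]. One more
    differentiation sends [a] to [p * a] and [c] to [p * c + a]; [fall_coef] and [phi_coef] are
    these two sequences. *)
Fixpoint fall_coef (j r : nat) : R :=
  match r with
  | O => (/ INR (j + 1))%R
  | S s => ((INR (j + 1) - INR s) * fall_coef j s)%R
  end.

Fixpoint phi_coef (j r : nat) : R :=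
  match r with
  | O => (- / INR (j + 1) ^ 2)%R
  | S s => ((INR (j + 1) - INR s) * phi_coef j s + fall_coef j s)%R
  end.

(* The [r]-th derivative of [t^(j+1)/(j+1) * ln t - t^(j+1)/(j+1)^2]. *)
Definition Fder (j r : nat) (t : R) : R :=
  if (r <=? j + 1)%nat
  then (t ^ (j + 1 - r) * (fall_coef j r * ln t + phi_coef j r))%R
  else ((-1) ^ (r - j - 2) * INR (fact j) * INR (fact (r - j - 2))
        / t ^ (r - j - 1))%R.

Lemma INR_S_neq0 (j : nat) : INR (j + 1) <> 0%R.
Proof. apply not_0_INR. lia. Qed.

Lemma fall_coef_fact (j r : nat) :
  (r <= j + 1)%nat ->
  (fall_coef j r * INR (fact (j + 1 - r)) = INR (fact j))%R.
Proof.
  induction r as [|r IH]; intros Hr.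
  - simpl fall_coef. rewrite Nat.sub_0_r. replace (j + 1)%nat with (S j) by lia.
    rewrite fact_simpl, mult_INR. field. apply not_0_INR. lia.
  - rewrite <- IH by lia. simpl fall_coef.
    replace (j + 1 - r)%nat with (S (j + 1 - S r)) by lia.
    rewrite fact_simpl, mult_INR.
    replace (INR (S (j + 1 - S r))) with (INR (j + 1) - INR r)%R; [ring|].
    rewrite <- minus_INR by lia. f_equal. lia.
Qed.

Lemma fall_coef_1 (j : nat) : fall_coef j 1 = 1%R.
Proof. unfold fall_coef. simpl INR at 2. field. apply INR_S_neq0. Qed.

Lemma phi_coef_1 (j : nat) : phi_coef j 1 = 0%R.
Proof. unfold phi_coef, fall_coef. simpl INR at 2. field. apply INR_S_neq0. Qed.

Lemma Fder_1 (j : nat) (t : R) : Fder j 1 t = (t ^ j * ln t)%R.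
Proof.
  unfold Fder. destruct (Nat.leb_spec 1 (j + 1)); [|lia].
  rewrite fall_coef_1, phi_coef_1. replace (j + 1 - 1)%nat with j by lia. ring.
Qed.

Lemma Fder_last (j : nat) (t : R) : Fder j (j + 3) t = (- INR (fact j) / t ^ 2)%R.
Proof.
  unfold Fder. destruct (Nat.leb_spec (j + 3) (j + 1)); [lia|].
  replace (j + 3 - j - 2)%nat with 1%nat by lia.
  replace (j + 3 - j - 1)%nat with 2%nat by lia. simpl fact. rewrite INR_1. unfold Rdiv.
  ring.
Qed.

Lemma is_derive_Fder (j r : nat) (t : R) :
  (0 < t)%R -> is_derive (Fder j r) t (Fder j (S r) t).
Proof.
  intros Ht. unfold Fder.
  destruct (Nat.leb_spec r (j + 1)) as [Hr|Hr].
  - set (p := (j + 1 - r)%nat).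
    assert (E : is_derive (fun t => t ^ p * (fall_coef j r * ln t + phi_coef j r))%R t
      (INR p * t ^ pred p * (fall_coef j r * ln t + phi_coef j r) +
       t ^ p * (fall_coef j r * (1 / t)))%R).
    { apply (is_derive_mult (fun t => t ^ p)%R
        (fun t => fall_coef j r * ln t + phi_coef j r)%R).
      - auto_derive; trivial. ring.
      - rewrite <- (Rplus_0_r (fall_coef j r * (1 / t))).
        apply (is_derive_plus (fun t => fall_coef j r * ln t)%R (fun _ => phi_coef j r)).
        + apply (is_derive_scal (fun t => ln t)).
          apply (is_derive_ln_comp (fun t => t)); [apply (is_derive_id (K := R_AbsRing))|lra].
        + apply (is_derive_const (K := R_AbsRing) (V := R_NormedModule)).
      - intros; apply Rmult_comm. }
    replace (if (S r <=? j + 1)%nat then _ else _) with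
      (INR p * t ^ pred p * (fall_coef j r * ln t + phi_coef j r) +
       t ^ p * (fall_coef j r * (1 / t)))%R; [exact E|].
    assert (Hp : INR p = (INR (j + 1) - INR r)%R) by (apply minus_INR; lia).
    destruct (Nat.leb_spec (S r) (j + 1)) as [Hr'|Hr'].
    + simpl fall_coef. simpl phi_coef. rewrite <- Hp.
      unfold p in *. replace (j + 1 - r)%nat with (S (j + 1 - S r)) by lia.
      simpl pow. simpl pred. field. lra.
    + assert (r = (j + 1)%nat) by lia. subst r.
      assert (H := fall_coef_fact j (j + 1) (Nat.le_refl _)).
      rewrite Nat.sub_diag in H. simpl fact in H. rewrite INR_1, Rmult_1_r in H.
      unfold p. rewrite Nat.sub_diag. rewrite H.
      replace (S (j + 1) - j - 2)%nat with 0%nat by lia.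
      replace (S (j + 1) - j - 1)%nat with 1%nat by lia. simpl. field. lra.
  - destruct (Nat.leb_spec (S r) (j + 1)) as [Hr'|Hr']; [lia|].
    set (q := (r - j - 2)%nat).
    replace (S r - j - 2)%nat with (S q) by lia.
    replace (r - j - 1)%nat with (S q) by lia.
    replace (S r - j - 1)%nat with (S (S q)) by lia.
    set (K := ((-1) ^ q * INR (fact j) * INR (fact q))%R).
    replace ((-1) ^ S q * INR (fact j) * INR (fact (S q)) / t ^ S (S q))%R
      with (- (K * INR (S q)) / (1 + (t - 1)) ^ S (S q))%R.
    + assert (H := is_derive_inv_pow K (t - 1) q ltac:(lra)).
      assert (H2 : is_derive (fun x => x - 1)%R t 1%R) by (auto_derive; trivial).
      assert (H3 := is_derive_comp (fun x => K / (1 + x) ^ S q)%R (fun x => x - 1)%R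
        t _ _ H H2).
      eapply is_derive_ext; [|eapply (eq_ind _ (is_derive _ t) H3)].
      * assert (H4 : forall y, (1 + (y - 1) = y)%R) by (intros; ring).
        intros x. cbv beta. rewrite H4. reflexivity.
      * match goal with |- @eq _ _ ?y => exact (Rmult_1_l y) end.
    + unfold K. rewrite fact_simpl, mult_INR.
      replace (1 + (t - 1))%R with t by ring. simpl pow. unfold Rdiv. ring.
Qed.

Lemma phi_phi_coef (j r : nat) : (r <= j + 1)%nat -> phi j r = phi_coef j r.
Proof.
  intros Hr. unfold phi.
  rewrite (Derive_n_ext_loc _ (Fder j 0)).
  - rewrite (proj2 (Derive_n_family (fun i => Fder j i) 0 2 (j + 1)
      (fun i t _ Ht => is_derive_Fder j i t ltac:(lra)) r 1 Hr ltac:(lra))).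
    unfold Fder. destruct (Nat.leb_spec r (j + 1)); [|lia].
    rewrite ln_1, pow1. ring.
  - exists (mkposreal 1 Rlt_0_1). intros t _. unfold Fder.
    destruct (Nat.leb_spec 0 (j + 1)); [|lia]. rewrite Nat.sub_0_r. simpl phi_coef.
    simpl fall_coef. field. apply INR_S_neq0.
Qed.

(* Euler-Maclaurin approximation of [sum_(k < x) k^j ln k]. *)
Definition Mfun (b : nat -> C) (j : nat) (x : R) : C :=
  Csum 0 (j + 2) (fun r => b r * Fder j r x).

(** The expansion is cut at total order [j + 3] whatever [r] is: the derivative of that order is
    [- j! / t^2], already free of logarithms and summable over the integers. *)
Lemma Fder_taylor (j r : nat) (x : R) :
  (r <= j + 2)%nat -> (1 <= x)%R ->
  (Rabs (Fder j r (x + 1) -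
     Rsum (j + 3 - r) (fun i => / INR (fact i) * Fder j (r + i) x))
   <= INR (fact j) / x ^ 2)%R.
Proof.
  intros Hr Hx.
  destruct (taylor_family (fun i => Fder j (r + i)) 0 (x + 2) x (x + 1)
    (j + 2 - r)) as (s & Hs & E); try lra.
  { intros i t _ Ht. rewrite Nat.add_succ_r. apply is_derive_Fder. lra. }
  rewrite Nat.add_0_r in E. rewrite E.
  replace (S (j + 2 - r)) with (j + 3 - r)%nat by lia.
  replace (x + 1 - x)%R with 1%R by ring.
  rewrite (Rsum_ext (j + 3 - r) (fun i => 1 ^ i / INR (fact i) * Fder j (r + i) x)%R
    (fun i => / INR (fact i) * Fder j (r + i) x)%R).
  2:{ intros i _. rewrite pow1. unfold Rdiv. ring. }
  match goal with |- (Rabs (?A + ?B - ?A) <= _)%R =>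
    replace (A + B - A)%R with B by ring end.
  rewrite pow1. replace (r + (j + 3 - r))%nat with (j + 3)%nat by lia.
  rewrite Fder_last.
  assert (Hf : (1 <= INR (fact (j + 3 - r)))%R).
  { apply (le_INR 1). apply lt_O_fact. }
  assert (Hj := INR_fact_lt_0 j).
  assert (Hxs : (x ^ 2 <= s ^ 2)%R) by (apply pow_incr; lra).
  assert (Hx2 : (0 < x ^ 2)%R) by (apply pow_lt; lra).
  replace (1 / INR (fact (j + 3 - r)) * (- INR (fact j) / s ^ 2))%R with
    (- (/ INR (fact (j + 3 - r)) * (INR (fact j) / s ^ 2)))%R
    by (field; split; lra).
  rewrite Rabs_Ropp, Rabs_pos_eq.
  - rewrite <- (Rmult_1_l (INR (fact j) / x ^ 2)). apply Rmult_le_compat.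
    + apply Rlt_le, Rinv_0_lt_compat. lra.
    + apply Rlt_le, Rdiv_lt_0_compat; lra.
    + rewrite <- Rinv_1. apply Rinv_le_contravar; lra.
    + apply Rmult_le_compat_l; [lra|]. apply Rinv_le_contravar; lra.
  - apply Rmult_le_pos.
    + apply Rlt_le, Rinv_0_lt_compat. lra.
    + apply Rlt_le, Rdiv_lt_0_compat; lra.
Qed.

(** The recursion with its diagonal term included. The extra 1 at [q = 1] is what produces the
    summand itself in Euler-Maclaurin summation. *)
Lemma bern_rec_incl (b : nat -> C) (q : nat) :
  bern_rec b ->
  Csum 0 (S q) (fun r => b r / (fact (q - r))%:C) =
  b q + match q with 1 => 1%R | _ => 0%R end.
Proof.
  intros Hb. rewrite Csum0_S, Nat.sub_diag.
  replace (b q / (fact 0)%:C) with (b q) by (unfold Nat2C; simpl; field).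
  rewrite Cplus_comm. f_equal. destruct q as [|q]; [reflexivity|].
  rewrite Hb. now destruct q.
Qed.

(** After Taylor expansion at [x] and regrouping by total order [q], the coefficient of [Fder j q x]
    is [b q], plus 1 for [q = 1]; this gives [Mfun b j x] and [Fder j 1 x = x^j * ln x]. What is
    left is the Taylor remainders. *)
Lemma Mfun_step (b : nat -> C) (j : nat) :
  bern_rec b ->
  exists K, (0 <= K)%R /\ forall x, (1 <= x)%R ->
    (Cmod (Mfun b j (x + 1) - Mfun b j x - RtoC (x ^ j * ln x))%C <= K / x ^ 2)%R.
Proof.
  intros Hb. exists (Rsum (j + 2) (fun r => Cmod (b r) * INR (fact j))%R).
  split.
  { apply Rsum_pos. intros. apply Rmult_le_pos; [apply Cmod_ge_0|apply pos_INR]. }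
  intros x Hx.
  set (T := fun r => Rsum (j + 3 - r) (fun i => / INR (fact i) * Fder j (r + i) x)%R).
  assert (E : Mfun b j x + RtoC (x ^ j * ln x) = Csum 0 (j + 2) (fun r => b r * T r)).
  (* The term [r = j + 2] is added to complete the triangle; it is the same on both sides and is
     removed at the end. *)
  { assert (E1 : Csum 0 (j + 3) (fun r => b r * T r) =
      Csum 0 (j + 3) (fun q => (b q + match q with 1 => 1%R | _ => 0%R end) * Fder j q x)).
    { rewrite (Csum_ext 0 (j + 3) (fun r => b r * T r) (fun r =>
        Csum 0 (j + 3 - r) (fun i => b r / (fact i)%:C * Fder j (r + i) x))).
      2:{ intros r _. unfold T. rewrite <- Csum_RtoC, <- Csum_scal.
          apply Csum_ext. intros i _. rewrite RtoC_mult, RtoC_Rinv.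
          unfold Nat2C, Cdiv. ring. }
      rewrite <- (Csum_triangle (j + 3)
        (fun r i => b r / (fact i)%:C * Fder j (r + i) x)).
      apply Csum_ext. intros q _. rewrite <- bern_rec_incl by trivial.
      rewrite <- Csum_scal_r. apply Csum_ext. intros r Hr.
      now replace (r + (q - r))%nat with q by lia. }
    rewrite (Csum_ext 0 (j + 3) (fun q => (b q + _) * Fder j q x) (fun q =>
      b q * Fder j q x + (match q with 1 => 1%R | _ => 0%R end) * Fder j q x)) in E1
      by (intros; ring).
    rewrite Csum_plus in E1. replace (j + 3)%nat with (S (j + 2)) in E1 by lia.
    rewrite (Csum0_S (j + 2) (fun r => b r * T r)) in E1.
    rewrite (Csum0_S (j + 2) (fun q => b q * Fder j q x)) in E1.
    assert (ET : T (j + 2)%nat = Fder j (j + 2) x).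
    { unfold T. replace (j + 3 - (j + 2))%nat with 1%nat by lia. simpl Rsum.
      rewrite Nat.add_0_r. f_equal. simpl. field. }
    rewrite ET in E1.
    assert (E2 : Csum 0 (S (j + 2)) (fun q =>
      (match q with 1 => 1%R | _ => 0%R end) * Fder j q x) = RtoC (x ^ j * ln x)).
    { rewrite (Csum_chasles 0 2) by lia. rewrite !Csum0_S, (Csum_nil 0 0) by lia.
      rewrite (Csum_zero 2), <- Fder_1; [ring|].
      intros i Hi. destruct i as [|[|i]]; [lia|lia|ring]. }
    rewrite E2 in E1. fold (Mfun b j x) in E1.
    set (s := Csum 0 (j + 2) (fun r => b r * T r)) in *.
    set (y := b (j + 2)%nat * Fder j (j + 2) x) in *.
    replace s with (s + y - y) by ring. rewrite E1. ring. }
  replace (Mfun b j (x + 1) - Mfun b j x - RtoC (x ^ j * ln x)) with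
    (Mfun b j (x + 1) - (Mfun b j x + RtoC (x ^ j * ln x))) by ring.
  rewrite E. unfold Mfun. rewrite <- Csum_minus.
  unfold Rdiv. rewrite (Rmult_comm (Rsum _ _)), <- Rsum_scal.
  apply Cmod_Csum_le. intros r Hr.
  replace (b r * Fder j r (x + 1) - b r * T r) with
    (b r * RtoC (Fder j r (x + 1) - T r)) by (rewrite RtoC_minus; ring).
  rewrite Cmod_mult, Cmod_R.
  assert (H := Fder_taylor j r x ltac:(lia) Hx). fold (T r) in H.
  replace (/ x ^ 2 * (Cmod (b r) * INR (fact j)))%R with
    (Cmod (b r) * (INR (fact j) / x ^ 2))%R by (unfold Rdiv; ring).
  apply Rmult_le_compat_l; [apply Cmod_ge_0|exact H].
Qed.

Lemma Rsum_inv_sq (n : nat) : (Rsum n (fun i => / INR (S i) ^ 2) <= 2)%R.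
Proof.
  assert (H : (Rsum (S n) (fun i => / INR (S i) ^ 2) <= 2 - / INR (S n))%R).
  { induction n as [|n IH]; [simpl; lra|].
    change (Rsum (S (S n)) (fun i => / INR (S i) ^ 2)%R) with
      (Rsum (S n) (fun i => / INR (S i) ^ 2) + / INR (S (S n)) ^ 2)%R.
    assert (Hp : (0 < INR (S n))%R) by (apply lt_0_INR; lia).
    rewrite (S_INR (S n)). set (y := INR (S n)) in *.
    assert (H1 : (/ (y + 1) ^ 2 <= / y - / (y + 1))%R); [|lra].
    replace (/ y - / (y + 1))%R with (/ (y * (y + 1)))%R by (field; lra).
    apply Rinv_le_contravar; nra. }
  apply Rle_trans with (Rsum (S n) (fun i => / INR (S i) ^ 2))%R.
  - apply Rsum_mono; [|lia]. intros i. apply Rlt_le, Rinv_0_lt_compat, pow_lt.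
    apply lt_0_INR. lia.
  - assert (Hp : (0 < / INR (S n))%R) by (apply Rinv_0_lt_compat, lt_0_INR; lia).
    lra.
Qed.

Lemma Clim_steps (u : nat -> C) (K : R) :
  (forall n, (Cmod (u (S n) - u n)%C <= K / INR (S n) ^ 2)%R) ->
  exists l, Clim u l.
Proof.
  intros H.
  destruct (Csum_abs_conv (fun n => u (S n) - u n)
    (fun n => K * / INR (S n) ^ 2)%R (Rabs K * 2)) as [l Hl]; trivial.
  - intros n. rewrite Rsum_scal. assert (H0 := Rsum_inv_sq n).
    assert (H1 : (0 <= Rsum n (fun i => / INR (S i) ^ 2))%R).
    { apply Rsum_pos. intros i. apply Rlt_le, Rinv_0_lt_compat, pow_lt.
      apply lt_0_INR. lia. }
    apply Rle_trans with (Rabs K * Rsum n (fun i => / INR (S i) ^ 2))%R.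
    + apply Rmult_le_compat_r; trivial. apply Rle_abs.
    + apply Rmult_le_compat_l; trivial. apply Rabs_pos.
  - exists (u 0%nat + l). eapply Clim_ext; [|apply Clim_plus;
      [apply (Clim_const (u 0%nat))|exact Hl]].
    intros n. simpl. induction n as [|n IH]; [simpl; ring|].
    rewrite Csum0_S, Cplus_assoc, IH. ring.
Qed.

Lemma is_lim_seq_inv_S : is_lim_seq (fun n => / INR (S n))%R 0%R.
Proof.
  apply (is_lim_seq_incr_1 (fun n => / INR n)%R).
  replace (Finite 0) with (Rbar_inv p_infty) by reflexivity.
  apply is_lim_seq_inv; [apply is_lim_seq_INR|discriminate].
Qed.

Lemma is_lim_seq_div_sq (K : R) : is_lim_seq (fun n => K / INR (S n) ^ 2)%R 0%R.
Proof.
  replace 0%R with (K * (0 * 0))%R by ring.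
  apply (is_lim_seq_ext (fun n => K * (/ INR (S n) * / INR (S n)))%R).
  - intros n. simpl pow. rewrite Rmult_1_r, <- Rinv_mult. reflexivity.
  - apply is_lim_seq_mult'; [apply is_lim_seq_const|].
    apply is_lim_seq_mult'; apply is_lim_seq_inv_S.
Qed.

(** * Derivatives of Hurwitz zeta functions at nonpositive integers *)

Definition xlog (j : nat) (x : R) : R := (x ^ j * ln x)%R.

(* Tends to [zeta'(-j, x + 1) - zeta'(-j)]. *)
Definition dseq (b : nat -> C) (j : nat) (x : R) (N : nat) : C :=
  Mfun b j (INR N + x + 1) - Mfun b j (INR N + 1) -
  RtoC (Rsum N (fun k => xlog j (INR k + 1 + x) - xlog j (INR k + 1))%R).

Definition Dfun (b : nat -> C) (j : nat) (x : R) : C := CLim (dseq b j x).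

Lemma Mfun_step_nat (b : nat -> C) (j : nat) :
  bern_rec b ->
  exists K, forall x n, (0 <= x)%R ->
    (Cmod (Mfun b j (INR (S n) + x + 1) - Mfun b j (INR n + x + 1)
       - RtoC (xlog j (INR n + 1 + x)))%C <= K / INR (S n) ^ 2)%R.
Proof.
  intros Hb. destruct (Mfun_step b j Hb) as (K & HK0 & HK). exists K.
  intros x n Hx. assert (Hn := pos_INR n).
  rewrite S_INR. replace (INR n + 1 + x)%R with (INR n + x + 1)%R by ring.
  eapply Rle_trans; [apply HK; lra|].
  apply Rmult_le_compat_l; trivial. apply Rinv_le_contravar.
  - apply pow_lt. lra.
  - apply pow_incr. lra.
Qed.

Lemma dseq_step (b : nat -> C) (j : nat) (x : R) (n : nat) :
  dseq b j x (S n) - dseq b j x n =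
  (Mfun b j (INR (S n) + x + 1) - Mfun b j (INR n + x + 1)
     - RtoC (xlog j (INR n + 1 + x))) -
  (Mfun b j (INR (S n) + 0 + 1) - Mfun b j (INR n + 0 + 1)
     - RtoC (xlog j (INR n + 1 + 0))).
Proof.
  unfold dseq. simpl Rsum. rewrite !Rplus_0_r, RtoC_plus, RtoC_minus. ring.
Qed.

Lemma Dfun_lim (b : nat -> C) (j : nat) (x : R) :
  bern_rec b -> (0 <= x)%R -> Clim (dseq b j x) (Dfun b j x).
Proof.
  intros Hb Hx. destruct (Mfun_step_nat b j Hb) as [K HK].
  destruct (Clim_steps (dseq b j x) (K + K)) as [l Hl].
  - intros n. rewrite dseq_step. unfold Cminus at 1.
    eapply Rle_trans; [apply Cmod_triangle|]. rewrite Cmod_opp.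
    unfold Rdiv. rewrite Rmult_plus_distr_r.
    apply Rplus_le_compat; [apply HK; lra|apply HK; lra].
  - unfold Dfun. now rewrite (CLim_unique _ _ Hl).
Qed.

Lemma Dfun_0 (b : nat -> C) (j : nat) : Dfun b j 0 = 0.
Proof.
  apply CLim_unique. eapply Clim_ext; [|apply (Clim_const 0)].
  intros n. unfold dseq. rewrite Rplus_0_r.
  rewrite (Rsum_ext n _ (fun _ => 0 * 0)%R).
  - rewrite Rsum_scal, Rmult_0_l. ring.
  - intros i _. rewrite Rplus_0_r. ring.
Qed.

(** Replacing [x] by [x + 1] shifts the finite sum by one place, which leaves two boundary terms.
    The one at infinity is absorbed by [Mfun] up to an error that tends to 0. *)
Lemma Dfun_step (b : nat -> C) (j : nat) (x : R) :
  bern_rec b -> (0 <= x)%R ->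
  Dfun b j (x + 1) = Dfun b j x + RtoC (xlog j (x + 1)).
Proof.
  intros Hb Hx. apply CLim_unique.
  destruct (Mfun_step_nat b j Hb) as [K HK].
  set (e := fun n => Mfun b j (INR (S n) + x + 1) - Mfun b j (INR n + x + 1)
     - RtoC (xlog j (INR n + 1 + x))).
  assert (He : Clim e 0).
  { apply Clim_squeeze with (N := 0%nat) (v := fun n => (K / INR (S n) ^ 2)%R).
    - intros n _. replace (e n - 0) with (e n) by ring. exact (HK x n Hx).
    - apply is_lim_seq_div_sq. }
  apply Clim_ext with (u := fun n =>
    dseq b j x n + RtoC (xlog j (x + 1)) + e n).
  - intros n. unfold dseq, e.
    assert (Hs : Rsum n (fun k => xlog j (INR k + 1 + (x + 1)) - xlog j (INR k + 1))%R =
      (Rsum n (fun k => xlog j (INR k + 1 + x) - xlog j (INR k + 1)) +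
       xlog j (INR n + 1 + x) - xlog j (x + 1))%R).
    { induction n as [|n IH].
      - simpl. replace (0 + 1 + x)%R with (x + 1)%R by ring. ring.
      - simpl Rsum. rewrite IH, S_INR.
        replace (INR n + 1 + (x + 1))%R with (INR n + 1 + 1 + x)%R by ring. ring. }
    rewrite Hs, S_INR, !RtoC_minus, !RtoC_plus.
    replace (INR n + (x + 1) + 1)%R with (INR n + 1 + x + 1)%R by ring. ring.
  - replace (Dfun b j x + RtoC (xlog j (x + 1))) with
      (Dfun b j x + RtoC (xlog j (x + 1)) + 0) by ring.
    apply Clim_plus; trivial. apply Clim_plus; [now apply Dfun_lim|].
    apply Clim_const.
Qed.

Lemma Im_Csum_0 (n : nat) (f : nat -> C) :
  (forall i, (i < n)%nat -> Im (f i) = 0%R) -> Im (Csum 0 n f) = 0%R.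
Proof.
  intros H. rewrite Im_Csum, (Rsum_ext n _ (fun _ => 0 * 0)%R).
  - rewrite Rsum_scal. ring.
  - intros i Hi. rewrite H by trivial. ring.
Qed.

Lemma Im_Cmult_0 (a b : C) : Im a = 0%R -> Im b = 0%R -> Im (a * b) = 0%R.
Proof.
  destruct a, b. unfold Im. simpl. intros -> ->. ring.
Qed.

Lemma Im_Cplus_0 (a b : C) : Im a = 0%R -> Im b = 0%R -> Im (a + b) = 0%R.
Proof.
  destruct a, b. unfold Im. simpl. intros -> ->. ring.
Qed.

Lemma Im_Cminus_0 (a b : C) : Im a = 0%R -> Im b = 0%R -> Im (a - b) = 0%R.
Proof.
  destruct a, b. unfold Im. simpl. intros -> ->. ring.
Qed.

Lemma Mfun_real (b : nat -> C) (j : nat) (x : R) :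
  bern_rec b -> Im (Mfun b j x) = 0%R.
Proof.
  intros Hb. apply Im_Csum_0. intros i _. apply Im_Cmult_0; [|reflexivity].
  now apply bnum_real.
Qed.

Lemma Clim_real (u : nat -> C) (l : C) :
  (forall n, Im (u n) = 0%R) -> Clim u l -> Im l = 0%R.
Proof.
  intros H Hl. apply Clim_Im in Hl. apply is_lim_seq_unique in Hl.
  rewrite (Lim_seq_ext _ (fun _ => 0%R)), Lim_seq_const in Hl; trivial.
  now injection Hl.
Qed.

Lemma Dfun_real (b : nat -> C) (j : nat) (x : R) :
  bern_rec b -> (0 <= x)%R -> Im (Dfun b j x) = 0%R.
Proof.
  intros Hb Hx. apply (Clim_real (dseq b j x)); [|now apply Dfun_lim].
  intros n. unfold dseq. apply Im_Cminus_0; [|reflexivity].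
  apply Im_Cminus_0; now apply Mfun_real.
Qed.

(** * Polynomial identities for the coefficients [G_{n,j}] *)

Lemma poly_coef_eq (n : nat) (c d : nat -> C) :
  (forall u, Csum 0 n (fun j => c j * u ^ j) = Csum 0 n (fun j => d j * u ^ j)) ->
  forall j, (j < n)%nat -> c j = d j.
Proof.
  intros H j Hj.
  set (e := fun i => if (i <? n)%nat then c i - d i else 0).
  assert (Hp := psn_finite 0 1 n e ltac:(lra) ltac:(intros i Hi; unfold e;
    destruct (Nat.ltb_spec i n); [lia|reflexivity])).
  assert (H0 := psn_zero 0 1 _ e _ ltac:(lra) Hp).
  assert (He : e j = 0).
  { apply H0. intros eps Heps. exists (RtoC (eps / 2)). repeat split.
    - intros E. apply RtoC_inj in E. lra.
    - replace (RtoC (eps / 2) - 0) with (RtoC (eps / 2)) by ring.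
      rewrite Cmod_R, Rabs_pos_eq; lra.
    - set (w := RtoC (eps / 2) - 0).
      rewrite (Csum_ext 0 n _ (fun i => c i * w ^ i - d i * w ^ i)).
      + rewrite Csum_minus, H. ring.
      + intros i Hi. unfold e. destruct (Nat.ltb_spec i n); [ring|lia]. }
  unfold e in He. destruct (Nat.ltb_spec j n); [|lia].
  replace (c j) with (c j - d j + d j) by ring. rewrite He. ring.
Qed.

Lemma Cprod_shift (k : nat) (v : C) :
  Cprod (S k) (fun i => v + 1 - i%:C) = (v + 1) * Cprod k (fun i => v - i%:C).
Proof.
  induction k as [|k IH].
  - simpl. unfold Nat2C. simpl. ring.
  - change (Cprod (S (S k)) (fun i => v + 1 - i%:C)) with
      (Cprod (S k) (fun i => v + 1 - i%:C) * (v + 1 - (S k)%:C)).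
    rewrite IH. simpl Cprod. unfold Nat2C. rewrite S_INR, RtoC_plus. ring.
Qed.

Lemma Cbinom_pascal (k : nat) (v : C) :
  Cbinom (v + 1) (S k) = Cbinom v (S k) + Cbinom v k.
Proof.
  unfold Cbinom. rewrite Cprod_shift, fact_S_C. simpl Cprod.
  assert (H1 := fact_neq0_C k). assert (H2 := Nat2C_neq0 (S k) ltac:(lia)).
  assert (E : (S k)%:C = k%:C + 1) by (unfold Nat2C; now rewrite S_INR, RtoC_plus).
  rewrite E in H2 |- *. field. now split.
Qed.

Lemma Cbinom_0_S (k : nat) : Cbinom 0 (S k) = 0.
Proof.
  unfold Cbinom. assert (H : Cprod (S k) (fun i => 0 - i%:C) = 0).
  { induction k as [|k IH]; [simpl; unfold Nat2C; simpl; ring|].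
    change (Cprod (S (S k)) (fun i => 0 - i%:C)) with
      (Cprod (S k) (fun i => 0 - i%:C) * (0 - (S k)%:C)).
    rewrite IH. ring. }
  rewrite H. unfold Cdiv. ring.
Qed.

(** Pascal's rule for [Cbinom (z - u)], compared coefficient by coefficient in [u]. *)
Lemma Gpoly_shift (n j : nat) (z : C) :
  (1 <= n)%nat -> (j < S n)%nat ->
  Gpoly (S n) j (z + 1) = Gpoly (S n) j z + (if (j <? n)%nat then Gpoly n j z else 0).
Proof.
  intros Hn. revert j. apply poly_coef_eq. intros u.
  rewrite Gpoly_spec by lia.
  rewrite (Csum_ext 0 (S n) (fun j => (Gpoly (S n) j z + _) * u ^ j) (fun j =>
    Gpoly (S n) j z * u ^ j + (if (j <? n)%nat then Gpoly n j z else 0) * u ^ j))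
    by (intros; ring).
  rewrite Csum_plus, Gpoly_spec by lia.
  rewrite (Csum0_S n), Nat.ltb_irrefl.
  rewrite (Csum_ext 0 n _ (fun j => Gpoly n j z * u ^ j)).
  - rewrite Gpoly_spec by lia.
    replace (S n - 1)%nat with (S (n - 1)) by lia.
    replace (z + 1 - u) with (z - u + 1) by ring. rewrite Cbinom_pascal. ring.
  - intros i Hi. destruct (Nat.ltb_spec i n); [reflexivity|lia].
Qed.

Lemma Gpoly_1 (z : C) : Gpoly 1 0 z = 1.
Proof. unfold Gpoly. simpl. unfold Nat2C. simpl. field. Qed.

(* Candidate for [log G_n(x+1)]. *)
Definition ell (b : nat -> C) (n : nat) (x : R) : C :=
  Csum 0 n (fun j => Gpoly n j x * Dfun b j x).

Lemma ell_0 (b : nat -> C) (n : nat) : ell b n 0 = 0.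
Proof.
  apply Csum_zero. intros i _. rewrite Dfun_0. ring.
Qed.

Lemma ell_step_1 (b : nat -> C) (x : R) :
  bern_rec b -> (0 <= x)%R -> ell b 1 (x + 1) = ell b 1 x + RtoC (ln (x + 1)).
Proof.
  intros Hb Hx. unfold ell. rewrite !Csum0_S, !(Csum_nil 0 0) by lia.
  rewrite !Gpoly_1, Dfun_step by trivial. unfold xlog. simpl pow.
  rewrite Rmult_1_l. ring.
Qed.

(** The logarithms produced by [Dfun_step] cancel: their total factor is the sum of
    [G_{n+1,j}(x+1) * (x+1)^j], which is [binom(0, n) = 0] since [n >= 1]. The remaining terms
    follow Pascal's rule. *)
Lemma ell_step (b : nat -> C) (n : nat) (x : R) :
  bern_rec b -> (1 <= n)%nat -> (0 <= x)%R ->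
  ell b (S n) (x + 1) = ell b (S n) x + ell b n x.
Proof.
  intros Hb Hn Hx. unfold ell at 1.
  rewrite (Csum_ext 0 (S n) _ (fun j =>
    Gpoly (S n) j x * Dfun b j x +
    (if (j <? n)%nat then Gpoly n j x else 0) * Dfun b j x +
    RtoC (ln (x + 1)) * (Gpoly (S n) j (x + 1)%R * RtoC (x + 1) ^ j))).
  - rewrite !Csum_plus, Csum_scal, Gpoly_spec by lia. fold (ell b (S n) x).
    replace (RtoC (x + 1) - RtoC (x + 1)) with (RtoC 0) by ring.
    replace (S n - 1)%nat with (S (n - 1)) by lia. rewrite Cbinom_0_S.
    rewrite (Csum0_S n), Nat.ltb_irrefl.
    rewrite (Csum_ext 0 n _ (fun j => Gpoly n j x * Dfun b j x)).
    + fold (ell b n x). ring.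
    + intros i Hi. destruct (Nat.ltb_spec i n); [reflexivity|lia].
  - intros j Hj. rewrite Dfun_step by trivial. unfold xlog.
    rewrite RtoC_mult, RtoC_pow.
    assert (Hg := Gpoly_shift n j x Hn ltac:(lia)). rewrite <- RtoC_plus in Hg.
    set (g := Gpoly (S n) j (x + 1)%R) in *.
    transitivity (g * Dfun b j x + RtoC (ln (x + 1)) * (g * RtoC (x + 1) ^ j));
      [ring|].
    rewrite Hg at 1. ring.
Qed.

(** * Polynomial functions *)

Definition polyfun (d : nat) (f : C -> C) : Prop :=
  exists c : nat -> C, forall x, f x = Csum 0 (S d) (fun i => c i * x ^ i).

Lemma polyfun_ext (d : nat) (f g : C -> C) :
  (forall x, f x = g x) -> polyfun d f -> polyfun d g.
Proof. intros H [c Hc]. exists c. intros x. now rewrite <- H. Qed.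

Lemma polyfun_mono (d d' : nat) (f : C -> C) : (d <= d')%nat -> polyfun d f -> polyfun d' f.
Proof.
  intros H [c Hc]. exists (fun i => if (i <=? d)%nat then c i else 0).
  intros x. rewrite Hc, (Csum_chasles 0 (S d) (S d')) by lia.
  rewrite (Csum_zero (S d) (S d')), Cplus_0_r.
  - apply Csum_ext. intros i Hi. destruct (Nat.leb_spec i d); [reflexivity|lia].
  - intros i Hi. destruct (Nat.leb_spec i d); [lia|ring].
Qed.

Lemma polyfun_const (d : nat) (k : C) : polyfun d (fun _ => k).
Proof.
  apply polyfun_mono with 0%nat; [lia|]. exists (fun _ => k). intros x.
  rewrite Csum0_S. simpl. ring.
Qed.

Lemma polyfun_plus (d : nat) (f g : C -> C) :
  polyfun d f -> polyfun d g -> polyfun d (fun x => f x + g x).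
Proof.
  intros [c Hc] [e He]. exists (fun i => c i + e i). intros x.
  rewrite Hc, He, <- Csum_plus. apply Csum_ext. intros; ring.
Qed.

Lemma polyfun_scal (d : nat) (k : C) (f : C -> C) :
  polyfun d f -> polyfun d (fun x => k * f x).
Proof.
  intros [c Hc]. exists (fun i => k * c i). intros x.
  rewrite Hc, <- Csum_scal. apply Csum_ext. intros; ring.
Qed.

Lemma polyfun_minus (d : nat) (f g : C -> C) :
  polyfun d f -> polyfun d g -> polyfun d (fun x => f x - g x).
Proof.
  intros Hf Hg. apply polyfun_ext with (fun x => f x + (- (1)) * g x).
  { intros; ring. }
  apply polyfun_plus; trivial. now apply polyfun_scal.
Qed.

Lemma polyfun_sum (d a b : nat) (f : nat -> C -> C) :
  (forall i, (a <= i < b)%nat -> polyfun d (f i)) ->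
  polyfun d (fun x => Csum a b (fun i => f i x)).
Proof.
  intros H. destruct (Nat.le_gt_cases b a) as [Hb|Hb].
  { apply polyfun_ext with (fun _ => 0); [|apply polyfun_const].
    intros x. now rewrite Csum_nil. }
  induction b as [|b IH]; [lia|].
  apply polyfun_ext with (fun x => Csum a b (fun i => f i x) + f b x).
  { intros x. now rewrite Csum_S by lia. }
  apply polyfun_plus; [|apply H; lia].
  destruct (Nat.eq_dec a b) as [->|Hn].
  - apply polyfun_ext with (fun _ => 0); [|apply polyfun_const].
    intros x. now rewrite Csum_nil.
  - apply IH; [|lia]. intros i Hi. apply H. lia.
Qed.

Lemma polyfun_mulx (d : nat) (f : C -> C) : polyfun d f -> polyfun (S d) (fun x => x * f x).
Proof.
  intros [c Hc]. exists (fun i => match i with O => RtoC 0 | S k => c k end).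
  intros x. rewrite Csum0_S_l, Hc, <- Csum_scal.
  rewrite (Csum_ext 0 (S d) (fun i => c i * x ^ S i) (fun i => x * (c i * x ^ i)))
    by (intros; simpl; ring).
  now rewrite Cmult_0_l, Cplus_0_l.
Qed.

Lemma polyfun_id : polyfun 1 (fun x => x).
Proof.
  apply polyfun_ext with (fun x => x * 1); [intros; ring|].
  apply polyfun_mulx, polyfun_const.
Qed.

Lemma polyfun_mult (d e : nat) (f g : C -> C) :
  polyfun d f -> polyfun e g -> polyfun (d + e) (fun x => f x * g x).
Proof.
  intros [c Hc] Hg.
  apply polyfun_ext with (fun x => Csum 0 (S d) (fun i => c i * (x ^ i * g x))).
  { intros x. rewrite Hc, <- Csum_scal_r. apply Csum_ext. intros; ring. }
  apply polyfun_sum. intros i Hi. apply polyfun_scal. apply polyfun_mono with (i + e)%nat; [lia|].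
  clear Hi. induction i as [|i IH].
  - apply polyfun_ext with g; [intros; simpl; ring|exact Hg].
  - apply polyfun_ext with (fun x => x * (x ^ i * g x)); [intros; simpl; ring|].
    now apply polyfun_mulx.
Qed.

Lemma polyfun_pow (d k : nat) (f : C -> C) : polyfun d f -> polyfun (k * d) (fun x => f x ^ k).
Proof.
  intros Hf. induction k as [|k IH]; [apply (polyfun_const 0 1)|].
  simpl. now apply polyfun_mult.
Qed.

Lemma polyfun_pow_le (d k : nat) (f : C -> C) :
  polyfun 1 f -> (k <= d)%nat -> polyfun d (fun x => f x ^ k).
Proof.
  intros Hf Hk. apply polyfun_mono with (k * 1)%nat; [lia|]. now apply polyfun_pow.
Qed.

Lemma polyfun_shift (a : C) : polyfun 1 (fun x => x + a).
Proof. apply polyfun_plus; [apply polyfun_id|apply polyfun_const]. Qed.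

Lemma polyfun_comp_shift (d : nat) (f : C -> C) (a : C) :
  polyfun d f -> polyfun d (fun x => f (x + a)).
Proof.
  intros [c Hc].
  apply polyfun_ext with (fun x => Csum 0 (S d) (fun i => c i * (x + a) ^ i)).
  { intros x. now rewrite Hc. }
  apply polyfun_sum. intros i Hi. apply polyfun_scal, polyfun_pow_le; [apply polyfun_shift|lia].
Qed.

Lemma polyfun_analytic (d : nat) (f : C -> C) (a : C) : polyfun d f -> analytic_at f a.
Proof.
  intros [c Hc].
  assert (H : forall n, analytic_at (fun x => Csum 0 n (fun i => c i * x ^ i)) a).
  { induction n as [|n IH]; [exact (analytic_const 0 a)|].
    apply analytic_ext with (fun x => Csum 0 n (fun i => c i * x ^ i) + c n * (x - 0) ^ n).
    - exists 1%R. split; [lra|]. intros w _. rewrite Csum0_S.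
      now replace (w - 0) with w by ring.
    - apply analytic_plus; trivial. apply analytic_mult; [apply analytic_const|].
      apply analytic_pow, analytic_id. }
  apply analytic_ext with (2 := H (S d)). exists 1%R. split; [lra|].
  intros w _. apply Hc.
Qed.

(** Write [f = c 0 + x * g]. Then [g n = (f n - c 0) / n] tends to 0 as well, so [g = 0] by
    induction on the degree, and the constant left over equals its limit 0. *)
Lemma polyfun_lim0 (d : nat) (f : C -> C) :
  polyfun d f -> Clim (fun n => f n%:C) 0 -> forall x, f x = 0.
Proof.
  revert f. induction d as [|d IH]; intros f [c Hc] Hl.
  - assert (E : forall x, f x = c 0%nat).
    { intros x. rewrite Hc, Csum0_S. simpl. ring. }
    intros x. rewrite E. apply (Clim_unique (fun n => f n%:C)); trivial.
    apply Clim_ext with (fun _ => c 0%nat); [now intros; rewrite E|apply Clim_const].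
  - set (g := fun x => Csum 0 (S d) (fun i => c (S i) * x ^ i)).
    assert (E : forall x, f x = c 0%nat + x * g x).
    { intros x. rewrite Hc, Csum0_S_l. unfold g. rewrite <- Csum_scal. simpl pow.
      rewrite Cmult_1_r. f_equal. apply Csum_ext. intros i _. simpl. ring. }
    assert (Hg : forall x, g x = 0).
    { apply IH; [now exists (fun i => c (S i))|]. apply Clim_incr_1.
      apply Clim_ext with (fun n => RtoC (/ INR (S n)) * (f (S n)%:C - c 0%nat)).
      - intros n. rewrite E, RtoC_Rinv. fold (Nat2C (S n)). field.
        now apply Nat2C_neq0.
      - replace (RtoC 0) with (RtoC 0 * (0 - c 0%nat)) by ring.
        apply Clim_mult; [apply Clim_RtoC, is_lim_seq_inv_S|].
        apply Clim_minus; [now apply Clim_incr_1 in Hl|apply Clim_const]. }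
    intros x. apply (Clim_unique (fun n => f n%:C)); trivial.
    apply Clim_ext with (fun _ => f x); [|apply Clim_const].
    intros n. rewrite !E, !Hg. ring.
Qed.

(** * The constant term of the asymptotic expansion *)

Lemma Cprod_falling (j r : nat) :
  (r <= j)%nat ->
  Cprod r (fun i => j%:C - i%:C) * (fact (j - r))%:C = (fact j)%:C.
Proof.
  induction r as [|r IH]; intros Hr.
  - simpl. rewrite Nat.sub_0_r. ring.
  - rewrite <- IH by lia. simpl Cprod.
    replace (j - r)%nat with (S (j - S r)) by lia. rewrite fact_S_C.
    replace (S (j - S r))%:C with (j%:C - r%:C); [ring|].
    unfold Nat2C. rewrite <- RtoC_minus, <- minus_INR by lia. do 2 f_equal. lia.
Qed.

Lemma Cbinom_nat (j r : nat) :
  (r <= j)%nat ->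
  Cbinom j%:C r = (fact j)%:C / ((fact r)%:C * (fact (j - r))%:C).
Proof.
  intros Hr. rewrite <- (Cprod_falling j r Hr). unfold Cbinom. field.
  split; apply fact_neq0_C.
Qed.

Lemma Cpow_binom (j : nat) (z v : C) :
  (v + z) ^ j = Csum 0 (S j) (fun r => Cbinom j%:C r * z ^ (j - r) * v ^ r).
Proof.
  assert (H := epow_plus j z v). unfold epow in H at 1.
  replace ((v + z) ^ j) with ((fact j)%:C * ((z + v) ^ j / (fact j)%:C)).
  2:{ replace (z + v) with (v + z) by ring. field. apply fact_neq0_C. }
  rewrite H, <- Csum_scal. apply Csum_ext. intros r Hr.
  rewrite Cbinom_nat by lia. unfold epow. field. split; apply fact_neq0_C.
Qed.

(** The part of [Mfun] free of [ln]; for [b = bnum B] it is the polynomial [P_j]. *)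
Definition Prest (b : nat -> C) (j : nat) (x : C) : C :=
  Csum 0 (j + 2) (fun r => b r * phi_coef j r * x ^ (j + 1 - r)).

Lemma Mfun_split (b : nat -> C) (j : nat) (t : R) :
  Mfun b j t = (fact j)%:C * bpoly b (S j) t * RtoC (ln t) + Prest b j t.
Proof.
  unfold Mfun, bpoly, Prest. rewrite <- Csum_scal, <- Csum_scal_r.
  replace (S (S j)) with (j + 2)%nat by lia. rewrite <- Csum_plus.
  apply Csum_ext. intros r Hr. unfold Fder.
  destruct (Nat.leb_spec r (j + 1)); [|lia].
  rewrite RtoC_mult, RtoC_plus, RtoC_mult, RtoC_pow.
  unfold epow. replace (S j - r)%nat with (j + 1 - r)%nat by lia.
  assert (H1 := fall_coef_fact j r ltac:(lia)).
  assert (H2 := fact_neq0_C (j + 1 - r)). unfold Nat2C in *.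
  rewrite <- H1, RtoC_mult. field. exact H2.
Qed.

(** For the Bernoulli numbers, the coefficient of [y^s] in [B_{j+1}(y + z) / (j + 1)], which is the
    factor of the logarithm in [Mfun] at [y + z]. *)
Definition bshift_coef (b : nat -> C) (j : nat) (z : C) (s : nat) : C :=
  (fact j)%:C * bpoly b (j + 1 - s) z / (fact s)%:C.

Lemma bshift_coef_sum (b : nat -> C) (j : nat) (z y : C) :
  bern_rec b ->
  Csum 0 (j + 2) (fun s => bshift_coef b j z s * y ^ s) =
  (fact j)%:C * bpoly b (S j) (y + z).
Proof.
  intros Hb. replace (y + z) with (z + y) by ring. rewrite bpoly_plus by trivial.
  rewrite Csum_rev, <- Csum_scal. replace (S (S j)) with (j + 2)%nat by lia.
  apply Csum_ext. intros s Hs. unfold bshift_coef, epow.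
  replace (S j - (S j - s))%nat with s by lia.
  replace (j + 1 - s)%nat with (S j - s)%nat by lia. unfold Cdiv. ring.
Qed.

(** [y^s] times the part of [ln (1 + z / y)] below order [m]. It is used with [m <= s + 1], where
    the natural subtraction is exact and the result is a polynomial in [y]. *)
Definition log_trunc (m : nat) (z y : C) (s : nat) : C :=
  Csum 0 m (fun l => log1p_coef l * z ^ l * y ^ (s - l)).

(* Polynomial part in [y] of [(y + z) ^ j * ln (1 + z / y)]. *)
Definition tpoly (j : nat) (z y : C) : C :=
  Csum 0 (S j) (fun r => Cbinom j%:C r * z ^ (j - r) * log_trunc (S r) z y r).

(** The same expansion as in [tpoly] with one more order kept, so that the term in [1 / y] is
    included. This is what the convergence factors [Phi_n] subtract. *)
Definition trunc (j : nat) (z y : C) : C :=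
  Csum 0 (S j) (fun r => Cbinom j%:C r * z ^ (j - r) *
    (log_trunc (S (S r)) z y (S r) / y)).

(** Polynomial part in [y] of [Mfun] at [y + z] minus the binomial combination of the [Mfun] of
    order [r] at [y], once the multiples of [ln y] are set aside. *)
Definition Vpoly (b : nat -> C) (j : nat) (z y : C) : C :=
  Csum 0 (j + 2) (fun s => bshift_coef b j z s * log_trunc (S s) z y s)
  + Prest b j (y + z)
  - Csum 0 (S j) (fun r => Cbinom j%:C r * z ^ (j - r) * Prest b r y).

(** This explains the shape of [Q_j]: at [y = 1] the truncated logarithms become the alternating
    sums of [z^l / l], and the binomial sum is the given one read backwards. *)
Lemma Qpoly_Vpoly (B : nat -> C -> C) (j : nat) (z : C) :
  is_bernoulli_poly B -> Qpoly B j z = Vpoly (bnum B) j z 1.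
Proof.
  intros hB. unfold Qpoly, Vpoly.
  assert (HP : forall i x, Ppoly B i x = Prest (bnum B) i x).
  { intros i x. apply Csum_ext. intros r Hr. rewrite phi_phi_coef by lia.
    reflexivity. }
  rewrite HP. replace (z + 1) with (1 + z) by ring.
  rewrite (Csum_chasles 0 1 (j + 2)) by lia. rewrite Csum0_S, (Csum_nil 0 0) by lia.
  replace (log_trunc 1 z 1 0) with (RtoC 0)
    by (unfold log_trunc; rewrite Csum0_S; simpl; ring).
  replace (j + 1)%nat with (S j) by lia.
  rewrite (Csum_rev j (fun r => Cbinom j%:C r * z ^ (j - r) * Prest (bnum B) r 1)).
  rewrite (Csum_ext 0 (S j) (fun r => Cbinom j%:C r * z ^ r * Ppoly B (j - r) 1)
    (fun r => Cbinom j%:C (j - r) * z ^ (j - (j - r)) * Prest (bnum B) (j - r) 1)).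
  2:{ intros r Hr. rewrite HP. replace (j - (j - r))%nat with r by lia.
      do 2 f_equal. rewrite !Cbinom_nat by lia.
      replace (j - (j - r))%nat with r by lia. field. split; apply fact_neq0_C. }
  rewrite <- Csum_scal.
  rewrite (Csum_ext 1 (j + 2) (fun i => / (S j)%:C * _)
    (fun s => bshift_coef (bnum B) j z s * log_trunc (S s) z 1 s)); [ring|].
  intros s Hs. unfold bshift_coef. rewrite Cbinom_nat by lia.
  rewrite (bernoulli_bpoly B) by trivial.
  replace (j + 1 - s)%nat with (S j - s)%nat by lia. rewrite fact_S_C.
  assert (E : Csum 1 (s + 1) (fun l => (- (1)) ^ (l - 1) * z ^ l / l%:C) =
    log_trunc (S s) z 1 s).
  { unfold log_trunc. rewrite (Csum_chasles 0 1 (S s)) by lia.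
    rewrite Csum0_S, (Csum_nil 0 0) by lia. simpl (log1p_coef 0).
    rewrite Cmult_0_l, Cmult_0_l, !Cplus_0_l. replace (s + 1)%nat with (S s) by lia.
    apply Csum_ext. intros [|l] Hl; [lia|]. rewrite Cpow_1_l. simpl log1p_coef.
    simpl Nat.sub. rewrite Nat.sub_0_r. unfold Cdiv. ring. }
  rewrite E. field.
  split; [apply fact_neq0_C|]. split; [apply fact_neq0_C|]. now apply Nat2C_neq0.
Qed.

(** This is the coefficient of [z^(j+1) / y] in [(y + z)^j * ln (1 + z / y)]; it follows from the
    expansion of [(-1 + 1)^(j+1) = 0]. *)
Lemma alt_binom (j : nat) :
  Csum 0 (S j) (fun r => Cbinom j%:C r * log1p_coef (S r)) = / (S j)%:C.
Proof.
  assert (HS : (S j)%:C <> 0) by now apply Nat2C_neq0.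
  assert (H := Cpow_binom (S j) 1 (- (1))).
  replace (- (1) + 1) with (RtoC 0) in H by ring. rewrite Csum0_S_l in H.
  rewrite (Csum_ext 0 (S j) _ (fun r => - (S j)%:C *
    (Cbinom j%:C r * log1p_coef (S r)))) in H.
  - rewrite Csum_scal in H. rewrite Cbinom_nat, Nat.sub_0_r in H by lia.
    rewrite Cpow_1_l in H.
    change ((- (1)) ^ 0) with (RtoC 1) in H. change (0 ^ S j) with (0 * 0 ^ j) in H.
    set (s := Csum 0 (S j) _) in *.
    replace ((fact (S j))%:C / ((fact 0)%:C * (fact (S j))%:C)) with (RtoC 1) in H.
    2:{ change ((fact 0)%:C) with (RtoC 1). field. apply fact_neq0_C. }
    assert (H1 : (S j)%:C * s = 1).
    { replace ((S j)%:C * s) with (1 - (1 * 1 * 1 + - (S j)%:C * s)) by ring.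
      rewrite <- H. ring. }
    replace s with ((S j)%:C * s / (S j)%:C) by (field; trivial).
    rewrite H1. field. trivial.
  - intros r Hr. rewrite !Cbinom_nat by lia. rewrite Cpow_1_l.
    simpl log1p_coef. rewrite !fact_S_C. simpl Nat.sub. 
    change ((- (1)) ^ S r) with (- (1) * (- (1)) ^ r). field.
    repeat split; try apply fact_neq0_C; now apply Nat2C_neq0.
Qed.

Lemma trunc_split (j : nat) (z y : C) :
  y <> 0 -> trunc j z y = tpoly j z y + z ^ S j / (S j)%:C / y.
Proof.
  intros Hy. unfold trunc, tpoly.
  rewrite (Csum_ext 0 (S j) (fun r => Cbinom j%:C r * z ^ (j - r) *
    (log_trunc (S (S r)) z y (S r) / y)) (fun r =>
    Cbinom j%:C r * z ^ (j - r) * log_trunc (S r) z y r +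
    z ^ S j / y * (Cbinom j%:C r * log1p_coef (S r)))).
  - rewrite Csum_plus, Csum_scal, alt_binom. f_equal. unfold Cdiv. ring.
  - intros r Hr. unfold log_trunc. rewrite (Csum0_S (S r)), Nat.sub_diag.
    rewrite (Csum_ext 0 (S r) (fun l => log1p_coef l * z ^ l * y ^ (S r - l))
      (fun l => y * (log1p_coef l * z ^ l * y ^ (r - l)))).
    + rewrite Csum_scal.
      replace (z ^ S j) with (z ^ (j - r) * z ^ S r)
        by (rewrite <- Cpow_add_r; f_equal; lia).
      simpl (y ^ 0). field. exact Hy.
    + intros l Hl. replace (S r - l)%nat with (S (r - l)) by lia. simpl. ring.
Qed.

Lemma polyfun_log_trunc (m d : nat) (z : C) (s : nat) :
  (s <= d)%nat -> polyfun d (fun y => log_trunc m z y s).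
Proof.
  intros Hs. apply polyfun_sum. intros i Hi. apply polyfun_scal.
  apply polyfun_pow_le; [apply polyfun_id|lia].
Qed.

Lemma polyfun_Prest (b : nat -> C) (j d : nat) :
  (j + 1 <= d)%nat -> polyfun d (Prest b j).
Proof.
  intros Hd. apply polyfun_sum. intros r Hr. apply polyfun_scal.
  apply polyfun_pow_le; [apply polyfun_id|lia].
Qed.

Lemma polyfun_Vpoly (b : nat -> C) (j : nat) (z : C) : polyfun (j + 1) (Vpoly b j z).
Proof.
  apply polyfun_minus; [apply polyfun_plus|].
  - apply polyfun_sum. intros s Hs. apply polyfun_scal, polyfun_log_trunc. lia.
  - apply (polyfun_comp_shift (j + 1) (Prest b j) z), polyfun_Prest. lia.
  - apply polyfun_sum. intros r Hr. apply polyfun_scal, polyfun_Prest. lia.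
Qed.

Lemma polyfun_tpoly (j : nat) (z : C) : polyfun (j + 1) (tpoly j z).
Proof. apply polyfun_sum. intros r Hr. apply polyfun_scal, polyfun_log_trunc. lia. Qed.

(** The Taylor error [(x / y)^(m+1)] multiplied by [y^s] with [s <= m] is [O(1 / y)]. The case
    [m = s] serves [Verr], the case [m = s + 1] serves [trunc]. *)
Lemma log_error_lim (x : R) (s m : nat) :
  (0 <= x)%R -> (s <= m)%nat ->
  Clim (fun N => RtoC (INR (S N) ^ s) * RtoC (ln (1 + x / INR (S N)))
     - log_trunc (S m) x (S N)%:C m * / (S N)%:C ^ (m - s)) 0.
Proof.
  intros Hx Hs.
  apply Clim_squeeze with (N := 0%nat) (v := fun N => (x ^ S m * / INR (S N))%R).
  - intros N _. set (y := INR (S N)).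
    assert (Hy : (1 <= y)%R) by (apply (le_INR 1); lia).
    assert (E : log_trunc (S m) x (S N)%:C m * / (S N)%:C ^ (m - s) =
      RtoC (y ^ s * Rsum (S m) (fun i => Re (log1p_coef i) * (x / y) ^ i)%R)).
    { rewrite RtoC_mult, <- Csum_RtoC. unfold log_trunc.
      rewrite <- Csum_scal_r, <- Csum_scal.
      apply Csum_ext. intros l Hl. rewrite RtoC_mult, <- log1p_coef_real.
      unfold Rdiv. rewrite !RtoC_pow, RtoC_mult, RtoC_Rinv.
      unfold Nat2C. fold y. rewrite Cpow_mult_l.
      assert (Hy0 : RtoC y <> 0) by (intros H; apply RtoC_inj in H; lra).
      assert (Hp : forall k, RtoC y ^ k <> 0) by (intros k; now apply Cpow_nz).
      rewrite Cpow_inv by trivial.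
      assert (E : RtoC y ^ (m - l) * RtoC y ^ l = RtoC y ^ s * RtoC y ^ (m - s)).
      { rewrite <- !Cpow_add_r. f_equal. lia. }
      replace (RtoC y ^ (m - l)) with (RtoC y ^ s * RtoC y ^ (m - s) / RtoC y ^ l)
        by (rewrite <- E; field; apply Hp).
      field. split; apply Hp. }
    rewrite E, <- RtoC_mult, <- RtoC_minus.
    match goal with |- (Cmod (?a - RtoC 0)%C <= _)%R =>
      replace (a - RtoC 0) with a by ring end.
    rewrite Cmod_R, <- Rmult_minus_distr_l, Rabs_mult, (Rabs_pos_eq (y ^ s)) by (apply pow_le; lra).
    assert (Hxy : (0 <= x / y)%R).
    { apply Rmult_le_pos; trivial. apply Rlt_le, Rinv_0_lt_compat. lra. }
    apply Rle_trans with (y ^ s * (x / y) ^ S m)%R.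
    + apply Rmult_le_compat_l; [apply pow_le; lra|]. now apply ln1p_taylor.
    + unfold Rdiv. rewrite Rpow_mult_distr.
      replace (y ^ s * (x ^ S m * (/ y) ^ S m))%R with
        (x ^ S m * (y ^ s * (/ y) ^ S m))%R by ring.
      apply Rmult_le_compat_l; [now apply pow_le|].
      assert (Hq : (0 < / y <= 1)%R).
      { split; [apply Rinv_0_lt_compat; lra|].
        rewrite <- Rinv_1. apply Rinv_le_contravar; lra. }
      assert (E2 : (y ^ s * (/ y) ^ S m = (/ y) ^ (m - s) * / y)%R).
      { replace (S m) with (s + (m - s) + 1)%nat by lia.
        rewrite !pow_add, pow_1.
        replace (y ^ s * ((/ y) ^ s * (/ y) ^ (m - s) * / y))%R with
          ((y * / y) ^ s * ((/ y) ^ (m - s) * / y))%R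
          by (rewrite Rpow_mult_distr; ring).
        rewrite Rinv_r, pow1 by lra. ring. }
      rewrite E2. assert (H1 : ((/ y) ^ (m - s) <= 1)%R).
      { rewrite <- (pow1 (m - s)). apply pow_incr. lra. }
      set (p := ((/ y) ^ (m - s))%R) in *. nra.
  - replace 0%R with (x ^ S m * 0)%R by ring.
    apply is_lim_seq_mult'; [apply is_lim_seq_const|apply is_lim_seq_inv_S].
Qed.

Lemma Clim_0_ext_sum (m : nat) (c : nat -> C) (e : nat -> nat -> C) :
  (forall s, (s < m)%nat -> Clim (e s) 0) ->
  Clim (fun N => Csum 0 m (fun s => c s * e s N)) 0.
Proof.
  intros H. replace (RtoC 0) with (Csum 0 m (fun s => c s * 0))
    by (apply Csum_zero; intros; ring).
  apply (Clim_Csum m (fun N s => c s * e s N)). intros s Hs.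
  apply Clim_scal. auto.
Qed.

Definition gdiff (N : nat) : R :=
  (ln (INR (S N)) - Rsum N (fun k => / INR (S k)))%R.

Lemma ln_succ_diff (N : nat) :
  (Rabs (ln (INR (S (S N))) - ln (INR (S N)) - / INR (S N)) <= / INR (S N) ^ 2)%R.
Proof.
  assert (Hy : (1 <= INR (S N))%R) by (apply (le_INR 1); lia).
  rewrite (S_INR (S N)). set (y := INR (S N)) in *.
  assert (Hiy : (0 < / y)%R) by (apply Rinv_0_lt_compat; lra).
  assert (H := ln1p_taylor (/ y) 1 ltac:(lra)).
  replace (ln (y + 1) - ln y)%R with (ln (1 + / y)).
  2:{ replace (y + 1)%R with (y * (1 + / y))%R by (field; lra).
      rewrite ln_mult by lra. ring. }
  replace (Rsum 2 (fun i => Re (log1p_coef i) * (/ y) ^ i)%R) with (/ y)%R in H.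
  2:{ assert (E0 : Re (log1p_coef 0) = 0%R) by reflexivity.
      assert (E1 : Re (log1p_coef 1) = 1%R).
      { unfold log1p_coef, Nat2C. change ((- (1)) ^ 0) with (RtoC 1).
        rewrite Cdiv_RtoC. simpl. field. }
      cbn [Rsum]. rewrite E0, E1. ring. }
  rewrite pow_inv in H. exact H.
Qed.

Lemma gdiff_lim : is_lim_seq gdiff (- euler_gamma)%R.
Proof.
  assert (Hlim : exists l, Clim (fun n => RtoC (gdiff n)) l).
  { apply Clim_steps with 1%R. intros n. rewrite <- RtoC_minus, Cmod_R.
    unfold gdiff. cbn [Rsum]. rewrite Rdiv_1_l.
    eapply Rle_trans; [|apply ln_succ_diff]. right. f_equal. ring. }
  destruct Hlim as [l Hl].
  assert (Hr := Clim_Re _ _ Hl).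
  assert (Hr' : is_lim_seq gdiff (Re l)) by exact Hr.
  replace (- euler_gamma)%R with (Re l); [exact Hr'|].
  unfold euler_gamma.
  rewrite (is_lim_seq_unique _ (- Re l)%R); [simpl; ring|].
  replace (- Re l)%R with (- Re l + 0)%R by ring.
  apply (is_lim_seq_ext (fun n => - gdiff n + / INR (S n))%R).
  - intros n. assert (E : forall k, sum_n (fun k => / INR (S k))%R k =
      Rsum (S k) (fun k => / INR (S k))%R).
    { induction k as [|k IH].
      - rewrite sum_O. symmetry. apply Rplus_0_l.
      - rewrite sum_Sn, IH. reflexivity. }
    rewrite E. unfold gdiff. cbn [Rsum]. ring.
  - apply is_lim_seq_plus'; [|apply is_lim_seq_inv_S].
    apply (is_lim_seq_opp gdiff (Re l)), Hr'.
Qed.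

Lemma bern_rec_0 (b : nat -> C) : bern_rec b -> b 0%nat = 1.
Proof.
  intros Hb. assert (H := Hb 0%nat). rewrite Csum0_S, (Csum_nil 0 0) in H by lia.
  rewrite Cplus_0_l in H. change ((fact (1 - 0))%:C) with (RtoC 1) in H.
  rewrite <- H. field.
Qed.

(** This compares the factors of [ln y]: after the binomial combination only [x^(j+1) / (j+1)]
    survives. It meets the harmonic sum coming from [trunc], and the two give Euler's constant. *)
Lemma bpoly_log_coef (b : nat -> C) (j : nat) (x y : C) :
  bern_rec b ->
  (fact j)%:C * bpoly b (S j) (y + x) =
  Csum 0 (S j) (fun r => Cbinom j%:C r * x ^ (j - r) *
    ((fact r)%:C * bpoly b (S r) y)) + x ^ S j / (S j)%:C.
Proof.
  intros Hb. rewrite bpoly_plus, Csum0_S_l by trivial.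
  rewrite Cmult_plus_distr_l, Cplus_comm. f_equal.
  - rewrite <- Csum_scal. apply Csum_ext. intros r Hr.
    rewrite Cbinom_nat by lia. unfold epow. simpl Nat.sub. field.
    split; apply fact_neq0_C.
  - unfold bpoly. rewrite Csum0_S, (Csum_nil 0 0), bern_rec_0 by (trivial; lia).
    simpl Nat.sub. rewrite epow_0. unfold epow. rewrite fact_S_C. field.
    split; [now apply Nat2C_neq0|apply fact_neq0_C].
Qed.

(** What remains of [dseq] when [(k + x)^j] is expanded in powers of [k], the [ln k] terms are
    gathered into the sequences for zeta, and [trunc] is paired with [ln (1 + x / k)]. *)
Definition Wseq (b : nat -> C) (j : nat) (x : R) (N : nat) : C :=
  Mfun b j (INR N + x + 1) -
  Csum 0 (S j) (fun r => Cbinom j%:C r * x ^ (j - r) * Mfun b r (INR N + 1)) -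
  Csum 0 N (fun k => trunc j x (S k)%:C).

(** The exponent [s - s] keeps each summand in the literal form of [log_error_lim] with [m = s]. *)
Definition Verr (b : nat -> C) (j : nat) (x : R) (N : nat) : C :=
  Csum 0 (j + 2) (fun s => bshift_coef b j x s *
    (RtoC (INR (S N) ^ s) * RtoC (ln (1 + x / INR (S N)))
     - log_trunc (S s) x (S N)%:C s * / (S N)%:C ^ (s - s))).

Lemma ln_plus_split (x y : R) :
  (0 <= x)%R -> (1 <= y)%R -> ln (y + x) = (ln y + ln (1 + x / y))%R.
Proof.
  intros Hx Hy.
  assert (Hxy : (0 <= x / y)%R).
  { apply Rmult_le_pos; trivial. apply Rlt_le, Rinv_0_lt_compat. lra. }
  rewrite <- ln_mult by lra. f_equal. field. lra.
Qed.

Lemma Wseq_Vpoly (b : nat -> C) (j : nat) (x : R) (N : nat) :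
  bern_rec b -> (0 <= x)%R ->
  Wseq b j x N = Vpoly b j x (S N)%:C - Csum 0 N (fun k => tpoly j x (S k)%:C)
    + RtoC x ^ S j / (S j)%:C * RtoC (gdiff N) + Verr b j x N.
Proof.
  intros Hb Hx. unfold Wseq.
  assert (Hy : (1 <= INR (S N))%R) by (apply (le_INR 1); lia).
  replace (INR N + x + 1)%R with (INR (S N) + x)%R by (rewrite S_INR; ring).
  replace (INR N + 1)%R with (INR (S N)) by (rewrite S_INR; ring).
  rewrite Mfun_split, ln_plus_split by trivial.
  rewrite (Csum_ext 0 (S j) (fun r => Cbinom j%:C r * RtoC x ^ (j - r) * Mfun b r (INR (S N)))
    (fun r => Cbinom j%:C r * RtoC x ^ (j - r) * ((fact r)%:C * bpoly b (S r) (S N)%:C)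
       * RtoC (ln (INR (S N))) +
     Cbinom j%:C r * RtoC x ^ (j - r) * Prest b r (S N)%:C)).
  2:{ intros r _. rewrite Mfun_split. unfold Nat2C. ring. }
  rewrite Csum_plus, Csum_scal_r.
  rewrite (Csum_ext 0 N (fun k => trunc j x (S k)%:C) (fun k => tpoly j x (S k)%:C +
    RtoC x ^ S j / (S j)%:C * RtoC (/ INR (S k)))).
  2:{ intros k _. rewrite trunc_split by now apply Nat2C_neq0.
      rewrite RtoC_Rinv. reflexivity. }
  rewrite Csum_plus, Csum_scal, Csum_RtoC.
  unfold Vpoly, Verr, gdiff. rewrite RtoC_minus.
  rewrite (Csum_ext 0 (j + 2) (fun s => bshift_coef b j x s * (RtoC (INR (S N) ^ s) * _ - _))
    (fun s => bshift_coef b j x s * (S N)%:C ^ s * RtoC (ln (1 + x / INR (S N))) -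
      bshift_coef b j x s * log_trunc (S s) x (S N)%:C s)).
  2:{ intros s _. rewrite Nat.sub_diag, RtoC_pow. unfold Nat2C. simpl (_ ^ 0).
      field. }
  rewrite Csum_minus, Csum_scal_r, bshift_coef_sum by trivial.
  rewrite !RtoC_plus. fold (Nat2C (S N)).
  rewrite (bpoly_log_coef b j x (S N)%:C) by trivial. ring.
Qed.

Lemma Verr_lim (b : nat -> C) (j : nat) (x : R) :
  (0 <= x)%R -> Clim (Verr b j x) 0.
Proof.
  intros Hx. apply (Clim_0_ext_sum (j + 2) (bshift_coef b j x)).
  intros s _. apply log_error_lim; trivial.
Qed.

Lemma Mfun_step_lim (b : nat -> C) (j : nat) (x : R) :
  bern_rec b -> (0 <= x)%R ->
  Clim (fun n => Mfun b j (INR (S n) + x + 1) - Mfun b j (INR n + x + 1)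
     - RtoC (xlog j (INR n + 1 + x))) 0.
Proof.
  intros Hb Hx. destruct (Mfun_step_nat b j Hb) as [K HK].
  apply Clim_squeeze with (N := 0%nat) (v := fun n => (K / INR (S n) ^ 2)%R).
  - intros n _. match goal with |- (Cmod (?a - RtoC 0)%C <= _)%R =>
      replace (a - RtoC 0) with a by ring end. exact (HK x n Hx).
  - apply is_lim_seq_div_sq.
Qed.

(** Derived from the step estimates of [Mfun], independently of [Wseq_Vpoly]. Confronting the two
    descriptions of the increment yields [Vpoly_telescope]. *)
Lemma Wseq_step (b : nat -> C) (j : nat) (x : R) :
  bern_rec b -> (0 <= x)%R -> Clim (fun N => Wseq b j x (S N) - Wseq b j x N) 0.
Proof.
  intros Hb Hx.
  set (e := fun i x n => Mfun b i (INR (S n) + x + 1) - Mfun b i (INR n + x + 1)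
     - RtoC (xlog i (INR n + 1 + x))).
  set (d := fun r N => RtoC (INR (S N) ^ r) * RtoC (ln (1 + x / INR (S N)))
     - log_trunc (S (S r)) x (S N)%:C (S r) * / (S N)%:C ^ (S r - r)).
  apply Clim_ext with (u := fun N => e j x N
    - Csum 0 (S j) (fun r => Cbinom j%:C r * RtoC x ^ (j - r) * e r 0%R N)
    + Csum 0 (S j) (fun r => Cbinom j%:C r * RtoC x ^ (j - r) * d r N)).
  - intros N. unfold Wseq. rewrite (Csum0_S N).
    assert (Hy : (1 <= INR (S N))%R) by (apply (le_INR 1); lia).
    assert (Ej : RtoC (xlog j (INR N + 1 + x)) =
      Csum 0 (S j) (fun r => Cbinom j%:C r * RtoC x ^ (j - r) *
        (RtoC (INR (S N) ^ r) * (RtoC (ln (INR (S N))) + RtoC (ln (1 + x / INR (S N))))))).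
    { unfold xlog. replace (INR N + 1 + x)%R with (INR (S N) + x)%R
        by (rewrite S_INR; ring).
      rewrite ln_plus_split, RtoC_mult, RtoC_pow, !RtoC_plus, Cpow_binom by trivial.
      rewrite <- Csum_scal_r. apply Csum_ext. intros r _. rewrite RtoC_pow. ring. }
    unfold e at 1. rewrite Ej.
    rewrite (Csum_ext 0 (S j) (fun r => Cbinom j%:C r * RtoC x ^ (j - r) * e r 0%R N)
      (fun r => Cbinom j%:C r * RtoC x ^ (j - r) * Mfun b r (INR (S N) + 1) -
        Cbinom j%:C r * RtoC x ^ (j - r) * Mfun b r (INR N + 1) -
        Cbinom j%:C r * RtoC x ^ (j - r) *
        (RtoC (INR (S N) ^ r) * RtoC (ln (INR (S N)))))).
    2:{ intros r _. unfold e, xlog. rewrite !Rplus_0_r, <- (S_INR N), RtoC_mult. ring. }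
    rewrite !Csum_minus.
    unfold trunc.
    rewrite (Csum_ext 0 (S j) (fun r => Cbinom j%:C r * RtoC x ^ (j - r) * d r N)
      (fun r => Cbinom j%:C r * RtoC x ^ (j - r) *
        (RtoC (INR (S N) ^ r) * RtoC (ln (1 + x / INR (S N)))) -
        Cbinom j%:C r * RtoC x ^ (j - r) *
        (log_trunc (S (S r)) x (S N)%:C (S r) / (S N)%:C))).
    2:{ intros r _. unfold d. replace (S r - r)%nat with 1%nat by lia.
        replace ((S N)%:C ^ 1) with ((S N)%:C) by (simpl; ring). unfold Cdiv. ring. }
    rewrite Csum_minus.
    rewrite (Csum_ext 0 (S j) (fun r => Cbinom j%:C r * RtoC x ^ (j - r) *
        (RtoC (INR (S N) ^ r) * (RtoC (ln (INR (S N))) + RtoC (ln (1 + x / INR (S N))))))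
      (fun r => Cbinom j%:C r * RtoC x ^ (j - r) *
        (RtoC (INR (S N) ^ r) * RtoC (ln (INR (S N)))) +
        Cbinom j%:C r * RtoC x ^ (j - r) *
        (RtoC (INR (S N) ^ r) * RtoC (ln (1 + x / INR (S N)))))) by (intros; ring).
    rewrite Csum_plus. ring.
  - replace (RtoC 0) with (RtoC 0 - 0 + 0) by ring.
    apply Clim_plus; [apply Clim_minus|].
    + now apply Mfun_step_lim.
    + apply Clim_0_ext_sum. intros r _. apply Mfun_step_lim; trivial. lra.
    + apply Clim_0_ext_sum. intros r _. apply log_error_lim; [trivial|lia].
Qed.

(** At a positive integer [y] the left side is the increment of [Wseq] minus those of the [gdiff]
    and [Verr] terms. All three tend to 0, so the polynomial vanishes; consequently the polynomial
    part of [Wseq] keeps its initial value, at [y = 1]. *)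
Lemma Vpoly_telescope (b : nat -> C) (j : nat) (x : R) :
  bern_rec b -> (0 <= x)%R ->
  forall y, Vpoly b j x (y + 1) - Vpoly b j x y - tpoly j x y = 0.
Proof.
  intros Hb Hx. apply (polyfun_lim0 (j + 1)).
  - apply polyfun_minus; [apply polyfun_minus|apply polyfun_tpoly].
    + apply (polyfun_comp_shift (j + 1) (Vpoly b j x)), polyfun_Vpoly.
    + apply polyfun_Vpoly.
  - apply Clim_incr_1.
    set (c := RtoC x ^ S j / (S j)%:C).
    apply Clim_ext with (u := fun N => (Wseq b j x (S N) - Wseq b j x N) -
      c * RtoC (gdiff (S N) - gdiff N) - (Verr b j x (S N) - Verr b j x N)).
    + intros N. rewrite !Wseq_Vpoly by trivial. rewrite Csum0_S. fold c.
      replace ((S N)%:C + 1) with ((S (S N))%:C)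
        by (unfold Nat2C; now rewrite (S_INR (S N)), RtoC_plus).
      rewrite RtoC_minus. ring.
    + replace (RtoC 0) with (0 - c * 0 - (0 - 0)) by ring.
      apply Clim_minus; [apply Clim_minus|apply Clim_minus].
      * now apply Wseq_step.
      * apply Clim_scal. apply Clim_RtoC.
        replace 0%R with (- euler_gamma - - euler_gamma)%R by ring.
        apply is_lim_seq_minus'; [|apply gdiff_lim].
        apply (is_lim_seq_incr_1 gdiff), gdiff_lim.
      * apply (proj1 (Clim_incr_1 (Verr b j x) 0)). now apply Verr_lim.
      * now apply Verr_lim.
Qed.

Lemma Wseq_lim (b : nat -> C) (j : nat) (x : R) :
  bern_rec b -> (0 <= x)%R ->
  Clim (Wseq b j x)
    (Vpoly b j x 1 - euler_gamma * (RtoC x ^ S j / (S j)%:C)).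
Proof.
  intros Hb Hx.
  set (c := RtoC x ^ S j / (S j)%:C).
  apply Clim_ext with (u := fun N =>
    Vpoly b j x 1 + c * RtoC (gdiff N) + Verr b j x N).
  - intros N. rewrite Wseq_Vpoly by trivial. fold c. do 2 f_equal.
    assert (H := Vpoly_telescope b j x Hb Hx).
    induction N as [|N IH].
    + rewrite Csum_nil by lia. change (1%:C) with (RtoC 1). ring.
    + rewrite Csum0_S, IH. specialize (H (S N)%:C).
      replace ((S N)%:C + 1) with ((S (S N))%:C) in H
        by (unfold Nat2C; now rewrite (S_INR (S N)), RtoC_plus).
      replace (Vpoly b j x (S (S N))%:C) with
        (Vpoly b j x (S (S N))%:C - Vpoly b j x (S N)%:C - tpoly j x (S N)%:C
         + Vpoly b j x (S N)%:C + tpoly j x (S N)%:C) by ring.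
      rewrite H. ring.
  - replace (Vpoly b j x 1 - euler_gamma * c) with
      (Vpoly b j x 1 + c * RtoC (- euler_gamma) + 0)
      by (rewrite RtoC_opp; ring).
    apply Clim_plus; [apply Clim_plus; [apply Clim_const|]|now apply Verr_lim].
    apply Clim_scal, Clim_RtoC, gdiff_lim.
Qed.

(** * The exponents [F_n] and [Phi_n] *)

Lemma Csum_swap_le (n : nat) (f : nat -> nat -> C) :
  Csum 0 n (fun r => Csum 0 (S r) (fun m => f r m)) =
  Csum 0 n (fun m => Csum m n (fun r => f r m)).
Proof.
  induction n as [|n IH]; [reflexivity|].
  rewrite Csum0_S, IH, (Csum0_S n (fun m => Csum m (S n) _)).
  rewrite (Csum_ext 0 n (fun m => Csum m (S n) (fun r => f r m))
    (fun m => Csum m n (fun r => f r m) + f n m)).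
  - rewrite Csum_plus, Csum0_S, (Csum_S n n), (Csum_nil n n) by lia.
    change (fun m => f n m) with (f n). ring.
  - intros m Hm. now rewrite Csum_S by lia.
Qed.

(* Re-expansion of [Cbinom (z - u) (n - 1)] in powers of [u - z]. *)
Lemma Gpoly_transfer (n : nat) (z : C) (L : nat -> C) :
  (1 <= n)%nat ->
  Csum 0 n (fun j => Gpoly n j z *
    Csum 0 (S j) (fun r => Cbinom j%:C r * z ^ (j - r) * L r)) =
  Csum 0 n (fun r => Gpoly n r 0 * L r).
Proof.
  intros Hn.
  set (c := fun r => Csum r n (fun j => Gpoly n j z * (Cbinom j%:C r * z ^ (j - r)))).
  assert (Hc : forall L', Csum 0 n (fun j => Gpoly n j z *
    Csum 0 (S j) (fun r => Cbinom j%:C r * z ^ (j - r) * L' r)) =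
    Csum 0 n (fun r => c r * L' r)).
  { intros L'. rewrite (Csum_ext 0 n _ (fun j => Csum 0 (S j) (fun r =>
      Gpoly n j z * (Cbinom j%:C r * z ^ (j - r)) * L' r))).
    - rewrite Csum_swap_le. apply Csum_ext. intros r Hr.
      unfold c. now rewrite Csum_scal_r.
    - intros j Hj. rewrite <- Csum_scal. apply Csum_ext. intros; ring. }
  rewrite Hc. apply Csum_ext. intros r Hr. f_equal.
  apply (poly_coef_eq n c (fun r => Gpoly n r 0)); [|lia].
  intros u. rewrite <- (Hc (fun r => u ^ r)).
  rewrite Gpoly_spec by trivial.
  rewrite (Csum_ext 0 n _ (fun j => Gpoly n j z * (u + z) ^ j)).
  - rewrite Gpoly_spec by trivial. f_equal. ring.
  - intros j Hj. now rewrite Cpow_binom.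
Qed.

Lemma Gpoly_transfer_coef (n r : nat) (z : C) :
  (1 <= n)%nat -> (r < n)%nat ->
  Gpoly n r 0 = Csum r n (fun j => Gpoly n j z * (Cbinom j%:C r * z ^ (j - r))).
Proof.
  intros Hn Hr.
  assert (H := Gpoly_transfer n z (fun i => if (i =? r)%nat then 1 else 0) Hn).
  rewrite (Csum_chasles 0 r n), (Csum_chasles r (S r) n) in H by lia.
  set (lhs := Csum 0 r _ + _) in H.
  rewrite (Csum_chasles 0 r n), (Csum_chasles r (S r) n) in H by lia.
  rewrite Csum_zero, (Csum_S r r), (Csum_nil r r), (Csum_zero (S r) n), Nat.eqb_refl in H
    by (lia || (intros i Hi; destruct (Nat.eqb_spec i r); [lia|ring])).
  replace (Gpoly n r 0) with (0 + (0 + Gpoly n r 0 * 1 + 0)) by ring.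
  rewrite <- H. unfold lhs. rewrite Csum_zero, Cplus_0_l.
  - rewrite <- (Csum_chasles r (S r) n) by lia. apply Csum_ext. intros j Hj. f_equal.
    rewrite (Csum_chasles 0 r (S j)), (Csum_chasles r (S r) (S j)) by lia.
    rewrite Csum_zero, (Csum_S r r), (Csum_nil r r), (Csum_zero (S r)), Nat.eqb_refl
      by (lia || (intros i Hi; destruct (Nat.eqb_spec i r); [lia|ring])).
    ring.
  - intros j Hj. rewrite Csum_zero; [ring|]. intros i Hi.
    destruct (Nat.eqb_spec i r); [lia|ring].
Qed.

(** It makes the [r = n - 1] term of the zeta sum vanish, so that the sum up to [n - 2] in [F_n] may
    be extended to the full range of [r]. *)
Lemma Gpoly_lead (n : nat) (z : C) :
  (1 <= n)%nat -> Gpoly n (n - 1) 0 = Gpoly n (n - 1) z.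
Proof.
  intros Hn. rewrite (Gpoly_transfer_coef n (n - 1) z) by lia.
  replace n with (S (n - 1)) at 2 by lia. rewrite Csum_S, Csum_nil by lia.
  rewrite Cbinom_nat by lia. rewrite Nat.sub_diag.
  change ((fact 0)%:C) with (RtoC 1). simpl (z ^ 0). field. apply fact_neq0_C.
Qed.

Lemma Gpoly_stirling (n r : nat) :
  (1 <= n)%nat -> (r < n)%nat ->
  Gpoly n r 0 = / (fact (n - 1))%:C * ((- (1)) ^ r * stirling1 (n - 1) r).
Proof.
  intros Hn. revert r. apply poly_coef_eq. intros u.
  rewrite Gpoly_spec by trivial.
  rewrite (Csum_ext 0 n _ (fun j =>
    / (fact (n - 1))%:C * (stirling1 (n - 1) j * (- u) ^ j))).
  - rewrite Csum_scal. assert (H := stirling1_spec (n - 1) (- u)).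
    replace (n - 1 + 1)%nat with n in H by lia.
    rewrite H. unfold Cbinom, Cdiv. rewrite Cmult_comm. f_equal.
    replace (0 - u) with (- u) by ring. reflexivity.
  - intros j _. replace (- u) with (- (1) * u) by ring. rewrite Cpow_mult_l. ring.
Qed.

Lemma CpowZ_pred (x : C) (m : nat) :
  x <> 0 -> CpowZ x (Z.of_nat m - 1) = x ^ m / x.
Proof.
  intros Hx. destruct m as [|[|m]].
  - simpl. rewrite Cmult_1_r. unfold Cdiv. now rewrite Cmult_1_l.
  - simpl. field. exact Hx.
  - replace (Z.of_nat (S (S m)) - 1)%Z with (Z.pos (Pos.of_succ_nat m)) by lia.
    simpl CpowZ. rewrite SuccNat2Pos.id_succ. simpl. field. exact Hx.
Qed.

Lemma Cpow_m1_sq (p : nat) : (- (1)) ^ p * (- (1)) ^ p = 1.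
Proof.
  rewrite <- Cpow_mult_l. replace (- (1) * - (1)) with (RtoC 1) by ring.
  apply Cpow_1_l.
Qed.

(** [Gpoly_transfer] moves the coefficients to [z = 0], where they are signed Stirling numbers over
    [(n-1)!]; reversing the inner sum orders the terms by the power of [k]. *)
Lemma Phifun_trunc (n : nat) (z : C) (k : nat) :
  (1 <= n)%nat -> (1 <= k)%nat ->
  Phifun n z k = Csum 0 n (fun j => Gpoly n j z * trunc j z k%:C).
Proof.
  intros Hn Hk. unfold trunc.
  rewrite (Gpoly_transfer n z (fun r => log_trunc (S (S r)) z k%:C (S r) / k%:C)) by trivial.
  assert (Hk0 : k%:C <> 0) by (apply Nat2C_neq0; lia).
  unfold Phifun. rewrite <- Csum_scal.
  rewrite (Csum_ext 0 n (fun r => Gpoly n r 0 * _) (fun r => Csum 0 (S r) (fun m =>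
    / (fact (n - 1))%:C * (stirling1 (n - 1) r / (r - m + 1)%:C * z ^ (r - m + 1)
      * (- (1)) ^ m * (k%:C ^ m / k%:C))))).
  - rewrite Csum_swap_le. apply Csum_ext. intros m Hm.
    rewrite CpowZ_pred by trivial. rewrite Csum_scal. f_equal.
    rewrite <- !Csum_scal_r. reflexivity.
  - intros r Hr. rewrite Gpoly_stirling by lia. unfold log_trunc.
    rewrite Csum0_S_l. simpl (log1p_coef 0). rewrite Cmult_0_l, Cmult_0_l, Cplus_0_l.
    rewrite Csum_rev. unfold Cdiv at 1. rewrite <- Csum_scal_r, <- Csum_scal.
    apply Csum_ext. intros m Hm.
    replace (S r - S (r - m))%nat with m by lia.
    replace (r - m + 1)%nat with (S (r - m)) by lia.
    simpl log1p_coef.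
    replace ((- (1)) ^ r) with ((- (1)) ^ (r - m) * (- (1)) ^ m)
      by (rewrite <- Cpow_add_r; f_equal; lia).
    assert (Hs := Cpow_m1_sq (r - m)).
    set (s := (- (1)) ^ (r - m)) in *.
    transitivity (s * s * (/ (fact (n - 1))%:C *
      (stirling1 (n - 1) r / (S (r - m))%:C * z ^ (S (r - m))
       * (- (1)) ^ m * (k%:C ^ m / k%:C)))).
    + unfold Cdiv. ring.
    + rewrite Hs. ring.
Qed.

(** * Complex derivatives and integrals of polynomials *)

(** Unlike the total function [C_derive], this carries a power series at [a], so that the rules for
    sums and products become rules for coefficients. *)
Definition has_der (f : C -> C) (a l : C) : Prop :=
  exists r m c, (0 < r)%R /\ psn a r m c f /\ c 1%nat = l.

Lemma has_der_C_derive (f : C -> C) (a l : C) : has_der f a l -> C_derive f a = l.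
Proof.
  intros (r & m & c & Hr & Hc & <-). now apply psn_C_derive with r m.
Qed.

Lemma has_der_const (k a : C) : has_der (fun _ => k) a 0.
Proof.
  destruct (NB_const a 1 k) as [c Hc]. exists 1%R, (Cmod k), c.
  split; [lra|]. split; trivial.
  assert (Hd : psn a 1 (Cmod k) (fun i => match i with O => k | S _ => RtoC 0 end)
    (fun _ => k)).
  { split.
    - intros n. assert (H := Cmod_ge_0 k). destruct n as [|n]; [exact H|].
      induction n as [|n IH]; [simpl; lra|].
      change (Rsum (S n) (fun i =>
        Cmod (match i with O => k | S _ => RtoC 0 end) * 1 ^ i) +
        Cmod (RtoC 0) * 1 ^ S n <= Cmod k)%R.
      rewrite Cmod_0. lra.
    - intros w _. apply Clim_ext_loc with (u := fun _ => k) (N := 1%nat);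
        [|apply Clim_const].
      intros [|n] Hn; [lia|]. rewrite Csum0_S_l, Csum_zero; [simpl; ring|].
      intros; ring. }
  rewrite (psn_unique a 1 _ _ _ _ _ _ ltac:(lra) Hc Hd); [reflexivity|].
  intros eps He. exists (a + RtoC (eps / 2)). repeat split.
  - intros H. assert (H1 : RtoC (eps / 2) = 0) by
      (replace (RtoC (eps / 2)) with (a + RtoC (eps / 2) - a) by ring; rewrite H; ring).
    apply RtoC_inj in H1. lra.
  - replace (a + RtoC (eps / 2) - a) with (RtoC (eps / 2)) by ring.
    rewrite Cmod_R, Rabs_pos_eq; lra.
Qed.

Lemma has_der_ext (f g : C -> C) (a l : C) :
  agree_near f g a -> has_der f a l -> has_der g a l.
Proof.
  intros (e & He & H) (r & m & c & Hr & Hc & Hl).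
  exists (Rmin r (e / 2)), m, c.
  assert (H1 : (0 < Rmin r (e / 2))%R) by (apply Rmin_pos; lra).
  split; trivial. split; trivial. apply psn_ext with f.
  - intros w Hw. apply H. eapply Rle_lt_trans; [exact Hw|].
    eapply Rle_lt_trans; [apply Rmin_r|]. lra.
  - apply psn_restrict with r; trivial. split; [lra|apply Rmin_l].
Qed.

Lemma has_der_ext_all (f g : C -> C) (a l : C) :
  (forall w, f w = g w) -> has_der f a l -> has_der g a l.
Proof.
  intros H. apply has_der_ext. exists 1%R. split; [lra|]. intros; apply H.
Qed.

Lemma has_der_plus (f g : C -> C) (a l k : C) :
  has_der f a l -> has_der g a k -> has_der (fun w => f w + g w) a (l + k).
Proof.
  intros (r & m & c & Hr & Hc & <-) (r' & m' & c' & Hr' & Hc' & <-).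
  exists (Rmin r r'), (m + m')%R, (fun i => c i + c' i).
  assert (H1 : (0 < Rmin r r')%R) by now apply Rmin_pos.
  split; trivial. split; [|reflexivity]. apply psn_plus; [| |lra].
  - apply psn_restrict with r; trivial. split; [lra|apply Rmin_l].
  - apply psn_restrict with r'; trivial. split; [lra|apply Rmin_r].
Qed.

Lemma has_der_mult (f g : C -> C) (a l k : C) :
  has_der f a l -> has_der g a k ->
  has_der (fun w => f w * g w) a (f a * k + l * g a).
Proof.
  intros (r & m & c & Hr & Hc & <-) (r' & m' & c' & Hr' & Hc' & <-).
  exists (Rmin r r'), (m * m')%R,
    (fun i => Csum 0 (S i) (fun k => c k * c' (i - k)%nat)).
  assert (H1 : (0 < Rmin r r')%R) by now apply Rmin_pos.
  split; trivial. split.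
  - apply psn_mult; trivial.
    + apply psn_restrict with r; trivial. split; [lra|apply Rmin_l].
    + apply psn_restrict with r'; trivial. split; [lra|apply Rmin_r].
  - rewrite (psn_at a r m c f Hr Hc), (psn_at a r' m' c' g Hr' Hc').
    rewrite !Csum0_S, (Csum_nil 0 0) by lia. simpl. ring.
Qed.

Lemma has_der_scal (k : C) (f : C -> C) (a l : C) :
  has_der f a l -> has_der (fun w => k * f w) a (k * l).
Proof.
  intros H. replace (k * l) with (k * l + 0 * f a) by ring.
  apply (has_der_mult (fun _ => k) f); trivial. apply has_der_const.
Qed.

Lemma has_der_id (a p : C) : has_der (fun w => w - p) a 1.
Proof.
  destruct (NB_id a 1 p ltac:(lra)) as [c Hc].
  exists 1%R, (Cmod (a - p) + 1)%R, c. split; [lra|]. split; trivial.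
  rewrite <- (psn_C_derive a 1 _ c _ ltac:(lra) Hc).
  apply C_derive_lim with (K := 0%R) (r := 1%R); [lra|].
  intros w Hw _. replace ((w - p - (a - p)) / (w - a) - 1) with (RtoC 0).
  - rewrite Cmod_0. lra.
  - field. intros H. apply Hw. replace w with (w - a + a) by ring. rewrite H. ring.
Qed.

Lemma has_der_pow (a p : C) (k : nat) :
  has_der (fun w => (w - p) ^ S k) a ((S k)%:C * (a - p) ^ k).
Proof.
  induction k as [|k IH].
  - apply has_der_ext_all with (fun w => w - p); [intros; simpl; ring|].
    replace ((1)%:C * (a - p) ^ 0) with (RtoC 1); [apply has_der_id|].
    unfold Nat2C. simpl. ring.
  - apply has_der_ext_all with (fun w => (w - p) * (w - p) ^ S k); [reflexivity|].
    replace ((S (S k))%:C * (a - p) ^ S k) with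
      ((a - p) * ((S k)%:C * (a - p) ^ k) + 1 * (a - p) ^ S k).
    + apply (has_der_mult (fun w => w - p) (fun w => (w - p) ^ S k)); trivial.
      apply has_der_id.
    + unfold Nat2C. rewrite (S_INR (S k)), RtoC_plus. simpl. ring.
Qed.

Lemma has_der_poly (p a : C) (N : nat) (g : nat -> C) :
  has_der (fun u => Csum 0 (S N) (fun j => g j * (u - p) ^ j)) a
    (Csum 0 N (fun j => (S j)%:C * g (S j) * (a - p) ^ j)).
Proof.
  induction N as [|N IH].
  - apply has_der_ext_all with (fun _ => g 0%nat); [|apply has_der_const].
    intros w. rewrite Csum0_S. simpl. ring.
  - apply has_der_ext_all with (fun u =>
      Csum 0 (S N) (fun j => g j * (u - p) ^ j) + g (S N) * (u - p) ^ S N).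
    { intros w. now rewrite (Csum0_S (S N)). }
    rewrite Csum0_S. apply has_der_plus; trivial.
    replace ((S N)%:C * g (S N) * (a - p) ^ N) with
      (g (S N) * ((S N)%:C * (a - p) ^ N)) by ring.
    apply has_der_scal, has_der_pow.
Qed.

Lemma iter_C_derive_poly (p : C) (r : nat) : forall N g, (r < N)%nat ->
  Nat.iter r C_derive (fun u => Csum 0 N (fun j => g j * (u - p) ^ j)) p
  = (fact r)%:C * g r.
Proof.
  induction r as [|r IH]; intros N g Hr.
  - simpl. destruct N as [|N]; [lia|]. rewrite Csum0_S_l, Csum_zero.
    + unfold Nat2C. simpl. ring.
    + intros i _. replace (p - p) with (RtoC 0) by ring. simpl. ring.
  - rewrite Nat.iter_succ_r. destruct N as [|N]; [lia|].
    replace (C_derive (fun u => Csum 0 (S N) (fun j => g j * (u - p) ^ j)))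
      with (fun u => Csum 0 N (fun j => ((S j)%:C * g (S j)) * (u - p) ^ j)).
    + rewrite (IH N (fun j => (S j)%:C * g (S j))) by lia. rewrite fact_S_C. ring.
    + apply functional_extensionality. intros u. symmetry.
      apply has_der_C_derive, has_der_poly.
Qed.

Lemma Nat_iter_ext (r : nat) (f g : C -> C) (a : C) :
  (forall u, f u = g u) -> Nat.iter r C_derive f a = Nat.iter r C_derive g a.
Proof. intros H. now rewrite (functional_extensionality f g H). Qed.

Lemma is_RInt_monomial (c : C) (j : nat) :
  @is_RInt C_R_CompleteNormedModule (fun t : R => RtoC (t ^ j) * c) 0 1
    (c / (S j)%:C).
Proof.
  set (k := fun t : R => (t ^ S j / INR (S j))%R).
  assert (HS : INR (S j) <> 0%R) by now apply not_0_INR.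
  assert (Hk : forall t, is_derive k t (t ^ j)%R).
  { intros t. unfold k. auto_derive; trivial.
    change (Init.Nat.pred (S j)) with j. simpl Init.Nat.pred. field. exact HS. }
  assert (E : forall (x : R) (v : C), scal x (v : C_R_NormedModule) = RtoC x * v).
  { intros x [a b]. apply injective_projections; simpl; unfold scal; simpl;
      unfold mult; simpl; ring. }
  replace (c / (S j)%:C) with (minus (scal (k 1%R) (c : C_R_NormedModule))
    (scal (k 0%R) (c : C_R_NormedModule))).
  - apply is_RInt_ext with (fun t : R => scal (t ^ j)%R (c : C_R_NormedModule)).
    { intros t _. apply E. }
    apply (is_RInt_derive (V := C_R_CompleteNormedModule)
      (fun t : R => scal (k t) (c : C_R_NormedModule))).
    + intros t _. apply (is_derive_scal_l (V := C_R_NormedModule) k t (t ^ j)%R c), Hk.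
    + intros t _. apply (continuous_scal_l (V := C_R_NormedModule)
        (fun t : R => (t ^ j)%R) c).
      apply continuity_pt_filterlim. apply derivable_continuous_pt.
      apply derivable_pt_pow.
  - rewrite !E. unfold k. rewrite pow1, pow_i by lia.
    change (RtoC (1 / INR (S j)) * c - RtoC (0 / INR (S j)) * c = c / (S j)%:C).
    rewrite <- !Cdiv_RtoC. unfold Nat2C, Cdiv. ring.
Qed.

Lemma RInt_poly (n : nat) (g : nat -> C) (z : C) :
  @RInt C_R_CompleteNormedModule
    (fun t : R => z * Csum 0 n (fun j => g j * (t * z) ^ j)) 0 1 =
  Csum 0 n (fun j => g j * (z ^ S j / (S j)%:C)).
Proof.
  apply is_RInt_unique.
  induction n as [|n IH].
  - apply is_RInt_ext with (fun _ : R => RtoC 0 : C_R_CompleteNormedModule).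
    { intros t _. rewrite Csum_nil by lia. symmetry. apply Cmult_0_r. }
    replace (Csum 0 0 (fun j => g j * (z ^ S j / (S j)%:C))) with
      (scal (1 - 0)%R (RtoC 0 : C_R_CompleteNormedModule)).
    + apply (is_RInt_const (V := C_R_CompleteNormedModule)).
    + rewrite Csum_nil by lia. apply (scal_zero_r (V := C_R_NormedModule)).
  - apply is_RInt_ext with (fun t : R =>
      plus (z * Csum 0 n (fun j => g j * (t * z) ^ j) : C_R_CompleteNormedModule)
        (RtoC (t ^ n) * (g n * z ^ S n))).
    { intros t _. rewrite Csum0_S, RtoC_pow.
      change (z * Csum 0 n (fun j => g j * (t * z) ^ j) + RtoC t ^ n * (g n * z ^ S n)
        = z * (Csum 0 n (fun j => g j * (t * z) ^ j) + g n * (t * z) ^ n)).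
      rewrite Cpow_mult_l. simpl. ring. }
    rewrite Csum0_S. apply (is_RInt_plus (V := C_R_CompleteNormedModule)); trivial.
    replace (g n * (z ^ S n / (S n)%:C)) with (g n * z ^ S n / (S n)%:C)
      by (unfold Cdiv; ring).
    apply is_RInt_monomial.
Qed.

(** Expanding [Cbinom (z - u) (n - 1)] about [u = z] and about [u = 0] identifies the bracketed
    derivatives as [Gpoly n r 0] and [Gpoly n r z]; the integral is taken monomial by monomial. *)
Lemma Ffun_eq (B : nat -> C -> C) (zeta : C -> C) (n : nat) (z : C) :
  is_bernoulli_poly B -> (1 <= n)%nat ->
  Ffun B zeta n z =
  Csum 0 n (fun j => Gpoly n j z *
    (Vpoly (bnum B) j z 1 - euler_gamma * (z ^ S j / (S j)%:C))) +
  Csum 0 n (fun r => (Gpoly n r 0 - Gpoly n r z) * C_derive zeta (- r%:C)).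
Proof.
  intros hB Hn. unfold Ffun.
  assert (Hb0 : forall u, Cbinom (z - u) (n - 1) =
    Csum 0 n (fun j => Gpoly n j z * (u - 0) ^ j)).
  { intros u. replace (u - 0) with u by ring. now rewrite Gpoly_spec. }
  assert (Hbz : forall u, Cbinom (z - u) (n - 1) =
    Csum 0 n (fun j => Gpoly n j 0 * (u - z) ^ j)).
  { intros u. rewrite Gpoly_spec by trivial. f_equal. ring. }
  rewrite (Csum_ext 0 (n - 1) _ (fun r =>
    (Gpoly n r 0 - Gpoly n r z) * C_derive zeta (- r%:C))).
  2:{ intros r Hr. f_equal.
      rewrite (Nat_iter_ext r _ _ z Hbz), (Nat_iter_ext r _ _ 0 Hb0).
      rewrite !iter_C_derive_poly by lia. field. apply fact_neq0_C. }
  assert (E3 : Csum 0 n (fun r => (Gpoly n r 0 - Gpoly n r z) * C_derive zeta (- r%:C))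
    = Csum 0 (n - 1) (fun r => (Gpoly n r 0 - Gpoly n r z) * C_derive zeta (- r%:C))).
  { rewrite (Csum_chasles 0 (n - 1) n) by lia. rewrite (Csum_zero (n - 1) n); [ring|].
    intros r Hr. replace r with (n - 1)%nat by lia.
    rewrite (Gpoly_lead n z) by trivial. ring. }
  rewrite E3.
  rewrite (RInt_ext (V := C_R_CompleteNormedModule) _
    (fun t : R => z * Csum 0 n (fun j => Gpoly n j z * (t * z) ^ j))).
  2:{ intros t _. now rewrite Gpoly_spec. }
  rewrite RInt_poly.
  rewrite (Csum_ext 0 n (fun j => Gpoly n j z * (Vpoly _ j z 1 - _)) (fun j =>
    Gpoly n j z * Qpoly B j z -
    euler_gamma * (Gpoly n j z * (z ^ S j / (S j)%:C)))).
  2:{ intros j _. rewrite Qpoly_Vpoly by trivial. ring. }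
  rewrite Csum_minus, Csum_scal. ring.
Qed.

(* Partial sums of the divergent series defining [zeta'(-r)], regularised. *)
Definition zeta_seq (b : nat -> C) (r N : nat) : C :=
  Mfun b r (INR N + 1) - RtoC (Rsum N (fun k => xlog r (INR k + 1))).

(** The identity is exact for every [N]. Summed against [G_{n,j}(x)], the powers [(k + x)^j] give
    [binom(-k, n-1)] as the factor of [ln (1 + x / k)], while [Gpoly_transfer] turns the
    coefficients of the zeta sequences into [Gpoly n r 0]. *)
Lemma ell_formula (B : nat -> C -> C) (zeta : C -> C) (n : nat) (x : R) :
  is_bernoulli_poly B -> (1 <= n)%nat -> (0 <= x)%R ->
  (forall r, (r < n)%nat ->
     Clim (zeta_seq (bnum B) r) (C_derive zeta (- r%:C))) ->
  Clim (fun N => Csum 0 N (fun k => Phifun n x (S k) -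
      Cbinom (- (S k)%:C) (n - 1) * RtoC (ln (1 + x / INR (S k)))))
    (ell (bnum B) n x - Ffun B zeta n x).
Proof.
  intros hB Hn Hx HZ. set (b := bnum B) in *.
  assert (Hb : bern_rec b) by now apply bnum_rec.
  apply Clim_ext with (u := fun N =>
    Csum 0 n (fun j => Gpoly n j x * dseq b j x N) -
    (Csum 0 n (fun j => Gpoly n j x * Wseq b j x N) +
     Csum 0 n (fun r => (Gpoly n r 0 - Gpoly n r x) * zeta_seq b r N))).
  - intros N.
    assert (Ed : forall j, dseq b j x N = Wseq b j x N +
      Csum 0 (S j) (fun r => Cbinom j%:C r * RtoC x ^ (j - r) * zeta_seq b r N) -
      zeta_seq b j N +
      Csum 0 N (fun k => trunc j x (S k)%:C -
        ((S k)%:C + x) ^ j * RtoC (ln (1 + x / INR (S k))))).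
    { intros j. unfold dseq, Wseq, zeta_seq.
      rewrite (Csum_ext 0 (S j) (fun r => Cbinom j%:C r * RtoC x ^ (j - r) *
          (Mfun b r (INR N + 1) - _))
        (fun r => Cbinom j%:C r * RtoC x ^ (j - r) * Mfun b r (INR N + 1) -
          Csum 0 N (fun k => Cbinom j%:C r * RtoC x ^ (j - r) *
            RtoC (xlog r (INR k + 1))))).
      2:{ intros r _. rewrite Csum_scal, Csum_RtoC. ring. }
      rewrite !Csum_minus, Csum_swap.
      rewrite (Csum_ext 0 N (fun k => Csum 0 (S j) (fun r => Cbinom j%:C r *
        RtoC x ^ (j - r) * RtoC (xlog r (INR k + 1)))) (fun k =>
        RtoC (xlog j (INR k + 1 + x)) -
        ((S k)%:C + x) ^ j * RtoC (ln (1 + x / INR (S k))))).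
      2:{ intros k _. unfold xlog at 2.
          assert (Hy : (1 <= INR (S k))%R) by (apply (le_INR 1); lia).
          rewrite <- S_INR, ln_plus_split, RtoC_mult, RtoC_pow, !RtoC_plus by trivial.
          fold (Nat2C (S k)).
          replace (((S k)%:C + x) ^ j * (RtoC (ln (INR (S k))) +
            RtoC (ln (1 + x / INR (S k)))) -
            ((S k)%:C + x) ^ j * RtoC (ln (1 + x / INR (S k)))) with
            (((S k)%:C + x) ^ j * RtoC (ln (INR (S k)))) by ring.
          rewrite Cpow_binom, <- Csum_scal_r. apply Csum_ext. intros r _.
          unfold xlog. rewrite RtoC_mult, RtoC_pow. unfold Nat2C. ring. }
      rewrite Csum_minus, Csum_RtoC.
      assert (Er : Rsum N (fun k => xlog j (INR k + 1 + x) - xlog j (INR k + 1))%R =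
        (Rsum N (fun k => xlog j (INR k + 1 + x)) -
         Rsum N (fun k => xlog j (INR k + 1)))%R).
      { clear. induction N as [|N IH]; simpl; [ring|]. rewrite IH. ring. }
      rewrite Er, RtoC_minus. ring. }
    rewrite (Csum_ext 0 n (fun j => Gpoly n j x * dseq b j x N) (fun j =>
      Gpoly n j x * Wseq b j x N +
      Gpoly n j x * Csum 0 (S j) (fun r =>
        Cbinom j%:C r * RtoC x ^ (j - r) * zeta_seq b r N) -
      Gpoly n j x * zeta_seq b j N +
      Csum 0 N (fun k => Gpoly n j x * trunc j x (S k)%:C -
        RtoC (ln (1 + x / INR (S k))) * (Gpoly n j x * ((S k)%:C + x) ^ j)))).
    2:{ intros j _. rewrite Ed.
        rewrite (Csum_ext 0 N (fun k => Gpoly n j x * trunc j x (S k)%:C - _)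
          (fun k => Gpoly n j x * (trunc j x (S k)%:C -
            ((S k)%:C + x) ^ j * RtoC (ln (1 + x / INR (S k))))))
          by (intros; ring).
        rewrite Csum_scal. ring. }
    rewrite Csum_plus, Csum_minus, Csum_plus, Gpoly_transfer, Csum_swap by trivial.
    rewrite (Csum_ext 0 n (fun r => (Gpoly n r 0 - Gpoly n r x) * zeta_seq b r N)
      (fun r => Gpoly n r 0 * zeta_seq b r N - Gpoly n r x * zeta_seq b r N))
      by (intros; ring).
    rewrite Csum_minus.
    rewrite (Csum_ext 0 N (fun k => Phifun n x (S k) - _) (fun k => Csum 0 n (fun j =>
      Gpoly n j x * trunc j x (S k)%:C -
        RtoC (ln (1 + x / INR (S k))) * (Gpoly n j x * ((S k)%:C + x) ^ j)))).
    2:{ intros k _. rewrite Csum_minus, Csum_scal, Gpoly_spec by trivial.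
        rewrite Phifun_trunc by lia.
        replace (RtoC x - ((S k)%:C + x)) with (- (S k)%:C) by ring. ring. }
    ring.
  - rewrite Ffun_eq by trivial. fold b. apply Clim_minus; [|apply Clim_plus].
    + apply (Clim_Csum n (fun N j => Gpoly n j x * dseq b j x N)). intros j _.
      apply Clim_scal. now apply Dfun_lim.
    + apply (Clim_Csum n (fun N j => Gpoly n j x * Wseq b j x N)). intros j _.
      apply Clim_scal. now apply Wseq_lim.
    + apply (Clim_Csum n (fun N r => (Gpoly n r 0 - Gpoly n r x) * zeta_seq b r N)).
      intros r Hr. apply Clim_scal. auto.
Qed.

(** * Binomial series with complex exponent *)

Lemma Cprod_S (n : nat) (f : nat -> C) : Cprod (S n) f = Cprod n f * f n.
Proof. reflexivity. Qed.

Lemma Cbinom_S (v : C) (i : nat) :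
  Cbinom v (S i) = Cbinom v i * ((v - i%:C) / (S i)%:C).
Proof.
  unfold Cbinom. rewrite Cprod_S, fact_S_C. field.
  split; [now apply Nat2C_neq0|apply fact_neq0_C].
Qed.

(** Each new factor [(v - i) / (i + 1)] has norm at most [(p + i) / (i + 1)], which is at most [p]
    because [p >= 1]. *)
Lemma NB_Cbinom (a : C) (r p : R) (v : C -> C) (i : nat) :
  (0 < r)%R -> (1 <= p)%R -> NB a r p v ->
  NB a r (p ^ i) (fun s => Cbinom (v s) i).
Proof.
  intros Hr Hp Hv. induction i as [|i IH].
  - apply NB_ext with (fun _ => 1).
    + intros. unfold Cbinom. simpl. unfold Nat2C. simpl. field.
    + apply NB_le with (Cmod 1); [rewrite Cmod_1; simpl; lra|apply NB_const].
  - apply NB_ext with (fun s => Cbinom (v s) i * (/ (S i)%:C * (v s + - i%:C))).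
    { intros s _. rewrite Cbinom_S. unfold Cdiv. ring. }
    assert (Hn := pos_INR i).
    apply NB_le with (p ^ i * (Cmod (/ (S i)%:C) * (p + Cmod (- i%:C))))%R.
    + rewrite Cmod_inv, Cmod_opp, !Cmod_Nat2C, S_INR by now apply Nat2C_neq0.
      simpl pow. rewrite (Rmult_comm p).
      apply Rmult_le_compat_l; [apply pow_le; lra|].
      apply (Rmult_le_reg_l (INR i + 1)); [lra|].
      rewrite <- Rmult_assoc, Rinv_r by lra. nra.
    + apply NB_mult; trivial. apply NB_scal. apply NB_plus; [lra|trivial|].
      apply NB_const.
Qed.

(** The range [0 < v < 1] makes the Taylor remainder easy: [|v - i| <= i + 1], so the falling
    factorial is absorbed by the factorial, and the exponent of [1 + s] is negative. It suffices as
    a starting set for continuation in [v]. *)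
Lemma binomial_real (v u : R) :
  (0 < v < 1)%R -> (0 < u <= / 2)%R ->
  Clim (fun n => Csum 0 n (fun i => Cbinom v i * RtoC u ^ i))
    (RtoC (exp (v * ln (1 + u)))).
Proof.
  intros Hv Hu.
  set (fall := fix fall n := match n with O => 1%R | S m => (fall m * (v - INR m))%R end).
  assert (Hfall : forall n, (Rabs (fall n) <= INR (fact n))%R).
  { induction n as [|n IH]; [simpl; rewrite Rabs_R1; lra|].
    simpl fall. rewrite Rabs_mult, fact_simpl, mult_INR, Rmult_comm.
    assert (Hn := pos_INR n).
    apply Rmult_le_compat; trivial; try apply Rabs_pos.
    rewrite S_INR. apply Rabs_le. lra. }
  assert (Hc : forall n, Cbinom v n = RtoC (fall n / INR (fact n))).
  { intros n. rewrite <- Cdiv_RtoC. unfold Cbinom. unfold Nat2C at 2. f_equal.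
    induction n as [|n IH]; [reflexivity|]. rewrite Cprod_S, IH.
    simpl fall. rewrite RtoC_mult, RtoC_minus. reflexivity. }
  apply Clim_incr_1.
  apply Clim_squeeze with (N := 0%nat) (v := fun n => (2 * u ^ S n)%R).
  2:{ replace 0%R with (2 * 0)%R by ring.
      apply is_lim_seq_mult'; [apply is_lim_seq_const|].
      apply (is_lim_seq_incr_1 (fun n => (u ^ n)%R)). apply is_lim_seq_geom.
      rewrite Rabs_pos_eq; lra. }
  intros n _.
  destruct (taylor_family (fun i t => fall i * exp ((v - INR i) * ln (1 + t)))%R
    (-1) 1 0 u n) as (s & Hs & E); try lra.
  { intros i t _ Ht. simpl fall.
    assert (H1 : is_derive (fun t => ln (1 + t)) t (1 / (1 + t))%R).
    { apply (is_derive_ln_comp (fun t => 1 + t)%R); [auto_derive; trivial; ring|lra]. }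
    assert (H2 : is_derive (fun t => exp ((v - INR i) * ln (1 + t)))%R t
      ((v - INR i) * (1 / (1 + t)) * exp ((v - INR i) * ln (1 + t)))%R).
    { apply (is_derive_comp exp (fun t => (v - INR i) * ln (1 + t))%R).
      - apply is_derive_exp.
      - apply (is_derive_scal (fun t => ln (1 + t))). exact H1. }
    replace (fall i * (v - INR i) * exp ((v - INR (S i)) * ln (1 + t)))%R with
      (fall i * ((v - INR i) * (1 / (1 + t)) * exp ((v - INR i) * ln (1 + t))))%R.
    - apply (is_derive_scal (fun t => exp ((v - INR i) * ln (1 + t)))%R). exact H2.
    - rewrite S_INR. replace ((v - (INR i + 1)) * ln (1 + t))%R with
        ((v - INR i) * ln (1 + t) + - ln (1 + t))%R by ring.
      rewrite exp_plus, exp_Ropp, exp_ln by lra. field. lra. }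
  simpl fall in E at 1. replace (u - 0)%R with u in E by ring.
  rewrite Rmult_1_l in E.
  replace ((v - INR 0) * ln (1 + u))%R with (v * ln (1 + u))%R in E by (simpl; ring).
  rewrite E.
  assert (E2 : Csum 0 (S n) (fun i => Cbinom v i * RtoC u ^ i) =
    RtoC (Rsum (S n) (fun i => u ^ i / INR (fact i) *
      (fall i * exp ((v - INR i) * ln (1 + 0))))%R)).
  { rewrite <- Csum_RtoC. apply Csum_ext. intros i _.
    rewrite Hc, <- RtoC_pow, <- RtoC_mult. f_equal.
    rewrite Rplus_0_r, ln_1, Rmult_0_r, exp_0. unfold Rdiv. ring. }
  rewrite E2, <- RtoC_minus, Cmod_R.
  match goal with |- (Rabs (?A - (?A + ?B)) <= _)%R =>
    replace (A - (A + B))%R with (- B)%R by ring end.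
  rewrite Rabs_Ropp, !Rabs_mult.
  assert (Hf : (0 < INR (fact (S n)))%R) by apply INR_fact_lt_0.
  rewrite (Rabs_pos_eq (u ^ S n / INR (fact (S n)))).
  2:{ apply Rmult_le_pos; [apply pow_le; lra|]. apply Rlt_le, Rinv_0_lt_compat, Hf. }
  rewrite (Rabs_pos_eq (exp _)) by apply Rlt_le, exp_pos.
  assert (Hu0 : (0 <= u ^ S n)%R) by (apply pow_le; lra).
  assert (He : (exp ((v - INR (S n)) * ln (1 + s)) <= 2)%R).
  { assert (Hl : (0 <= ln (1 + s))%R).
    { rewrite <- ln_1. apply Rlt_le, ln_increasing; lra. }
    assert (Hn : (1 <= INR (S n))%R) by (apply (le_INR 1); lia).
    apply Rle_trans with (exp 0); [|rewrite exp_0; lra].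
    apply Rnot_lt_le. intros Hlt. apply exp_lt_inv in Hlt. nra. }
  apply Rle_trans with (u ^ S n / INR (fact (S n)) * (INR (fact (S n)) * 2))%R.
  - apply Rmult_le_compat_l.
    + apply Rmult_le_pos; trivial. apply Rlt_le, Rinv_0_lt_compat, Hf.
    + apply Rmult_le_compat; trivial; [apply Rabs_pos|apply Rlt_le, exp_pos].
  - right. field. lra.
Qed.

Lemma Rsum_half_pow (x : R) (q n : nat) :
  (0 <= x <= / 2)%R -> (Rsum n (fun k => x ^ (q + k)) <= 2 * x ^ q)%R.
Proof.
  intros Hx.
  rewrite (Rsum_ext n _ (fun k => x ^ q * x ^ k)%R) by (intros; apply pow_add).
  rewrite Rsum_scal, Rmult_comm. apply Rmult_le_compat_r; [apply pow_le; lra|].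
  eapply Rle_trans; [apply Rsum_geom_le; lra|].
  rewrite <- (Rinv_inv 2). apply Rinv_le_contravar; lra.
Qed.

Lemma NB_binom_term (a : C) (r p u : R) (v : C -> C) (i : nat) :
  (0 < r)%R -> (1 <= p)%R -> (0 <= u)%R -> NB a r p v ->
  NB a r ((p * u) ^ i) (fun s => Cbinom (v s) i * RtoC u ^ i).
Proof.
  intros Hr Hp Hu Hv.
  apply NB_ext with (fun s => RtoC u ^ i * Cbinom (v s) i); [intros; ring|].
  apply NB_le with (Cmod (RtoC u ^ i) * p ^ i)%R.
  - rewrite Cmod_pow, Cmod_R, Rabs_pos_eq, Rpow_mult_distr by trivial. lra.
  - apply NB_scal. now apply NB_Cbinom.
Qed.

(** For fixed [u] both sides are analytic in the exponent [v]; they agree at small positive [v],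
    which accumulate at 0. *)
Lemma binomial_series (v : C) (p u : R) :
  (Cmod v <= p)%R -> (1 <= p)%R -> (0 < u)%R -> (p * u <= / 2)%R ->
  Clim (fun n => Csum 0 n (fun i => Cbinom v i * RtoC u ^ i))
    (Cexp (v * RtoC (ln (1 + u)))).
Proof.
  intros Hv Hp Hu Hpu.
  assert (Hu2 : (u <= / 2)%R) by nra.
  assert (Hid : NB 0 p p (fun v => v)).
  { apply NB_ext with (fun w => w - 0); [intros; ring|].
    apply NB_le with (Cmod (0 - 0) + p)%R; [|apply NB_id; lra].
    replace (0 - 0) with (RtoC 0) by ring. rewrite Cmod_0. lra. }
  set (F := fun v => CLim (fun n => Csum 0 n (fun i => Cbinom v i * RtoC u ^ i))).
  assert (Hpu0 : (0 <= p * u)%R) by nra.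
  assert (HF : forall w, (Cmod (w - 0) <= p)%R ->
    Clim (fun n => Csum 0 n (fun i => Cbinom w i * RtoC u ^ i)) (F w)).
  { intros w Hw.
    destruct (Csum_abs_conv (fun i => Cbinom w i * RtoC u ^ i)
      (fun i => (p * u) ^ i)%R 2) as [l Hl].
    - intros i. apply (NB_bound 0 p _ (fun w => Cbinom w i * RtoC u ^ i)); trivial.
      + lra.
      + apply NB_binom_term; trivial; lra.
    - intros n. eapply Rle_trans; [apply (Rsum_half_pow (p * u) 0 n)|]; simpl; lra.
    - unfold F. now rewrite (CLim_unique _ _ Hl). }
  replace (Cexp (v * RtoC (ln (1 + u)))) with (F v).
  { apply HF. now replace (v - 0) with v by ring. }
  apply (NB_agree 0 p 2 (exp (p * Cmod (RtoC (ln (1 + u)))))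
    F (fun v => Cexp (v * RtoC (ln (1 + u))))); try lra.
  - apply NB_series with (m := fun i => ((p * u) ^ i)%R)
      (f := fun i v => Cbinom v i * RtoC u ^ i); trivial.
    + lra.
    + intros i. apply NB_binom_term; trivial; lra.
    + intros n. eapply Rle_trans; [apply (Rsum_half_pow (p * u) 0 n)|]; simpl; lra.
  - apply NB_exp; [lra|]. apply NB_mult; trivial; [lra|apply NB_const].
  - intros eps He. set (x := Rmin (eps / 2) (/ 2)).
    assert (H1 := Rmin_l (eps / 2) (/ 2)). assert (H2 := Rmin_r (eps / 2) (/ 2)).
    assert (H3 : (0 < x)%R) by (apply Rmin_pos; lra). fold x in H1, H2.
    exists (RtoC x). split; [intros H; apply RtoC_inj in H; lra|].
    replace (RtoC x - 0) with (RtoC x) by ring. rewrite Cmod_R, Rabs_pos_eq by lra.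
    split; [lra|]. apply CLim_unique. rewrite <- RtoC_mult, Cexp_RtoC.
    apply binomial_real; lra.
  - now replace (v - 0) with v by ring.
Qed.

Lemma NB_binom_rem (a : C) (r p u : R) (v : C -> C) (q : nat) :
  (0 < r)%R -> (1 <= p)%R -> (0 < u)%R -> (p * u <= / 2)%R -> NB a r p v ->
  NB a r (2 * (p * u) ^ q) (fun s => Cexp (v s * RtoC (ln (1 + u))) -
    Csum 0 q (fun i => Cbinom (v s) i * RtoC u ^ i)).
Proof.
  intros Hr Hp Hu Hpu Hv. assert (Hpu0 : (0 <= p * u)%R) by nra.
  apply NB_series with (m := fun k => ((p * u) ^ (q + k))%R)
    (f := fun k s => Cbinom (v s) (q + k) * RtoC u ^ (q + k)); trivial.
  - intros k. apply NB_binom_term; trivial; lra.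
  - intros n. apply Rsum_half_pow; lra.
  - intros w Hw.
    assert (H := binomial_series (v w) p u (NB_bound a r p v w Hr Hv Hw) Hp Hu Hpu).
    apply (Clim_incr_n _ _ q) in H.
    apply Clim_ext with (u := fun n =>
      Csum 0 (n + q) (fun i => Cbinom (v w) i * RtoC u ^ i) -
      Csum 0 q (fun i => Cbinom (v w) i * RtoC u ^ i)).
    + intros n. rewrite (Csum_chasles 0 q (n + q)) by lia.
      rewrite (Nat.add_comm n q), Csum_shift. ring.
    + apply Clim_minus; [exact H|apply Clim_const].
Qed.

(** A telescoping form of the integral test: [(y+1)^(-1-e)] is at most [(y^(-e) - (y+1)^(-e)) / e],
    from [ln (y+1) - ln y >= 1 / (y+1)] and the convexity of [exp]. *)
Lemma Rsum_p_series (e : R) (n : nat) :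
  (0 < e)%R -> (Rsum n (fun k => exp (- (1 + e) * ln (INR (S k)))) <= 1 + / e)%R.
Proof.
  intros He.
  assert (Hie : (0 < / e)%R) by now apply Rinv_0_lt_compat.
  assert (H : (Rsum (S n) (fun k => exp (- (1 + e) * ln (INR (S k)))) <=
    1 + / e - / e * exp (- e * ln (INR (S n))))%R).
  { induction n as [|n IH].
    - cbn [Rsum]. change (INR 1) with 1%R. rewrite ln_1, !Rmult_0_r, exp_0. lra.
    - change (Rsum (S (S n)) (fun k => exp (- (1 + e) * ln (INR (S k))))) with
        (Rsum (S n) (fun k => exp (- (1 + e) * ln (INR (S k)))) +
         exp (- (1 + e) * ln (INR (S (S n)))))%R.
      assert (Hy : (1 <= INR (S n))%R) by (apply (le_INR 1); lia).
      rewrite (S_INR (S n)). set (y := INR (S n)) in *.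
      assert (Hk : (exp (- (1 + e) * ln (y + 1)) <=
        / e * (exp (- e * ln y) - exp (- e * ln (y + 1))))%R); [|lra].
      replace (- (1 + e) * ln (y + 1))%R with
        (- e * ln (y + 1) + - ln (y + 1))%R by ring.
      replace (- e * ln y)%R with (- e * ln (y + 1) + e * (ln (y + 1) - ln y))%R by ring.
      rewrite !exp_plus, (exp_Ropp (ln _)), exp_ln by lra.
      set (E := exp (- e * ln (y + 1))). assert (HE : (0 < E)%R) by apply exp_pos.
      assert (Hl : (/ (y + 1) <= ln (y + 1) - ln y)%R).
      { assert (H0 : (ln y <= ln (y + 1) + - / (y + 1))%R); [|lra].
        rewrite <- (ln_exp (- / (y + 1))), <- ln_mult by (try apply exp_pos; lra).
        apply ln_le; [lra|].
        assert (Hx := exp_ineq1_le (- / (y + 1))).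
        apply Rle_trans with ((y + 1) * (1 + - / (y + 1)))%R.
        - right. field. lra.
        - apply Rmult_le_compat_l; lra. }
      assert (Hx := exp_ineq1_le (e * (ln (y + 1) - ln y))).
      assert (Hd : (e * / (y + 1) <= e * (ln (y + 1) - ln y))%R).
      { apply Rmult_le_compat_l; lra. }
      apply Rle_trans with (/ e * (E * (e * / (y + 1))))%R.
      + right. field. lra.
      + apply Rmult_le_compat_l; [lra|].
        replace (E * exp (e * (ln (y + 1) - ln y)) - E)%R with
          (E * (exp (e * (ln (y + 1) - ln y)) - 1))%R by ring.
        apply Rmult_le_compat_l; lra. }
  apply Rle_trans with (Rsum (S n) (fun k => exp (- (1 + e) * ln (INR (S k))))).
  - apply Rsum_mono; [|lia]. intros. apply Rlt_le, exp_pos.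
  - assert (H0 : (0 < exp (- e * ln (INR (S n))))%R) by apply exp_pos. nra.
Qed.

(** * The Riemann zeta function left of its half-plane of convergence *)

(* Euler-Maclaurin approximation of [sum_(k >= x) k^-s]. *)
Definition ztail (b : nat -> C) (J : nat) (x : R) (s : C) : C :=
  Csum 0 (J + 2) (fun r => b r *
    (/ (s - 1) * Cprod r (fun i => 1 - s - i%:C) *
     Cexp ((1 - s - r%:C) * RtoC (ln x)))).

Definition zpow (k : nat) (s : C) : C := Cexp (- s * ln (INR (S k))).

Definition zstep (b : nat -> C) (J : nat) (n : nat) (s : C) : C :=
  zpow n s + (ztail b J (INR (S (S n))) s - ztail b J (INR (S n)) s).

Lemma Cprod_add (r i : nat) (f : nat -> C) :
  Cprod (r + i) f = Cprod r f * Cprod i (fun l => f (r + l)%nat).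
Proof.
  induction i as [|i IH]; [rewrite Nat.add_0_r; simpl; ring|].
  rewrite Nat.add_succ_r, !Cprod_S, IH. ring.
Qed.

Lemma Cprod_ext (n : nat) (f g : nat -> C) :
  (forall i, (i < n)%nat -> f i = g i) -> Cprod n f = Cprod n g.
Proof.
  induction n as [|n IH]; intros H; [reflexivity|].
  rewrite !Cprod_S, IH, H by auto with arith. reflexivity.
Qed.

Lemma Cprod_Cbinom (r : nat) (v : C) :
  Cprod r (fun i => v - i%:C) = (fact r)%:C * Cbinom v r.
Proof. unfold Cbinom. field. apply fact_neq0_C. Qed.

Definition binom_rem (J r : nat) (u : R) (s : C) : C :=
  Cexp ((1 - s - r%:C) * RtoC (ln (1 + u))) -
  Csum 0 (J + 3 - r) (fun i => Cbinom (1 - s - r%:C) i * RtoC u ^ i).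

(* The terms of the binomial expansion below the remainder cancel by the
   recursion of the Bernoulli numbers. *)
Lemma binom_cancel (b : nat -> C) (J : nat) (u w : C) :
  bern_rec b ->
  Csum 0 (J + 2) (fun r => b r * (Cprod r (fun i => w - i%:C) * u ^ r *
    (Csum 0 (J + 3 - r) (fun i => Cbinom (w - r%:C) i * u ^ i) - 1))) = w * u.
Proof.
  intros Hb. set (P := fun r => Cprod r (fun i => w - i%:C)).
  set (T := fun r => Csum 0 (J + 3 - r) (fun i => Cbinom (w - r%:C) i * u ^ i)).
  assert (E1 : Csum 0 (J + 3) (fun r => b r * (P r * u ^ r * T r)) =
    Csum 0 (J + 3) (fun q => (b q + match q with 1 => 1%R | _ => 0%R end) * (P q * u ^ q))).
  { rewrite (Csum_ext 0 (J + 3) _ (fun r =>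
      Csum 0 (J + 3 - r) (fun i => b r / (fact i)%:C * (P (r + i)%nat * u ^ (r + i))))).
    2:{ intros r _. unfold T. rewrite <- !Csum_scal.
        apply Csum_ext. intros i _. unfold P. rewrite Cprod_add, Cpow_add_r.
        rewrite (Cprod_ext i (fun l => w - (r + l)%nat%:C) (fun l => w - r%:C - l%:C)).
        - rewrite (Cprod_Cbinom i). field. apply fact_neq0_C.
        - intros l _. unfold Nat2C. rewrite plus_INR, RtoC_plus. ring. }
    rewrite <- (Csum_triangle (J + 3)
      (fun r i => b r / (fact i)%:C * (P (r + i)%nat * u ^ (r + i)))).
    apply Csum_ext. intros q _. rewrite <- bern_rec_incl by trivial.
    rewrite <- Csum_scal_r. apply Csum_ext. intros r Hr.
    now replace (r + (q - r))%nat with q by lia. }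
  rewrite (Csum_ext 0 (J + 3) (fun q => (b q + _) * _) (fun q =>
    b q * (P q * u ^ q) + (match q with 1 => 1%R | _ => 0%R end) * (P q * u ^ q))) in E1
    by (intros; ring).
  rewrite Csum_plus in E1. replace (J + 3)%nat with (S (J + 2)) in E1 by lia.
  rewrite (Csum0_S (J + 2) (fun r => b r * (P r * u ^ r * T r))) in E1.
  rewrite (Csum0_S (J + 2) (fun q => b q * (P q * u ^ q))) in E1.
  assert (ET : T (J + 2)%nat = 1).
  { unfold T. replace (J + 3 - (J + 2))%nat with 1%nat by lia.
    rewrite Csum0_S, (Csum_nil 0 0) by lia. unfold Cbinom, Nat2C. simpl. field. }
  rewrite ET in E1.
  assert (E2 : Csum 0 (S (J + 2)) (fun q =>
    (match q with 1 => 1%R | _ => 0%R end) * (P q * u ^ q)) = w * u).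
  { rewrite (Csum_chasles 0 2) by lia. rewrite !Csum0_S, (Csum_nil 0 0) by lia.
    rewrite (Csum_zero 2).
    - unfold P, Nat2C. simpl. ring.
    - intros i Hi. destruct i as [|[|i]]; [lia|lia|ring]. }
  rewrite E2 in E1.
  rewrite (Csum_ext 0 (J + 2) _ (fun r =>
    b r * (P r * u ^ r * T r) - b r * (P r * u ^ r))) by (intros; unfold P, T; ring).
  rewrite Csum_minus.
  set (s1 := Csum 0 (J + 2) (fun r => b r * (P r * u ^ r * T r))) in *.
  set (s2 := Csum 0 (J + 2) (fun r => b r * (P r * u ^ r))) in *.
  set (y := b (J + 2)%nat * (P (J + 2)%nat * u ^ (J + 2))) in *.
  replace s1 with (s1 + b (J + 2)%nat * (P (J + 2)%nat * u ^ (J + 2) * 1) - y)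
    by (unfold y; ring).
  rewrite E1. ring.
Qed.

Lemma Cexp_INR_ln (r : nat) (y : R) (c : C) :
  (0 < y)%R ->
  Cexp ((c - r%:C) * RtoC (ln y)) = Cexp (c * RtoC (ln y)) * RtoC (/ y) ^ r.
Proof.
  intros Hy. replace ((c - r%:C) * RtoC (ln y)) with
    (c * RtoC (ln y) + RtoC (INR r * - ln y))
    by (unfold Nat2C; rewrite RtoC_mult, RtoC_opp; ring).
  rewrite Cexp_plus, Cexp_RtoC. f_equal. rewrite <- RtoC_pow. f_equal.
  induction r as [|r IH]; [simpl; rewrite Rmult_0_l; apply exp_0|].
  rewrite S_INR, Rmult_plus_distr_r, exp_plus, IH, Rmult_1_l, exp_Ropp, exp_ln by trivial.
  simpl. ring.
Qed.

(** With [y = n + 1], the power [y^(1-s)] is factored out and each [(1 + 1/y)^(1-s-r)] is split into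
    a binomial polynomial and its remainder. By [binom_cancel] the polynomials compensate the
    summand [y^(-s)]. *)
Lemma zstep_eq (b : nat -> C) (J n : nat) (s : C) :
  bern_rec b -> s <> 1 ->
  zstep b J n s = Cexp ((1 - s) * RtoC (ln (INR (S n)))) * (/ (s - 1) *
    Csum 0 (J + 2) (fun r => b r * ((fact r)%:C * Cbinom (1 - s) r *
      RtoC (/ INR (S n)) ^ r * binom_rem J r (/ INR (S n)) s))).
Proof.
  intros Hb Hs. unfold zstep, zpow, ztail.
  assert (Hs1 : s - 1 <> 0).
  { intros H. apply Hs. replace s with (s - 1 + 1) by ring. rewrite H. ring. }
  assert (Hy : (0 < INR (S n))%R) by (apply lt_0_INR; lia).
  assert (Hln : ln (INR (S (S n))) = (ln (INR (S n)) + ln (1 + / INR (S n)))%R).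
  { assert (Hiy : (0 < / INR (S n))%R) by now apply Rinv_0_lt_compat.
    rewrite <- ln_mult by lra. f_equal. rewrite (S_INR (S n)). field. lra. }
  set (y := INR (S n)) in *. set (u := (/ y)%R). set (l := ln (1 + u)).
  rewrite <- Csum_minus.
  set (A := Cexp ((1 - s) * RtoC (ln y))).
  assert (Ez : Cexp (- s * ln y) = A * RtoC u).
  { replace (- s * ln y) with ((1 - s - 1%:C) * RtoC (ln y))
      by (unfold Nat2C; simpl; ring).
    rewrite Cexp_INR_ln by trivial. fold A. fold u. simpl. ring. }
  rewrite Ez.
  rewrite (Csum_ext 0 (J + 2) _ (fun r => A * / (s - 1) * (b r * (Cprod r (fun i => 1 - s - i%:C) *
    RtoC u ^ r * (Cexp ((1 - s - r%:C) * RtoC l) - 1))))).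
  2:{ intros r _. rewrite Hln. fold u. fold l. rewrite RtoC_plus, Cmult_plus_distr_l, Cexp_plus.
      rewrite Cexp_INR_ln by trivial. fold A. fold u. ring. }
  rewrite Csum_scal.
  rewrite (Csum_ext 0 (J + 2) (fun r => b r * (Cprod r _ * _ * _)) (fun r =>
    b r * ((fact r)%:C * Cbinom (1 - s) r * RtoC u ^ r * binom_rem J r u s) +
    b r * (Cprod r (fun i => (1 - s) - i%:C) * RtoC u ^ r *
      (Csum 0 (J + 3 - r) (fun i => Cbinom ((1 - s) - r%:C) i * RtoC u ^ i) - 1)))).
  2:{ intros r _. rewrite <- Cprod_Cbinom. unfold binom_rem. fold l. ring. }
  rewrite Csum_plus, binom_cancel by trivial. field. exact Hs1.
Qed.

(** For the finitely many initial terms of a series, where the size of the norm is irrelevant. *)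
Definition NBe (a : C) (r : R) (f : C -> C) : Prop := exists m, NB a r m f.

Lemma NBe_ext (a : C) (r : R) (f g : C -> C) :
  (forall w, (Cmod (w - a) <= r)%R -> f w = g w) -> NBe a r f -> NBe a r g.
Proof. intros H [m Hm]. exists m. now apply NB_ext with f. Qed.

Lemma NBe_plus (a : C) (r : R) (f g : C -> C) :
  (0 < r)%R -> NBe a r f -> NBe a r g -> NBe a r (fun w => f w + g w).
Proof. intros Hr [m Hm] [k Hk]. exists (m + k)%R. apply NB_plus; trivial; lra. Qed.

Lemma NBe_mult (a : C) (r : R) (f g : C -> C) :
  (0 < r)%R -> NBe a r f -> NBe a r g -> NBe a r (fun w => f w * g w).
Proof. intros Hr [m Hm] [k Hk]. exists (m * k)%R. now apply NB_mult. Qed.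

Lemma NBe_const (a : C) (r : R) (k : C) : NBe a r (fun _ => k).
Proof. exists (Cmod k). apply NB_const. Qed.

Lemma NBe_id (a : C) (r : R) (p : C) : (0 < r)%R -> NBe a r (fun w => w - p).
Proof. intros Hr. exists (Cmod (a - p) + r)%R. apply NB_id. lra. Qed.

Lemma NBe_scal (a : C) (r : R) (k : C) (f : C -> C) :
  NBe a r f -> NBe a r (fun w => k * f w).
Proof. intros [m Hm]. exists (Cmod k * m)%R. now apply NB_scal. Qed.

Lemma NBe_minus (a : C) (r : R) (f g : C -> C) :
  (0 < r)%R -> NBe a r f -> NBe a r g -> NBe a r (fun w => f w - g w).
Proof.
  intros Hr Hf Hg. apply NBe_ext with (fun w => f w + - (1) * g w).
  { intros; ring. }
  apply NBe_plus; trivial. now apply NBe_scal.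
Qed.

Lemma NBe_exp (a : C) (r : R) (f : C -> C) :
  (0 < r)%R -> NBe a r f -> NBe a r (fun w => Cexp (f w)).
Proof. intros Hr [m Hm]. exists (exp m). now apply NB_exp. Qed.

Lemma NBe_sum (a : C) (r : R) (n : nat) (f : nat -> C -> C) :
  (0 < r)%R -> (forall i, (i < n)%nat -> NBe a r (f i)) ->
  NBe a r (fun w => Csum 0 n (fun i => f i w)).
Proof.
  intros Hr. induction n as [|n IH]; intros H; [exact (NBe_const a r 0)|].
  apply NBe_ext with (fun w => Csum 0 n (fun i => f i w) + f n w).
  { intros. now rewrite Csum0_S. }
  apply NBe_plus; auto.
Qed.

Lemma NB_sum (a : C) (r : R) (n : nat) (m : nat -> R) (f : nat -> C -> C) :
  (0 < r)%R -> (forall i, (i < n)%nat -> NB a r (m i) (f i)) ->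
  NB a r (Rsum n m) (fun w => Csum 0 n (fun i => f i w)).
Proof.
  intros Hr. induction n as [|n IH]; intros H.
  - apply NB_le with (Cmod 0); [rewrite Cmod_0; simpl; lra|]. exact (NB_const a r 0).
  - apply NB_ext with (fun w => Csum 0 n (fun i => f i w) + f n w).
    { intros. now rewrite Csum0_S. }
    simpl Rsum. apply NB_plus; auto. lra.
Qed.

Lemma NBe_prod (a : C) (r : R) (n : nat) (f : nat -> C -> C) :
  (0 < r)%R -> (forall i, (i < n)%nat -> NBe a r (f i)) ->
  NBe a r (fun w => Cprod n (fun i => f i w)).
Proof.
  intros Hr. induction n as [|n IH]; intros H; [exact (NBe_const a r 1)|].
  simpl. apply NBe_mult; auto.
Qed.

(** The explicit estimates hold only from some index on, while [psn_series] wants a summable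
    majorant of all terms; the initial ones receive arbitrary finite norms. *)
Lemma NB_eventually (a : C) (r T : R) (f : nat -> C -> C) (M : nat -> R) (n0 : nat) :
  (forall n, (0 <= M n)%R) -> (forall n, (Rsum n M <= T)%R) ->
  (forall n, NBe a r (f n)) -> (forall n, (n0 <= n)%nat -> NB a r (M n) (f n)) ->
  exists M' T', (forall n, NB a r (M' n) (f n)) /\ forall n, (Rsum n M' <= T')%R.
Proof.
  intros HM HT Hf Hn.
  set (m := fun n => proj1_sig (constructive_indefinite_description _ (Hf n))).
  assert (Hm : forall n, NB a r (m n) (f n)).
  { intros n. exact (proj2_sig (constructive_indefinite_description _ (Hf n))). }
  assert (Hm0 : forall n, (0 <= m n)%R) by (intros n; now apply NB_pos with a r (f n)).
  set (M' := fun n => if (n <? n0)%nat then m n else M n).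
  exists M', (Rsum n0 m + T)%R. split.
  - intros n. unfold M'. destruct (Nat.ltb_spec n n0); auto.
  - intros n. assert (H : (Rsum n M' <= Rsum (Nat.min n n0) m + Rsum n M)%R).
    { induction n as [|n IH]; [simpl; lra|].
      change (Rsum n M' + M' n <= Rsum (Nat.min (S n) n0) m + (Rsum n M + M n))%R.
      unfold M' at 2.
      destruct (Nat.ltb_spec n n0) as [Hc|Hc].
      - replace (Nat.min (S n) n0) with (S n) by lia.
        replace (Nat.min n n0) with n in IH by lia. simpl. specialize (HM n). lra.
      - replace (Nat.min (S n) n0) with n0 by lia.
        replace (Nat.min n n0) with n0 in IH by lia. lra. }
    assert (H2 : (Rsum (Nat.min n n0) m <= Rsum n0 m)%R) by (apply Rsum_mono; auto; lia).
    specialize (HT n). lra.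
Qed.

Lemma NBe_inv (a p : C) (r : R) :
  (0 < r)%R -> (r < Cmod (p - a))%R -> NBe a r (fun w => / (w - p)).
Proof. intros Hr Hp. eexists. now apply NB_inv. Qed.

Lemma NBe_lin (a k c : C) (r : R) : (0 < r)%R -> NBe a r (fun s => k - s - c).
Proof.
  intros Hr. apply NBe_ext with (fun s => - (1) * (s - (k - c))); [intros; ring|].
  apply NBe_scal. now apply NBe_id.
Qed.

Lemma NBe_ztail (b : nat -> C) (J : nat) (x : R) (a : C) (r : R) :
  (0 < r)%R -> (r < Cmod (1 - a))%R -> NBe a r (ztail b J x).
Proof.
  intros Hr H1. apply NBe_sum; trivial. intros i _. apply NBe_scal.
  apply NBe_mult; [trivial|apply NBe_mult|]; trivial.
  - now apply NBe_inv.
  - apply NBe_prod; trivial. intros l _. now apply NBe_lin.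
  - apply NBe_exp; trivial. apply NBe_mult; trivial; [now apply NBe_lin|apply NBe_const].
Qed.

Lemma NBe_zstep (b : nat -> C) (J n : nat) (a : C) (r : R) :
  (0 < r)%R -> (r < Cmod (1 - a))%R -> NBe a r (zstep b J n).
Proof.
  intros Hr H1. apply NBe_plus; trivial.
  - apply NBe_exp; trivial. apply NBe_mult; trivial; [|apply NBe_const].
    apply NBe_ext with (fun s => 0 - s - 0); [intros; ring|]. now apply NBe_lin.
  - apply NBe_minus; trivial; now apply NBe_ztail.
Qed.

(** In [zstep_eq], with [y = n + 1], the power has norm at most [y^(1 - Re a + r)] on the disc, and
    every remainder together with its power of [1/y] is [O(y^(-J-3))]. *)
Lemma NB_zstep (b : nat -> C) (J : nat) (a : C) (r : R) :
  bern_rec b -> (0 < r)%R -> (r < Cmod (1 - a))%R ->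
  exists K n0, (0 <= K)%R /\ forall n, (n0 <= n)%nat ->
    NB a r (K * exp (- (1 + (Re a + INR J + 1 - r)) * ln (INR (S n)))) (zstep b J n).
Proof.
  intros Hb Hr H1.
  (* This bounds the norm of all [1 - s - i] that occur, and the final 1 provides the [p >= 1] of
     [NB_Cbinom]. *)
  set (p := (Cmod (1 - a) + INR (J + 2) + r + 1)%R).
  assert (HJ := pos_INR (J + 2)). assert (Hp : (1 <= p)%R) by (unfold p; lra).
  set (D := (/ (Cmod (1 - a) - r))%R).
  assert (HD : (0 < D)%R) by (apply Rinv_0_lt_compat; lra).
  set (Q := Rsum (J + 2) (fun r0 =>
    Cmod (b r0) * (INR (fact r0) * p ^ r0) * (2 * p ^ (J + 3 - r0)))%R).
  assert (HQ : (0 <= Q)%R).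
  { apply Rsum_pos. intros i.
    assert (Hpp : forall k, (0 <= p ^ k)%R) by (intros; apply pow_le; lra).
    apply Rmult_le_pos; [apply Rmult_le_pos; [apply Cmod_ge_0|]|].
    - apply Rmult_le_pos; [apply pos_INR|auto].
    - specialize (Hpp (J + 3 - i)%nat). lra. }
  (* From this index on [p / y <= 1/2], the range of the binomial series. *)
  destruct (INR_unbounded (2 * p)) as [n0 Hn0].
  exists (D * Q)%R, n0. split; [apply Rmult_le_pos; lra|].
  intros n Hn.
  assert (Hy : (2 * p <= INR (S n))%R).
  { apply Rlt_le, (Rlt_le_trans _ _ _ Hn0). apply le_INR. lia. }
  set (y := INR (S n)) in *. set (u := (/ y)%R).
  assert (Hu : (0 < u)%R) by (apply Rinv_0_lt_compat; lra).
  assert (Hpu : (p * u <= / 2)%R).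
  { apply (Rmult_le_reg_r y); [lra|]. unfold u.
    rewrite Rmult_assoc, Rinv_l by lra. lra. }
  assert (Hlin : forall i, (i <= J + 2)%nat -> NB a r p (fun s => 1 - s - i%:C)).
  { intros i Hi. apply NB_ext with (fun s => - (1) * (s - (1 - i%:C))); [intros; ring|].
    apply NB_le with (Cmod (- (1)) * (Cmod (a - (1 - i%:C)) + r))%R;
      [|apply NB_scal, NB_id; lra].
    rewrite Cmod_opp, Cmod_1, Rmult_1_l. unfold p.
    replace (a - (1 - i%:C)) with (- (1 - a) + i%:C) by ring.
    assert (Ht := Cmod_triangle (- (1 - a)) i%:C).
    rewrite Cmod_opp, Cmod_Nat2C in Ht.
    assert (Hi2 : (INR i <= INR (J + 2))%R) by (apply le_INR; lia). lra. }
  apply NB_ext with (fun s => Cexp ((1 - s) * RtoC (ln y)) * (/ (s - 1) *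
    Csum 0 (J + 2) (fun r => b r * ((fact r)%:C * Cbinom (1 - s) r *
      RtoC u ^ r * binom_rem J r u s)))).
  { intros s Hs. rewrite zstep_eq; trivial. intros E. subst s.
    lra. }
  apply NB_le with (exp ((1 - Re a + r) * ln y) * (D * (Q * u ^ (J + 3))))%R.
  - right. replace (- (1 + (Re a + INR J + 1 - r)) * ln y)%R with
      ((1 - Re a + r) * ln y + - (INR (J + 3) * ln y))%R.
    2:{ rewrite plus_INR. simpl (INR 3). ring. }
    rewrite exp_plus.
    replace (exp (- (INR (J + 3) * ln y))) with (u ^ (J + 3))%R; [ring|].
    unfold u. rewrite <- (exp_ln y) at 1 by lra. rewrite <- exp_Ropp.
    generalize (J + 3)%nat. induction n1 as [|k IH].
    + simpl. rewrite Rmult_0_l, Ropp_0, exp_0. reflexivity.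
    + rewrite S_INR, Rmult_plus_distr_r, Ropp_plus_distr, exp_plus, Rmult_1_l, <- IH.
      simpl. ring.
  - apply NB_mult; trivial; [|apply NB_mult; trivial].
    + apply NB_ext with (fun s => Cexp ((1 - a) * RtoC (ln y)) *
        Cexp (- RtoC (ln y) * ((s - a) * 1))).
      { intros s _. rewrite <- Cexp_plus. f_equal. ring. }
      apply NB_le with (Cmod (Cexp ((1 - a) * RtoC (ln y))) * exp (r * ln y))%R.
      * rewrite Cmod_Cexp, <- exp_plus. right. f_equal.
        destruct a as [a1 a2]. simpl. unfold Re. simpl. ring.
      * apply NB_scal, NB_exp; trivial.
        assert (Hl : (0 <= ln y)%R).
        { rewrite <- ln_1. apply ln_le; lra. }
        apply NB_le with (Cmod (- RtoC (ln y)) * (r * Cmod 1))%R.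
        { rewrite Cmod_opp, Cmod_R, Cmod_1, Rabs_pos_eq by trivial. lra. }
        apply NB_scal, NB_shift; [lra|apply NB_const].
    + now apply NB_inv.
    + apply NB_le with (Rsum (J + 2) (fun r0 => Cmod (b r0) *
        ((INR (fact r0) * p ^ r0) * u ^ r0 * (2 * (p * u) ^ (J + 3 - r0))))%R).
      * rewrite (Rmult_comm Q). unfold Q. rewrite <- Rsum_scal. right. apply Rsum_ext.
        intros i Hi. rewrite Rpow_mult_distr.
        replace (u ^ (J + 3))%R with (u ^ i * u ^ (J + 3 - i))%R
          by (rewrite <- pow_add; f_equal; lia). ring.
      * apply NB_sum; trivial. intros i Hi. apply NB_scal.
        apply NB_mult; trivial; [|apply NB_binom_rem; trivial; apply Hlin; lia].
        apply NB_ext with (fun s => RtoC u ^ i * ((fact i)%:C * Cbinom (1 - s) i)).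
        { intros; ring. }
        apply NB_le with (Cmod (RtoC u ^ i) * (Cmod (fact i)%:C * p ^ i))%R.
        { rewrite Cmod_pow, Cmod_R, Cmod_Nat2C, Rabs_pos_eq by lra. right. ring. }
        apply NB_scal, NB_scal. apply NB_Cbinom; trivial.
        apply NB_ext with (fun s => 1 - s - 0%:C).
        { intros s _. unfold Nat2C. simpl. ring. }
        apply Hlin. lia.
Qed.

(** Continuation of zeta to [Re s > -J - 1], [s <> 1], as the limit of the corrected partial
    sums. *)
Definition zcont (b : nat -> C) (J : nat) (s : C) : C :=
  CLim (fun N => Csum 0 N (fun k => zpow k s) + ztail b J (INR (S N)) s).

Lemma zcont_partial (b : nat -> C) (J N : nat) (s : C) :
  Csum 0 N (fun k => zpow k s) + ztail b J (INR (S N)) s =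
  ztail b J 1 s + Csum 0 N (fun k => zstep b J k s).
Proof.
  induction N as [|N IH].
  - rewrite !Csum_nil by lia. simpl INR. ring.
  - rewrite !Csum0_S, Cplus_assoc, <- IH. unfold zstep. ring.
Qed.

(** The series of steps converges in norm around [a], so its coefficients are sums of coefficients.
    Read at order 1 this is termwise differentiation. *)
Lemma zcont_spec (b : nat -> C) (J : nat) (a : C) :
  bern_rec b -> a <> 1 -> (- INR J - 1 < Re a)%R ->
  analytic_at (zcont b J) a /\
  Clim (fun N => C_derive (ztail b J 1) a +
      Csum 0 N (fun n => C_derive (zstep b J n) a))
    (C_derive (zcont b J) a).
Proof.
  intros Hb Ha Hre.
  assert (Hd : (0 < Cmod (1 - a))%R).
  { apply Cmod_gt_0. intros H. apply Ha. replace a with (1 - (1 - a)) by ring.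
    rewrite H. ring. }
  (* The first bound keeps the pole 1 outside the disc, the second leaves the positive excess [e] in
     the exponent of the p-series. *)
  set (r := Rmin (Cmod (1 - a) / 2) ((Re a + INR J + 1) / 2)).
  assert (Hr1 := Rmin_l (Cmod (1 - a) / 2) ((Re a + INR J + 1) / 2)).
  assert (Hr2 := Rmin_r (Cmod (1 - a) / 2) ((Re a + INR J + 1) / 2)).
  assert (Hr : (0 < r)%R) by (apply Rmin_pos; lra). fold r in Hr1, Hr2.
  set (e := (Re a + INR J + 1 - r)%R). assert (He : (0 < e)%R) by (unfold e; lra).
  destruct (NB_zstep b J a r Hb Hr ltac:(lra)) as (K & n0 & HK & Hn0).
  destruct (NB_eventually a r (K * (1 + / e)) (zstep b J)
    (fun n => K * exp (- (1 + e) * ln (INR (S n))))%R n0) as (M & T & HM & HT).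
  - intros n. apply Rmult_le_pos; trivial. apply Rlt_le, exp_pos.
  - intros n. rewrite Rsum_scal. apply Rmult_le_compat_l; trivial.
    now apply Rsum_p_series.
  - intros n. apply NBe_zstep; lra.
  - exact Hn0.
  - set (c := fun n => proj1_sig (constructive_indefinite_description _ (HM n))).
    assert (Hc : forall n, psn a r (M n) (c n) (zstep b J n)).
    { intros n. exact (proj2_sig (constructive_indefinite_description _ (HM n))). }
    destruct (psn_series_coef a r T M c (zstep b J) Hr Hc HT) as [D HD].
    destruct (NBe_ztail b J 1 a r Hr ltac:(lra)) as (m & ct & Hct).
    set (F := fun s => CLim (fun N => Csum 0 N (fun k => zstep b J k s))).
    assert (HF : forall w, (Cmod (w - a) <= r)%R ->
      Clim (fun N => Csum 0 N (fun k => zstep b J k w)) (F w)).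
    { intros w Hw.
      destruct (Csum_abs_conv (fun k => zstep b J k w) M T) as [l Hl]; trivial.
      - intros k. now apply (NB_bound a r (M k) (zstep b J k) w).
      - unfold F. now rewrite (CLim_unique _ _ Hl). }
    assert (HpF : psn a r T D F).
    { apply psn_series with M c (zstep b J); trivial. lra. }
    assert (Hp : psn a r (m + T) (fun i => ct i + D i) (zcont b J)).
    { apply psn_ext with (fun s => ztail b J 1 s + F s).
      - intros w Hw. symmetry. apply CLim_unique.
        apply Clim_ext with (u := fun N =>
          ztail b J 1 w + Csum 0 N (fun k => zstep b J k w)).
        + intros N. now rewrite zcont_partial.
        + apply Clim_plus; [apply Clim_const|now apply HF].
      - apply psn_plus; trivial. lra. }
    split.
    + apply analytic_NB. exists r, (m + T)%R. split; trivial. eexists. exact Hp.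
    + rewrite (psn_C_derive _ _ _ _ _ Hr Hp), (psn_C_derive _ _ _ _ _ Hr Hct).
      apply Clim_plus; [apply Clim_const|].
      apply Clim_ext with (2 := HD 1%nat). intros N. apply Csum_ext. intros k _.
      symmetry. apply (psn_C_derive _ _ _ _ _ Hr (Hc k)).
Qed.

Lemma zcont_zeta (b : nat -> C) (J : nat) (zeta : C -> C) (s : C) :
  is_riemann_zeta zeta -> (2 <= Re s)%R -> zcont b J s = zeta s.
Proof.
  intros [_ Hz] Hs. apply CLim_unique.
  replace (zeta s) with (zeta s + 0) by ring. apply Clim_plus.
  - specialize (Hz s ltac:(lra)). rewrite is_series_Clim in Hz.
    eapply Clim_ext; [|exact Hz]. intros n. reflexivity.
  - unfold ztail.
    apply (Clim_ext (fun N => Csum 0 (J + 2) (fun r =>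
      (b r * (/ (s - 1) * Cprod r (fun i => 1 - s - i%:C))) *
      Cexp ((1 - s - r%:C) * RtoC (ln (INR (S N))))))).
    { intros N. apply Csum_ext. intros; ring. }
    apply (Clim_0_ext_sum (J + 2) (fun r =>
      b r * (/ (s - 1) * Cprod r (fun i => 1 - s - i%:C)))
      (fun r N => Cexp ((1 - s - r%:C) * RtoC (ln (INR (S N)))))).
    intros r _. apply Clim_squeeze with (N := 0%nat) (v := fun N => (/ INR (S N))%R);
      [|apply is_lim_seq_inv_S].
    intros N _. set (y := INR (S N)).
    assert (Hy : (1 <= y)%R) by (apply (le_INR 1); lia).
    match goal with |- (Cmod (?x - RtoC 0)%C <= _)%R =>
      replace (x - RtoC 0) with x by ring end.
    rewrite Cmod_Cexp. rewrite <- (exp_ln y) at 2 by lra. rewrite <- exp_Ropp.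
    assert (Hl : (0 <= ln y)%R) by (rewrite <- ln_1; apply ln_le; lra).
    assert (Hrr := pos_INR r).
    replace (Re ((1 - s - r%:C) * RtoC (ln y))) with ((1 - Re s - INR r) * ln y)%R
      by (destruct s; simpl; unfold Re; simpl; ring).
    apply Rnot_lt_le. intros Hlt. apply exp_lt_inv in Hlt. nra.
Qed.

Lemma agree_near_at_acc (f g : C -> C) (a : C) : agree_near f g a -> agree_acc f g a.
Proof.
  intros (e & He & H) eps Heps. set (x := Rmin (eps / 2) (e / 2)).
  assert (H1 := Rmin_l (eps / 2) (e / 2)). assert (H2 := Rmin_r (eps / 2) (e / 2)).
  assert (H3 : (0 < x)%R) by (apply Rmin_pos; lra). fold x in H1, H2.
  assert (Hc : Cmod (a + RtoC x - a) = x).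
  { replace (a + RtoC x - a) with (RtoC x) by ring. rewrite Cmod_R, Rabs_pos_eq; lra. }
  exists (a + RtoC x). repeat split; [|lra|apply H; lra].
  intros E. rewrite E in Hc. replace (a - a) with (RtoC 0) in Hc by ring.
  rewrite Cmod_0 in Hc. lra.
Qed.

(** Order [j] is just enough: both segments lie in [Re s >= -j], inside the half-plane
    [Re s > -j - 1] where [zcont b j] is analytic away from 1. *)
Lemma zeta_zcont_near (b : nat -> C) (j : nat) (zeta : C -> C) :
  bern_rec b -> is_riemann_zeta zeta -> agree_near zeta (zcont b j) (- j%:C).
Proof.
  intros Hb Hz. assert (Hj := pos_INR j).
  assert (Hloc : forall a : C, a <> 1 -> (- INR j - 1 < Re a)%R ->
    agree_acc zeta (zcont b j) a -> agree_near zeta (zcont b j) a).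
  { intros a Ha Hre. apply analytic_agree; [exact (proj1 Hz a Ha)|].
    exact (proj1 (zcont_spec b j a Hb Ha Hre)). }
  assert (Hi : agree_near zeta (zcont b j) Ci).
  { apply (agree_continuation zeta (zcont b j) (RtoC 3) Ci).
    - intros H. apply (f_equal snd) in H. simpl in H. lra.
    - intros t Ht. apply Hloc.
      + intros H. assert (H1 := f_equal snd H). assert (H2 := f_equal fst H).
        simpl in H1, H2. assert (t = 0)%R by lra. subst t. lra.
      + simpl. unfold Re. simpl. lra.
    - intros eps He. exists (RtoC (3 + eps / 2)).
      replace (RtoC (3 + eps / 2) - RtoC 3) with (RtoC (eps / 2))
        by (rewrite RtoC_plus; ring).
      rewrite Cmod_R, Rabs_pos_eq by lra. repeat split; try lra.
      + intros H. apply RtoC_inj in H. lra.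
      + symmetry. apply zcont_zeta; trivial. simpl. lra. }
  apply (agree_continuation zeta (zcont b j) Ci (- j%:C)).
  - intros H. apply (f_equal snd) in H. simpl in H. lra.
  - intros t Ht. apply Hloc.
    + intros H. assert (H1 := f_equal snd H). assert (H2 := f_equal fst H).
      simpl in H1, H2. assert (t = 1)%R by lra. subst t. lra.
    + simpl. unfold Re. simpl. nra.
  - now apply agree_near_at_acc.
Qed.

(** * Derivative of the continued zeta function at nonpositive integers *)

Lemma analytic_has_der (f : C -> C) (a : C) :
  analytic_at f a -> has_der f a (C_derive f a).
Proof.
  rewrite analytic_NB. intros (r & m & Hr & c & Hc). exists r, m, c.
  repeat split; trivial; try apply Hc. symmetry. now apply psn_C_derive with r m.
Qed.

Lemma has_der_unique (f : C -> C) (a l k : C) : has_der f a l -> has_der f a k -> l = k.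
Proof.
  intros Hl Hk. now rewrite <- (has_der_C_derive f a l Hl), (has_der_C_derive f a k Hk).
Qed.

(** The derivative exists by the geometric series; its value follows by differentiating
    [(w - p) * / (w - p) = 1]. *)
Lemma has_der_inv (a p : C) :
  a <> p -> has_der (fun w => / (w - p)) a (- / (a - p) ^ 2).
Proof.
  intros Hap.
  assert (H0 : a - p <> 0).
  { intros H. apply Hap. replace a with (a - p + p) by ring. rewrite H. ring. }
  assert (Hd : (0 < Cmod (p - a))%R) by (rewrite Cmod_minus_sym; now apply Cmod_gt_0).
  assert (Han : analytic_at (fun w => / (w - p)) a).
  { apply analytic_NB. exists (Cmod (p - a) / 2)%R. eexists. split; [lra|].
    apply NB_inv; lra. }
  apply analytic_has_der in Han.
  assert (Hm := has_der_mult _ _ a _ _ (has_der_id a p) Han).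
  assert (H1 : has_der (fun w => (w - p) * / (w - p)) a 0).
  { apply has_der_ext with (fun _ => 1); [|apply has_der_const].
    exists (Cmod (p - a)). split; trivial. intros w Hw. field. intros H.
    assert (Hwp : w = p) by (replace w with (w - p + p) by ring; rewrite H; ring).
    subst w. lra. }
  assert (E := has_der_unique _ _ _ _ Hm H1).
  replace (- / (a - p) ^ 2) with (C_derive (fun w => / (w - p)) a); trivial.
  set (l := C_derive (fun w => / (w - p)) a) in *.
  replace l with (((a - p) * l + 1 * / (a - p) - / (a - p)) / (a - p))
    by (field; trivial).
  rewrite E. field. exact H0.
Qed.

Lemma has_der_exp_lin (k c a : C) :
  has_der (fun s => Cexp (k * s + c)) a (k * Cexp (k * a + c)).
Proof.
  exists 1%R, (Cmod (Cexp (k * a + c)) * exp (Cmod k))%R,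
    (fun i => Cexp (k * a + c) * epow i k).
  split; [lra|]. split.
  - apply psn_ext with (fun s => Cexp (k * a + c) * Cexp (k * (s - a))).
    { intros w _. rewrite <- Cexp_plus. f_equal. ring. }
    apply psn_scal. split.
    + intros n. eapply Rle_trans; [|apply (Rsum_exp_le (Cmod k) n), Cmod_ge_0].
      apply Rsum_le. intros i _. unfold epow.
      rewrite Cmod_div, Cmod_pow, Cmod_Nat2C by apply fact_neq0_C.
      rewrite pow1. lra.
    + intros w _. eapply Clim_ext; [|apply Cexp_series]. intros n. simpl.
      apply Csum_ext. intros i _. unfold epow. rewrite Cpow_mult_l.
      unfold Cdiv. ring.
  - unfold epow, Nat2C. simpl. field.
Qed.

(** The new factor [1 - s - r] has value [j + 1 - r] and derivative [-1] at [s = -j], which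
    reproduces the recursions of [fall_coef] and [phi_coef]. This is where the constants [phi_{j,r}]
    meet zeta. *)
Lemma fall_coef_Cprod (j r : nat) :
  has_der (fun s => / (s - 1) * Cprod r (fun i => 1 - s - i%:C)) (- j%:C)
    (RtoC (phi_coef j r)) /\
  / (- j%:C - 1) * Cprod r (fun i => 1 - - j%:C - i%:C) = - RtoC (fall_coef j r).
Proof.
  assert (Hj1 : - j%:C <> 1).
  { intros H. apply (f_equal fst) in H. simpl in H. assert (Hp := pos_INR j). lra. }
  assert (Ej : - j%:C - 1 = - RtoC (INR (j + 1))).
  { unfold Nat2C. rewrite plus_INR, RtoC_plus. simpl. ring. }
  assert (Hn : RtoC (INR (j + 1)) <> 0).
  { intros H. apply RtoC_inj in H. now apply (INR_S_neq0 j). }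
  induction r as [|r [IH1 IH2]].
  - split.
    + apply has_der_ext_all with (fun s => / (s - 1)); [intros; simpl; ring|].
      replace (RtoC (phi_coef j 0)) with (- / (- j%:C - 1) ^ 2).
      * now apply has_der_inv.
      * rewrite Ej. simpl phi_coef. rewrite RtoC_opp, RtoC_Rinv, Rmult_1_r, RtoC_mult.
        simpl. field. exact Hn.
    + rewrite Ej. simpl. rewrite RtoC_Rinv. field. exact Hn.
  - assert (Er : 1 - - j%:C - r%:C = RtoC (INR (j + 1) - INR r)).
    { unfold Nat2C. rewrite plus_INR, RtoC_minus, RtoC_plus. simpl. ring. }
    split.
    + apply has_der_ext_all with (fun s =>
        (/ (s - 1) * Cprod r (fun i => 1 - s - i%:C)) * (- (1) * (s - (1 - r%:C)))).
      { intros s. rewrite Cprod_S. ring. }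
      replace (RtoC (phi_coef j (S r))) with
        ((/ (- j%:C - 1) * Cprod r (fun i => 1 - - j%:C - i%:C)) * (- (1) * 1) +
         RtoC (phi_coef j r) * (- (1) * (- j%:C - (1 - r%:C)))).
      * apply (has_der_mult (fun s => / (s - 1) * Cprod r (fun i => 1 - s - i%:C))
          (fun s => - (1) * (s - (1 - r%:C)))); trivial.
        apply has_der_scal, has_der_id.
      * rewrite IH2. replace (- (1) * (- j%:C - (1 - r%:C))) with
          (1 - - j%:C - r%:C) by ring.
        rewrite Er. simpl phi_coef. rewrite RtoC_plus, RtoC_mult. ring.
    + rewrite Cprod_S, Er, Cmult_assoc, IH2. simpl fall_coef. rewrite RtoC_mult. ring.
Qed.

(** Differentiating [x^(1-s-r)] in [s] contributes [- ln x], against the coefficient value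
    [- fall_coef j r]; together with [phi_coef j r] this is [Fder j r x]. *)
Lemma has_der_ztail (b : nat -> C) (j : nat) (x : R) :
  (0 < x)%R -> has_der (ztail b j x) (- j%:C) (Mfun b j x).
Proof.
  intros Hx. unfold Mfun, ztail.
  assert (H : forall n, (n <= j + 2)%nat -> has_der (fun s => Csum 0 n (fun r => b r *
    (/ (s - 1) * Cprod r (fun i => 1 - s - i%:C) *
     Cexp ((1 - s - r%:C) * RtoC (ln x))))) (- j%:C)
    (Csum 0 n (fun r => b r * Fder j r x))); [|now apply H].
  induction n as [|n IH]; intros Hn; [exact (has_der_const 0 _)|].
  apply has_der_ext_all with (fun s => Csum 0 n (fun r => b r *
    (/ (s - 1) * Cprod r (fun i => 1 - s - i%:C) *
     Cexp ((1 - s - r%:C) * RtoC (ln x)))) + b n *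
    ((/ (s - 1) * Cprod n (fun i => 1 - s - i%:C)) *
     Cexp (- RtoC (ln x) * s + (1 - n%:C) * RtoC (ln x)))).
  { intros s. rewrite Csum0_S.
    replace (- RtoC (ln x) * s + (1 - n%:C) * RtoC (ln x)) with
      ((1 - s - n%:C) * RtoC (ln x)) by ring. ring. }
  rewrite Csum0_S. apply has_der_plus; [apply IH; lia|]. apply has_der_scal.
  destruct (fall_coef_Cprod j n) as [H1 H2].
  set (E := Cexp (- RtoC (ln x) * - j%:C + (1 - n%:C) * RtoC (ln x))).
  assert (EE : E = RtoC (x ^ (j + 1 - n))).
  { unfold E. replace (- RtoC (ln x) * - j%:C + (1 - n%:C) * RtoC (ln x)) with
      (RtoC (INR (j + 1 - n) * ln x)).
    - rewrite Cexp_RtoC. f_equal. rewrite <- (exp_ln x) at 2 by trivial.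
      generalize (j + 1 - n)%nat. induction n0 as [|k IHk].
      + simpl. rewrite Rmult_0_l. apply exp_0.
      + rewrite S_INR, Rmult_plus_distr_r, exp_plus, IHk, Rmult_1_l. simpl. ring.
    - unfold Nat2C. rewrite minus_INR, plus_INR, RtoC_mult, RtoC_minus, RtoC_plus by lia.
      simpl. ring. }
  replace (RtoC (Fder j n x)) with
    ((/ (- j%:C - 1) * Cprod n (fun i => 1 - - j%:C - i%:C)) * (- RtoC (ln x) * E) +
     RtoC (phi_coef j n) * E).
  - apply (has_der_mult (fun s => / (s - 1) * Cprod n (fun i => 1 - s - i%:C))
      (fun s => Cexp (- RtoC (ln x) * s + (1 - n%:C) * RtoC (ln x)))); trivial.
    apply has_der_exp_lin.
  - rewrite H2, EE. unfold Fder. destruct (Nat.leb_spec n (j + 1)); [|lia].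
    rewrite !RtoC_mult, RtoC_plus, RtoC_mult. ring.
Qed.

Lemma has_der_zpow (j k : nat) :
  has_der (zpow k) (- j%:C) (- RtoC (xlog j (INR k + 1))).
Proof.
  assert (Hk : (0 < INR (S k))%R) by (apply lt_0_INR; lia).
  apply has_der_ext_all with (fun s => Cexp (- RtoC (ln (INR (S k))) * s + 0)).
  { intros s. unfold zpow. f_equal. ring. }
  replace (- RtoC (xlog j (INR k + 1))) with (- RtoC (ln (INR (S k))) *
    Cexp (- RtoC (ln (INR (S k))) * - j%:C + 0)); [apply has_der_exp_lin|].
  rewrite <- S_INR. unfold xlog. rewrite RtoC_mult.
  replace (- RtoC (ln (INR (S k))) * - j%:C + 0) with (RtoC (INR j * ln (INR (S k)))).
  - rewrite Cexp_RtoC. replace (exp (INR j * ln (INR (S k)))) with (INR (S k) ^ j)%R.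
    + ring.
    + set (y := INR (S k)) in *. rewrite <- (exp_ln y) at 1 by trivial.
      induction j as [|j IH].
      * simpl. rewrite Rmult_0_l. symmetry. apply exp_0.
      * rewrite (S_INR j), Rmult_plus_distr_r, exp_plus, <- IH, Rmult_1_l.
        rewrite exp_ln by trivial. simpl. ring.
  - unfold Nat2C. rewrite RtoC_mult. ring.
Qed.

Lemma zeta_seq_lim (b : nat -> C) (j : nat) (zeta : C -> C) :
  bern_rec b -> is_riemann_zeta zeta ->
  Clim (zeta_seq b j) (C_derive zeta (- j%:C)).
Proof.
  intros Hb Hz. assert (Hj := pos_INR j).
  assert (Hj1 : - j%:C <> 1).
  { intros H. apply (f_equal fst) in H. simpl in H. lra. }
  destruct (zcont_spec b j (- j%:C) Hb Hj1) as [Han Hlim].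
  { simpl. unfold Re. simpl. lra. }
  destruct (zeta_zcont_near b j zeta Hb Hz) as (e & He & Hne).
  assert (Ed : C_derive zeta (- j%:C) = C_derive (zcont b j) (- j%:C)).
  { apply has_der_C_derive. apply has_der_ext with (zcont b j).
    - exists e. split; trivial. intros w Hw. symmetry. auto.
    - now apply analytic_has_der. }
  rewrite Ed. eapply Clim_ext; [|exact Hlim]. intros N. simpl.
  rewrite (has_der_C_derive _ _ _ (has_der_ztail b j 1 Rlt_0_1)).
  unfold zeta_seq. induction N as [|N IH].
  - rewrite Csum_nil by lia. simpl. rewrite Rplus_0_l. ring.
  - rewrite Csum0_S, Cplus_assoc, IH. cbn [Rsum].
    assert (Hs : has_der (zstep b j N) (- j%:C) (- RtoC (xlog j (INR N + 1)) +
      (Mfun b j (INR (S (S N))) + - (1) * Mfun b j (INR (S N))))).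
    { apply has_der_ext_all with (fun s => zpow N s +
        (ztail b j (INR (S (S N))) s + - (1) * ztail b j (INR (S N)) s)).
      { intros s. unfold zstep. ring. }
      apply has_der_plus; [apply has_der_zpow|]. apply has_der_plus.
      - apply has_der_ztail. apply lt_0_INR. lia.
      - apply has_der_scal, has_der_ztail. apply lt_0_INR. lia. }
    rewrite (has_der_C_derive _ _ _ Hs). rewrite RtoC_plus, (S_INR (S N)), (S_INR N).
    ring.
Qed.

(** * The infinite product *)

Lemma NB_log1p_rem (a : C) (r p : R) (v : C -> C) (q : nat) :
  (0 < r)%R -> (p <= / 2)%R -> NB a r p v ->
  NB a r (2 * p ^ q) (fun s => Clog1p (v s) -
    Csum 0 q (fun i => log1p_coef i * v s ^ i)).
Proof.
  intros Hr Hp Hv. assert (Hp0 := NB_pos a r p v Hv).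
  apply NB_series with (m := fun k => (p ^ (q + k))%R)
    (f := fun k s => log1p_coef (q + k) * v s ^ (q + k)); trivial.
  - intros k. apply NB_le with (Cmod (log1p_coef (q + k)) * p ^ (q + k))%R.
    + rewrite <- (Rmult_1_l (p ^ (q + k))) at 2.
      apply Rmult_le_compat_r; [now apply pow_le|apply Cmod_log1p_coef].
    + apply NB_scal. now apply NB_pow.
  - intros n. apply Rsum_half_pow; lra.
  - intros w Hw. assert (Hb := NB_bound a r p v w Hr Hv Hw).
    assert (H := Clog1p_series (v w) ltac:(lra)).
    apply (Clim_incr_n _ _ q) in H.
    apply Clim_ext with (u := fun n =>
      Csum 0 (n + q) (fun i => log1p_coef i * v w ^ i) -
      Csum 0 q (fun i => log1p_coef i * v w ^ i)).
    + intros n. rewrite (Csum_chasles 0 q (n + q)) by lia.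
      rewrite (Nat.add_comm n q), Csum_shift. ring.
    + apply Clim_minus; [exact H|apply Clim_const].
Qed.

(** A logarithm of [gamma_factor n z k], valid for [|z| <= k / 2]. *)
Definition hlog (n k : nat) (z : C) : C :=
  Phifun n z k - Cbinom (- k%:C) (n - 1) * Clog1p (z / k%:C).

Lemma Phifun_eq (n : nat) (z : C) (k : nat) :
  (1 <= n)%nat -> (1 <= k)%nat ->
  Phifun n z k = Csum 0 n (fun r => Gpoly n r 0 *
    (log_trunc (S (S r)) z k%:C (S r) / k%:C)).
Proof.
  intros Hn Hk. rewrite Phifun_trunc by trivial.
  apply (Gpoly_transfer n z (fun r => log_trunc (S (S r)) z k%:C (S r) / k%:C)).
  exact Hn.
Qed.

Lemma Cbinom_neg_eq (n k : nat) :
  (1 <= n)%nat -> Cbinom (- k%:C) (n - 1) = Csum 0 n (fun r => Gpoly n r 0 * k%:C ^ r).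
Proof. intros Hn. rewrite Gpoly_spec by trivial. f_equal. ring. Qed.

(** Split [binom(-k, n-1)] into powers of [k]: for the part in [k^r], [Phi_n] removes the terms of
    the logarithm up to order [r + 1]. The remainder of order [r + 2] in [z / k] makes every part
    [O(k^(-2))]. *)
Lemma hlog_eq (n k : nat) (z : C) :
  (1 <= n)%nat -> (1 <= k)%nat ->
  hlog n k z = Csum 0 n (fun r => - Gpoly n r 0 * k%:C ^ r *
    (Clog1p (z / k%:C) - Csum 0 (S (S r)) (fun l => log1p_coef l * (z / k%:C) ^ l))).
Proof.
  intros Hn Hk. assert (Hk0 : k%:C <> 0) by (apply Nat2C_neq0; lia).
  unfold hlog. rewrite Phifun_eq, Cbinom_neg_eq by trivial.
  rewrite <- Csum_scal_r, <- Csum_minus. apply Csum_ext. intros r Hr.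
  assert (E : log_trunc (S (S r)) z k%:C (S r) / k%:C =
    k%:C ^ r * Csum 0 (S (S r)) (fun l => log1p_coef l * (z / k%:C) ^ l)).
  { unfold log_trunc, Cdiv at 1. rewrite <- Csum_scal_r, <- Csum_scal.
    apply Csum_ext. intros l Hl. unfold Cdiv. rewrite Cpow_mult_l, Cpow_inv by trivial.
    assert (Hp : forall i, k%:C ^ i <> 0) by (intros; now apply Cpow_nz).
    assert (E : k%:C ^ (S r - l) * k%:C ^ l = k%:C ^ r * k%:C).
    { rewrite <- Cpow_add_r. replace (S r - l + l)%nat with (S r) by lia. simpl. ring. }
    replace (k%:C ^ (S r - l)) with (k%:C ^ r * k%:C / k%:C ^ l)
      by (rewrite <- E; field; apply Hp).
    field. split; [apply Hp|trivial]. }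
  rewrite E. ring.
Qed.

Lemma NB_hlog (n : nat) (rho : R) :
  (1 <= n)%nat -> (0 < rho)%R ->
  exists K, (0 <= K)%R /\ forall k, (1 <= k)%nat -> (2 * rho <= INR k)%R ->
    NB 0 rho (K / INR k ^ 2) (hlog n k).
Proof.
  intros Hn Hrho.
  exists (Rsum n (fun r => Cmod (- Gpoly n r 0) * (2 * rho ^ (S (S r))))%R). split.
  { apply Rsum_pos. intros i. apply Rmult_le_pos; [apply Cmod_ge_0|].
    assert (H : (0 <= rho ^ S (S i))%R) by (apply pow_le; lra). lra. }
  intros k Hk Hk2. assert (Hk0 : k%:C <> 0) by (apply Nat2C_neq0; lia).
  assert (Hkr : (0 < INR k)%R) by (apply lt_0_INR; lia).
  apply NB_ext with (fun z => Csum 0 n (fun r => - Gpoly n r 0 * k%:C ^ r *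
    (Clog1p (z / k%:C) - Csum 0 (S (S r)) (fun l => log1p_coef l * (z / k%:C) ^ l)))).
  { intros z _. now rewrite hlog_eq. }
  assert (Hv : NB 0 rho (rho / INR k) (fun z => z / k%:C)).
  { apply NB_ext with (fun z => / k%:C * ((z - 0) * 1)); [intros; field; trivial|].
    apply NB_le with (Cmod (/ k%:C) * (rho * Cmod 1))%R.
    - rewrite Cmod_inv, Cmod_Nat2C, Cmod_1 by trivial. unfold Rdiv. lra.
    - apply NB_scal, NB_shift; [lra|apply NB_const]. }
  assert (Hp : (rho / INR k <= / 2)%R).
  { apply (Rmult_le_reg_r (INR k)); trivial. unfold Rdiv.
    rewrite Rmult_assoc, Rinv_l by lra. lra. }
  apply NB_le with (Rsum n (fun r => Cmod (- Gpoly n r 0 * k%:C ^ r)%C *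
    (2 * (rho / INR k) ^ (S (S r))))%R).
  - right. unfold Rdiv. rewrite (Rmult_comm (Rsum _ _)), <- Rsum_scal.
    apply Rsum_ext. intros r _. rewrite Cmod_mult, Cmod_pow, Cmod_Nat2C.
    rewrite Rpow_mult_distr, pow_inv.
    replace (INR k ^ S (S r))%R with (INR k ^ r * INR k ^ 2)%R by (simpl; ring).
    field. split; [lra|]. apply pow_nonzero. lra.
  - apply (NB_sum 0 rho n _ (fun r z => - Gpoly n r 0 * k%:C ^ r *
      (Clog1p (z / k%:C) - Csum 0 (S (S r)) (fun l => log1p_coef l * (z / k%:C) ^ l))));
      trivial.
    intros r _. apply NB_scal.
    apply (NB_log1p_rem 0 rho (rho / INR k) (fun z => z / k%:C)); trivial.
Qed.

Lemma Cexp_pow (l : C) (p : nat) : Cexp l ^ p = Cexp (RtoC (INR p) * l).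
Proof.
  induction p as [|p IH].
  - simpl. rewrite Cmult_0_l, Cexp_0. reflexivity.
  - rewrite S_INR, RtoC_plus. simpl Cpow. rewrite IH, <- Cexp_plus. f_equal. ring.
Qed.

Lemma CpowZ_Cexp (l : C) (m : Z) : CpowZ (Cexp l) m = Cexp (RtoC (IZR m) * l).
Proof.
  destruct m as [|p|p]; unfold CpowZ.
  - now rewrite Cmult_0_l, Cexp_0.
  - rewrite Cexp_pow, INR_IZR_INZ, positive_nat_Z. reflexivity.
  - rewrite Cexp_pow, <- Cexp_opp, INR_IZR_INZ, positive_nat_Z. f_equal.
    rewrite <- Pos2Z.opp_pos, opp_IZR, RtoC_opp. ring.
Qed.

Lemma Zbinom_neg (n k : nat) :
  RtoC (IZR (- Zbinom (- Z.of_nat k) (n - 1))) = - Cbinom (- k%:C) (n - 1).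
Proof.
  rewrite opp_IZR, RtoC_opp, Zbinom_Cbinom. do 2 f_equal.
  rewrite opp_IZR, RtoC_opp, <- INR_IZR_INZ. reflexivity.
Qed.

Lemma gamma_factor_Cexp (n k : nat) (z l : C) :
  Cexp l = 1 + z / k%:C ->
  gamma_factor n z k = Cexp (Phifun n z k - Cbinom (- k%:C) (n - 1) * l).
Proof.
  intros Hl. unfold gamma_factor. rewrite <- Hl, CpowZ_Cexp, Zbinom_neg, <- Cexp_plus.
  f_equal. ring.
Qed.

Lemma Clim_Cexp (u : nat -> C) (l : C) : Clim u l -> Clim (fun n => Cexp (u n)) (Cexp l).
Proof.
  intros H.
  assert (He : psn 0 1 (exp 1) (fun i => epow i 1) Cexp).
  { split.
    - intros n. eapply Rle_trans; [|apply (Rsum_exp_le 1 n); lra].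
      apply Rsum_le. intros i _. unfold epow.
      rewrite Cmod_div, Cmod_pow, Cmod_Nat2C, Cmod_1 by apply fact_neq0_C.
      rewrite !pow1. lra.
    - intros w _. eapply Clim_ext; [|apply Cexp_series]. intros n. simpl.
      apply Csum_ext. intros i _. unfold epow. rewrite Cpow_1_l.
      replace (w - 0) with w by ring. unfold Cdiv. ring. }
  destruct (proj1 (Clim_eps u l) H 1%R Rlt_0_1) as [N HN].
  apply Clim_squeeze with (N := N)
    (v := fun n => (Cmod (Cexp l) * (exp 1 * Cmod (u n - l)))%R).
  - intros n Hn. specialize (HN n Hn).
    replace (Cexp (u n) - Cexp l) with (Cexp l * (Cexp (u n - l) - 1)).
    2:{ rewrite Cexp_minus. field. apply Cexp_neq0. }
    rewrite Cmod_mult. apply Rmult_le_compat_l; [apply Cmod_ge_0|].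
    assert (Hr := psn_remainder 0 1 _ _ _ (u n - l) 1 Rlt_0_1 He).
    replace (u n - l - 0) with (u n - l) in Hr by ring.
    specialize (Hr ltac:(lra)). rewrite Csum0_S, (Csum_nil 0 0), epow_0 in Hr by lia.
    change ((u n - l) ^ 0) with (RtoC 1) in Hr.
    replace (Cexp (u n - l) - (0 + 1 * 1)) with (Cexp (u n - l) - 1) in Hr by ring.
    replace ((Cmod (u n - l) / 1) ^ 1)%R with (Cmod (u n - l)) in Hr by field.
    exact Hr.
  - replace 0%R with (Cmod (Cexp l) * (exp 1 * 0))%R by ring.
    apply is_lim_seq_mult'; [apply is_lim_seq_const|].
    apply is_lim_seq_mult'; [apply is_lim_seq_const|exact H].
Qed.

Definition Pinf (n : nat) (z : C) : C :=
  CLim (fun N => Cprod N (fun i => gamma_factor n z (S i))).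

Lemma polyfun_log_trunc_z (m d : nat) (y : C) (s : nat) :
  (m <= S d)%nat -> polyfun d (fun z => log_trunc m z y s).
Proof.
  intros Hm. apply polyfun_sum. intros i Hi.
  apply polyfun_ext with (fun z => log1p_coef i * y ^ (s - i) * z ^ i); [intros; ring|].
  apply polyfun_scal.
  apply polyfun_pow_le; [apply polyfun_id|lia].
Qed.

Lemma polyfun_Phifun (n k : nat) :
  (1 <= n)%nat -> (1 <= k)%nat -> polyfun n (fun z => Phifun n z k).
Proof.
  intros Hn Hk.
  apply polyfun_ext with (fun z => Csum 0 n (fun r => Gpoly n r 0 / k%:C *
    log_trunc (S (S r)) z k%:C (S r))).
  { intros z. rewrite Phifun_eq by trivial. apply Csum_ext. intros r _.
    unfold Cdiv. ring. }
  apply polyfun_sum. intros r Hr. apply polyfun_scal, polyfun_log_trunc_z. lia.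
Qed.

Lemma analytic_Cexp (f : C -> C) (a : C) :
  analytic_at f a -> analytic_at (fun w => Cexp (f w)) a.
Proof.
  rewrite !analytic_NB. intros (r & m & Hr & Hf). exists r, (exp m).
  split; trivial. now apply NB_exp.
Qed.

Lemma analytic_CpowZ (k : nat) (m : Z) (z : C) :
  (1 <= k)%nat -> z <> - k%:C -> analytic_at (fun w => CpowZ (1 + w / k%:C) m) z.
Proof.
  intros Hk Hz. assert (Hk0 : k%:C <> 0) by (apply Nat2C_neq0; lia).
  assert (Hlin : polyfun 1 (fun w => 1 + w / k%:C)).
  { apply polyfun_ext with (fun w => / k%:C * (w + k%:C)); [intros; field; trivial|].
    apply polyfun_scal, polyfun_shift. }
  destruct m as [|p|p]; unfold CpowZ.
  - apply analytic_const.
  - apply analytic_pow. now apply (polyfun_analytic 1).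
  - assert (Hzk : z + k%:C <> 0).
    { intros H. apply Hz. replace z with (z + k%:C - k%:C) by ring. rewrite H. ring. }
    assert (Hd : (0 < Cmod (- k%:C - z))%R).
    { rewrite <- Cmod_opp. apply Cmod_gt_0.
      now replace (- (- k%:C - z)) with (z + k%:C) by ring. }
    apply analytic_ext with (fun w => (k%:C * / (w - - k%:C)) ^ Pos.to_nat p).
    + exists (Cmod (- k%:C - z)). split; trivial. intros w Hw.
      assert (Hwk : w + k%:C <> 0).
      { intros H. assert (w = - k%:C) by
          (replace w with (w + k%:C - k%:C) by ring; rewrite H; ring).
        subst w. lra. }
      rewrite <- Cpow_inv.
      * f_equal. field. repeat split; trivial.
        now replace (w - - k%:C) with (w + k%:C) by ring.
      * intros H. apply Hwk. replace (w + k%:C) with (k%:C * (1 + w / k%:C))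
          by (field; trivial). rewrite H. ring.
    + apply analytic_pow, analytic_mult; [apply analytic_const|].
      apply analytic_NB. exists (Cmod (- k%:C - z) / 2)%R. eexists. split; [lra|].
      apply NB_inv; lra.
Qed.

Lemma CpowZ_neq0 (x : C) (m : Z) : x <> 0 -> CpowZ x m <> 0.
Proof.
  intros Hx. destruct m as [|p|p]; unfold CpowZ.
  - intros H. apply RtoC_inj in H. lra.
  - now apply Cpow_nz.
  - intros H. assert (H1 := Cpow_nz x (Pos.to_nat p) Hx).
    assert (H2 : x ^ Pos.to_nat p * / x ^ Pos.to_nat p = 1) by (field; trivial).
    rewrite H, Cmult_0_r in H2. apply RtoC_inj in H2. lra.
Qed.

Lemma Cprod_neq0 (n : nat) (f : nat -> C) :
  (forall i, (i < n)%nat -> f i <> 0) -> Cprod n f <> 0.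
Proof.
  induction n as [|n IH]; intros H.
  - simpl. intros E. apply RtoC_inj in E. lra.
  - simpl. apply Cmult_neq_0; auto.
Qed.

(** The product is split at an index depending on [|z|]: finitely many factors, analytic and nonzero
    away from the negative integers, times the exponential of a series convergent in norm. The
    latter never vanishes, so the limit is nonzero. *)
Lemma Pinf_spec (n : nat) (z : C) :
  (1 <= n)%nat -> (forall k, (1 <= k)%nat -> z <> - k%:C) ->
  Clim (fun N => Cprod N (fun i => gamma_factor n z (S i))) (Pinf n z) /\
  Pinf n z <> 0 /\ analytic_at (Pinf n) z.
Proof.
  (* One unit of room makes the disc around 0 contain a neighbourhood of [z]. *)
  intros Hn Hz. set (rho := (Cmod z + 1)%R).
  assert (Hcz := Cmod_ge_0 z). assert (Hrho : (0 < rho)%R) by (unfold rho; lra).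
  destruct (NB_hlog n rho Hn Hrho) as (K & HK0 & HK).
  destruct (INR_unbounded (2 * rho)) as [n0 Hn0].
  assert (Hbig : forall i, (2 * rho <= INR (S (n0 + i)))%R).
  { intros i. apply Rlt_le, (Rlt_le_trans _ _ _ Hn0). apply le_INR. lia. }
  set (h := fun i => hlog n (S (n0 + i))).
  assert (Hh : forall i, NB 0 rho (K * / INR (S i) ^ 2) (h i)).
  { intros i. apply NB_le with (K / INR (S (n0 + i)) ^ 2)%R.
    - apply Rmult_le_compat_l; trivial. apply Rinv_le_contravar.
      + apply pow_lt, lt_0_INR. lia.
      + apply pow_incr. split; [apply pos_INR|apply le_INR; lia].
    - apply HK; [lia|apply Hbig]. }
  assert (HT : forall N, (Rsum N (fun i => K * / INR (S i) ^ 2) <= K * 2)%R).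
  { intros N. rewrite Rsum_scal. apply Rmult_le_compat_l; trivial. apply Rsum_inv_sq. }
  set (H := fun w => CLim (fun N => Csum 0 N (fun i => h i w))).
  assert (HH : forall w, (Cmod (w - 0) <= rho)%R ->
    Clim (fun N => Csum 0 N (fun i => h i w)) (H w)).
  { intros w Hw. destruct (Csum_abs_conv (fun i => h i w)
      (fun i => (K * / INR (S i) ^ 2)%R) (K * 2)) as [l Hl]; trivial.
    - intros i. now apply (NB_bound 0 rho _ (h i) w).
    - unfold H. now rewrite (CLim_unique _ _ Hl). }
  assert (HNB : NB 0 rho (K * 2) H).
  { apply NB_series with (m := fun i => (K * / INR (S i) ^ 2)%R) (f := h); trivial. }
  assert (Hlim : forall w, (Cmod (w - 0) <= rho)%R ->
    Clim (fun N => Cprod N (fun i => gamma_factor n w (S i)))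
      (Cprod n0 (fun i => gamma_factor n w (S i)) * Cexp (H w))).
  { intros w Hw. apply (Clim_incr_n _ _ n0).
    apply Clim_ext with (u := fun N => Cprod n0 (fun i => gamma_factor n w (S i)) *
      Cexp (Csum 0 N (fun i => h i w))).
    - intros N. rewrite (Nat.add_comm N n0), Cprod_add. f_equal.
      induction N as [|N IH]; [simpl; apply Cexp_0|].
      rewrite Csum0_S, Cexp_plus, IH, Cprod_S. f_equal. symmetry.
      apply gamma_factor_Cexp. apply Cexp_log1p.
      rewrite Cmod_div, Cmod_Nat2C by now apply Nat2C_neq0.
      replace (w - 0) with w in Hw by ring.
      assert (Hp : (0 < INR (S (n0 + N)))%R) by (apply lt_0_INR; lia).
      apply (Rmult_le_reg_r (INR (S (n0 + N)))); trivial. unfold Rdiv.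
      rewrite Rmult_assoc, Rinv_l by lra. specialize (Hbig N). lra.
    - apply Clim_mult; [apply Clim_const|]. apply Clim_Cexp. now apply HH. }
  assert (Hz0 : (Cmod (z - 0) <= rho)%R).
  { replace (z - 0) with z by ring. unfold rho. lra. }
  assert (E : forall w, (Cmod (w - 0) <= rho)%R ->
    Pinf n w = Cprod n0 (fun i => gamma_factor n w (S i)) * Cexp (H w)).
  { intros w Hw. apply CLim_unique. now apply Hlim. }
  split; [rewrite E by trivial; now apply Hlim|]. split.
  - rewrite E by trivial. apply Cmult_neq_0; [|apply Cexp_neq0].
    apply Cprod_neq0. intros i _. apply Cmult_neq_0; [|apply Cexp_neq0].
    apply CpowZ_neq0. intros Hc. apply (Hz (S i) ltac:(lia)).
    assert (Hi : (S i)%:C <> 0) by now apply Nat2C_neq0.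
    replace z with ((S i)%:C * (1 + z / (S i)%:C) - (S i)%:C) by (field; trivial).
    rewrite Hc. ring.
  - apply analytic_ext with
      (fun w => Cprod n0 (fun i => gamma_factor n w (S i)) * Cexp (H w)).
    + exists 1%R. split; [lra|]. intros w Hw. apply E.
      replace (w - RtoC 0) with (w - z + z) by ring.
      eapply Rle_trans; [apply Cmod_triangle|]. unfold rho. lra.
    + apply analytic_mult.
      * clear - Hz Hn. induction n0 as [|k IH]; [exact (analytic_const 1 z)|].
        simpl Cprod. apply analytic_mult; trivial.
        apply analytic_mult; [apply analytic_CpowZ; [lia|apply Hz; lia]|].
        apply analytic_Cexp. apply (polyfun_analytic n). apply polyfun_Phifun; [trivial|lia].
      * apply analytic_Cexp. apply analytic_NB. exists 1%R, (K * 2)%R. split; [lra|].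
        apply NB_recentre with (RtoC 0) rho; trivial; [lra|].
        replace (z - 0) with z by ring. unfold rho. lra.
Qed.

(** * Degrees of the exponents *)

Lemma linprod_coef_gt (a c : nat -> C) (n j : nat) :
  (n < j)%nat -> linprod_coef a c n j = 0.
Proof.
  revert j. induction n as [|n IH]; intros [|j] Hj; simpl; try lia; trivial.
  rewrite !IH by lia. ring.
Qed.

(** Each factor [z - i - u] contributes either its [u] or its [z - i]. *)
Lemma polyfun_linprod (n : nat) : forall j d, (n - j <= d)%nat ->
  polyfun d (fun z => linprod_coef (fun i => z - i%:C) (fun _ => - (1)) n j).
Proof.
  induction n as [|n IH]; intros j d Hd.
  - simpl. destruct j; apply polyfun_const.
  - simpl. apply polyfun_plus.
    + destruct (Nat.le_gt_cases j n) as [Hj|Hj].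
      * replace d with (1 + (d - 1))%nat by lia.
        apply (polyfun_mult 1 (d - 1) (fun z => z - n%:C)); [|apply IH; lia].
        apply (polyfun_shift (- n%:C)).
      * apply polyfun_ext with (fun _ => 0); [|apply polyfun_const].
        intros z. rewrite linprod_coef_gt by trivial. ring.
    + apply (polyfun_scal d (- (1)) (fun z => match j with O => 0 | S i =>
        linprod_coef (fun i => z - i%:C) (fun _ => - (1)) n i end)).
      destruct j as [|j]; [apply polyfun_const|apply IH; lia].
Qed.

Lemma polyfun_Gpoly (n j d : nat) : (n - 1 - j <= d)%nat -> polyfun d (Gpoly n j).
Proof.
  intros Hd. unfold Gpoly.
  apply polyfun_ext with (fun z => / (fact (n - 1))%:C *
    linprod_coef (fun i => z - i%:C) (fun _ => - (1)) (n - 1) j).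
  { intros z. unfold Cdiv. ring. }
  apply polyfun_scal, polyfun_linprod. exact Hd.
Qed.

Lemma polyfun_bpoly (b : nat -> C) (k : nat) : polyfun k (bpoly b k).
Proof.
  apply polyfun_sum. intros i Hi.
  apply polyfun_ext with (fun x => b i / (fact (k - i))%:C * x ^ (k - i)).
  { intros x. unfold epow, Cdiv. ring. }
  apply polyfun_scal.
  apply polyfun_pow_le; [apply polyfun_id|lia].
Qed.

Lemma polyfun_Vpoly_z (b : nat -> C) (j : nat) (y : C) :
  polyfun (j + 1) (fun z => Vpoly b j z y).
Proof.
  apply polyfun_minus; [apply polyfun_plus|].
  - apply polyfun_sum. intros s Hs.
    apply polyfun_ext with (fun z => (fact j)%:C / (fact s)%:C *
      (bpoly b (j + 1 - s) z * log_trunc (S s) z y s)).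
    { intros z. unfold bshift_coef, Cdiv. ring. }
    apply polyfun_scal. replace (j + 1)%nat with ((j + 1 - s) + s)%nat at 1 by lia.
    apply (polyfun_mult (j + 1 - s) s); [apply polyfun_bpoly|]. apply polyfun_log_trunc_z. lia.
  - apply polyfun_ext with (fun z => Prest b j (z + y)).
    { intros z. f_equal. ring. }
    apply (polyfun_comp_shift (j + 1) (Prest b j)), polyfun_Prest. lia.
  - apply polyfun_sum. intros r Hr.
    apply polyfun_ext with (fun z => Cbinom j%:C r * Prest b r y * z ^ (j - r)).
    { intros z. ring. }
    apply polyfun_scal.
  apply polyfun_pow_le; [apply polyfun_id|lia].
Qed.

Lemma polyfun_Ffun (B : nat -> C -> C) (zeta : C -> C) (n : nat) :
  is_bernoulli_poly B -> (1 <= n)%nat -> polyfun n (Ffun B zeta n).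
Proof.
  intros hB Hn.
  apply polyfun_ext with (fun z => Csum 0 n (fun j => Gpoly n j z *
      (Vpoly (bnum B) j z 1 - euler_gamma * (z ^ S j / (S j)%:C))) +
    Csum 0 n (fun r => (Gpoly n r 0 - Gpoly n r z) * C_derive zeta (- r%:C))).
  { intros z. now rewrite Ffun_eq. }
  apply polyfun_plus; apply polyfun_sum.
  - intros j Hj.
    apply polyfun_mono with (n - 1 - j + (j + 1))%nat; [lia|]. apply polyfun_mult.
    + now apply polyfun_Gpoly.
    + apply polyfun_minus; [apply polyfun_Vpoly_z|].
      apply polyfun_ext with (fun z => euler_gamma / (S j)%:C * z ^ S j).
      { intros z. unfold Cdiv. ring. }
      apply polyfun_scal.
  apply polyfun_pow_le; [apply polyfun_id|lia].
  - intros r Hr.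
    apply polyfun_ext with (fun z => C_derive zeta (- r%:C) * (Gpoly n r 0 - Gpoly n r z)).
    { intros z. ring. }
    apply polyfun_scal, polyfun_minus; [apply polyfun_const|]. apply polyfun_Gpoly. lia.
Qed.

(** * Real derivatives *)

Lemma sum_n_Rsum (u : nat -> R) (n : nat) : sum_n u n = Rsum (S n) u.
Proof.
  induction n as [|n IH].
  - rewrite sum_O. symmetry. apply Rplus_0_l.
  - rewrite sum_Sn, IH. reflexivity.
Qed.

(** The real parts of the coefficients form a real power series of radius at least [r], so
    derivatives of [f] of every order are read off the complex coefficients. *)
Lemma psn_real_smooth (x r m : R) (c : nat -> C) (F : C -> C) (f : R -> R) :
  (0 < r)%R -> psn (RtoC x) r m c F ->
  (forall t, (Rabs (t - x) <= r)%R -> Re (F (RtoC t)) = f t) ->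
  (forall k t, (Rabs (t - x) < r)%R -> ex_derive_n f k t) /\
  forall k, Derive_n f k x = (Re (c k) * INR (fact k))%R.
Proof.
  intros Hr Hc Hf. set (a := fun i => Re (c i)).
  assert (Hser : forall t, (Rabs (t - x) <= r)%R -> is_pseries a (t - x)%R (f t)).
  { intros t Ht. apply is_pseries_R.
    change (is_lim_seq (sum_n (fun k => a k * (t - x) ^ k)%R) (f t)).
    apply (is_lim_seq_ext
      (fun n => Re (Csum 0 (S n) (fun i => c i * (RtoC t - RtoC x) ^ i)))).
    - intros n. rewrite sum_n_Rsum, Re_Csum. apply Rsum_ext. intros i _.
      rewrite <- RtoC_minus, <- RtoC_pow. destruct (c i) as [c1 c2] eqn:E.
      unfold a. rewrite E. simpl. unfold Re. simpl. ring.
    - apply (is_lim_seq_incr_1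
        (fun n => Re (Csum 0 n (fun i => c i * (RtoC t - RtoC x) ^ i)))).
      rewrite <- Hf by trivial. apply Clim_Re. apply (proj2 Hc).
      now rewrite <- RtoC_minus, Cmod_R. }
  assert (Hrad : Rbar_le r (CV_radius a)).
  { apply (proj1 (CV_radius_bounded a)). exists m. intros n.
    rewrite Rabs_mult, (Rabs_pos_eq (r ^ n)) by (apply pow_le; lra).
    assert (H := psn_coef_le _ _ _ _ _ n Hr Hc).
    assert (Hp : (0 < r ^ n)%R) by now apply pow_lt.
    apply Rle_trans with (Cmod (c n) * r ^ n)%R.
    - apply Rmult_le_compat_r; [lra|apply re_le_Cmod].
    - apply Rle_trans with (m / r ^ n * r ^ n)%R.
      + apply Rmult_le_compat_r; lra.
      + right. field. lra. }
  assert (Hlt : forall y, (y < r)%R -> Rbar_lt y (CV_radius a)).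
  { intros y Hy. eapply Rbar_lt_le_trans; [|exact Hrad]. exact Hy. }
  assert (Hloc : forall t, (Rabs (t - x) < r)%R ->
    locally t (fun s => PSeries a (s + - x) = f s)).
  { intros t Ht. assert (Hd : (0 < r - Rabs (t - x))%R) by lra.
    exists (mkposreal _ Hd). intros s Hs. apply is_pseries_unique.
    apply Hser. change (Rabs (s - t) < r - Rabs (t - x))%R in Hs.
    replace (s - x)%R with ((s - t) + (t - x))%R by ring.
    eapply Rle_trans; [apply Rabs_triang|]. lra. }
  split.
  - intros k t Ht. apply ex_derive_n_ext_loc with (fun s => PSeries a (s + - x)).
    { now apply Hloc. }
    apply (ex_derive_n_comp_trans (PSeries a)). apply ex_derive_n_PSeries. now apply Hlt.
  - intros k. rewrite <- (Derive_n_ext_loc (fun s => PSeries a (s + - x)) f).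
    + rewrite (Derive_n_comp_trans (PSeries a)), Rplus_opp_r, Derive_n_coef; trivial.
      now apply Hlt.
    + apply Hloc. rewrite Rminus_diag, Rabs_R0. exact Hr.
Qed.

(** In the absence of a constant term every summand of the norm gains a factor [p / r]; shrinking
    the disc brings the norm below the 1/2 demanded by [NB_log1p]. *)
Lemma psn_vanish (a : C) (r p m : R) (c : nat -> C) (f : C -> C) :
  (0 < p <= r)%R -> psn a r m c f -> f a = 0 -> psn a p (m * (p / r)) c f.
Proof.
  intros Hp Hc Hfa.
  assert (Hc0 : c 0%nat = 0) by (rewrite <- (psn_at a r m c f); trivial; lra).
  split; [|intros w Hw; apply (proj2 Hc); lra].
  intros n. apply Rle_trans with (Rsum n (fun i => Cmod (c i) * r ^ i) * (p / r))%R.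
  - rewrite Rmult_comm, <- Rsum_scal. apply Rsum_le. intros [|i] _.
    + rewrite Hc0, Cmod_0. lra.
    + assert (Hq : (0 <= p / r <= 1)%R).
      { split; [apply Rlt_le, Rdiv_lt_0_compat; lra|].
        apply (Rmult_le_reg_r r); [lra|]. unfold Rdiv.
        rewrite Rmult_assoc, Rinv_l by lra. lra. }
      replace (p ^ S i)%R with (p / r * ((p / r) ^ i * r ^ S i))%R.
      2:{ replace p with (p / r * r)%R at 3 by (field; lra).
          rewrite Rpow_mult_distr. simpl. ring. }
      assert (H1 : ((p / r) ^ i <= 1)%R).
      { rewrite <- (pow1 i). apply pow_incr. lra. }
      assert (H2 : (0 <= r ^ S i)%R) by (apply pow_le; lra).
      assert (H3 := Cmod_ge_0 (c (S i))).
      replace (Cmod (c (S i)) * (p / r * ((p / r) ^ i * r ^ S i)))%R with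
        (p / r * ((Cmod (c (S i)) * r ^ S i) * (p / r) ^ i))%R by ring.
      apply Rmult_le_compat_l; [lra|].
      rewrite <- (Rmult_1_r (Cmod (c (S i)) * r ^ S i)) at 2.
      apply Rmult_le_compat_l; trivial. now apply Rmult_le_pos.
  - apply Rmult_le_compat_r; [apply Rlt_le, Rdiv_lt_0_compat; lra|apply (proj1 Hc)].
Qed.

(** Near [x] one has [ln f = ln y + ln (1 + (f / y - 1))] with [y = f x > 0]; the second logarithm
    is a power series composed with a function that vanishes at [x]. *)
Lemma ln_smooth (f : C -> C) (x d : R) :
  (0 < d)%R -> analytic_at f (RtoC x) ->
  (forall t, (Rabs (t - x) < d)%R -> Im (f (RtoC t)) = 0%R /\ (0 < Re (f (RtoC t)))%R) ->
  forall k, ex_derive_n (fun t => ln (Re (f (RtoC t)))) k x.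
Proof.
  intros Hd Hf Hpos.
  assert (Hreal : forall t, (Rabs (t - x) < d)%R -> f (RtoC t) = RtoC (Re (f (RtoC t)))).
  { intros t Ht. apply injective_projections; [reflexivity|]. apply (Hpos t Ht). }
  assert (Hx0 : (Rabs (x - x) < d)%R) by (rewrite Rminus_diag, Rabs_R0; lra).
  set (y := Re (f (RtoC x))). assert (Hy : (0 < y)%R) by apply (Hpos x Hx0).
  assert (Hy0 : RtoC y <> 0) by (intros H; apply RtoC_inj in H; lra).
  assert (Hfx : f (RtoC x) = RtoC y) by now apply Hreal.
  set (v := fun w => / RtoC y * f w + - (1)).
  assert (Hva : analytic_at v (RtoC x)).
  { apply analytic_plus; [|apply analytic_const].
    apply (analytic_mult (fun _ => / RtoC y)); [apply analytic_const|exact Hf]. }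
  apply analytic_NB in Hva. destruct Hva as (r & m & Hr & c & Hc).
  assert (Hm := psn_pos _ _ _ _ _ Hc).
  assert (Hvx : v (RtoC x) = 0) by (unfold v; rewrite Hfx; field; trivial).
  (* [m * p / r <= m / (2 * (m + 1)) <= 1/2], and [p <= d / 2] stays where [f] is positive. *)
  set (p := Rmin (d / 2) (Rmin r (r / (2 * (m + 1))))).
  assert (Hp1 : (p <= d / 2)%R) by apply Rmin_l.
  assert (Hp2 : (p <= Rmin r (r / (2 * (m + 1))))%R) by apply Rmin_r.
  assert (Hp3 := Rmin_l r (r / (2 * (m + 1)))).
  assert (Hp4 := Rmin_r r (r / (2 * (m + 1)))).
  assert (Hp : (0 < p)%R).
  { apply Rmin_pos; [lra|]. apply Rmin_pos; trivial.
    apply Rdiv_lt_0_compat; lra. }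
  assert (Hv : NB (RtoC x) p (m * (p / r)) v).
  { exists c. apply psn_vanish; trivial. lra. }
  assert (Hn : (m * (p / r) <= / 2)%R).
  { apply Rle_trans with (m * (/ (2 * (m + 1))))%R.
    - apply Rmult_le_compat_l; trivial. apply (Rmult_le_reg_r r); trivial.
      unfold Rdiv. rewrite Rmult_assoc, Rinv_l by lra.
      unfold Rdiv in Hp4. lra.
    - apply (Rmult_le_reg_r (2 * (m + 1))); [lra|].
      rewrite Rmult_assoc, Rinv_l by lra. lra. }
  assert (HF : NB (RtoC x) p (Cmod (RtoC (ln y)) + 2)
    (fun w => RtoC (ln y) + Clog1p (v w))).
  { apply NB_plus; [lra|apply NB_const|]. now apply NB_log1p with (m * (p / r))%R. }
  destruct HF as [e He].
  destruct (psn_real_smooth x p _ e _ (fun t => ln (Re (f (RtoC t)))) Hp He)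
    as [H _].
  - intros t Ht. assert (Htd : (Rabs (t - x) < d)%R) by lra.
    assert (Hb : (Cmod (v (RtoC t)) <= / 2)%R).
    { eapply Rle_trans; [|exact Hn]. apply (NB_bound (RtoC x) p _ v); trivial.
      now rewrite <- RtoC_minus, Cmod_R. }
    destruct (Hpos t Htd) as [_ Hft].
    assert (Ev : v (RtoC t) = RtoC (Re (f (RtoC t)) / y - 1)).
    { unfold v. rewrite (Hreal t Htd) at 1. rewrite RtoC_minus, <- Cdiv_RtoC.
      unfold Cdiv. ring. }
    rewrite Ev in Hb |- *. rewrite Cmod_R in Hb. rewrite Clog1p_real by trivial.
    rewrite <- RtoC_plus. simpl.
    replace (1 + (Re (f (RtoC t)) / y - 1))%R with (Re (f (RtoC t)) / y)%R by ring.
    unfold Rdiv. rewrite ln_mult, ln_Rinv by (trivial; now apply Rinv_0_lt_compat).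
    ring.
  - intros k. apply H. rewrite Rminus_diag, Rabs_R0. exact Hp.
Qed.

(** * Uniqueness of convex solutions of a difference equation *)

Lemma Derive_n_shift (f : R -> R) (k : nat) (x : R) :
  Derive_n (fun t => f (t + 1)%R) k x = Derive_n f k (x + 1).
Proof. apply Derive_n_comp_trans. Qed.

Lemma locally_pos (x : R) : (0 < x)%R -> locally x (fun t : R => (0 < t)%R).
Proof.
  intros Hx. exists (mkposreal x Hx). intros t Ht.
  apply Rabs_def2 in Ht. simpl in Ht. unfold minus, plus, opp in Ht. simpl in Ht. lra.
Qed.

Lemma Derive_n_MVT (f : R -> R) (k : nat) (x y : R) :
  (forall k t, (0 < t)%R -> ex_derive_n f k t) -> (0 < x)%R -> (x <= y)%R ->
  exists s, (x <= s <= y)%R /\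
    (Derive_n f k y - Derive_n f k x = Derive_n f (S k) s * (y - x))%R.
Proof.
  intros Hf Hx Hxy.
  destruct (MVT_gen (Derive_n f k) x y (Derive_n f (S k))) as (s & Hs & E).
  - intros t Ht. rewrite Rmin_left, Rmax_right in Ht by trivial.
    apply Derive_correct. apply (Hf (S k)). lra.
  - intros t Ht. rewrite Rmin_left, Rmax_right in Ht by trivial.
    apply continuity_pt_filterlim. apply (ex_derive_continuous (V := R_NormedModule)).
    apply (Hf (S k)). lra.
  - rewrite Rmin_left, Rmax_right in Hs by trivial. exists s. split; trivial.
Qed.

(** Derivatives are two-sided and the functions are controlled only for [t >= 0]; so the
    differential hypotheses are stated for [t > 0] and the difference equation carries the value at
    0. *)
Lemma convex_solution_unique (n : nat) (f g u : R -> R) :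
  (forall k t, (0 < t)%R -> ex_derive_n f k t) ->
  (forall k t, (0 < t)%R -> ex_derive_n g k t) ->
  (forall t, (0 < t)%R -> (0 <= Derive_n f (S n) t)%R) ->
  (forall t, (0 < t)%R -> (0 <= Derive_n g (S n) t)%R) ->
  (forall t, (0 <= t)%R -> f (t + 1)%R = (f t + u t)%R) ->
  (forall t, (0 <= t)%R -> g (t + 1)%R = (g t + u t)%R) ->
  (forall t, (0 < t)%R -> is_lim_seq (fun N => Derive_n u n (t + INR N)) 0%R) ->
  f 0%R = g 0%R -> forall t, (0 <= t)%R -> f t = g t.
Proof.
  intros Hf Hg Hf2 Hg2 Hfu Hgu Hu H0.
  set (p := fun t => (f t - g t)%R).
  assert (Hl : forall (h : R -> R), (forall k t, (0 < t)%R -> ex_derive_n h k t) ->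
    forall x m, (0 < x)%R -> locally x (fun y : R => forall k, (k <= m)%nat -> ex_derive_n h k y)).
  { intros h Hh x m Hx. apply filter_imp with (2 := locally_pos x Hx). auto. }
  assert (Hp : forall k t, (0 < t)%R -> ex_derive_n p k t).
  { intros k t Ht. apply ex_derive_n_minus; now apply Hl. }
  assert (Hpd : forall k t, (0 < t)%R -> Derive_n p k t = (Derive_n f k t - Derive_n g k t)%R).
  { intros k t Ht. apply Derive_n_minus; now apply Hl. }
  assert (Hper : forall k t, (0 < t)%R -> Derive_n p k (t + 1) = Derive_n p k t).
  { intros k t Ht. rewrite <- Derive_n_shift. apply Derive_n_ext_loc.
    apply filter_imp with (2 := locally_pos t Ht). intros s Hs. unfold p.
    rewrite Hfu, Hgu by lra. ring. }
  assert (HperN : forall k N t, (0 < t)%R -> Derive_n p k (t + INR N) = Derive_n p k t).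
  { intros k N t Ht. induction N as [|N IH]; [simpl; now rewrite Rplus_0_r|].
    rewrite S_INR, <- Rplus_assoc, Hper; trivial. assert (HN := pos_INR N). lra. }
  assert (Hud : forall h, (forall k t, (0 < t)%R -> ex_derive_n h k t) ->
    (forall t, (0 <= t)%R -> h (t + 1)%R = (h t + u t)%R) ->
    forall t, (0 < t)%R -> Derive_n u n t = (Derive_n h n (t + 1) - Derive_n h n t)%R).
  { intros h Hh Hhu t Ht. rewrite <- Derive_n_shift, <- Derive_n_minus.
    - apply Derive_n_ext_loc. apply filter_imp with (2 := locally_pos t Ht).
      intros s Hs. rewrite Hhu by lra. ring.
    - apply filter_imp with (2 := locally_pos t Ht). intros s Hs k _.
      apply ex_derive_n_comp_trans. apply Hh. lra.
    - now apply Hl. }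
  assert (Hmono : forall h, (forall k t, (0 < t)%R -> ex_derive_n h k t) ->
    (forall t, (0 < t)%R -> (0 <= Derive_n h (S n) t)%R) ->
    forall x y, (0 < x)%R -> (x <= y)%R -> (Derive_n h n x <= Derive_n h n y)%R).
  { intros h Hh Hh2 x y Hx Hxy. destruct (Derive_n_MVT h n x y Hh Hx Hxy) as (s & Hs & E).
    assert (Hs2 := Hh2 s ltac:(lra)). nra. }
  assert (Hc1 : forall x y, (0 < x)%R -> (x <= y <= x + 1)%R ->
    Derive_n p n y = Derive_n p n x).
  { intros x y Hx Hy.
    (* Monotonicity of the [n]-th derivatives bounds the variation of those of
       [f] and [g] on a unit interval by their increment, that is by [u]. *)
    assert (Hb : forall N, (Rabs (Derive_n p n y - Derive_n p n x) <=
      Derive_n u n (x + INR N))%R).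
    { intros N. assert (HN := pos_INR N).
      rewrite <- (HperN n N y), <- (HperN n N x) by lra. rewrite !Hpd by lra.
      assert (F1 := Hmono f Hf Hf2 (x + INR N)%R (y + INR N)%R ltac:(lra) ltac:(lra)).
      assert (F2 := Hmono f Hf Hf2 (y + INR N)%R (x + INR N + 1)%R ltac:(lra) ltac:(lra)).
      assert (G1 := Hmono g Hg Hg2 (x + INR N)%R (y + INR N)%R ltac:(lra) ltac:(lra)).
      assert (G2 := Hmono g Hg Hg2 (y + INR N)%R (x + INR N + 1)%R ltac:(lra) ltac:(lra)).
      assert (U1 := Hud f Hf Hfu (x + INR N)%R ltac:(lra)).
      assert (U2 := Hud g Hg Hgu (x + INR N)%R ltac:(lra)).
      apply Rabs_le. lra. }
    assert (Hle : (Rabs (Derive_n p n y - Derive_n p n x) <= 0)%R).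
    { apply (is_lim_seq_le (fun _ => Rabs (Derive_n p n y - Derive_n p n x))
        (fun N => Derive_n u n (x + INR N)) (Rabs (Derive_n p n y - Derive_n p n x)) 0%R); auto.
      apply is_lim_seq_const. }
    assert (Ha := Rle_abs (Derive_n p n y - Derive_n p n x)).
    assert (Hb2 := Rle_abs (- (Derive_n p n y - Derive_n p n x))).
    rewrite Rabs_Ropp in Hb2. lra. }
  assert (HcN : forall N x y, (0 < x)%R -> (x <= y <= x + INR N)%R ->
    Derive_n p n y = Derive_n p n x).
  { induction N as [|N IH]; intros x y Hx Hy.
    - simpl in Hy. now replace y with x by lra.
    - rewrite S_INR in Hy. destruct (Rle_lt_dec y (x + INR N)) as [Hc|Hc].
      + apply IH; lra.
      + assert (HN := pos_INR N).
        rewrite (Hc1 (x + INR N)%R y) by lra. apply IH; lra. }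
  assert (Hcn : forall x, (0 < x)%R -> Derive_n p n x = Derive_n p n 1).
  { intros x Hx. destruct (Rle_lt_dec x 1) as [Hc|Hc].
    - symmetry. apply (HcN 1%nat); simpl; lra.
    - destruct (INR_unbounded x) as [N HN]. apply (HcN N); lra. }
  (* Descent on the order: a periodic function with constant derivative has derivative 0, by the
     mean value theorem over one period, hence is itself constant. *)
  assert (Hk : forall k, (k <= n)%nat -> forall x, (0 < x)%R ->
    Derive_n p (n - k) x = Derive_n p (n - k) 1).
  { induction k as [|k IH]; intros Hkn x Hx; [rewrite Nat.sub_0_r; auto|].
    assert (E : S (n - S k) = (n - k)%nat) by lia.
    assert (Hz : Derive_n p (n - k) 1 = 0%R).
    { destruct (Derive_n_MVT p (n - S k) 1 (1 + 1) Hp ltac:(lra) ltac:(lra)) as (s & Hs & Es).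
      rewrite E, Hper, (IH ltac:(lia) s) in Es by lra. lra. }
    assert (Hw : forall x y, (0 < x)%R -> (x <= y)%R ->
      Derive_n p (n - S k) y = Derive_n p (n - S k) x).
    { intros a c Ha Hac.
      destruct (Derive_n_MVT p (n - S k) a c Hp Ha Hac) as (s & Hs & Es).
      rewrite E, (IH ltac:(lia) s), Hz in Es by lra. lra. }
    destruct (Rle_lt_dec x 1) as [Hc|Hc]; [symmetry; apply Hw; lra|apply Hw; lra]. }
  (* Constancy is known only for [t > 0]; the difference equation transports the value 0 from
     [t = 0] to [t = 1]. *)
  assert (H1 : p 1%R = 0%R).
  { unfold p. replace 1%R with (0 + 1)%R by ring.
    rewrite Hfu, Hgu, H0 by lra. ring. }
  intros t [Ht|<-]; [|exact H0].
  assert (Ht2 := Hk n (Nat.le_refl n) t Ht). rewrite Nat.sub_diag in Ht2.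
  simpl in Ht2. rewrite H1 in Ht2. unfold p in Ht2. lra.
Qed.

(** * Derivatives of the candidate for [log G_n] *)

Lemma polyfun_psn (a : C) (r : R) (n : nat) (F : C -> C) :
  (0 <= r)%R -> polyfun n F ->
  exists m c, psn a r m c F /\ forall i, (n < i)%nat -> c i = 0.
Proof.
  intros Hr HF. destruct (polyfun_comp_shift n F a HF) as [c Hc].
  set (e := fun i => if (i <=? n)%nat then c i else 0).
  assert (He : forall i, (S n <= i)%nat -> e i = 0).
  { intros i Hi. unfold e. destruct (Nat.leb_spec i n); [lia|reflexivity]. }
  eexists. exists e. split; [|exact He].
  eapply psn_ext; [|exact (psn_finite a r (S n) e Hr He)].
  intros w _. cbv beta. transitivity (F (w - a + a)); [|f_equal; ring].
  rewrite Hc. apply Csum_ext. intros i Hi. unfold e.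
  destruct (Nat.leb_spec i n); [reflexivity|lia].
Qed.

Lemma psn_log1p_lin (a q : C) (r : R) :
  (0 < r)%R -> (Cmod q * r <= / 2)%R ->
  psn a r 2 (fun i => log1p_coef i * q ^ i) (fun w => Clog1p (q * (w - a))).
Proof.
  intros Hr Hq. assert (Hcq := Cmod_ge_0 q). split.
  - intros n. apply Rle_trans with (Rsum n (fun i => (Cmod q * r) ^ (0 + i))%R).
    + apply Rsum_le. intros i _. rewrite Cmod_mult, Cmod_pow. simpl Nat.add.
      rewrite Rpow_mult_distr, Rmult_assoc.
      rewrite <- (Rmult_1_l (Cmod q ^ i * r ^ i)) at 2.
      apply Rmult_le_compat_r; [|apply Cmod_log1p_coef].
      apply Rmult_le_pos; apply pow_le; lra.
    + eapply Rle_trans; [apply Rsum_half_pow; nra|]. simpl. lra.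
  - intros w Hw. eapply Clim_ext; [|apply Clog1p_series].
    + intros n. simpl. apply Csum_ext. intros i _. rewrite Cpow_mult_l. ring.
    + rewrite Cmod_mult. nra.
Qed.

Lemma psn_NB_coef (a : C) (r m m' : R) (c : nat -> C) (f : C -> C) :
  (0 < r)%R -> psn a r m c f -> NB a r m' f -> psn a r m' c f.
Proof.
  intros Hr Hc [c' Hc']. apply psn_coef_ext with c'; trivial.
  apply (psn_unique a r _ _ _ _ f f Hr Hc' Hc).
  apply agree_near_at_acc. exists 1%R. split; [lra|reflexivity].
Qed.

(** The logarithm of [1 + w / k] is recentred at the real point [x]: its series at 0 would fail for
    small [k], whereas [|w - x| / (k + x)] is small for every [k >= 1]. Here the index [k] stands
    for [k + 1]. *)
Definition glog (n : nat) (x : R) (k : nat) (w : C) : C :=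
  Phifun n w (S k) - Cbinom (- (S k)%:C) (n - 1) *
    (RtoC (ln (1 + x / INR (S k))) + Clog1p (/ RtoC (INR (S k) + x) * (w - RtoC x))).

(** At order [n + 1] the polynomial [Phi_n] and the constant contribute 0, so the coefficient is
    that of the logarithm alone. *)
Lemma glog_psn (n : nat) (x : R) (k : nat) (r : R) :
  (1 <= n)%nat -> (0 <= x)%R -> (0 < r <= / 2)%R ->
  exists m c, psn (RtoC x) r m c (glog n x k) /\
    c (S n) = - Cbinom (- (S k)%:C) (n - 1) *
      (log1p_coef (S n) * (/ RtoC (INR (S k) + x)) ^ S n).
Proof.
  intros Hn Hx Hr.
  assert (Hk : (1 <= INR (S k))%R) by (apply (le_INR 1); lia).
  destruct (polyfun_psn (RtoC x) r n (fun w => Phifun n w (S k)) ltac:(lra)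
    (polyfun_Phifun n (S k) Hn ltac:(lia))) as (m1 & c1 & Hc1 & Hz1).
  destruct (polyfun_psn (RtoC x) r n (fun _ => RtoC (ln (1 + x / INR (S k)))) ltac:(lra)
    (polyfun_const n _)) as (m2 & c2 & Hc2 & Hz2).
  assert (Hq : (Cmod (/ RtoC (INR (S k) + x)) * r <= / 2)%R).
  { rewrite <- RtoC_Rinv, Cmod_R, Rabs_pos_eq by
      (apply Rlt_le, Rinv_0_lt_compat; lra).
    assert (H : (/ (INR (S k) + x) <= 1)%R).
    { rewrite <- Rinv_1. apply Rinv_le_contravar; lra. }
    nra. }
  assert (Hc3 := psn_log1p_lin (RtoC x) (/ RtoC (INR (S k) + x)) r ltac:(lra) Hq).
  assert (Hs := psn_plus _ _ _ _ _ _ _ _ Hc1 (psn_scal _ _ _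
    (- Cbinom (- (S k)%:C) (n - 1)) _ _ (psn_plus _ _ _ _ _ _ _ _ Hc2 Hc3 ltac:(lra)))
    ltac:(lra)).
  eexists. eexists. split.
  - eapply psn_ext; [|exact Hs]. intros w _. cbv beta. unfold glog. ring.
  - cbv beta. rewrite Hz1, Hz2 by lia. ring.
Qed.

Lemma ln_shift (x t y : R) :
  (0 < y)%R -> (0 <= x)%R -> (0 <= t)%R ->
  (ln (1 + x / y) + ln (1 + / (y + x) * (t - x)) = ln (1 + t / y))%R.
Proof.
  intros Hy Hx Ht.
  replace (1 + x / y)%R with ((y + x) / y)%R by (field; lra).
  replace (1 + / (y + x) * (t - x))%R with ((y + t) / (y + x))%R by (field; lra).
  replace (1 + t / y)%R with ((y + t) / y)%R by (field; lra).
  rewrite <- ln_mult by (apply Rdiv_lt_0_compat; lra). f_equal. field. lra.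
Qed.

Lemma glog_real (n : nat) (x t : R) (k : nat) :
  (0 <= x)%R -> (0 <= t)%R -> (Rabs (t - x) <= / 2)%R ->
  glog n x k (RtoC t) = Phifun n (RtoC t) (S k) -
    Cbinom (- (S k)%:C) (n - 1) * RtoC (ln (1 + t / INR (S k))).
Proof.
  intros Hx Ht Hd. assert (Hk : (1 <= INR (S k))%R) by (apply (le_INR 1); lia).
  unfold glog. rewrite <- RtoC_Rinv, <- RtoC_minus, <- RtoC_mult, Clog1p_real.
  - rewrite <- RtoC_plus, ln_shift by (trivial; lra). reflexivity.
  - rewrite Rabs_mult, (Rabs_pos_eq (/ _)) by (apply Rlt_le, Rinv_0_lt_compat; lra).
    assert (H : (/ (INR (S k) + x) <= 1)%R).
    { rewrite <- Rinv_1. apply Rinv_le_contravar; lra. }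
    assert (H2 : (0 < / (INR (S k) + x))%R) by (apply Rinv_0_lt_compat; lra).
    nra.
Qed.

(** For large [k] the identity theorem on reals near [x] shows that [glog] is [hlog], whose norm is
    [O(k^(-2))]; the other terms merely have finite norm. *)
Lemma glog_summable (n : nat) (x r : R) :
  (1 <= n)%nat -> (0 <= x)%R -> (0 < r <= / 2)%R ->
  exists M T, (forall k, NB (RtoC x) r (M k) (glog n x k)) /\
    forall N, (Rsum N M <= T)%R.
Proof.
  intros Hn Hx Hr.
  assert (Hcx : Cmod (RtoC x) = x) by (rewrite Cmod_R; now apply Rabs_pos_eq).
  destruct (NB_hlog n (x + 1) Hn ltac:(lra)) as (K & HK0 & HK).
  destruct (INR_unbounded (2 * (x + 1))) as [n0 Hn0].
  apply (NB_eventually (RtoC x) r (K * 2) (glog n x) (fun k => K * / INR (S k) ^ 2)%R n0).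
  - intros k. apply Rmult_le_pos; trivial. apply Rlt_le, Rinv_0_lt_compat, pow_lt.
    apply lt_0_INR. lia.
  - intros N. rewrite Rsum_scal. apply Rmult_le_compat_l; trivial. apply Rsum_inv_sq.
  - intros k. destruct (glog_psn n x k r Hn Hx Hr) as (m & c & Hc & _).
    exists m, c. exact Hc.
  - intros k Hk.
    assert (Hk2 : (2 * (x + 1) <= INR (S k))%R).
    { apply Rlt_le, (Rlt_le_trans _ _ _ Hn0). apply le_INR. lia. }
    assert (Hh : NB (RtoC x) r (K * / INR (S k) ^ 2) (hlog n (S k))).
    { apply NB_recentre with (RtoC 0) (x + 1)%R; [lra| |apply HK; [lia|trivial]].
      replace (RtoC x - 0) with (RtoC x) by ring. lra. }
    apply NB_ext with (2 := Hh).
    destruct (glog_psn n x k r Hn Hx Hr) as (m & c & Hc & _).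
    apply (NB_agree (RtoC x) r (K * / INR (S k) ^ 2) m); trivial; [lra|now exists c|].
    intros eps He. set (d := Rmin (eps / 2) (/ 2)).
    assert (H1 := Rmin_l (eps / 2) (/ 2)). assert (H2 := Rmin_r (eps / 2) (/ 2)).
    assert (H3 : (0 < d)%R) by (apply Rmin_pos; lra). fold d in H1, H2.
    exists (RtoC (x + d)).
    replace (RtoC (x + d) - RtoC x) with (RtoC d) by (rewrite RtoC_plus; ring).
    rewrite Cmod_R, Rabs_pos_eq by lra. repeat split; [|lra|].
    + intros E. apply RtoC_inj in E. lra.
    + rewrite glog_real; try lra.
      2:{ replace (x + d - x)%R with d by ring. rewrite Rabs_pos_eq; lra. }
      unfold hlog. unfold Nat2C at 2. rewrite Cdiv_RtoC, Clog1p_pos; [reflexivity|].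
      assert (Hkp : (0 < INR (S k))%R) by lra. split.
      * apply Rmult_le_pos; [lra|]. apply Rlt_le, Rinv_0_lt_compat, Hkp.
      * apply (Rmult_lt_reg_r (INR (S k))); trivial. unfold Rdiv.
        rewrite Rmult_assoc, Rinv_l by lra. lra.
Qed.

(** [binom(k + q - 1, q)], the absolute value of [binom(-k, q)] for [k >= 0]. *)
Fixpoint rising (k : R) (q : nat) : R :=
  match q with
  | O => 1%R
  | S p => (rising k p * ((k + INR p) / INR (S p)))%R
  end.

Lemma Cbinom_neg_rising (k q : nat) :
  Cbinom (- k%:C) q = (- (1)) ^ q * RtoC (rising (INR k) q).
Proof.
  induction q as [|q IH].
  - unfold Cbinom, Nat2C. simpl. field.
  - rewrite Cbinom_S, IH. cbn [rising]. rewrite RtoC_mult, <- Cdiv_RtoC, RtoC_plus.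
    fold (Nat2C (S q)). fold (Nat2C k). fold (Nat2C q).
    change ((- (1)) ^ S q) with (- (1) * (- (1)) ^ q). unfold Cdiv. ring.
Qed.

Lemma rising_pos (k : R) (q : nat) : (0 <= k)%R -> (0 <= rising k q)%R.
Proof.
  intros Hk. induction q as [|q IH]; cbn [rising]; [lra|].
  apply Rmult_le_pos; trivial. apply Rmult_le_pos.
  - assert (H := pos_INR q). lra.
  - apply Rlt_le, Rinv_0_lt_compat, lt_0_INR. lia.
Qed.

Lemma rising_le (n k : nat) :
  (1 <= n)%nat -> (1 <= k)%nat ->
  (rising (INR k) (n - 1) <= Rsum n (fun r => Cmod (Gpoly n r 0)) * INR k ^ (n - 1))%R.
Proof.
  intros Hn Hk. assert (Hk1 : (1 <= INR k)%R) by (apply (le_INR 1); lia).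
  assert (E : rising (INR k) (n - 1) = Cmod (Cbinom (- k%:C) (n - 1))).
  { rewrite Cbinom_neg_rising, Cmod_mult, Cmod_pow, Cmod_m1, pow1, Rmult_1_l, Cmod_R.
    rewrite Rabs_pos_eq; trivial. apply rising_pos. lra. }
  rewrite E, Cbinom_neg_eq by trivial. rewrite Rmult_comm, <- Rsum_scal.
  apply Cmod_Csum_le. intros r Hr. rewrite Cmod_mult, Cmod_pow, Cmod_Nat2C, Rmult_comm.
  apply Rmult_le_compat_r; [apply Cmod_ge_0|]. apply Rle_pow; [trivial|lia].
Qed.

(** The (n+1)-st derivative of the [k]-th term of [log G_n(x+1)]. The signs, one minus, [(-1)^(n-1)]
    from the binomial and [(-1)^n] from the logarithm, multiply to 1. *)
Definition dterm (n : nat) (x : R) (k : nat) : R :=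
  (INR (fact n) * rising (INR (S k)) (n - 1) * (/ (INR (S k) + x)) ^ S n)%R.

Lemma dterm_coef (n : nat) (x : R) (k : nat) :
  (1 <= n)%nat -> (0 <= x)%R ->
  (Re (- Cbinom (- (S k)%:C) (n - 1) *
      (log1p_coef (S n) * (/ RtoC (INR (S k) + x)) ^ S n)) * INR (fact (S n)))%R =
  dterm n x k.
Proof.
  intros Hn Hx. rewrite Cbinom_neg_rising. simpl log1p_coef.
  assert (HS : INR (S n) <> 0%R) by now apply not_0_INR.
  replace ((- (1)) ^ n) with (- (1) * (- (1)) ^ (n - 1)).
  2:{ replace n with (S (n - 1)) at 2 by lia. reflexivity. }
  assert (Hm := Cpow_m1_sq (n - 1)). set (s := (- (1)) ^ (n - 1)) in *.
  rewrite <- RtoC_Rinv, <- RtoC_pow.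
  replace (- (s * RtoC (rising (INR (S k)) (n - 1))) *
    (- (1) * s / (S n)%:C * RtoC ((/ (INR (S k) + x)) ^ S n))) with
    (s * s * (RtoC (rising (INR (S k)) (n - 1)) * (/ (S n)%:C *
      RtoC ((/ (INR (S k) + x)) ^ S n)))) by (unfold Cdiv; ring).
  rewrite Hm, Cmult_1_l. unfold Nat2C. rewrite <- RtoC_Rinv, <- !RtoC_mult.
  unfold dterm. rewrite fact_simpl, mult_INR. unfold Re, RtoC. cbn [fst].
  field. exact HS.
Qed.

Lemma dterm_pos (n : nat) (x : R) (k : nat) : (0 <= x)%R -> (0 <= dterm n x k)%R.
Proof.
  intros Hx. assert (Hk : (1 <= INR (S k))%R) by (apply (le_INR 1); lia).
  unfold dterm. apply Rmult_le_pos; [apply Rmult_le_pos; [apply pos_INR|]|].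
  - apply rising_pos. lra.
  - apply pow_le, Rlt_le, Rinv_0_lt_compat. lra.
Qed.

(** With [y = k + 1 + x] the binomial is [O(y^(n-1))], so a term is [O(1 / y^2)], compared with the
    telescoping [1/(y-1) - 1/y]. The resulting decay in [1/x] is what uniqueness needs one level
    higher. *)
Lemma dterm_sum_le (n : nat) (x : R) (N : nat) :
  (1 <= n)%nat -> (0 < x)%R ->
  (Rsum N (dterm n x) <=
   INR (fact n) * Rsum n (fun r => Cmod (Gpoly n r 0)) * / x)%R.
Proof.
  intros Hn Hx. set (Q := Rsum n (fun r => Cmod (Gpoly n r 0))).
  assert (HQ : (0 <= Q)%R) by (apply Rsum_pos; intros; apply Cmod_ge_0).
  assert (Hf := pos_INR (fact n)).
  assert (H1 : forall k, (dterm n x k <=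
    INR (fact n) * Q * (/ (INR k + x) - / (INR (S k) + x)))%R).
  { intros k. assert (Hk : (1 <= INR (S k))%R) by (apply (le_INR 1); lia).
    unfold dterm. set (y := (INR (S k) + x)%R).
    assert (Hy : (1 < y)%R) by (unfold y; lra).
    assert (Hiy : (0 < / y)%R) by (apply Rinv_0_lt_compat; lra).
    assert (Hr := rising_le n (S k) Hn ltac:(lia)). fold Q in Hr.
    rewrite !Rmult_assoc. apply Rmult_le_compat_l; trivial.
    apply Rle_trans with (Q * INR (S k) ^ (n - 1) * (/ y) ^ S n)%R.
    - apply Rmult_le_compat_r; trivial. apply pow_le. lra.
    - rewrite Rmult_assoc. apply Rmult_le_compat_l; trivial.
      apply Rle_trans with (y ^ (n - 1) * (/ y) ^ S n)%R.
      + apply Rmult_le_compat_r; [apply pow_le; lra|]. apply pow_incr. unfold y. lra.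
      + replace (S n) with ((n - 1) + 2)%nat by lia.
        rewrite pow_add, <- Rmult_assoc, <- Rpow_mult_distr, Rinv_r, pow1, Rmult_1_l by lra.
        replace (INR k + x)%R with (y - 1)%R by (unfold y; rewrite S_INR; ring).
        replace (/ (y - 1) - / y)%R with (/ ((y - 1) * y))%R by (field; lra).
        rewrite pow_inv. apply Rinv_le_contravar; nra. }
  apply Rle_trans with (Rsum N (fun k =>
    INR (fact n) * Q * (/ (INR k + x) - / (INR (S k) + x)))%R).
  { apply Rsum_le. auto. }
  rewrite Rsum_scal. apply Rmult_le_compat_l; [now apply Rmult_le_pos|].
  assert (E : Rsum N (fun k => / (INR k + x) - / (INR (S k) + x))%R =
    (/ x - / (INR N + x))%R).
  { induction N as [|N IH]; [simpl; rewrite Rplus_0_l; ring|].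
    cbn [Rsum]. rewrite IH. ring. }
  rewrite E. assert (HN := pos_INR N).
  assert (H2 : (0 < / (INR N + x))%R) by (apply Rinv_0_lt_compat; lra). lra.
Qed.

Lemma ell_smooth (B : nat -> C -> C) (zeta : C -> C) (n : nat) (x : R) :
  is_bernoulli_poly B -> is_riemann_zeta zeta -> (1 <= n)%nat -> (0 < x)%R ->
  (forall k, ex_derive_n (fun t => Re (ell (bnum B) n t)) k x) /\
  is_lim_seq (fun N => Rsum N (dterm n x))
    (Derive_n (fun t => Re (ell (bnum B) n t)) (S n) x).
Proof.
  intros hB hz Hn Hx. assert (Hb := bnum_rec B hB).
  (* [r <= x] keeps the real points of the disc nonnegative, where [ell_formula] holds; 1/2 is the
     radius for [glog]. *)
  set (r := Rmin (/ 2) x).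
  assert (Hr1 : (r <= / 2)%R) by apply Rmin_l. assert (Hr2 : (r <= x)%R) by apply Rmin_r.
  assert (Hr : (0 < r)%R) by (apply Rmin_pos; lra).
  destruct (glog_summable n x r Hn ltac:(lra) ltac:(lra)) as (M & T & HM & HT).
  assert (Hex : forall k, exists c, psn (RtoC x) r (M k) c (glog n x k) /\
    c (S n) = - Cbinom (- (S k)%:C) (n - 1) *
      (log1p_coef (S n) * (/ RtoC (INR (S k) + x)) ^ S n)).
  { intros k. destruct (glog_psn n x k r Hn ltac:(lra) ltac:(lra)) as (m & c & Hc & E).
    exists c. split; trivial. now apply psn_NB_coef with m. }
  set (c := fun k => proj1_sig (constructive_indefinite_description _ (Hex k))).
  assert (Hc : forall k, psn (RtoC x) r (M k) (c k) (glog n x k) /\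
    c k (S n) = - Cbinom (- (S k)%:C) (n - 1) *
      (log1p_coef (S n) * (/ RtoC (INR (S k) + x)) ^ S n)).
  { intros k. exact (proj2_sig (constructive_indefinite_description _ (Hex k))). }
  destruct (psn_series_coef (RtoC x) r T M c (glog n x) Hr (fun k => proj1 (Hc k)) HT)
    as [D HD].
  set (F := fun w => CLim (fun N => Csum 0 N (fun k => glog n x k w))).
  assert (HF : forall w, (Cmod (w - RtoC x) <= r)%R ->
    Clim (fun N => Csum 0 N (fun k => glog n x k w)) (F w)).
  { intros w Hw. destruct (Csum_abs_conv (fun k => glog n x k w) M T) as [l Hl]; trivial.
    - intros k. now apply (NB_bound (RtoC x) r (M k) (glog n x k) w).
    - unfold F. now rewrite (CLim_unique _ _ Hl). }
  assert (HpF : psn (RtoC x) r T D F).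
  { apply psn_series with M c (glog n x); trivial; [lra|]. intros k. apply Hc. }
  destruct (polyfun_psn (RtoC x) r n (Ffun B zeta n) ltac:(lra) (polyfun_Ffun B zeta n hB Hn))
    as (m1 & c1 & Hc1 & Hz1).
  assert (Hp := psn_plus _ _ _ _ _ _ _ _ Hc1 HpF ltac:(lra)).
  destruct (psn_real_smooth x r _ _ _ (fun t => Re (ell (bnum B) n t)) Hr Hp) as [H1 H2].
  - intros t Ht. cbv beta. f_equal.
    assert (Hxt : (0 <= t)%R) by (apply Rabs_le_between in Ht; lra).
    assert (Hl := ell_formula B zeta n t hB Hn Hxt
      (fun r _ => zeta_seq_lim (bnum B) r zeta Hb hz)).
    assert (E : F (RtoC t) = ell (bnum B) n t - Ffun B zeta n t).
    { apply CLim_unique. eapply Clim_ext; [|exact Hl]. intros N. simpl.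
      apply Csum_ext. intros k _. symmetry. apply glog_real; lra. }
    rewrite E. ring.
  - split.
    + intros k. apply H1. rewrite Rminus_diag, Rabs_R0. exact Hr.
    + rewrite H2. cbv beta. rewrite Hz1, Cplus_0_l by lia.
      apply (is_lim_seq_ext (fun N => Re (Csum 0 N (fun k => c k (S n))) * INR (fact (S n)))%R).
      * intros N. rewrite Re_Csum, Rmult_comm, <- Rsum_scal. apply Rsum_ext.
        intros k _. rewrite Rmult_comm, (proj2 (Hc k)). apply dterm_coef; [trivial|lra].
      * apply is_lim_seq_mult'; [|apply is_lim_seq_const]. apply Clim_Re, HD.
Qed.

Lemma ell_derive_bounds (B : nat -> C -> C) (zeta : C -> C) (n : nat) :
  is_bernoulli_poly B -> is_riemann_zeta zeta -> (1 <= n)%nat ->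
  exists K, forall x, (0 < x)%R ->
    (0 <= Derive_n (fun t => Re (ell (bnum B) n t)) (S n) x <= K * / x)%R.
Proof.
  intros hB hz Hn.
  exists (INR (fact n) * Rsum n (fun r => Cmod (Gpoly n r 0)))%R. intros x Hx.
  destruct (ell_smooth B zeta n x hB hz Hn Hx) as [_ Hl]. split.
  - apply (is_lim_seq_le (fun _ => 0%R) (fun N => Rsum N (dterm n x)) 0%R
      (Derive_n (fun t => Re (ell (bnum B) n t)) (S n) x)); trivial.
    + intros N. apply Rsum_pos. intros k. apply dterm_pos. lra.
    + apply is_lim_seq_const.
  - apply (is_lim_seq_le (fun N => Rsum N (dterm n x)) (fun _ =>
      (INR (fact n) * Rsum n (fun r => Cmod (Gpoly n r 0)) * / x)%R)
      (Derive_n (fun t => Re (ell (bnum B) n t)) (S n) x)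
      (INR (fact n) * Rsum n (fun r => Cmod (Gpoly n r 0)) * / x)%R); trivial.
    + intros N. now apply dterm_sum_le.
    + apply is_lim_seq_const.
Qed.

Lemma Gpoly_real (n j : nat) (x : R) : Im (Gpoly n j (RtoC x)) = 0%R.
Proof.
  unfold Gpoly, Cdiv, Nat2C. rewrite <- RtoC_Rinv. apply Im_Cmult_0; [|reflexivity].
  revert j. induction (n - 1)%nat as [|m IH]; intros j.
  - destruct j; reflexivity.
  - cbn [linprod_coef]. apply Im_Cplus_0; apply Im_Cmult_0; trivial.
    + simpl. ring.
    + simpl. ring.
    + destruct j; [reflexivity|apply IH].
Qed.

Lemma ell_real (b : nat -> C) (n : nat) (x : R) :
  bern_rec b -> (0 <= x)%R -> ell b n x = RtoC (Re (ell b n x)).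
Proof.
  intros Hb Hx. apply injective_projections; [reflexivity|].
  apply (Im_Csum_0 n (fun j => Gpoly n j x * Dfun b j x)). intros j _.
  apply Im_Cmult_0; [apply Gpoly_real|now apply Dfun_real].
Qed.

(** * Identification of [G_n] *)

Lemma multiple_gamma_analytic (G : nat -> C -> C) (n : nat) (x : R) :
  is_multiple_gamma G -> (0 <= x)%R -> analytic_at (G n) (x + 1).
Proof.
  intros (_ & H0 & H) Hx. destruct n as [|n].
  - apply analytic_ext with (fun w => w - 0).
    + exists 1%R. split; [lra|]. intros w _. rewrite H0. ring.
    + apply analytic_id.
  - apply (proj2 (proj2 (H (S n) ltac:(lia))) x Hx).
Qed.

Lemma multiple_gamma_step (G : nat -> C -> C) (n : nat) (x : R) :
  is_multiple_gamma G -> (0 <= x)%R ->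
  G (S n) (RtoC (x + 1) + 1) = G n (RtoC x + 1) * G (S n) (RtoC x + 1).
Proof.
  intros HG Hx. assert (H := proj1 (proj2 (proj2 HG) (S n) ltac:(lia)) (RtoC x + 1)).
  rewrite Nat.sub_succ, Nat.sub_0_r in H.
  rewrite RtoC_plus. apply H.
  - rewrite <- RtoC_plus. apply multiple_gamma_analytic; trivial. lra.
  - now apply multiple_gamma_analytic.
  - now apply multiple_gamma_analytic.
Qed.

(** Induction on [n]. The increment at one level is the logarithm at the level below, starting from
    [ln (t + 1)] for [G_0]; its required decay is the derivative bound for [ell] at that lower
    level, and the order matches exactly. *)
Lemma multiple_gamma_real (B : nat -> C -> C) (zeta : C -> C) (G : nat -> C -> C) :
  is_bernoulli_poly B -> is_riemann_zeta zeta -> is_multiple_gamma G ->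
  forall n x, (0 <= x)%R -> G (S n) (RtoC x + 1) = Cexp (ell (bnum B) (S n) x).
Proof.
  intros hB hz hG. assert (Hb := bnum_rec B hB).
  assert (Hpos : forall n (x : R), (0 <= x)%R -> Im (G (S n) (RtoC x + 1)) = 0%R /\
    (0 < Re (G (S n) (RtoC x + 1)%C))%R).
  { intros n x Hx. destruct (proj2 (proj2 (proj2 (proj2 hG) (S n) ltac:(lia))) x Hx)
      as (_ & H1 & H2 & _). rewrite RtoC_plus in H2. now split. }
  assert (Hreal : forall n (x : R), (0 <= x)%R ->
    G (S n) (RtoC x + 1) = RtoC (exp (ln (Re (G (S n) (RtoC x + 1)%C))))).
  { intros n x Hx. destruct (Hpos n x Hx) as [H1 H2]. rewrite exp_ln by trivial.
    apply injective_projections; [reflexivity|exact H1]. }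
  assert (Hconv : forall m (t : R), (1 <= m)%nat -> (0 <= t)%R ->
    (0 <= Derive_n (fun t => ln (Re (G m (RtoC t + 1)%C))) (S m) t)%R).
  { intros m t Hm Ht. rewrite <- (Nat.add_1_r m).
    rewrite (Derive_n_ext _ (fun t => ln (Re (G m (RtoC (t + 1)))))).
    - apply (proj2 (proj2 (proj2 (proj2 hG) m Hm)) t Ht).
    - intros s. now rewrite RtoC_plus. }
  assert (Hlog : forall n (x : R), (0 <= x)%R ->
    ln (Re (G (S n) (RtoC x + 1)%C)) = Re (ell (bnum B) (S n) x)).
  { induction n as [|n IH]; intros x Hx.
    - set (m' := 1%nat).
      apply (convex_solution_unique m'
        (fun t => ln (Re (G m' (RtoC t + 1)%C))) (fun t => Re (ell (bnum B) m' t))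
        (fun t => ln (t + 1))); trivial.
      + intros k t Ht. apply (ln_smooth (fun w => G m' (w + 1)) t t Ht).
        * apply analytic_translate. apply multiple_gamma_analytic; trivial. lra.
        * intros s Hs. apply Hpos. apply Rabs_def2 in Hs. lra.
      + intros k t Ht. apply (ell_smooth B zeta m' t hB hz ltac:(unfold m'; lia) Ht).
      + intros t Ht. apply Hconv; [unfold m'; lia|lra].
      + intros t Ht. destruct (ell_derive_bounds B zeta m' hB hz ltac:(unfold m'; lia))
          as [K HK]. now apply HK.
      + intros t Ht. unfold m'. rewrite multiple_gamma_step by trivial.
        rewrite (proj1 (proj2 hG)). destruct (Hpos 0%nat t Ht) as [H1 H2].
        replace (Re ((RtoC t + 1) * G 1%nat (RtoC t + 1))) with
          ((t + 1) * Re (G 1%nat (RtoC t + 1)%C))%R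
          by (destruct (G 1%nat (RtoC t + 1)); simpl; unfold Re; simpl; ring).
        rewrite ln_mult by (trivial; lra). ring.
      + intros t Ht. unfold m'. rewrite ell_step_1 by trivial.
        simpl. unfold Re. simpl. ring.
      + intros t Ht. unfold m'.
        apply (is_lim_seq_ext (fun N => / (t + INR N + 1))%R).
        * intros N. assert (HN := pos_INR N). symmetry.
          apply is_derive_unique. replace (/ (t + INR N + 1))%R with (1 / (t + INR N + 1))%R
            by (field; lra).
          apply (is_derive_ln_comp (fun t => t + 1)%R); [|lra].
          auto_derive; trivial.
        * apply is_lim_seq_le_le with (u := fun _ => 0%R) (w := fun N => (/ INR (S N))%R).
          -- intros N. assert (HN := pos_INR N). rewrite S_INR. split.
             ++ apply Rlt_le, Rinv_0_lt_compat. lra.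
             ++ apply Rinv_le_contravar; lra.
          -- apply is_lim_seq_const.
          -- apply is_lim_seq_inv_S.
      + rewrite ell_0, Cplus_0_l. unfold m'.
        rewrite (proj1 (proj2 (proj2 (proj2 hG) 1%nat ltac:(lia)))). simpl. apply ln_1.
    - set (m' := S (S n)).
      apply (convex_solution_unique m'
        (fun t => ln (Re (G m' (RtoC t + 1)%C))) (fun t => Re (ell (bnum B) m' t))
        (fun t => Re (ell (bnum B) (S n) t))); trivial.
      + intros k t Ht. apply (ln_smooth (fun w => G m' (w + 1)) t t Ht).
        * apply analytic_translate. apply multiple_gamma_analytic; trivial. lra.
        * intros s Hs. apply Hpos. apply Rabs_def2 in Hs. lra.
      + intros k t Ht. apply (ell_smooth B zeta m' t hB hz ltac:(unfold m'; lia) Ht).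
      + intros t Ht. apply Hconv; [unfold m'; lia|lra].
      + intros t Ht. destruct (ell_derive_bounds B zeta m' hB hz ltac:(unfold m'; lia))
          as [K HK]. now apply HK.
      + intros t Ht. unfold m'. rewrite multiple_gamma_step by trivial.
        rewrite (Hreal n t Ht), (IH t Ht). destruct (Hpos (S n) t Ht) as [H1 H2].
        set (E := Re (ell (bnum B) (S n) t)).
        replace (Re (RtoC (exp E) * G (S (S n)) (RtoC t + 1))) with
          (exp E * Re (G (S (S n)) (RtoC t + 1)%C))%R
          by (destruct (G (S (S n)) (RtoC t + 1)); simpl; unfold Re; simpl; ring).
        rewrite ln_mult by (trivial; apply exp_pos). rewrite ln_exp. ring.
      + intros t Ht. unfold m'. rewrite ell_step by (trivial; lia). reflexivity.
      + intros t Ht. unfold m'.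
        destruct (ell_derive_bounds B zeta (S n) hB hz ltac:(lia)) as [K HK].
        apply is_lim_seq_le_le with (u := fun _ => 0%R)
          (w := fun N => (Rabs K * / (INR N + t))%R).
        * intros N. assert (HN := pos_INR N).
          assert (H := HK (t + INR N)%R ltac:(lra)). split; [apply H|].
          eapply Rle_trans; [apply H|]. rewrite (Rplus_comm (INR N)).
          apply Rmult_le_compat_r; [|apply Rle_abs].
          apply Rlt_le, Rinv_0_lt_compat. lra.
        * apply is_lim_seq_const.
        * replace 0%R with (Rabs K * 0)%R by ring.
          apply is_lim_seq_mult'; [apply is_lim_seq_const|].
          replace (Finite 0) with (Rbar_inv p_infty) by reflexivity.
          apply is_lim_seq_inv; [|discriminate].
          apply (is_lim_seq_plus INR (fun _ => t) p_infty t p_infty);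
            [apply is_lim_seq_INR|apply is_lim_seq_const|reflexivity].
      + rewrite ell_0, Cplus_0_l.
        rewrite (proj1 (proj2 (proj2 (proj2 hG) m' ltac:(unfold m'; lia)))).
        simpl. apply ln_1. }
  intros n x Hx. rewrite Hreal, Hlog, ell_real, Cexp_RtoC by trivial. reflexivity.
Qed.

Lemma Pinf_real (B : nat -> C -> C) (zeta : C -> C) (n : nat) (x : R) :
  is_bernoulli_poly B -> is_riemann_zeta zeta -> (1 <= n)%nat -> (0 <= x)%R ->
  Cexp (Ffun B zeta n x) * Pinf n x = Cexp (ell (bnum B) n x).
Proof.
  intros hB hz Hn Hx. assert (Hb := bnum_rec B hB).
  assert (Hl := ell_formula B zeta n x hB Hn Hx
    (fun r _ => zeta_seq_lim (bnum B) r zeta Hb hz)).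
  apply Clim_Cexp in Hl.
  assert (E : Pinf n x = Cexp (ell (bnum B) n x - Ffun B zeta n x)).
  { apply CLim_unique. eapply Clim_ext; [|exact Hl]. intros N. cbv beta.
    induction N as [|N IH].
    - rewrite Csum_nil by lia. apply Cexp_0.
    - rewrite Csum0_S, Cexp_plus, IH, Cprod_S. f_equal. symmetry.
      apply gamma_factor_Cexp. assert (Hk : (0 < INR (S N))%R) by (apply lt_0_INR; lia).
      assert (Hq : (0 <= x / INR (S N))%R).
      { apply Rmult_le_pos; trivial. now apply Rlt_le, Rinv_0_lt_compat. }
      rewrite Cexp_RtoC, exp_ln by lra. unfold Nat2C.
      rewrite RtoC_plus, RtoC_div by lra. reflexivity. }
  rewrite E, <- Cexp_plus. f_equal. ring.
Qed.

Lemma pole_translate (f : C -> C) (a b : C) :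
  pole_at f (a + b) -> pole_at (fun w => f (w + b)) a.
Proof.
  intros (m & g & r & Hm & Hr & Hg & Hga & Hf).
  exists m, (fun w => g (w + b)), r. repeat split; trivial.
  - now apply analytic_translate.
  - intros w Hw Hwr. replace (w - a) with (w + b - (a + b)) by ring. apply Hf.
    + intros E. apply Hw. replace w with (w + b - b) by ring. rewrite E. ring.
    + now replace (w + b - (a + b)) with (w - a) by ring.
Qed.

Theorem theorem6 (B : nat -> C -> C) (zeta : C -> C) (G : nat -> C -> C)
    (hB : is_bernoulli_poly B) (hzeta : is_riemann_zeta zeta)
    (hG : is_multiple_gamma G)
    (n : nat) (hn : (1 <= n)%nat)
    (z : C) (hz : forall k : nat, (1 <= k)%nat -> z <> - k%:C) :
  exists P : C,
    is_infprod (gamma_factor n z) P /\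
    G n (z + 1) = Cexp (Ffun B zeta n z) * P.
Proof.
  exists (Pinf n z). destruct (Pinf_spec n z hn hz) as (Hlim & Hne & _).
  split; [split; [exact Hne|now apply Clim_filterlim]|].
  set (f := fun w => G n (w + 1)).
  set (g := fun w => Cexp (Ffun B zeta n w) * Pinf n w).
  assert (Hloc : forall a, (forall k, (1 <= k)%nat -> a <> - k%:C) ->
    agree_acc f g a -> agree_near f g a).
  { intros a Ha. apply meromorphic_agree.
    - destruct (proj1 hG n (a + 1)) as [H|H].
      + left. now apply (analytic_translate (G n)).
      + right. now apply (pole_translate (G n)).
    - apply analytic_mult.
      + apply analytic_Cexp. apply (polyfun_analytic n). now apply polyfun_Ffun.
      + now apply Pinf_spec. }
  assert (H1 : agree_acc f g 1).
  { intros eps He. exists (RtoC (1 + eps / 2)).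
    replace (RtoC (1 + eps / 2) - 1) with (RtoC (eps / 2)) by (rewrite RtoC_plus; ring).
    rewrite Cmod_R, Rabs_pos_eq by lra. repeat split; [|lra|].
    - intros E. apply RtoC_inj in E. lra.
    - unfold f, g. rewrite Pinf_real by (trivial; lra).
      replace n with (S (n - 1)) by lia.
      apply (multiple_gamma_real B zeta); trivial. lra. }
  assert (Hsnd : forall (k : nat) (w : C), w = - k%:C -> (snd w = 0 /\ fst w = - INR k)%R).
  { intros k w ->. simpl. split; ring. }
  (* The intermediate point [i] or [-i] is taken on the side of the real axis where [z] lies. *)
  assert (Hs : exists s : R, (s = 1 \/ s = -1)%R /\ (0 <= s * snd z)%R).
  { destruct (Rle_lt_dec 0 (snd z)); [exists 1%R|exists (-1)%R]; split; auto; lra. }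
  destruct Hs as (s & Hs & Hsz). set (q := (0%R, s) : C).
  assert (Hq : agree_near f g q).
  { apply (agree_continuation f g 1 q); trivial.
    - intros E. apply (f_equal snd) in E. simpl in E. destruct Hs; lra.
    - intros t Ht. apply Hloc. intros k Hk E. apply Hsnd in E. simpl in E.
      assert (Hkp := pos_INR k). destruct E as [E1 E2].
      assert (t = 0)%R by nra. subst t. lra. }
  assert (Hz : agree_near f g z).
  { destruct (Ceq_dec q z) as [<-|Hqz]; trivial.
    apply (agree_continuation f g q z); trivial.
    - intros t Ht. apply Hloc. intros k Hk E. assert (E' := E). apply Hsnd in E.
      simpl in E. destruct E as [E1 E2].
      (* On this segment [s] times the imaginary part is a sum of nonnegative terms; it can vanish
         only at [t = 1], where the point is [z] itself, excluded by [hz]. *)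
      assert (Ht1 : (1 - t + t * (s * snd z) = 0)%R) by (destruct Hs; subst s; nra).
      assert (t = 1)%R by nra. subst t.
      apply (hz k Hk). rewrite <- E'. ring.
    - now apply agree_near_at_acc. }
  destruct Hz as (e & He & Hz). apply Hz.
  replace (z - z) with (RtoC 0) by ring. now rewrite Cmod_0.
Qed.
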